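(* Let $(L,\omega,\upsilon)$ be a generalized indefinite string with Weyl--Titchmarsh function $m$. If $m$ is rational, then, with $N\in\mathbb{N}_0$, the function $\kappa$ and the Hankel determinants $\Delta_{j,k}$ associated with $m$ as described in the context, the generalized indefinite string $(L,\omega,\upsilon)$ has the form $$\omega=\omega_0\delta_0+\sum_{n=1}^{N}\omega_n\delta_{x_n},\qquad \upsilon=\upsilon_0\delta_0+\sum_{n=1}^{N}\upsilon_n\delta_{x_n},$$ where the length $L$, the increasing points $x_1,\ldots,x_N$ in $(0,L)$, the real weights $\omega_0,\ldots,\omega_N$ and the non-negative weights $\upsilon_0,\ldots,\upsilon_N$ are given by $$\frac1L=\frac{\Delta_{0,\kappa(N+1)+1}}{\Delta_{2,\kappa(N+1)}},\qquad x_n=\frac{\Delta_{2,\kappa(n)}}{\Delta_{0,\kappa(n)+1}},$$ $$\omega_0 = -\frac{\Delta_{-1,1}}{\Delta_{1,0}},\qquad \omega_n = \frac{\Delta_{-1,\kappa(n)+1}}{\Delta_{1,\kappa(n)}} - \frac{\Delta_{-1,\kappa(n+1)+1}}{\Delta_{1,\kappa(n+1)}},$$ $$\upsilon_0 = -\frac{\Delta_{-2,1}}{\Delta_{0,0}},\qquad \upsilon_n = \frac{\Delta_{-2,\kappa(n)+2}}{\Delta_{0,\kappa(n)+1}} - \frac{\Delta_{-2,\kappa(n+1)+1}}{\Delta_{0,\kappa(n+1)}}$$ for $n\in\{1,\dots,N\}$ (with the convention $1/L=0$ when $L=\infty$).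
   Context: **Generalized indefinite strings.** For $L\in(0,\infty]$ let $H^1_{\mathrm{loc}}[0,L)=\{f\in AC_{\mathrm{loc}}[0,L)\,|\,f'\in L^2_{\mathrm{loc}}[0,L)\}$ and $H^1_{\mathrm{c}}[0,L)=\{f\in H^1_{\mathrm{loc}}[0,L)\,|\,\mathrm{supp}(f)\text{ compact in }[0,L)\}$, and let $H^{-1}_{\mathrm{loc}}[0,L)$ be the topological dual of $H^1_{\mathrm{c}}[0,L)$. A distribution $\chi\in H^{-1}_{\mathrm{loc}}[0,L)$ is real if $\chi(h)$ is real for each real-valued $h\in H^1_{\mathrm{c}}[0,L)$. A generalized indefinite string is a triple $(L,\omega,\upsilon)$ with $L\in(0,\infty]$, $\omega$ a real distribution in $H^{-1}_{\mathrm{loc}}[0,L)$ and $\upsilon$ a non-negative Borel measure on $[0,L)$ (finite on compact subsets). $\delta_x$ denotes the unit Dirac measure at $x\in[0,L)$, also viewed as the distribution $h\mapsto h(x)$. A solution of $-f''=z\,\omega f+z^2\upsilon f$ ($z\in\mathbb{C}$) is a function $f\in H^1_{\mathrm{loc}}[0,L)$ such that $$d_f h(0)+\int_0^L f'(x)h'(x)\,dx=z\,\omega(fh)+z^2\int_{[0,L)}fh\,d\upsilon,\quad h\in H^1_{\mathrm{c}}[0,L),$$ for some constant $d_f\in\mathbb{C}$; this constant is uniquely determined and denoted by $f'(0-)$. The Weyl--Titchmarsh function is $$m(z)=\frac{\psi'(z,0-)}{z\psi(z,0)},\quad z\in\mathbb{C}\backslash\mathbb{R},$$ where $\psi(z,\cdot)$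 is a non-trivial solution (unique up to scalar multiples) satisfying $\int_0^L|\psi'(z,x)|^2dx+\int_{[0,L)}|z\psi(z,x)|^2d\upsilon(x)<\infty$ and vanishing at the right endpoint $L$ when $L$ is finite. The function $m$ is a Herglotz--Nevanlinna function, i.e. analytic on $\mathbb{C}\backslash\mathbb{R}$, mapping the upper half-plane into its closure, with $m(z)^\ast=m(z^\ast)$. **Spectral measure, moments, Hankel determinants.** $m$ has a unique representation $m(z)= a + bz + \int_{\mathbb{R}} \big(\frac{1}{\lambda-z} - \frac{\lambda}{1+\lambda^2}\big)d\rho(\lambda)$ with $a\in\mathbb{R}$, $b\geq0$ and a non-negative Borel measure $\rho$ on $\mathbb{R}$ with $\int_{\mathbb{R}}(1+\lambda^2)^{-1}d\rho(\lambda)<\infty$. Define $s_k=\int_{\mathbb{R}}\lambda^k\,d\rho(\lambda)$ for $k\in\mathbb{N}_0$ and $s_{-2}=-b$, $s_{-1}=\int_{\mathbb{R}}\frac{\lambda}{1+\lambda^2}d\rho(\lambda)-a$ (all exist for rational $m$). For $j\in\{-2,-1,0,1,2\}$ and $k\in\mathbb{N}_0$ let $\Delta_{j,k}=\det(s_{j+p+q})_{p,q=0}^{k-1}$ be the $k\times k$ Hankel determinant with top-left entry $s_j$ and bottom-right entry $s_{j+2k-2}$; all are equal to one when $k=0$. **$N$ and $\kappa$.** For rational $m$ let $D$ be the number of poles of $m$ in $\mathbb{C}$. Define $N\in\mathbb{N}_0$ so that the number of non-zero elements of the sequence $\Delta_{1,0},\ldots,\Delta_{1,D}$ is exactly $N+1$,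 and let $\kappa:\{1,\dots,N+1\}\to\{0,\dots,D\}$ be such that $\kappa(n)$ is the smallest $k\in\mathbb{N}_0$ for which $\Delta_{1,0},\ldots,\Delta_{1,k}$ has precisely $n$ non-zero elements (so $\kappa(1)=0$). *)

(* Defs.v *)
From HB Require Import structures.
From mathcomp Require Import all_boot all_order all_algebra complex.
From mathcomp Require Import all_classical all_reals all_analysis.

Set Implicit Arguments.
Unset Strict Implicit.
Unset Printing Implicit Defensive.

Import Order.TTheory GRing.Theory Num.Theory.
Import numFieldNormedType.Exports.

Local Open Scope classical_set_scope.
Local Open Scope ring_scope.
Local Open Scope complex_scope.

Section ComplexFunctions.
Context {R : realType}.

(* Modulus with values in R; the norm `|z| of the numeric field R[i] takes
   its values in R[i]. *)
Definition cabs (z : R[i]) : R := Num.sqrt (complex.Re z ^+ 2 + complex.Im z ^+ 2).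

(* R[i] is a normed module over itself but not over R, so differentiation and
   integration of functions of a real variable are componentwise. *)
Definition cderive (f : R -> R[i]) (x : R) : R[i] :=
  derive1 (fun t => complex.Re (f t)) x +i*
  derive1 (fun t => complex.Im (f t)) x.

Definition cintegral (mu : {measure set (measurableTypeR R) -> \bar R})
    (A : set R) (f : R -> R[i]) : R[i] :=
  Rintegral mu A (fun x => complex.Re (f x)) +i*
  Rintegral mu A (fun x => complex.Im (f x)).

End ComplexFunctions.

(* Functions on [0, L) are represented by total functions R -> R[i], whose
   values outside [0, L) play no role. *)
Section SobolevSpaces.
Context {R : realType} (L : \bar R).

Definition dom : set R := [set x | 0 <= x /\ (x%:E < L)%E].

Definition abs_continuous (c : R) (f : R -> R[i]) : Prop :=
  forall e : R, 0 < e -> exists2 d : R, 0 < d &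
    forall (n : nat) (u v : nat -> R),
      (forall i, (i < n)%N -> [/\ 0 <= u i, u i <= v i & v i <= c]) ->
      trivIset `I_n (fun i => [set x : R | u i < x /\ x < v i]) ->
      \sum_(i < n) (v i - u i) < d ->
      \sum_(i < n) cabs (f (v i) - f (u i)) < e.

Definition AC_loc (f : R -> R[i]) : Prop :=
  forall c, dom c -> abs_continuous c f.

Definition L2_loc (f : R -> R[i]) : Prop :=
  forall c, dom c ->
    (\int[lebesgue_measure]_(x in [set x : R | (0 <= x <= c)%R])
       (cabs (f x) ^+ 2)%R%:E < +oo)%E.

Definition H1loc (f : R -> R[i]) : Prop := AC_loc f /\ L2_loc (cderive f).

Definition supp (f : R -> R[i]) : set R :=
  closure [set x | dom x /\ f x != 0] `&` dom.

Definition H1c (f : R -> R[i]) : Prop := H1loc f /\ compact (supp f).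

Definition H1norm (h : R -> R[i]) : R :=
  Num.sqrt (Rintegral lebesgue_measure dom
    (fun x => cabs (h x) ^+ 2 + cabs (cderive h x) ^+ 2)).

(* H1c carries its strict inductive limit topology: a linear functional is
   continuous if and only if, for every c in [0, L), it is bounded on the
   functions supported in [0, c] for the H1 norm. *)
Definition in_H1loc_dual (chi : (R -> R[i]) -> R[i]) : Prop :=
  (forall (k : R[i]) (h1 h2 : R -> R[i]), H1c h1 -> H1c h2 ->
     chi (fun x => k * h1 x + h2 x) = k * chi h1 + chi h2) /\
  (forall c, dom c -> exists C : R, forall h, H1c h ->
     supp h `<=` [set x | x <= c] -> cabs (chi h) <= C * H1norm h).

Definition real_distribution (chi : (R -> R[i]) -> R[i]) : Prop :=
  forall h, H1c h -> (forall x, dom x -> complex.Im (h x) = 0) ->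
    complex.Im (chi h) = 0.

End SobolevSpaces.

(* A Borel measure on [0, L) is encoded as a Borel measure on R for which the
   complement of [0, L) is a null set. *)
Record gen_indefinite_string (R : realType) := GenIndefiniteString {
  len : \bar R;
  omega : (R -> R[i]) -> R[i];
  upsilon : {measure set (measurableTypeR R) -> \bar R};
  len_gt0 : (0 < len)%E;
  omega_dual : in_H1loc_dual len omega;
  omega_real : real_distribution len omega;
  upsilon_dom : upsilon (~` dom len) = 0%E;
  upsilon_compact : forall K : set R,
    compact K -> K `<=` dom len -> (upsilon K < +oo)%E
}.

Section WeylTitchmarsh.
Context {R : realType} (S : gen_indefinite_string R).
Let L := len S.

(* f is a solution of - f'' = z omega f + z^2 upsilon f with f'(0-) = d. *)
Definition solution (z : R[i]) (f : R -> R[i]) (d : R[i]) : Prop :=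
  H1loc L f /\
  forall h, H1c L h ->
    d * h 0 +
      cintegral lebesgue_measure (dom L) (fun x => cderive f x * cderive h x)
    = z * omega S (fun x => f x * h x) +
      z ^+ 2 * cintegral (upsilon S) (dom L) (fun x => f x * h x).

Definition weyl_solution (z : R[i]) (psi : R -> R[i]) (d : R[i]) : Prop :=
  [/\ solution z psi d,
      exists2 x, dom L x & psi x != 0,
      (\int[lebesgue_measure]_(x in dom L) (cabs (cderive psi x) ^+ 2)%R%:E +
       \int[upsilon S]_(x in dom L) (cabs (z * psi x)%R ^+ 2)%R%:E < +oo)%E &
      forall l : R, L = l%:E -> cabs (psi x) @[x --> l^'-] --> (0 : R)].

Definition weyl_titchmarsh (m : R[i] -> R[i]) : Prop :=
  forall z : R[i], complex.Im z != 0 ->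
    exists psi d, weyl_solution z psi d /\ m z = d / (z * psi 0).

End WeylTitchmarsh.

Section SpectralData.
Context {R : realType}.

Definition herglotz_representation (m : R[i] -> R[i]) (a b : R)
    (rho : {measure set (measurableTypeR R) -> \bar R}) : Prop :=
  [/\ 0 <= b,
      (\int[rho]_(l in [set: R]) ((1 + l ^+ 2)^-1)%R%:E < +oo)%E &
      forall z : R[i], complex.Im z != 0 ->
        m z = a%:C + b%:C * z +
          cintegral rho [set: R]
            (fun l => (l%:C - z)^-1 - (l / (1 + l ^+ 2))%:C)].

(* m is the restriction of a rational function with exactly D poles in the
   complex plane: the roots of the denominator in lowest terms. *)
Definition rational_with_poles (m : R[i] -> R[i]) (D : nat) : Prop :=
  exists p q : {poly R[i]},
    [/\ q != 0, coprimep p q,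
        forall z : R[i], complex.Im z != 0 -> m z = p.[z] / q.[z] &
        ([set z | root q z] #= `I_D)%card].

(* Negz 0 is -1 and Negz 1 is -2. *)
Definition moment (a b : R)
    (rho : {measure set (measurableTypeR R) -> \bar R}) (j : int) : R :=
  match j with
  | Posz k => Rintegral rho [set: R] (fun l : R => l ^+ k)
  | Negz 0 => Rintegral rho [set: R] (fun l : R => l / (1 + l ^+ 2)) - a
  | Negz 1 => - b
  | Negz _ => 0
  end.

Definition hankel (s : int -> R) (j : int) (k : nat) : R :=
  \det (\matrix_(p < k, q < k) s (j + p%:Z + q%:Z)).

(* The number of non-zero elements of Delta_{1,0}, ..., Delta_{1,k}. *)
Definition nonzero_count (s : int -> R) (k : nat) : nat :=
  count (fun i => hankel s 1 i != 0) (iota 0 k.+1).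

Definition Nindex (s : int -> R) (D : nat) : nat := (nonzero_count s D).-1.

(* The least k <= D with exactly n non-zero elements among
   Delta_{1,0}, ..., Delta_{1,k}; it exists for 1 <= n <= Nindex s D + 1. *)
Definition kappa_index (s : int -> R) (D n : nat) : nat :=
  find (fun k => nonzero_count s k == n) (iota 0 D.+1).

Definition inv_length (L : \bar R) : R :=
  if L is l%:E then l^-1 else 0.

End SpectralData.

(* Main.v *)
(** The measure of a rational Herglotz function is finitely supported, say on [l], so
    [m z = A + b z + sum_l r_l / (l - z)].

    Discreteness. Green's identity for Weyl solutions [phi z] normalized at [0] expresses the
    Nevanlinna kernel of [m] as a Gram matrix. This kernel has finite rank, so finitely many Weyl
    solutions satisfy linear relations: with [Q] the denominator of [m], [Q z * phi z] is a
    polynomial in [z] by Lagrange interpolation. Its coefficients [f_j] satisfy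
    [- f_j'' = omega f_(j-1) + upsilon f_(j-2)]. The first non-zero one is a multiple of
    [1 - x / L], and as the chain terminates, [omega] and [upsilon] vanish away from finitely many
    points.

    Inverse formulas. For a discrete string the value and slope of the Weyl solution at the [n]-th
    point are [A_n + z m B_n] and [E_n + z m C_n] with polynomials given by a two-term recursion,
    and the condition at [L] reads [O + z m P = 0]. Multiplied by [P], they become polynomials of
    small degree, so [A_n + z m B_n] and [E_n + z m C_n] have a high order zero at infinity. This
    says that the coefficients of [B_n], [C_n] and [P] solve Hankel systems, and Cramer's rule
    evaluates lengths and weights as quotients of Hankel determinants. The degrees of the
    [C_n] are exactly the indices where [Delta_1] does not vanish. *)
Require Import Defs.
From HB Require Import structures.
From mathcomp Require Import all_boot all_order all_algebra complex.
From mathcomp Require Import all_classical all_reals all_analysis.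
From mathcomp Require Import measurable_realfun qpoly.
From mathcomp Require Import zify ring lra.
Set Implicit Arguments.
Unset Strict Implicit.
Unset Printing Implicit Defensive.
Import Order.TTheory GRing.Theory Num.Theory.
Import numFieldNormedType.Exports.
Local Open Scope classical_set_scope.
Local Open Scope ring_scope.
Local Open Scope complex_scope.
Local Notation Re := complex.Re.
Local Notation Im := complex.Im.

(** * Absolutely continuous functions *)

Section AbsoluteContinuity.
Context {R : realType}.
Implicit Types (f g F : R -> R) (c d e u v : R).

(** The definitions are literal: absolute continuity by epsilon and delta, derivatives point by
    point through [derive1], total functions standing for functions on [[0, L)]. Hence each locally
    absolutely continuous function is given a measurable density, and energies are computed with
    densities. [omega] only acts on compactly supported functions, so Green's identity is tested
    with cut-offs; finite energy and the condition at [L] make the cut-off error small. Only null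
    vectors of the kernel are used: for them the Gram form is zero, hence so is the combination of
    Weyl solutions. Discreteness is read from the end of the chain. Where the last non-zero function
    [f_k] does not vanish, equation [k + 2] excludes [upsilon] and equation [k + 1] then excludes
    [omega]. The interior of the zero set of [f_k] is left to [f_(k-1)]. No power series occur: an
    expansion at infinity is an identity of polynomials, and an order of vanishing is a comparison
    of sizes. Determinants are non-zero because the residues of the measure are positive. *)

Definition nonoverlap (p q : R * R) :=
  [|| p.2 <= p.1, q.2 <= q.1, p.2 <= q.1 | q.2 <= p.1].

(** Families are lists, so that one interval can be replaced by a whole partition of it. Degenerate
    pairs count as [nonoverlap] because clamping to [[0, c]] produces them. *)
Definition admissible c (s : seq (R * R)) :=
  all (fun p => [&& 0 <= p.1, p.1 <= p.2 & p.2 <= c]) s && pairwise nonoverlap s.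

Definition AC c f := forall e, 0 < e -> exists2 d, 0 < d &
  forall s, admissible c s -> \sum_(p <- s) (p.2 - p.1) < d ->
    \sum_(p <- s) `|f p.2 - f p.1| <= e.

Definition steps u (s : seq R) := zip (u :: s) s.

Lemma steps_cons u v (s : seq R) : steps u (v :: s) = (u, v) :: steps v s.
Proof. by []. Qed.

Lemma steps_in u v (s : seq R) p : path <%O u s -> last u s = v -> p \in steps u s ->
  [/\ u <= p.1, p.1 <= p.2 & p.2 <= v].
Proof.
elim: s u => // w s IH u /= /andP[uw ws] lv.
have wv : w <= v by rewrite -lv; elim: s w {IH uw lv} ws => /= [w _|y s IH w /andP[wy ys]]; rewrite ?lexx // (le_trans (ltW wy))// IH.
rewrite steps_cons inE => /orP[/eqP -> /=|/(IH _ ws lv)[? ? ?]].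
  by split => //; exact: ltW.
by split => //; rewrite (le_trans (ltW uw)).
Qed.

Lemma steps_admissible u v (s : seq R) : path <%O u s -> last u s = v ->
  pairwise nonoverlap (steps u s) /\ \sum_(p <- steps u s) (p.2 - p.1) = v - u.
Proof.
elim: s u => [u _ /= <-|w s IH u /= /andP[uw ws] lv].
  by rewrite /steps/= big_nil subrr.
have [IH1 IH2] := IH _ ws lv.
rewrite steps_cons; split.
  rewrite /= IH1 andbT; apply/allP => p /(steps_in ws lv)[wp _ _].
  by rewrite /nonoverlap /= wp !orbT.
by rewrite big_cons IH2 /=; ring.
Qed.

Lemma steps_variation u v (s : seq R) f : itv_partition u v s ->
  variation u v f s = \sum_(p <- steps u s) `|f p.2 - f p.1|.
Proof.
move=> uvs; rewrite variation_zip//.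
elim: s u {uvs} => [u|w s IH u]; first by rewrite /steps /= !big_nil.
by rewrite steps_cons !big_cons /= IH.
Qed.

(** Replacing an interval of an admissible list by a partition of it keeps the total length. Suprema
    over partitions, taken one interval at a time, turn increments into total variations. *)
Lemma sum_total_variation_le c e d f :
  (forall s, admissible c s -> \sum_(p <- s) (p.2 - p.1) < d ->
    \sum_(p <- s) `|f p.2 - f p.1| <= e) ->
  forall s, admissible c s -> \sum_(p <- s) (p.2 - p.1) < d ->
    (\sum_(p <- s) total_variation p.1 p.2 f <= e%:E)%E.
Proof.
move=> H s.
(* [t] holds the pieces of the intervals that have already been partitioned. *)
suff G t : admissible c (s ++ t) -> \sum_(p <- s ++ t) (p.2 - p.1) < d ->
    (\sum_(p <- s) total_variation p.1 p.2 f +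
     (\sum_(p <- t) `|f p.2 - f p.1|)%:E <= e%:E)%E.
  by move=> a1 a2; have := G [::]; rewrite cats0 big_nil adde0; apply.
elim: s t => [|[u v] s IH] t; first by rewrite big_nil add0e lee_fin; exact: H.
move=> adm len; rewrite big_cons /= -addeA.
have [uv uv0 vc] : [/\ u <= v, 0 <= u & v <= c].
  by move: adm; rewrite /admissible /= => /andP[/andP[/and3P[]]].
move: uv; rewrite le_eqVlt => /predU1P[uv|uv].
  rewrite uv total_variationxx add0e; apply: IH.
    by move: adm; rewrite /admissible /= => /andP[/andP[_ ->] /andP[_ ->]].
  by move: len; rewrite big_cons /= uv subrr add0r.
have key l : itv_partition u v l ->
    (\sum_(p <- s) total_variation p.1 p.2 f +
     (\sum_(p <- t) `|f p.2 - f p.1|)%:E + (variation u v f l)%:E <= e%:E)%E.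
  move=> uvl; have [pl /eqP ll] := uvl.
  have [nl sl] := steps_admissible pl ll.
  rewrite -addeA -EFinD (steps_variation _ uvl) -big_cat /=; apply: IH.
  - move: adm; rewrite /admissible /= !all_cat !pairwise_cat.
    move=> /andP[/andP[_ /andP[-> ->]] /andP[nuv /and3P[nst -> ->]]]; rewrite nl !andbT /=.
    rewrite allrel_catr nst /=.
    have sub p q : p \in steps u l -> nonoverlap (u, v) q -> nonoverlap q p.
      move=> /(steps_in pl ll)[h1 h2 h3]; rewrite /nonoverlap /=.
      rewrite leNgt uv /= => /or3P[->//|h|h].
      - by rewrite (le_trans h3 h) !orbT.
      - by rewrite (le_trans h h1) !orbT.
    rewrite -all_cat in nuv; have {}nuv q : q \in s ++ t -> nonoverlap (u, v) q := (allP nuv) q; apply/and3P; split.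
    - apply/allP => p /(steps_in pl ll)[h1 h2 h3].
      by rewrite h2 (le_trans uv0 h1) (le_trans h3 vc).
    - apply/allrelP => q p qs ps; apply: sub ps _.
      by apply: nuv; rewrite mem_cat qs.
    - apply/allrelP => q p qs ps; apply: sub ps _.
      by apply: nuv; rewrite mem_cat qs orbT.
  - move: len; rewrite big_cons !big_cat /= sl.
    by move=> h; apply: le_lt_trans h; rewrite [leRHS]addrC addrA.
set A := (X in (_ + X)%E); rewrite addeC.
(* [A] might be infinite a priori; the trivial partition [[:: v]] excludes this. *)
have [Ay|Ay] := eqVneq A +oo%E.
  have := key [:: v] (itv_partition1 uv).
  by rewrite -/A Ay addye//.
have A0 : (0 <= A)%E.
  rewrite /A adde_ge0//.
    rewrite big_seq sume_ge0// => p ps.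
    apply: total_variation_ge0.
    have /andP[h0 _] := adm; have h := allP h0.
    by have /and3P[] : [&& 0 <= p.1, p.1 <= p.2 & p.2 <= c]
      by apply: h; rewrite inE mem_cat ps !orbT.
  by rewrite lee_fin sumr_ge0.
have fA : A \is a fin_num by rewrite ge0_fin_numE// ltey.
rewrite -leeBrDl//; apply: ge_ereal_sup => _ [_ [l uvl <-] <-].
by rewrite leeBrDl//; exact: key.
Qed.

End AbsoluteContinuity.

(** * Stieltjes measures of absolutely continuous functions *)

Section StieltjesDensity.
Context {R : realType}.
Implicit Types (f F : R -> R) (a b c d e u v x : R).
Local Notation lam := (@lebesgue_measure R).

(** Absolute values are absent because this is applied to nondecreasing functions. *)
Definition globalAC F := forall e, 0 < e -> exists2 d, 0 < d &
  forall s : seq (R * R), all (fun p => p.1 <= p.2) s -> pairwise nonoverlap s ->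
    \sum_(p <- s) (p.2 - p.1) < d -> \sum_(p <- s) (F p.2 - F p.1) <= e.

Lemma bounded_open_itv (I : set R) a b : open I -> is_interval I -> I `<=` `]a, b[ ->
  exists u v, u <= v /\ I = `]u, v[%classic.
Proof.
move=> oI iI Iab; have [->|/set0P[x Ix]] := eqVneq I set0.
  by exists a, a; split => //; rewrite set_itvoo0.
exists (inf I), (sup I).
have lI : has_lbound I by exists a => y /Iab; rewrite /= in_itv/= => /andP[/ltW].
have uI : has_ubound I by exists b => y /Iab; rewrite /= in_itv/= => /andP[_ /ltW].
split.
  by rewrite (le_trans (ge_inf lI Ix))// ub_le_sup.
transitivity (interior I).
  apply/seteqP; split; last exact: interior_subset.
  by move: oI; rewrite openE.
by rewrite interval_bounded_interior.
Qed.

Lemma disjoint_nonoverlap u v u' v' : `]u, v[%classic `&` `]u', v'[%classic = set0 ->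
  nonoverlap (u, v) (u', v').
Proof.
move=> h; rewrite /nonoverlap /=; apply/negPn/negP.
rewrite !negb_or -!ltNge => /and4P[h1 h2 h3 h4].
pose m := (Num.max u u' + Num.min v v') / 2.
have mm : Num.max u u' < Num.min v v'.
  by rewrite gt_max !lt_min h1 h2 h3 h4.
have hm1 : Num.max u u' < m by rewrite /m; lra.
have hm2 : m < Num.min v v' by rewrite /m; lra.
move: hm1 hm2; rewrite gt_max lt_min => /andP[? ?] /andP[? ?].
have : (`]u, v[%classic `&` `]u', v'[%classic) m.
  by split; rewrite /= in_itv/=; apply/andP.
by rewrite h.
Qed.

(** A null set lies in an open subset of []a, b[] of small length. Any finitely many of its
    component intervals have small total increment, and countable subadditivity gives the bound for
    all of them. *)
Lemma lebesgue_stieltjes_dominated (F : cumulative R R) a b : globalAC F ->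
  forall A, measurable A -> A `<=` `]a, b[%classic -> lam A = 0%E ->
  lebesgue_stieltjes_measure F A = 0%E.
Proof.
move=> acF A mA Aab lA; apply/eqP; rewrite eq_le measure_ge0 andbT.
apply/lee_addgt0Pr => e e0; rewrite add0e.
have [d d0 H] := acF e e0.
have lAy : (lam A < +oo)%E by rewrite lA.
have [V [oV AV Vd]] := lebesgue_regularity_outer mA lAy d0.
pose U := V `&` `]a, b[%classic.
have oU : open U by apply: openI => //; exact: interval_open.
have AU : A `<=` U by move=> x Ax; split; [exact: AV|exact: Aab].
have lU : (lam U < d%:E)%E.
  have mV : measurable V by exact: open_measurable.
  apply: le_lt_trans Vd.
  have E : (lam V <= lam (V `\` A) + lam A)%E.
    by rewrite -[X in (lam X <= _)%E](setDUK AV) setUC; apply: measureU2 => //; exact: measurableD.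
  apply: (@le_trans _ _ (lam V)).
    by apply: le_measure; rewrite ?inE//; [exact: open_measurable|exact: subIsetl].
  by apply: le_trans E _; rewrite lA adde0.
pose I := open_disjoint_itv oU.
have UI : U = \bigcup_q I q := open_disjoint_itv_bigcup oU.
have mI q : measurable (I q) by apply: open_measurable; exact: open_disjoint_itv_open.
have [h hI] : {h : nat -> R * R & forall q, (h q).1 <= (h q).2 /\ I q = `](h q).1, (h q).2[%classic}.
  apply: (@choice _ _ (fun q (p : R * R) => p.1 <= p.2 /\ I q = `]p.1, p.2[%classic)) => q.
  have Iab : I q `<=` `]a, b[%classic.
    apply: (@subset_trans _ U); last exact: subIsetr.
    by rewrite UI; exact: bigcup_sup.
  have [u [v [uv Iuv]]] := bounded_open_itv (@open_disjoint_itv_open _ _ oU q)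
    (@open_disjoint_itv_is_interval _ _ oU q) Iab.
  by exists (u, v).
have tI := @open_disjoint_itv_trivIset _ _ oU.
have key n : \sum_(q < n) (F (h q).2 - F (h q).1) <= e.
  rewrite -(big_mkord xpredT (fun q => F (h q).2 - F (h q).1)) /index_iota subn0.
  rewrite -(big_map h xpredT (fun p => F p.2 - F p.1)).
  apply: H.
  - by apply/allP => _ /mapP[q _ ->]; exact: (hI q).1.
  - rewrite pairwise_map; apply/(pairwiseP 0%N) => i j.
    rewrite !inE size_iota => ni nj ij; rewrite !nth_iota// !add0n.
    suff : nonoverlap ((h i).1, (h i).2) ((h j).1, (h j).2) by rewrite -!surjective_pairing.
    apply: disjoint_nonoverlap.
    rewrite -(hI i).2 -(hI j).2; move/trivIsetP : tI; apply => //.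
    by rewrite neq_ltn ij.
  - rewrite big_map -lte_fin; apply: le_lt_trans lU.
    rewrite -[X in iota 0 X](subn0 n) -/(index_iota 0 n) big_mkord -sumEFin.
    have -> : (\sum_(i < n) ((h i).2 - (h i).1)%:E = \sum_(i < n) lam (I i))%E.
      apply: eq_bigr => i _; rewrite (hI i).2 lebesgue_measure_itv /= lte_fin.
      have [_|h1] := ltrP (h i).1 (h i).2; first by rewrite EFinB.
      have -> : (h i).1 = (h i).2 by apply/eqP; rewrite eq_le h1 (hI i).1.
      by rewrite subrr.
    rewrite -(measure_bigsetU lam mI tI).
      apply: le_measure.
      - apply/mem_set. by apply: bigsetU_measurable => i _; exact: mI.
      - by apply/mem_set; apply: open_measurable.
      - by apply: (@subset_trans _ (\bigcup_q I q)); [exact: bigsetU_bigcup|rewrite -UI].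
apply: (@le_trans _ _ (lebesgue_stieltjes_measure F U)).
  by apply: le_measure => //; apply/mem_set => //; exact: open_measurable.
rewrite UI; apply: (le_trans (generalized_Boole_inequality _ _ _)) => //.
  by rewrite -UI; exact: open_measurable.
apply: lime_le; first by apply: is_cvg_nneseries.
near=> n; rewrite big_mkord.
apply: (@le_trans _ _ (\sum_(q < n) (F (h q).2 - F (h q).1)%:E)%E); last first.
  by rewrite sumEFin lee_fin.
apply: lee_sum => q _; rewrite -(wlength_itv_bnd F false false (hI q).1).
rewrite -(measurable_mu_extE (wlength F)).
  rewrite (hI q).2; apply: le_measure.
  - by apply/mem_set; exact: measurable_itv.
  - by apply/mem_set; exact: measurable_itv.
  - exact: subset_itv_oo_oc.
exact: is_ocitv.
Unshelve. all: by end_near. Qed.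

End StieltjesDensity.

(** * The fundamental theorem of calculus for absolutely continuous functions *)

Section AbsolutelyContinuousDensity.
Context {R : realType}.
Implicit Types (f F : R -> R) (a b c d e u v x : R).
Local Notation lam := (@lebesgue_measure R).

Lemma integrable_locally_integrable (g : R -> R) :
  lam.-integrable setT (EFin \o g) -> locally_integrable setT g.
Proof.
move=> /integrableP[mg ig]; have mg' : measurable_fun setT g by exact/measurable_EFinP.
split => //; first exact: openT.
move=> K _ cK; apply: le_lt_trans ig; apply: ge0_subset_integral => //=.
- exact: compact_measurable.
- by apply/measurable_EFinP; exact: measurableT_comp.
Qed.

Lemma globalAC_right_continuous F : nondecreasing F -> globalAC F ->
  right_continuous F.
Proof.
move=> ndF acF x; apply/cvgrPdist_le => e e0.
have [d d0 H] := acF e e0.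
near=> y.
have xy : x <= y by near: y; exact: nbhs_right_ge.
rewrite ler0_norm ?subr_le0 ?ndF// opprB.
have := H [:: (x, y)]; rewrite /= !big_seq1 /= xy; apply => //.
rewrite ltrBlDl; near: y; apply: nbhs_right_lt; by rewrite ltrDl.
Unshelve. all: by end_near. Qed.

(** Radon--Nikodym for the Stieltjes measure of [F] restricted to []a, b]], where it is finite. *)
Lemma cumulative_density (F : cumulative R R) a b : globalAC F ->
  exists2 g : R -> R, lam.-integrable setT (EFin \o g) &
    forall x, a <= x <= b -> F x - F a = \int[lam]_(t in `]a, x]%classic) g t.
Proof.
move=> acF.
have lF u v : u <= v -> lebesgue_stieltjes_measure F `]u, v]%classic = (F v - F u)%:E.
  move=> uv; rewrite -(wlength_itv_bnd F false false uv).
  by rewrite -(measurable_mu_extE (wlength F))//; exact: is_ocitv.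
have mD : measurable (`]a, b]%classic : set (measurableTypeR R)) by exact: measurable_itv.
have Dy : (lebesgue_stieltjes_measure F `]a, b]%classic < +oo)%E.
  have [ab|ba] := leP a b; first by rewrite lF// ltry.
  rewrite set_itv_ge ?bnd_simp -?ltNge ?ltW// ?measure0//.
  by rewrite -leNgt ltW.
pose nu := mfrestr mD Dy.
have dom : charge_of_finite_measure nu `<< lam.
  apply/null_content_dominatesP => A mA lA.
  rewrite /charge_of_finite_measure /= /nu /mfrestr /mrestr.
  (* The open interval is enlarged so as to contain []a, b]]. *)
  apply: (@lebesgue_stieltjes_dominated _ F (a - 1) (b + 1)) => //.
  - exact: measurableI.
  - move=> y [_]; rewrite /= !in_itv/= => /andP[? ?]; apply/andP; split; lra.
  - apply/eqP; rewrite eq_le measure_ge0 andbT -lA.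
    by apply: le_measure => //; apply/mem_set => //; exact: measurableI.
pose rn := Radon_Nikodym (charge_of_finite_measure nu) lam.
have rnfin x : rn x \is a fin_num by exact: Radon_Nikodym_fin_num.
have Ern : rn = EFin \o (fine \o rn) by apply/funext => x /=; rewrite fineK.
exists (fine \o rn).
  by rewrite -Ern; exact: Radon_Nikodym_integrable.
move=> x /andP[ax xb]; rewrite /Rintegral.
have -> : (\int[lam]_(t in `]a, x]) ((fine \o rn) t)%:E = \int[lam]_(t in `]a, x]) rn t)%E.
  by apply: eq_integral => t _; rewrite /= fineK.
rewrite -Radon_Nikodym_integral//.
rewrite /charge_of_finite_measure /= /nu /mfrestr /mrestr.
rewrite (_ : `]a, x] `&` `]a, b] = `]a, x]%classic); first by rewrite lF.
apply/setIidPl; exact: subset_itvl.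
Qed.

(** Composition with [clamp c] extends a function on [[0, c]] by constants, as cumulative functions
    live on the whole line. *)
Definition clamp c x := Num.max 0 (Num.min x c).

Lemma clamp_in c x : 0 <= c -> 0 <= clamp c x <= c.
Proof. by move=> c0; rewrite /clamp le_max lexx /= ge_max c0 ge_min lexx orbT. Qed.

Lemma clampE c x : 0 <= x <= c -> clamp c x = x.
Proof. by move=> /andP[x0 xc]; rewrite /clamp min_l// max_r. Qed.

Lemma clamp_le c x y : x <= y -> clamp c x <= clamp c y.
Proof.
move=> xy; rewrite /clamp /Num.max /Num.min.
by repeat case: ifPn; rewrite -?leNgt; lra.
Qed.

Lemma clamp_sub c x y : x <= y -> clamp c y - clamp c x <= y - x.
Proof.
move=> xy; rewrite /clamp /Num.max /Num.min.
by repeat case: ifPn; rewrite -?leNgt; lra.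
Qed.

(** The factor 2 serves [V - f], with [V] the variation function of [f]: its increments are at most
    twice those of [V]. *)
Lemma AC_globalAC c f F : 0 <= c -> AC c f ->
  (forall u v, 0 <= u -> u <= v -> v <= c ->
     ((F v - F u)%:E <= 2%:E * total_variation u v f)%E) ->
  globalAC (F \o clamp c).
Proof.
move=> c0 acf FTV e e0.
have e20 : 0 < e / 2 by rewrite divr_gt0.
have [d d0 H] := acf _ e20.
exists d => // s /allP sle sno sd.
pose s' := map (fun p => (clamp c p.1, clamp c p.2)) s.
have adm : admissible c s'.
  apply/andP; split.
    apply/allP => _ /mapP[p ps ->] /=.
    have /andP[-> _] := clamp_in p.1 c0; have /andP[_ ->] := clamp_in p.2 c0.
    by rewrite clamp_le// sle.
  rewrite pairwise_map; apply: sub_pairwise sno => p q /=.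
  by rewrite /nonoverlap /= => /or4P[] h; rewrite (clamp_le c h) ?orbT.
have s'd : \sum_(p <- s') (p.2 - p.1) < d.
  apply: le_lt_trans sd; rewrite big_map /= big_seq [leRHS]big_seq.
  by apply: ler_sum => p ps; exact/clamp_sub/sle.
have := sum_total_variation_le H adm s'd.
rewrite -lee_fin => h; apply: (@le_trans _ _ (2%:E * (\sum_(p <- s') total_variation p.1 p.2 f))%E); last first.
  rewrite [X in (_ <= X%:E)%E](_ : e = 2 * (e / 2)); last by field.
  by rewrite EFinM lee_pmul2l.
have TV0 p : p \in s' -> (0 <= total_variation p.1 p.2 f)%E.
  by move=> ps; apply: total_variation_ge0; have /andP[/allP/(_ _ ps)/and3P[]] := adm.
have -> : \sum_(p <- s) ((F \o clamp c) p.2 - (F \o clamp c) p.1) =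
  \sum_(p <- s') (F p.2 - F p.1) by rewrite big_map.
rewrite big_seq [X in (_ <= _ * X)%E]big_seq ge0_sume_distrr//.
rewrite -sumEFin; apply: lee_sum => p ps; apply: FTV.
all: by have /andP[/allP/(_ _ ps)/and3P[]] := adm.
Qed.

Lemma AC_total_variation_small c f : AC c f -> forall e, 0 < e -> exists2 d, 0 < d &
  forall u v, 0 <= u -> u <= v -> v <= c -> v - u < d ->
    (total_variation u v f <= e%:E)%E.
Proof.
move=> acf e e0; have [d d0 H] := acf e e0; exists d => // u v u0 uv vc vud.
have := @sum_total_variation_le R c e d f H [:: (u, v)].
by rewrite /admissible /= !big_seq1 /= u0 uv vc; apply.
Qed.

(** Pieces shorter than [d] contribute at most 1 each, and finitely many steps of length [d / 2]
    exhaust [[u, v]]. *)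
Lemma AC_total_variation_fin c f u v : AC c f -> 0 <= u -> u <= v -> v <= c ->
  total_variation u v f \is a fin_num.
Proof.
move=> acf u0 uv vc; have [d d0 H] := AC_total_variation_small acf ltr01.
have step n : forall w, u <= w -> w <= c -> w - u < n%:R * (d / 2) ->
    (total_variation u w f <= n%:R%:E)%E.
  elim: n => [|n IH] w uw wc; first by rewrite mul0r => h; exfalso; lra.
  move=> wn; have [wd|dw] := ltP (w - u) d.
    by apply: le_trans (H _ _ u0 uw wc wd) _; rewrite lee_fin ler1n.
  have h1 : u <= w - d / 2 by lra.
  have h2 : w - d / 2 <= w by lra.
  rewrite (total_variationD f h1 h2) -[X in (_ <= X%:E)%E]natr1 EFinD; apply: leeD.
    apply: IH => //; first by lra.
    by move: wn; rewrite -natr1 mulrDl mul1r; lra.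
  by apply: H => //; lra.
rewrite ge0_fin_numE ?total_variation_ge0//.
apply: le_lt_trans (step (Num.bound ((v - u) / (d / 2))) v uv vc _) (ltry _).
rewrite -ltr_pdivrMr ?divr_gt0//; apply: archi_boundP.
by rewrite divr_ge0 ?subr_ge0// divr_ge0// ltW.
Qed.

(** Jordan decomposition [f = V - (V - f)] with [V] the variation function: both parts are
    nondecreasing and absolutely continuous, so each has a density. Lebesgue differentiation
    identifies the difference [g] of the densities with the derivative almost everywhere. *)
Lemma AC_density c f : 0 < c -> AC c f ->
  exists g : R -> R, exists N : set (measurableTypeR R),
  [/\ lam.-integrable setT (EFin \o g), measurable N, lam N = 0%E,
      forall x, 0 <= x <= c -> f x = f 0 + \int[lam]_(t in `[0, x]%classic) g t &
      forall x, 0 < x < c -> ~ N x -> is_derive x (1 : R) f (g x)].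
Proof.
move=> c0 acf; have c0' := ltW c0.
pose V x := fine (total_variation 0 x f).
have VD u v : 0 <= u -> u <= v -> v <= c -> (V v - V u)%:E = total_variation u v f.
  move=> u0 uv vc; have v0 := le_trans u0 uv; have uc := le_trans uv vc.
  rewrite EFinB /V !fineK; [|exact: AC_total_variation_fin acf _ _ _..].
  rewrite (total_variationD f u0 uv) addeAC subee ?add0e//.
  exact: AC_total_variation_fin acf _ _ _.
have fTV u v : 0 <= u -> u <= v -> v <= c -> `|f v - f u| <= V v - V u.
  by move=> u0 uv vc; rewrite -lee_fin VD//; exact: total_variation_ge.
have ac1 : globalAC (V \o clamp c).
  apply: AC_globalAC acf _ => // u v u0 uv vc; rewrite VD//.
  have := total_variation_ge0 f uv; rewrite (mule_natl _ 2) => h.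
  by rewrite leeDl.
have ac2 : globalAC ((V \- f) \o clamp c).
  apply: AC_globalAC acf _ => // u v u0 uv vc /=.
  rewrite -VD// -EFinM lee_fin.
  have := fTV u v u0 uv vc; rewrite ler_norml => /andP[? ?]; lra.
have nd1 : nondecreasing (V \o clamp c).
  move=> x y xy /=; have /andP[x0 xc] := clamp_in x c0'; have /andP[y0 yc] := clamp_in y c0'.
  have := fTV _ _ x0 (clamp_le c xy) yc; rewrite ler_norml => /andP[? ?]; lra.
have nd2 : nondecreasing ((V \- f) \o clamp c).
  move=> x y xy /=; have /andP[x0 xc] := clamp_in x c0'; have /andP[y0 yc] := clamp_in y c0'.
  have := fTV _ _ x0 (clamp_le c xy) yc; rewrite ler_norml => /andP[? ?]; lra.
pose F1 : cumulative R R := HB.pack (V \o clamp c)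
  (isCumulative.Build R _ R _ nd1 (globalAC_right_continuous nd1 ac1)).
pose F2 : cumulative R R := HB.pack ((V \- f) \o clamp c)
  (isCumulative.Build R _ R _ nd2 (globalAC_right_continuous nd2 ac2)).
have [g1 ig1 E1] := @cumulative_density F1 0 c ac1.
have [g2 ig2 E2] := @cumulative_density F2 0 c ac2.
pose g := g1 \- g2.
have ig : lam.-integrable setT (EFin \o g).
  by rewrite (_ : EFin \o g = (EFin \o g1) \- (EFin \o g2))%E//; exact: integrableB.
have fE x : 0 <= x <= c -> f x = f 0 + \int[lam]_(t in `[0, x]%classic) g t.
  move=> xc; have := E1 _ xc; have := E2 _ xc; rewrite /= !clampE ?lexx// => e2 e1.
  have mI : measurable (`]0, x]%classic : set (measurableTypeR R)) by exact: measurable_itv.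
  rewrite -Rintegral_itv_obnd_cbnd; last exact: integrableS ig.
  rewrite RintegralB//; [|exact: integrableS ig1|exact: integrableS ig2].
  by rewrite -e1 -e2; ring.
pose G0 (y : R) : R := \int[lam]_(t in `[0, y]%classic) g t.
have igy y : lam.-integrable [set` Interval (BLeft 0) (BRight y)] (EFin \o g).
  by apply: integrableS ig => //; exact: measurable_itv.
have [N [mN N0 HN]] := FTC1 igy (integrable_locally_integrable ig).
exists g, N; split => // x /andP[x0 xc] Nx.
have [dx gx] : derivable G0 x 1 /\
   derive1 G0 x = g x.
  by apply: contrapT => h; apply: Nx; apply: HN => /= H; apply: h; apply: H; rewrite lte_fin.
pose G (y : R) : R := f 0 + G0 y.
apply: (@near_eq_is_derive _ _ _ G).
  near=> y; rewrite /G [f y]fE //; apply/andP; split; apply: ltW.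
    by near: y; exact: lt_nbhsr.
  by near: y; exact: lt_nbhsl.
rewrite /G -[X in is_derive _ _ _ X]add0r; apply: is_deriveD.
by split => //; rewrite -derive1E.
Unshelve. all: by end_near. Qed.

End AbsolutelyContinuousDensity.

(** * Integrals modulo null sets and discrete measures *)

Section IntegralNullSets.
Context d (T : measurableType d) (R : realType) (mu : {measure set T -> \bar R}).
Implicit Types (D E N : set T).
Local Open Scope ereal_scope.

Import HBNNSimple.

(* No measurability of f and g is assumed: derive1 of an absolutely continuous
   function need not be measurable on its null set of bad points. *)
Lemma ge0_le_integral_off_null N D E (f g : T -> \bar R) :
  measurable N -> mu N = 0 -> D `<=` E ->
  (forall x, D x -> 0 <= f x) -> (forall x, E x -> 0 <= g x) ->
  (forall x, D x -> ~ N x -> f x <= g x) ->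
  \int[mu]_(x in D) f x <= \int[mu]_(x in E) g x.
Proof.
move=> mN N0 DE f0 g0 fg; rewrite !ge0_integralE//.
apply: ge_ereal_sup => _ [h /= hf <-].
have mNc : measurable (~` N) by exact: measurableC.
(* Setting the simple function to zero on [N] keeps its integral and puts it below [g]
   everywhere. *)
pose h' : {nnsfun T >-> R} := proj_nnsfun h mNc.
have h'E x : h' x = if pselect (N x) then 0%R else h x.
  rewrite /h' /proj_nnsfun /= mindicE; case: pselect => [Nx|Nx].
    by rewrite memNset ?mulr0// => /(_ Nx).
  by rewrite mem_set// mulr1.
have -> : sintegral mu h = sintegral mu h'.
  rewrite -!integralT_nnsfun; apply: ge0_ae_eq_integral => //.
  - by apply/measurable_EFinP.
  - by apply/measurable_EFinP.
  - by move=> x _; rewrite lee_fin.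
  - by move=> x _; rewrite lee_fin.
  - exists N; split => // x /= hx; apply: contrapT => Nx; apply: hx => _.
    by rewrite -[RHS]/((h' x)%:E) h'E; case: pselect.
apply: ereal_sup_ubound; exists h' => // x; rewrite h'E.
have := hf x; rewrite !patchE; case: pselect => [Nx _|Nx].
  by case: ifPn => [/set_mem/g0//|_]; rewrite lexx.
case: ifPn => [/set_mem Dx hx|_ hx].
  by rewrite mem_set ?(le_trans hx)//; [exact: fg|exact: DE].
by apply: le_trans hx _; case: ifPn => [/set_mem/g0//|_].
Qed.

Lemma eq_integral_off_null N D (f g : T -> \bar R) :
  measurable N -> mu N = 0 -> (forall x, D x -> ~ N x -> f x = g x) ->
  \int[mu]_(x in D) f x = \int[mu]_(x in D) g x.
Proof.
move=> mN N0 fg; rewrite integralE [RHS]integralE.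
by congr (_ - _); apply/eqP; rewrite eq_le; apply/andP; split;
  apply: ge0_le_integral_off_null mN N0 _ _ _ _ => // x Dx Nx;
  rewrite ?funeposE ?funenegE fg.
Qed.

Lemma eq_Rintegral_off_null N D (f g : T -> R) :
  measurable N -> mu N = 0 -> (forall x, D x -> ~ N x -> f x = g x) ->
  (\int[mu]_(x in D) f x = \int[mu]_(x in D) g x)%R.
Proof.
by move=> mN N0 fg; congr fine; apply: eq_integral_off_null mN N0 _ => x Dx Nx;
  rewrite fg.
Qed.

End IntegralNullSets.

Section RintegralSum.
Context d (T : measurableType d) (R : realType) (mu : {measure set T -> \bar R}).

Lemma integrable_indic_lty (A : set T) : measurable A -> (mu A < +oo)%E ->
  mu.-integrable setT (EFin \o (\1_A : T -> R)).
Proof.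
move=> mA Ay; apply/integrableP; split.
  by apply/measurable_EFinP; exact: measurable_indic.
under eq_integral do rewrite /= ger0_norm//.
by rewrite integral_indic// setIT.
Qed.

Lemma integrable_seq_sum (D : set T) (I : eqType) (s : seq I) (f : I -> T -> R) :
  measurable D -> (forall i, i \in s -> mu.-integrable D (EFin \o f i)) ->
  mu.-integrable D (EFin \o (fun x => \sum_(i <- s) f i x)).
Proof.
move=> mD fi; rewrite (_ : _ \o _ = (fun x => \sum_(i <- s | i \in s) (f i x)%:E)%E).
  by apply: integrable_sum.
by apply/funext => x /=; rewrite big_seq sumEFin.
Qed.

Lemma Rintegral_sum (D : set T) (I : eqType) (s : seq I) (f : I -> T -> R) :
  measurable D -> (forall i, i \in s -> mu.-integrable D (EFin \o f i)) ->
  \int[mu]_(x in D) (\sum_(i <- s) f i x) = \sum_(i <- s) \int[mu]_(x in D) f i x.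
Proof.
move=> mD; elim: s => [|i s IH] fi.
  rewrite big_nil; under eq_Rintegral do rewrite big_nil.
  by rewrite Rintegral_cst// mul0r.
under eq_Rintegral do rewrite big_cons.
have fs j : j \in s -> mu.-integrable D (EFin \o f j).
  by move=> js; apply: fi; rewrite inE js orbT.
rewrite RintegralD//; last exact: integrable_seq_sum.
  by rewrite big_cons IH.
by apply: fi; rewrite inE eqxx.
Qed.

End RintegralSum.

(** * Measures with finite support *)

Section DiscreteMeasure.
Context {R : realType} (mu : {measure set (measurableTypeR R) -> \bar R}) (s : seq R).
Hypotheses (us : uniq s) (mus : mu (~` [set` s]) = 0%E)
  (mufin : forall x, x \in s -> (mu [set x] < +oo)%E).

Lemma set_seq_cons (y : R) (t : seq R) : [set` y :: t] = [set y] `|` [set` t].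
Proof.
apply/seteqP; split => z /=; first by rewrite inE => /orP[/eqP ->|]; [left|right].
by case=> [->|zt]; rewrite inE ?eqxx ?zt ?orbT.
Qed.

Lemma set_seq_nil : [set` ([::] : seq R)] = set0.
Proof. by apply/seteqP; split. Qed.

Lemma measurable_set_seq (t : seq R) : measurable ([set` t] : set (measurableTypeR R)).
Proof.
elim: t => [|y t IH]; first by rewrite set_seq_nil.
rewrite set_seq_cons; apply: measurableU => //; exact: measurable_set1.
Qed.

Lemma discrete_measureE (A : set (measurableTypeR R)) : measurable A ->
  mu A = (\sum_(x <- s) mu [set x] * (\d_(x : measurableTypeR R) A))%E.
Proof.
move=> mA; have mS := measurable_set_seq s.
have -> : mu A = mu (A `&` [set` s]).
  rewrite -{1}(setIT A) -(setUv [set` s]) setIUr measureU; last first.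
  - by rewrite setIACA setICr setI0.
  - by apply: measurableI => //; exact: measurableC.
  - exact: measurableI.
  rewrite -[RHS]adde0; congr (_ + _)%E; apply/eqP; rewrite eq_le measure_ge0 andbT -mus.
  by apply: le_measure; rewrite ?inE//; [apply: measurableI => //|]; exact: measurableC.
move: us; clear mus mufin mS.
elim: s => [_|y t IH /= /andP[yt ut]].
  by rewrite set_seq_nil setI0 measure0 big_nil.
rewrite big_cons set_seq_cons setIUr measureU.
- congr (_ + _)%E; last exact: IH.
  rewrite diracE.
  have [/set_mem Ay|/negP Ay] := boolP (y \in A).
    by rewrite mule1; congr (mu _); apply/setIidPr => z /= ->.
  rewrite mule0 (_ : _ `&` _ = set0) ?measure0//.
  by apply/seteqP; split => z //= [Az zy]; apply: Ay; rewrite inE -zy.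
- apply: measurableI => //; exact: measurable_set1.
- by apply: measurableI => //; exact: measurable_set_seq.
- apply/seteqP; split => z //= [[_ ->] [_ yt']]; by rewrite yt' in yt.
Qed.

(** Off the null complement of [s], an arbitrary [f] agrees with a finite combination of indicators
    of points, whose integral is explicit. *)
Lemma discrete_RintegralE (D : set R) (f : R -> R) :
  (\int[mu]_(x in D) f x = \sum_(x <- s | x \in D) f x * fine (mu [set x]))%R.
Proof.
have mS := measurable_set_seq s.
rewrite Rintegral_mkcond.
rewrite (@eq_Rintegral_off_null _ _ _ mu (~` [set` s]) _ _
  (fun x => \sum_(y <- s) (f \_ D) y * \1_([set y] : set (measurableTypeR R)) x))//; last 2 first.
- exact: measurableC.
- move=> x _ /contrapT /= xs.
  rewrite (bigD1_seq x)//= indicE mem_set// mulr1 big1 ?addr0// => y yx.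
  by rewrite indicE memNset ?mulr0//= => xy; rewrite xy eqxx in yx.
have int y : y \in s -> mu.-integrable setT (EFin \o (\1_([set y] : set (measurableTypeR R)) : _ -> R)).
  by move=> ys; apply: integrable_indic_lty; [exact: measurable_set1|exact: mufin].
rewrite Rintegral_sum//; last first.
  move=> y ys; rewrite (_ : _ \o _ = (fun x => ((f \_ D) y)%:E * (\1_([set y] : set (measurableTypeR R)) x)%:E)%E)//.
  by have := integrableZl measurableT ((f \_ D) y) (int y ys).
rewrite [RHS]big_mkcond [LHS]big_seq [RHS]big_seq; apply: eq_bigr => y ys; rewrite RintegralZl//; last exact: int.
have m1 : measurable ([set y] : set (measurableTypeR R)) by exact: measurable_set1.
rewrite /Rintegral (integral_indic _ measurableT m1) setIT.
rewrite patchE.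
by case: ifP => // _; rewrite mul0r.
Qed.

End DiscreteMeasure.

(** * Complex-valued functions and Sobolev spaces *)

Section ComplexModulus.
Context {R : realType}.
Implicit Types x y z : R[i].

Lemma ReD x y : Re (x + y) = Re x + Re y. Proof. by case: x y => ? ? []. Qed.
Lemma ImD x y : Im (x + y) = Im x + Im y. Proof. by case: x y => ? ? []. Qed.
Lemma ReN x : Re (- x) = - Re x. Proof. by case: x. Qed.
Lemma ImN x : Im (- x) = - Im x. Proof. by case: x. Qed.
Lemma ReM x y : Re (x * y) = Re x * Re y - Im x * Im y.
Proof. by case: x y => ? ? []. Qed.
Lemma ImM x y : Im (x * y) = Re x * Im y + Im x * Re y.
Proof. by case: x y => ? ? []. Qed.
Lemma ReC (r : R) : Re r%:C = r. Proof. by []. Qed.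
Lemma ImC (r : R) : Im r%:C = 0. Proof. by []. Qed.
Lemma ReJ x : Re x^* = Re x. Proof. by case: x. Qed.
Lemma ImJ x : Im x^* = - Im x. Proof. by case: x. Qed.

Lemma complex_ext x y : Re x = Re y -> Im x = Im y -> x = y.
Proof. by case: x y => ? ? [] /= ? ? -> ->. Qed.

Lemma Re_sum (I : Type) (s : seq I) (P : pred I) (F : I -> R[i]) :
  Re (\sum_(i <- s | P i) F i) = \sum_(i <- s | P i) Re (F i).
Proof. exact: (big_morph (@complex.Re R) ReD (erefl : Re (0 : R[i]) = 0)). Qed.

Lemma Im_sum (I : Type) (s : seq I) (P : pred I) (F : I -> R[i]) :
  Im (\sum_(i <- s | P i) F i) = \sum_(i <- s | P i) Im (F i).
Proof. exact: (big_morph (@complex.Im R) ImD (erefl : Im (0 : R[i]) = 0)). Qed.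

Lemma normcabs z : `|z| = (cabs z)%:C. Proof. exact: normc_def. Qed.

Lemma cabs_ge0 z : 0 <= cabs z. Proof. exact: sqrtr_ge0. Qed.

Lemma cabs0 : cabs (0 : R[i]) = 0.
Proof. by apply: complexI; rewrite -normcabs normr0. Qed.

Lemma cabs_eq0 z : (cabs z == 0) = (z == 0).
Proof. by rewrite -(normr_eq0 z) normcabs eq_complex /= eqxx andbT. Qed.

Lemma cabs_gt0 z : (0 < cabs z) = (z != 0).
Proof. by rewrite lt_def cabs_ge0 andbT cabs_eq0. Qed.

Lemma cabsM x y : cabs (x * y) = cabs x * cabs y.
Proof. by apply: complexI; rewrite rmorphM /= -!normcabs normrM. Qed.

Lemma cabsV x : cabs x^-1 = (cabs x)^-1.
Proof. by apply: complexI; rewrite fmorphV /= -!normcabs normfV. Qed.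

Lemma cabsN x : cabs (- x) = cabs x.
Proof. by apply: complexI; rewrite -!normcabs normrN. Qed.

Lemma cabsJ x : cabs x^* = cabs x.
Proof. by rewrite /cabs ReJ ImJ sqrrN. Qed.

Lemma cabsC (r : R) : cabs r%:C = `|r|.
Proof. by rewrite /cabs /= expr0n addr0 sqrtr_sqr. Qed.

Lemma cabsD x y : cabs (x + y) <= cabs x + cabs y.
Proof. by rewrite -lecR rmorphD /= -!normcabs ler_normD. Qed.

Lemma cabsB x y : cabs (x - y) <= cabs x + cabs y.
Proof. by rewrite -(cabsN y) cabsD. Qed.

Lemma cabs_distC x y : cabs (x - y) = cabs (y - x).
Proof. by rewrite -cabsN opprB. Qed.

Lemma cabs_sum (I : Type) (s : seq I) (P : pred I) (F : I -> R[i]) :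
  cabs (\sum_(i <- s | P i) F i) <= \sum_(i <- s | P i) cabs (F i).
Proof.
elim/big_ind2 : _ => [|x1 x2 y1 y2 h1 h2|//]; first by rewrite cabs0.
by apply: le_trans (cabsD _ _) _; exact: lerD.
Qed.

Lemma sqr_cabs z : cabs z ^+ 2 = Re z ^+ 2 + Im z ^+ 2.
Proof. by rewrite /cabs sqr_sqrtr// addr_ge0// sqr_ge0. Qed.

Lemma sqr_cabsC z : (cabs z ^+ 2)%:C = z * z^*.
Proof. by rewrite rmorphXn /= -normcabs sqr_normc. Qed.

Lemma Re_le_cabs z : `|Re z| <= cabs z.
Proof. by rewrite -sqrtr_sqr /cabs ler_wsqrtr// lerDl sqr_ge0. Qed.

Lemma Im_le_cabs z : `|Im z| <= cabs z.
Proof. by rewrite -sqrtr_sqr /cabs ler_wsqrtr// lerDr sqr_ge0. Qed.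

Lemma cabs_le_ReIm z : cabs z <= `|Re z| + `|Im z|.
Proof.
rewrite -(ler_sqr (cabs_ge0 z)) ?nnegrE ?addr_ge0// sqr_cabs sqrrD !real_normK ?num_real//.
by rewrite -addrA lerD2l lerDr mulrn_wge0// mulr_ge0.
Qed.

End ComplexModulus.

(** * Densities of complex absolutely continuous functions *)

Section SobolevDensity.
Context {R : realType}.
Implicit Types (f g h : R -> R[i]) (c u v : R) (L : \bar R).
Local Notation lam := (@lebesgue_measure R).

(** [p] stands for the real or the imaginary part. *)
Lemma abs_continuous_AC (p : R[i] -> R) c f :
  (forall x y, p (x - y) = p x - p y) -> (forall x, `|p x| <= cabs x) ->
  abs_continuous c f -> AC c (p \o f).
Proof.
move=> pB ple acf e e0; have [d d0 H] := acf e e0; exists d => // s adm sd.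
have /andP[/allP sin /(pairwiseP (0, 0)) sno] := adm.
pose u i := (nth (0, 0) s i).1; pose v i := (nth (0, 0) s i).2.
apply: ltW; apply: le_lt_trans (H (size s) u v _ _ _).
- rewrite -(big_mkord xpredT (fun i => cabs (f (v i) - f (u i)))) (big_nth (0, 0)).
  by apply: ler_sum => i _ /=; rewrite -pB; exact: ple.
- by move=> i si; have /and3P[] := sin _ (mem_nth (0, 0) si).
- have T i j : (i < j)%N -> (j < size s)%N ->
      [set x : R | u i < x /\ x < v i] `&` [set x | u j < x /\ x < v j] = set0.
    move=> ij js; have is_ := ltn_trans ij js; apply/seteqP; split => // x [[h1 h2] [h3 h4]].
    have := sno i j; rewrite !inE => /(_ is_ js ij).
    rewrite /nonoverlap -/(u i) -/(v i) -/(u j) -/(v j) => /or4P[] ?; lra.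
  apply/trivIsetP => i j /= si sj; rewrite neq_ltn => /orP[ij|ij]; first exact: T.
  by rewrite setIC; exact: T.
- by move: sd; rewrite (big_nth (0, 0)) big_mkord.
Qed.

(** A representative [g] of the derivative that is measurable on the whole line: [cderive f] has
    arbitrary values where [f] is not differentiable, so integrals are computed with [g]. *)
Definition density c f g :=
  [/\ measurable_fun setT (fun x : measurableTypeR R => Re (g x)),
      measurable_fun setT (fun x : measurableTypeR R => Im (g x)),
      lam.-integrable setT (fun x => (Re (g x))%:E) /\ lam.-integrable setT (fun x => (Im (g x))%:E),
      exists N : set (measurableTypeR R), [/\ measurable N, lam N = 0%E &
        forall x, 0 < x < c -> ~ N x ->
          is_derive x (1 : R) (fun t => Re (f t)) (Re (g x)) /\
          is_derive x (1 : R) (fun t => Im (f t)) (Im (g x))] &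
      forall u v, 0 <= u -> u <= v -> v <= c -> f v - f u = cintegral lam `[u, v]%classic g].

Lemma Rintegral_itv_split (g : R -> R) u v : lam.-integrable setT (EFin \o g) ->
  0 <= u -> u <= v ->
  \int[lam]_(t in `[0, v]%classic) g t - \int[lam]_(t in `[0, u]%classic) g t =
  \int[lam]_(t in `[u, v]%classic) g t.
Proof.
move=> ig u0 uv; rewrite Rintegral_itvB ?bnd_simp//.
- rewrite Rintegral_itv_obnd_cbnd//; apply: integrableS ig => //; exact: measurable_itv.
- apply: integrableS ig => //; exact: measurable_itv.
Qed.

Lemma abs_continuous_density c f : 0 < c -> abs_continuous c f -> exists g, density c f g.
Proof.
move=> c0 acf.
have ReB x y : Re (x - y) = Re x - Re y :> R by rewrite ReD ReN.
have ImB x y : Im (x - y) = Im x - Im y :> R by rewrite ImD ImN.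
have [g1 [N1 [ig1 mN1 N10 E1 d1]]] := AC_density c0 (abs_continuous_AC ReB (@Re_le_cabs R) acf).
have [g2 [N2 [ig2 mN2 N20 E2 d2]]] := AC_density c0 (abs_continuous_AC ImB (@Im_le_cabs R) acf).
exists (fun x => g1 x +i* g2 x); split => //=.
- by apply/measurable_EFinP; case/integrableP : ig1.
- by apply/measurable_EFinP; case/integrableP : ig2.
- exists (N1 `|` N2); split; first exact: measurableU.
    by apply: null_set_setU.
  move=> x xc /not_orP[n1 n2]; split; [exact: d1|exact: d2].
- move=> u v u0 uv vc.
  have u_ : 0 <= u <= c by rewrite u0 (le_trans uv).
  have v_ : 0 <= v <= c by rewrite vc (le_trans u0).
  apply: complex_ext; rewrite ?ReB ?ImB /cintegral /=.
    by have /= -> := E1 _ u_; have /= -> := E1 _ v_; rewrite opprD addrACA subrr add0r; exact: Rintegral_itv_split.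
  by have /= -> := E2 _ u_; have /= -> := E2 _ v_; rewrite opprD addrACA subrr add0r; exact: Rintegral_itv_split.
Qed.

End SobolevDensity.

(** * A Lipschitz criterion for H1loc *)

Section SobolevClosure.
Context {R : realType}.
Implicit Types (f g h : R -> R[i]) (c u v x : R) (L : \bar R).
Local Notation lam := (@lebesgue_measure R).

Lemma cderiveE f x (d : R[i]) : is_derive x (1 : R) (fun t => Re (f t)) (Re d) ->
  is_derive x (1 : R) (fun t => Im (f t)) (Im d) -> cderive f x = d.
Proof.
move=> h1 h2; rewrite /cderive !derive1E.
by rewrite (@derive_val _ _ _ _ _ _ _ h1) (@derive_val _ _ _ _ _ _ _ h2); case: d {h1 h2}.
Qed.

Lemma set1_null x : lam [set x] = 0%E.
Proof. exact: lebesgue_measure_set1. Qed.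

(** The endpoints join the null set, since derivatives are known only at interior points. *)
Lemma density_cderive c f g : density c f g ->
  exists N : set (measurableTypeR R), [/\ measurable N, lam N = 0%E &
    forall x, 0 <= x <= c -> ~ N x -> [/\ 0 < x < c,
      is_derive x (1 : R) (fun t => Re (f t)) (Re (g x)),
      is_derive x (1 : R) (fun t => Im (f t)) (Im (g x)) & cderive f x = g x]].
Proof.
case=> _ _ _ [N [mN N0 HN]] _.
have m1 y : measurable ([set y] : set (measurableTypeR R)) by exact: measurable_set1.
exists (N `|` ([set 0] `|` [set c])); split.
- by do 2 apply: measurableU => //.
- apply: null_set_setU => //; first exact: measurableU.
  by apply: null_set_setU => //; exact: set1_null.
- move=> x /andP[x0 xc] /not_orP[Nx /not_orP[/= xn0 xnc]].
  have xc' : 0 < x < c.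
    by rewrite !lt_neqAle x0 xc !andbT eq_sym; apply/andP; split; apply/eqP.
  have [h1 h2] := HN x xc' Nx.
  by split => //; exact: cderiveE.
Qed.

Lemma domS L c x : dom L c -> 0 <= x <= c -> dom L x.
Proof.
move=> [c0 cL] /andP[x0 xc]; split => //; apply: le_lt_trans cL; by rewrite lee_fin.
Qed.

Definition seg c : set R := [set x | 0 <= x <= c].

Lemma segE c : seg c = `[0, c]%classic.
Proof. by apply/seteqP; split => x; rewrite /seg /= in_itv. Qed.

Lemma measurable_seg c : measurable (seg c : set (measurableTypeR R)).
Proof. by rewrite segE; exact: measurable_itv. Qed.

Lemma lebesgue_seg_lty c : (lam (seg c) < +oo)%E.
Proof.
rewrite segE lebesgue_measure_itv /=.
by case: ifPn => _; rewrite ?ltry// oppe0 adde0 ltry.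
Qed.

Lemma density_L2 L f c g : H1loc L f -> dom L c -> density c f g ->
  (\int[lam]_(x in seg c) (cabs (g x) ^+ 2)%:E < +oo)%E.
Proof.
move=> [_ /(_ c)Lf] dc dg; have [N [mN N0 HN]] := density_cderive dg.
rewrite (_ : \int[lam]_(x in seg c) (cabs (g x) ^+ 2)%:E =
  \int[lam]_(x in seg c) (cabs (cderive f x) ^+ 2)%:E)%E; first exact: Lf.
by apply: eq_integral_off_null mN N0 _ => x xc Nx; have [_ _ _ ->] := HN x xc Nx.
Qed.

Lemma measurable_cabs2 (D : set (measurableTypeR R)) (g : measurableTypeR R -> R[i]) :
  measurable_fun D (fun x => Re (g x)) -> measurable_fun D (fun x => Im (g x)) ->
  measurable_fun D (fun x => cabs (g x) ^+ 2).
Proof.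
move=> m1 m2; rewrite (_ : (fun x => _) = (fun x => Re (g x) ^+ 2 + Im (g x) ^+ 2)).
  by apply: measurable_funD; apply: measurable_funX.
by apply/funext => x; rewrite sqr_cabs.
Qed.

(** One estimate for sums, products, conjugates and quotients alike. The bound on increments gives
    absolute continuity of [v]; in the limit of difference quotients it bounds the derivative of [v]
    almost everywhere by those of [f] and [g]. *)
Lemma H1loc_lipschitz L (v f g : R -> R[i]) : H1loc L f -> H1loc L g ->
  (forall c, dom L c -> exists2 C, 0 <= C & forall x y, seg c x -> seg c y ->
     cabs (v x - v y) <= C * (cabs (f x - f y) + cabs (g x - g y) + `|x - y|)) ->
  H1loc L v.
Proof.
move=> Hf Hg lip.
have acv : AC_loc L v.
  move=> c dc e e0; have [C C0 HC] := lip c dc.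
  (* Each of the three sums will be below [e'], so that the total is below [e * (C / (C + 1))]. *)
  pose e' := e / (3 * (C + 1)).
  have e'0 : 0 < e' by rewrite /e' divr_gt0// mulr_gt0//; lra.
  have [d1 d10 H1] := Hf.1 c dc e' e'0.
  have [d2 d20 H2] := Hg.1 c dc e' e'0.
  exists (Num.min (Num.min d1 d2) e'); first by rewrite !lt_min d10 d20.
  move=> n a b ab tr; rewrite !lt_min => /andP[/andP[s1 s2] s3].
  have S (k : 'I_n) : seg c (b k) /\ seg c (a k).
    have [a0 ab_ bc] := ab k (ltn_ord k).
    by split; rewrite /seg /=; apply/andP; split => //; apply: le_trans; eauto.
  apply: (@le_lt_trans _ _ (C * (\sum_(i < n) cabs (f (b i) - f (a i)) +
     \sum_(i < n) cabs (g (b i) - g (a i)) + \sum_(i < n) (b i - a i)))).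
    rewrite -!big_split /= mulr_sumr; apply: ler_sum => i _.
    have [sb sa] := S i; have := HC _ _ sb sa.
    by rewrite [`|_|]ger0_norm// subr_ge0; have [] := ab i (ltn_ord i).
  have := H1 n a b ab tr s1; have := H2 n a b ab tr s2; move: s3.
  set X1 := \sum_(i < n) _; set X2 := \sum_(i < n) _; set X3 := \sum_(i < n) _.
  move=> h1 h2 h3.
  apply: (@le_lt_trans _ _ (C * (3 * e'))); first by apply: ler_wpM2l => //; lra.
  rewrite /e'; have -> : C * (3 * (e / (3 * (C + 1)))) = e * (C / (C + 1)).
    by field; lra.
  by rewrite gtr_pMr// ltr_pdivrMr; lra.
split => // c dc; have [C C0 HC] := lip c dc; have [c0 _] := dc.
move: c0; rewrite le_eqVlt => /predU1P[<-|c0].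
  rewrite (_ : [set x | _] = [set (0 : R)]); first by rewrite integral_set1.
  by apply/seteqP; split => x /=; [move/le_anti|move=> ->; rewrite lexx].
have [gf df] := abs_continuous_density c0 (Hf.1 c dc).
have [gg dg] := abs_continuous_density c0 (Hg.1 c dc).
have [gv dv] := abs_continuous_density c0 (acv c dc).
have [N1 [mN1 N10 HN1]] := density_cderive df.
have [N2 [mN2 N20 HN2]] := density_cderive dg.
have [N3 [mN3 N30 HN3]] := density_cderive dv.
have lf := density_L2 Hf dc df; have lg := density_L2 Hg dc dg.
pose N := N1 `|` (N2 `|` N3).
have mN : measurable N by do 2 apply: measurableU => //.
have N0 : lam N = 0%E.
  by apply: null_set_setU => //; [exact: measurableU|exact: null_set_setU].
(* Cauchy--Schwarz for five terms, the four parts of [gf] and [gg] and the constant 1, gives a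
   factor 5; the two parts of [gv] give a factor 2. *)
pose K := 10 * C ^+ 2.
have K0 : 0 <= K by rewrite mulr_ge0// sqr_ge0.
apply: (@le_lt_trans _ _ (\int[lam]_(x in seg c)
   (K%:E * ((cabs (gf x) ^+ 2)%:E + (cabs (gg x) ^+ 2)%:E + 1%:E)))%E).
  apply: (ge0_le_integral_off_null mN N0) => //.
  - by move=> x _; rewrite lee_fin sqr_ge0.
  - by move=> x _; rewrite -!EFinD -EFinM lee_fin mulr_ge0// addr_ge0// addr_ge0// sqr_ge0.
  move=> x xc /not_orP[n1 /not_orP[n2 n3]].
  have [xc' f1 f2 _] := HN1 x xc n1; have [_ g1 g2 _] := HN2 x xc n2.
  have [_ v1 v2 ->] := HN3 x xc n3.
  rewrite -!EFinD -EFinM lee_fin.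
  pose B := C * (`|Re (gf x)| + `|Im (gf x)| + (`|Re (gg x)| + `|Im (gg x)|) + 1).
  have quot (p : R -> R) (d : R) : is_derive x (1 : R) p d ->
      (fun t => t^-1 * (p (t + x) - p x)) @ 0^' --> d.
    move=> [dp <-]; have : (fun t => t^-1 *: (p (t *: (1 : R) + x) - p x)) @ 0^' --> 'D_1 p x by exact: dp.
    by under eq_fun do rewrite [X in p (X + _)]mulr1.
  (* [p] will be the real or the imaginary part of [v]; the bound passes to the limit of difference
     quotients. *)
  have bound (p : R -> R) (d : R) : is_derive x (1 : R) p d ->
      (forall s t, seg c s -> seg c t -> `|p s - p t| <= cabs (v s - v t)) -> `|d| <= B.
    move=> pd pv.
    have lim1 : (fun t => `|t^-1 * (p (t + x) - p x)|) @ 0^' --> `|d|.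
      by apply: cvg_norm; exact: quot.
    have lim2 : (fun t => C * (`|t^-1 * (Re (f (t + x)) - Re (f x))| + `|t^-1 * (Im (f (t + x)) - Im (f x))|
       + (`|t^-1 * (Re (g (t + x)) - Re (g x))| + `|t^-1 * (Im (g (t + x)) - Im (g x))|) + 1)) @ 0^' --> B.
      apply: cvgMr; apply: cvgD; last exact: cvg_cst.
      by apply: cvgD; apply: cvgD; apply: cvg_norm; apply: quot.
    apply: (ler_cvg_to lim1 lim2); near=> t.
    have t0 : t != 0 by near: t; exact: nbhs_dnbhs_neq.
    have tc : seg c (t + x).
      rewrite /seg /=; have : `|t| < Num.min x (c - x).
        near: t; apply: dnbhs0_lt; rewrite lt_min; move/andP: xc' => [-> ?] /=; lra.
      rewrite lt_min ltr_norml => /andP[/andP[? ?] /ltr_normlP[? ?]]; apply/andP; split; lra.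
    have := HC _ _ tc xc; have := pv _ _ tc xc; move=> h1 h2.
    have := le_trans h1 h2; rewrite addrK.
    have tn0 : `|t| != 0 by rewrite normr_eq0.
    rewrite !normrM normfV ler_pdivrMl ?normr_gt0// => h; apply: le_trans h _.
    have cf (k : R -> R[i]) : cabs (k (t + x) - k x) <=
      `|Re (k (t + x)) - Re (k x)| + `|Im (k (t + x)) - Im (k x)|.
      by apply: le_trans (cabs_le_ReIm _) _; rewrite ReD ImD ReN ImN.
    move: (cf f) (cf g).
    set X1 := `|Re _ - _|; set X2 := `|Im _ - _|; set X3 := `|Re _ - _|; set X4 := `|Im _ - _|.
    move=> cff cfg.
    have -> : `|t| * (C * (`|t|^-1 * X1 + `|t|^-1 * X2 + (`|t|^-1 * X3 + `|t|^-1 * X4) + 1)) =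
      C * (X1 + X2 + (X3 + X4) + `|t|) by field.
    by apply: ler_wpM2l => //; lra.
  have b1 : `|Re (gv x)| <= B.
    apply: (bound (fun t => Re (v t))) => // s t _ _.
    by rewrite -ReN -ReD; exact: Re_le_cabs.
  have b2 : `|Im (gv x)| <= B.
    apply: (bound (fun t => Im (v t))) => // s t _ _.
    by rewrite -ImN -ImD; exact: Im_le_cabs.
  rewrite !sqr_cabs.
  have B0 : 0 <= B := le_trans (normr_ge0 _) b1.
  have s1 : Re (gv x) ^+ 2 <= B ^+ 2 by rewrite -real_normK ?num_real// ler_sqr ?nnegrE.
  have s2 : Im (gv x) ^+ 2 <= B ^+ 2 by rewrite -real_normK ?num_real// ler_sqr ?nnegrE.
  apply: (@le_trans _ _ (B ^+ 2 + B ^+ 2)); first exact: lerD.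
  rewrite /B exprMn /K -(real_normK (num_real (Re (gf x)))) -(real_normK (num_real (Im (gf x)))).
  rewrite -(real_normK (num_real (Re (gg x)))) -(real_normK (num_real (Im (gg x)))).
  move: (`|Re (gf x)|) (`|Im (gf x)|) (`|Re (gg x)|) (`|Im (gg x)|) => a1 a2 a3 a4.
  have -> : C ^+ 2 * (a1 + a2 + (a3 + a4) + 1) ^+ 2 + C ^+ 2 * (a1 + a2 + (a3 + a4) + 1) ^+ 2 =
     C ^+ 2 * (2 * (a1 + a2 + (a3 + a4) + 1) ^+ 2) by ring.
  rewrite (mulrC 10) -(mulrA (C ^+ 2) 10); apply: ler_wpM2l; first exact: sqr_ge0.
  rewrite -subr_ge0.
  (* Lagrange's identity: twice the sum of the squared differences of the five terms. *)
  have -> : 10 * (a1 ^+ 2 + a2 ^+ 2 + (a3 ^+ 2 + a4 ^+ 2) + 1) - 2 * (a1 + a2 + (a3 + a4) + 1) ^+ 2 =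
    2 * ((a1 - a2) ^+ 2 + (a1 - a3) ^+ 2 + (a1 - a4) ^+ 2 + (a1 - 1) ^+ 2 + (a2 - a3) ^+ 2
      + (a2 - a4) ^+ 2 + (a2 - 1) ^+ 2 + (a3 - a4) ^+ 2 + (a3 - 1) ^+ 2 + (a4 - 1) ^+ 2) by ring.
  by rewrite mulr_ge0// !addr_ge0// sqr_ge0.
have [mf1 mf2 _ _ _] := df; have [mg1 mg2 _ _ _] := dg.
have mS := measurable_seg c.
have m1 : measurable_fun (seg c : set (measurableTypeR R)) (fun x => (cabs (gf x) ^+ 2)%:E).
  by apply/measurable_EFinP; apply: measurable_funTS; exact: measurable_cabs2.
have m2 : measurable_fun (seg c : set (measurableTypeR R)) (fun x => (cabs (gg x) ^+ 2)%:E).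
  by apply/measurable_EFinP; apply: measurable_funTS; exact: measurable_cabs2.
rewrite ge0_integralZl//; last 2 first.
- by apply: emeasurable_funD => //; exact: emeasurable_funD.
- by move=> x _; rewrite -!EFinD lee_fin !addr_ge0// sqr_ge0.
rewrite ge0_integralD//; [|by move=> x _; rewrite -EFinD lee_fin addr_ge0// sqr_ge0|exact: emeasurable_funD].
rewrite ge0_integralD//; [|by move=> x _; rewrite lee_fin sqr_ge0..].
rewrite integral_cst//= mul1e.
apply: lte_mul_pinfty => //.
apply: lte_add_pinfty; first exact: lte_add_pinfty.
exact: lebesgue_seg_lty.
Unshelve. all: by end_near. Qed.

End SobolevClosure.

(** * Complex-valued integrals *)

Section ComplexIntegral.
Context {R : realType} (mu : {measure set (measurableTypeR R) -> \bar R}).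
Implicit Types (D : set (measurableTypeR R)) (f g : R -> R[i]) (k : R[i]).

Lemma integrable_cst_lty D (r : R) : measurable D -> (mu D < +oo)%E ->
  mu.-integrable D (fun=> r%:E).
Proof.
move=> mD Dy; apply/integrableP; split; first exact: measurable_cst.
by rewrite integral_cst//= lte_mul_pinfty.
Qed.

Definition cmeasurable D f :=
  measurable_fun D (fun x : measurableTypeR R => Re (f x)) /\
  measurable_fun D (fun x : measurableTypeR R => Im (f x)).

Definition cintegrable D f :=
  cmeasurable D f /\ mu.-integrable D (fun x => (cabs (f x))%:E).

Definition square_integrable D f :=
  cmeasurable D f /\ mu.-integrable D (fun x => (cabs (f x) ^+ 2)%:E).

Lemma cmeasurable_cst D k : cmeasurable D (fun=> k).
Proof. by split; exact: measurable_cst. Qed.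

Lemma cmeasurableD D f g : cmeasurable D f -> cmeasurable D g ->
  cmeasurable D (fun x => f x + g x).
Proof.
move=> [f1 f2] [g1 g2]; split.
  by rewrite (_ : (fun x => _) = (fun x => Re (f x) + Re (g x)));
    [exact: measurable_funD|apply/funext => x; rewrite ReD].
by rewrite (_ : (fun x => _) = (fun x => Im (f x) + Im (g x)));
  [exact: measurable_funD|apply/funext => x; rewrite ImD].
Qed.

Lemma cmeasurableM D f g : cmeasurable D f -> cmeasurable D g ->
  cmeasurable D (fun x => f x * g x).
Proof.
move=> [f1 f2] [g1 g2]; split.
  rewrite (_ : (fun x => _) = (fun x => Re (f x) * Re (g x) - Im (f x) * Im (g x))).
    by apply: measurable_funB; exact: measurable_funM.
  by apply/funext => x; rewrite ReM.
rewrite (_ : (fun x => _) = (fun x => Re (f x) * Im (g x) + Im (f x) * Re (g x))).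
  by apply: measurable_funD; exact: measurable_funM.
by apply/funext => x; rewrite ImM.
Qed.

Lemma cmeasurableJ D f : cmeasurable D f -> cmeasurable D (fun x => (f x)^*).
Proof.
move=> [f1 f2]; split.
  by rewrite (_ : (fun x => _) = (fun x => Re (f x)))//; apply/funext => x; rewrite ReJ.
rewrite (_ : (fun x => _) = (fun x => - Im (f x))); first exact: measurableT_comp.
by apply/funext => x; rewrite ImJ.
Qed.

Lemma cmeasurable_cabs2 D f : cmeasurable D f -> measurable_fun D (fun x => cabs (f x) ^+ 2).
Proof. by move=> [? ?]; exact: measurable_cabs2. Qed.

Lemma cmeasurable_cabs D f : cmeasurable D f -> measurable_fun D (fun x => cabs (f x)).
Proof.
move=> mf; rewrite (_ : (fun x => _) = (fun x => Num.sqrt (cabs (f x) ^+ 2))).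
  apply: (measurableT_comp (f := @Num.sqrt R)); last exact: cmeasurable_cabs2.
  exact: continuous_measurable_fun (@sqrt_continuous R).
by apply/funext => x; rewrite sqrtr_sqr ger0_norm// cabs_ge0.
Qed.

Lemma cintegrable_le D f (b : R -> R) : measurable D -> cmeasurable D f ->
  mu.-integrable D (EFin \o b) -> (forall x, D x -> cabs (f x) <= b x) -> cintegrable D f.
Proof.
move=> mD mf ib fb; split => //; apply: (le_integrable mD _ _ ib).
  by apply/measurable_EFinP; exact: cmeasurable_cabs.
move=> x Dx /=; rewrite lee_fin ger0_norm ?cabs_ge0//.
by apply: le_trans (fb x Dx) (ler_norm _).
Qed.

Lemma cintegrable_Re D f : measurable D -> cintegrable D f ->
  mu.-integrable D (EFin \o (fun x => Re (f x))).
Proof.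
move=> mD [[f1 f2] fi]; apply: (le_integrable mD _ _ fi); first exact/measurable_EFinP.
by move=> x Dx /=; rewrite lee_fin (ger0_norm (cabs_ge0 _)) Re_le_cabs.
Qed.

Lemma cintegrable_Im D f : measurable D -> cintegrable D f ->
  mu.-integrable D (EFin \o (fun x => Im (f x))).
Proof.
move=> mD [[f1 f2] fi]; apply: (le_integrable mD _ _ fi); first exact/measurable_EFinP.
by move=> x Dx /=; rewrite lee_fin (ger0_norm (cabs_ge0 _)) Im_le_cabs.
Qed.

Lemma cintegrableD D f g : measurable D -> cintegrable D f -> cintegrable D g ->
  cintegrable D (fun x => f x + g x).
Proof.
move=> mD [mf fi] [mg gi]; apply: (@cintegrable_le _ _ (fun x => cabs (f x) + cabs (g x))) => //.
- exact: cmeasurableD.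
- by rewrite (_ : _ \o _ = (fun x => (cabs (f x))%:E + (cabs (g x))%:E)%E)//; exact: integrableD.
- by move=> x _; exact: cabsD.
Qed.

Lemma cintegrableZ D k f : measurable D -> cintegrable D f -> cintegrable D (fun x => k * f x).
Proof.
move=> mD [mf fi]; apply: (@cintegrable_le _ _ (fun x => cabs k * cabs (f x))) => //.
- by apply: cmeasurableM => //; exact: cmeasurable_cst.
- by rewrite (_ : _ \o _ = (fun x => (cabs k)%:E * (cabs (f x))%:E)%E)//; exact: integrableZl.
- by move=> x _; rewrite cabsM.
Qed.

Lemma cintegrable_sum D (I : eqType) (s : seq I) (f : I -> R -> R[i]) : measurable D ->
  (forall i, i \in s -> cintegrable D (f i)) -> cintegrable D (fun x => \sum_(i <- s) f i x).
Proof.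
move=> mD; elim: s => [_|i s IH h].
  rewrite (_ : (fun x => _) = (fun=> 0)); last by apply/funext => x; rewrite big_nil.
  split; first exact: cmeasurable_cst.
  by rewrite (_ : (fun x => _) = cst 0%E); [exact: integrable0|apply/funext => x; rewrite cabs0].
rewrite (_ : (fun x => _) = (fun x => f i x + \sum_(j <- s) f j x)); last first.
  by apply/funext => x; rewrite big_cons.
apply: cintegrableD => //; first by apply: h; rewrite inE eqxx.
by apply: IH => j js; apply: h; rewrite inE js orbT.
Qed.

Lemma cintegralD D f g : measurable D -> cintegrable D f -> cintegrable D g ->
  cintegral mu D (fun x => f x + g x) = cintegral mu D f + cintegral mu D g.
Proof.
move=> mD fi gi; apply: complex_ext; rewrite ?ReD ?ImD /cintegral /=.
  by under eq_Rintegral do rewrite ReD; rewrite RintegralD//; exact: cintegrable_Re.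
by under eq_Rintegral do rewrite ImD; rewrite RintegralD//; exact: cintegrable_Im.
Qed.

Lemma cintegralZ D k f : measurable D -> cintegrable D f ->
  cintegral mu D (fun x => k * f x) = k * cintegral mu D f.
Proof.
move=> mD fi; have rf := cintegrable_Re mD fi; have jf := cintegrable_Im mD fi.
have Z (r : R) (h : R -> R) : mu.-integrable D (EFin \o h) ->
    mu.-integrable D (EFin \o (fun x => r * h x)).
  move=> hi; rewrite (_ : _ \o _ = (fun x => r%:E * (h x)%:E)%E)//; exact: integrableZl.
apply: complex_ext; rewrite ?ReM ?ImM /cintegral /=.
  under eq_Rintegral do rewrite ReM.
  by rewrite RintegralB// ?RintegralZl//; exact: Z.
under eq_Rintegral do rewrite ImM.
by rewrite RintegralD// ?RintegralZl//; exact: Z.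
Qed.

Lemma cintegral_sum D (I : eqType) (s : seq I) (f : I -> R -> R[i]) : measurable D ->
  (forall i, i \in s -> cintegrable D (f i)) ->
  cintegral mu D (fun x => \sum_(i <- s) f i x) = \sum_(i <- s) cintegral mu D (f i).
Proof.
move=> mD fi; apply: complex_ext; rewrite ?Re_sum ?Im_sum /cintegral /=.
  under eq_Rintegral do rewrite Re_sum.
  by rewrite Rintegral_sum// => i /fi; exact: cintegrable_Re.
under eq_Rintegral do rewrite Im_sum.
by rewrite Rintegral_sum// => i /fi; exact: cintegrable_Im.
Qed.

Lemma cintegralJ D f : measurable D -> cintegrable D f ->
  cintegral mu D (fun x => (f x)^*) = (cintegral mu D f)^*.
Proof.
move=> mD fi; apply: complex_ext; rewrite ?ReJ ?ImJ /cintegral /=.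
  by under eq_Rintegral do rewrite ReJ.
under eq_Rintegral do rewrite ImJ -mulN1r.
by rewrite RintegralZl ?mulN1r//; exact: cintegrable_Im.
Qed.

Lemma cabs_cintegral_le D f (b : R -> R) : measurable D -> cintegrable D f ->
  mu.-integrable D (EFin \o b) -> (forall x, D x -> cabs (f x) <= b x) ->
  cabs (cintegral mu D f) <= 2 * \int[mu]_(x in D) b x.
Proof.
move=> mD fi ib fb; apply: le_trans (cabs_le_ReIm _) _.
have S (p : R -> R) : mu.-integrable D (EFin \o p) -> (forall x, D x -> `|p x| <= cabs (f x)) ->
    `|\int[mu]_(x in D) p x| <= \int[mu]_(x in D) b x.
  move=> pi pf; apply: le_trans (le_normr_Rintegral mD pi) _.
  apply: le_Rintegral => //; first exact: integrable_norm.
  by move=> x Dx; apply: le_trans (pf x Dx) (fb x Dx).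
rewrite mulr_natl mulr2n /cintegral /=; apply: lerD; apply: S.
- exact: cintegrable_Re.
- by move=> x _; exact: Re_le_cabs.
- exact: cintegrable_Im.
- by move=> x _; exact: Im_le_cabs.
Qed.

Lemma square_integrableM D f g : measurable D ->
  square_integrable D f -> square_integrable D g -> cintegrable D (fun x => f x * g x).
Proof.
move=> mD [mf fi] [mg gi].
apply: (@cintegrable_le _ _ (fun x => cabs (f x) ^+ 2 + cabs (g x) ^+ 2)) => //.
- exact: cmeasurableM.
- by rewrite (_ : _ \o _ = (fun x => (cabs (f x) ^+ 2)%:E + (cabs (g x) ^+ 2)%:E)%E)//; exact: integrableD.
- move=> x _; rewrite cabsM.
  have := cabs_ge0 (f x); have := cabs_ge0 (g x).
  move: (cabs (f x)) (cabs (g x)) => u v u0 v0; have := sqr_ge0 (u - v); nra.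
Qed.

Lemma square_integrable_bounded D f g M : measurable D -> cmeasurable D g ->
  (forall x, D x -> cabs (g x) <= M) -> square_integrable D f ->
  square_integrable D (fun x => g x * f x).
Proof.
move=> mD mg gM [mf fi]; split; first exact: cmeasurableM.
have : mu.-integrable D (fun x => ((M ^+ 2)%:E * (cabs (f x) ^+ 2)%:E)%E) by exact: integrableZl.
apply: le_integrable => //.
  by apply/measurable_EFinP; apply: cmeasurable_cabs2; exact: cmeasurableM.
move=> x Dx; rewrite -EFinM !abse_EFin lee_fin (ger0_norm (sqr_ge0 _)) (ger0_norm (mulr_ge0 (sqr_ge0 _) (sqr_ge0 _))).
rewrite cabsM exprMn ler_wpM2r ?sqr_ge0// ler_sqr ?nnegrE ?cabs_ge0//; first exact: gM.
exact: le_trans (cabs_ge0 _) (gM x Dx).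
Qed.

Lemma square_integrable_fin D f M : measurable D -> (mu D < +oo)%E -> cmeasurable D f ->
  (forall x, D x -> cabs (f x) <= M) -> square_integrable D f.
Proof.
move=> mD Dy mf fM; split => //.
apply: (@le_integrable _ _ _ _ _ mD _ (fun=> (M ^+ 2)%:E)).
- by apply/measurable_EFinP; exact: cmeasurable_cabs2.
- move=> x Dx; rewrite !abse_EFin lee_fin !ger0_norm ?sqr_ge0//.
  rewrite ler_sqr ?nnegrE ?cabs_ge0//; first exact: fM.
  exact: le_trans (cabs_ge0 _) (fM x Dx).
- by apply: integrable_cst_lty.
Qed.

(** The domains may differ as long as the integrands vanish on the excess; this moves integrals from
    [dom L] to a segment. *)
Lemma cintegral_off_null (N : set (measurableTypeR R)) (D E : set R) f g :
  measurable N -> mu N = 0%E -> (forall x, D x -> ~ N x -> E x -> f x = g x) ->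
  (forall x, D x -> ~ N x -> ~ E x -> f x = 0) ->
  (forall x, E x -> ~ N x -> ~ D x -> g x = 0) ->
  cintegral mu D f = cintegral mu E g.
Proof.
move=> mN N0 h1 h2 h3.
suff S (p : R[i] -> R) : p 0 = 0 ->
    \int[mu]_(x in D) p (f x) = \int[mu]_(x in E) p (g x).
  by rewrite /cintegral; congr (_ +i* _); apply: S.
move=> p0; rewrite Rintegral_mkcond [RHS]Rintegral_mkcond.
apply: (eq_Rintegral_off_null mN N0) => x _ Nx; rewrite !patchE.
case: ifPn => [/set_mem Dx|/negP]; case: ifPn => [/set_mem Ex|/negP] //.
- by rewrite h1.
- by move=> Ex; rewrite h2// => Ex'; apply: Ex; exact/mem_set.
- by move=> Dx; rewrite h3// => Dx'; apply: Dx; exact/mem_set.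
Qed.

End ComplexIntegral.

(** * Almost everywhere derivatives and the energy form *)

Section WeakDerivative.
Context {R : realType}.
Implicit Types (f g h : R -> R[i]) (c u v x p q : R) (k : R[i]).
Local Notation lam := (@lebesgue_measure R).

Definition cder f x (d : R[i]) :=
  is_derive x (1 : R) (fun t => Re (f t)) (Re d) /\
  is_derive x (1 : R) (fun t => Im (f t)) (Im d).

Lemma cder_cderive f x d : cder f x d -> cderive f x = d.
Proof. by case=> ? ?; exact: cderiveE. Qed.

Lemma is_derive_ext (a b : R -> R) x (d d' : R) : (forall t, a t = b t) -> d = d' ->
  is_derive x (1 : R) a d -> is_derive x (1 : R) b d'.
Proof. by move=> /funext -> ->. Qed.

Lemma cderC k x : cder (fun=> k) x 0.
Proof. by split; exact: is_derive_cst. Qed.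

Lemma cderD f h x a b : cder f x a -> cder h x b -> cder (fun t => f t + h t) x (a + b).
Proof.
move=> [f1 f2] [h1 h2]; split.
- apply: (is_derive_ext _ _ (is_deriveD f1 h1)) => [t|]; by rewrite ReD.
- apply: (is_derive_ext _ _ (is_deriveD f2 h2)) => [t|]; by rewrite ImD.
Qed.

Lemma is_derive_mul (a b : R -> R) x (a' b' : R) :
  is_derive x (1 : R) a a' -> is_derive x (1 : R) b b' ->
  is_derive x (1 : R) (fun t => a t * b t) (a' * b x + a x * b').
Proof.
move=> ha hb; apply: (is_derive_ext _ _ (is_deriveM ha hb)) => //.
by rewrite /GRing.scale /=; ring.
Qed.

Lemma cderM f h x a b : cder f x a -> cder h x b ->
  cder (fun t => f t * h t) x (a * h x + f x * b).
Proof.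
move=> [f1 f2] [h1 h2]; split.
- apply: (is_derive_ext _ _ (is_deriveB (is_derive_mul f1 h1) (is_derive_mul f2 h2))) => [t|].
    by rewrite ReM.
  by rewrite ReD !ReM; ring.
- apply: (is_derive_ext _ _ (is_deriveD (is_derive_mul f1 h2) (is_derive_mul f2 h1))) => [t|].
    by rewrite ImM.
  by rewrite ImD !ImM; ring.
Qed.

Lemma cderJ f x a : cder f x a -> cder (fun t => (f t)^*) x a^*.
Proof.
move=> [f1 f2]; split; first by apply: (is_derive_ext _ _ f1) => [t|]; rewrite ReJ.
by apply: (is_derive_ext _ _ (is_deriveN f2)) => [t|]; rewrite ImJ.
Qed.

Lemma cder_near f h x a : (\forall t \near x, f t = h t) -> cder f x a -> cder h x a.
Proof.
move=> fh [f1 f2]; split.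
- by apply: near_eq_is_derive f1; near=> t; rewrite (near fh t).
- by apply: near_eq_is_derive f2; near=> t; rewrite (near fh t).
Unshelve. all: by end_near. Qed.

Lemma cder_real (r : R -> R) x (d : R) : is_derive x (1 : R) r d -> cder (fun t => (r t)%:C) x d%:C.
Proof. by move=> h; split => //=; exact: is_derive_cst. Qed.

Definition weak_deriv c f g := exists N : set (measurableTypeR R),
  [/\ measurable N, lam N = 0%E & forall x, seg c x -> ~ N x -> 0 < x < c /\ cder f x (g x)].

Lemma density_weak c f g : density c f g -> weak_deriv c f g.
Proof.
move=> /density_cderive[N [mN N0 HN]]; exists N; split => // x xc Nx.
by have [h1 h2 h3 _] := HN x xc Nx.
Qed.

Lemma weak_deriv_map2 c f1 g1 f2 g2 F G :
  (forall x, 0 < x < c -> cder f1 x (g1 x) -> cder f2 x (g2 x) -> cder F x (G x)) ->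
  weak_deriv c f1 g1 -> weak_deriv c f2 g2 -> weak_deriv c F G.
Proof.
move=> H [N1 [m1 n1 h1]] [N2 [m2 n2 h2]]; exists (N1 `|` N2); split.
- exact: measurableU.
- exact: null_set_setU.
- move=> x xc /not_orP[nx1 nx2]; have [xc' ?] := h1 x xc nx1; have [_ ?] := h2 x xc nx2.
  by split => //; exact: H.
Qed.

Lemma weak_deriv_fin c f g (s : seq R) : 0 <= c ->
  (forall x, 0 < x < c -> x \notin s -> cder f x (g x)) -> weak_deriv c f g.
Proof.
move=> c0 H; exists [set` [:: 0, c & s]]; split; first exact: measurable_set_seq.
  elim: [:: 0, c & s] => [|y t IH]; first by rewrite set_seq_nil measure0.
  rewrite set_seq_cons; by apply: null_set_setU => //; (exact: measurable_set1 || exact: measurable_set_seq || exact: set1_null).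
move=> x /andP[x0 xc] /= /negP; rewrite !inE !negb_or => /and3P[h1 h2 h3].
have xc' : 0 < x < c by rewrite !lt_neqAle x0 xc eq_sym h1 h2.
by split => //; exact: H.
Qed.

(** Bilinear, without conjugation; conjugates are put into the test function. *)
Definition energy (L : \bar R) f h := cintegral lam (dom L) (fun x => cderive f x * cderive h x).

Lemma dom_open_nbhs (L : \bar R) x : (x%:E < L)%E -> \forall t \near x, (t%:E < L)%E.
Proof.
case: L => [l| |] //=.
- rewrite lte_fin => xl; near=> t; rewrite lte_fin; near: t; exact: lt_nbhsl.
- by move=> _; near=> t; rewrite ltry.
Unshelve. all: by end_near. Qed.

(** Beyond [c] the function [h] is zero near each point, so [cderive h] vanishes there; on [[0, c]]
    the derivatives are replaced by their representatives. *)
Lemma energyE L c f h gf gh : dom L c -> (forall x, dom L x -> c < x -> h x = 0) ->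
  weak_deriv c f gf -> weak_deriv c h gh ->
  energy L f h = cintegral lam (seg c) (fun x => gf x * gh x).
Proof.
move=> dc h0 [N1 [m1 n1 H1]] [N2 [m2 n2 H2]].
apply: (@cintegral_off_null _ _ (N1 `|` N2)).
- exact: measurableU.
- exact: null_set_setU.
- move=> x _ /not_orP[nx1 nx2] xc.
  have [_ /cder_cderive ->] := H1 x xc nx1; by have [_ /cder_cderive ->] := H2 x xc nx2.
- move=> x [x0 xL] _ nxc; have cx : c < x.
    by rewrite ltNge; apply/negP => xc; apply: nxc; rewrite /seg /= x0.
  have x0' : 0 < x by apply: le_lt_trans cx; case: dc.
  rewrite (@cder_cderive h x 0) ?mulr0//; apply: cder_near (cderC 0 x).
  near=> t; rewrite h0//; last by near: t; exact: lt_nbhsr.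
  split; last by near: t; exact: dom_open_nbhs.
  by apply: ltW; near: t; exact: lt_nbhsr.
- by move=> x xc _ ndx; exfalso; apply: ndx; exact: domS xc.
Unshelve. all: by end_near. Qed.

End WeakDerivative.

(** * Hölder estimates *)

Section SobolevToolkit.
Context {R : realType} (L : \bar R).
Implicit Types (f g h : R -> R[i]) (c u v x p q : R) (k : R[i]).
Local Notation lam := (@lebesgue_measure R).

Lemma density_exists f c : H1loc L f -> dom L c -> 0 < c -> exists g, density c f g.
Proof. by move=> Hf dc c0; apply: abs_continuous_density => //; exact: Hf.1. Qed.

Lemma density_square_integrable f c g : H1loc L f -> dom L c -> density c f g ->
  square_integrable lam (seg c) g.
Proof.
move=> Hf dc dg; have [m1 m2 _ _ _] := dg; split.
  by split; apply: measurable_funTS.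
apply/integrableP; split.
  by apply/measurable_EFinP; apply: measurable_funTS; exact: measurable_cabs2.
under eq_integral do rewrite /= ger0_norm ?sqr_ge0//.
exact: density_L2 Hf dc dg.
Qed.

Lemma measurable_itvR (i : interval R) : measurable ([set` i] : set (measurableTypeR R)).
Proof. exact: measurable_itv. Qed.

Lemma fine_lebesgue_itv u v : u <= v -> fine (lam `[u, v]%classic) = v - u.
Proof.
move=> uv; rewrite lebesgue_measure_itv /= lte_fin.
have [_|vu] := ltP u v; first by [].
by rewrite /=; apply/esym/eqP; rewrite subr_eq0 eq_le vu uv.
Qed.

Lemma lebesgue_itv_lty u v : (lam `[u, v]%classic < +oo)%E.
Proof.
by rewrite lebesgue_measure_itv /=; case: ifPn => _; rewrite ?ltry// -EFinD ltry.
Qed.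

(** Non-negativity of the integral of [(g - t) ^+ 2], with [t] the mean of [g]. *)
Lemma Rintegral_sqr_le (g : R -> R) u v : u < v ->
  lam.-integrable `[u, v]%classic (EFin \o g) ->
  lam.-integrable `[u, v]%classic (EFin \o (fun x => g x ^+ 2)) ->
  (\int[lam]_(x in `[u, v]%classic) g x) ^+ 2 <=
    (v - u) * \int[lam]_(x in `[u, v]%classic) (g x ^+ 2).
Proof.
move=> uv ig ig2; set m := \int[lam]_(x in _) g x.
have mI := measurable_itvR `[u, v].
have l0 : v - u != 0 by rewrite subr_eq0 gt_eqF.
have l1 : 0 < v - u by rewrite subr_gt0.
pose t := m / (v - u).
have ic : lam.-integrable `[u, v]%classic (EFin \o (fun=> t ^+ 2)).
  by apply: integrable_cst_lty => //; exact: lebesgue_itv_lty.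
have ig' : lam.-integrable `[u, v]%classic (EFin \o (fun x => 2 * t * g x)).
  by rewrite (_ : _ \o _ = (fun x => (2 * t)%:E * (g x)%:E)%E)//; exact: integrableZl.
have : 0 <= \int[lam]_(x in `[u, v]%classic) (g x ^+ 2 + t ^+ 2 - 2 * t * g x).
  apply: Rintegral_ge0 => x _; have := sqr_ge0 (g x - t); nra.
have ia : lam.-integrable `[u, v]%classic (EFin \o (fun x => g x ^+ 2 + t ^+ 2)).
  by rewrite (_ : _ \o _ = (fun x => (g x ^+ 2)%:E + (t ^+ 2)%:E)%E)//; exact: integrableD.
rewrite RintegralB// RintegralD// Rintegral_cst// RintegralZl// (fine_lebesgue_itv (ltW uv)).
rewrite -/m; set I := \int[lam]_(x in _) _ => h.
have E : (I + t ^+ 2 * (v - u) - 2 * t * m) * (v - u) = (v - u) * I - m ^+ 2.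
  by rewrite /t; field.
by rewrite -subr_ge0 -E; apply: mulr_ge0; [exact: h|exact: ltW].
Qed.

Lemma cintegral_hoelder g u v : u < v -> square_integrable lam `[u, v]%classic g ->
  cabs (cintegral lam `[u, v]%classic g) ^+ 2 <=
    (v - u) * \int[lam]_(x in `[u, v]%classic) (cabs (g x) ^+ 2).
Proof.
move=> uv [[m1 m2] sg]; have mI := measurable_itvR `[u, v].
have iC : lam.-integrable `[u, v]%classic (EFin \o (fun=> 1 : R)).
  by apply: integrable_cst_lty => //; exact: lebesgue_itv_lty.
have bnd (p : R[i] -> R) : measurable_fun `[u, v]%classic (fun x : measurableTypeR R => p (g x)) ->
    (forall z, p z ^+ 2 <= cabs z ^+ 2) ->
    lam.-integrable `[u, v]%classic (EFin \o (fun x => p (g x) ^+ 2)) /\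
    lam.-integrable `[u, v]%classic (EFin \o (fun x => p (g x))).
  move=> mp pl.
  have i2 : lam.-integrable `[u, v]%classic (EFin \o (fun x => p (g x) ^+ 2)).
    apply: (le_integrable mI _ _ sg).
      by apply/measurable_EFinP; exact: measurable_funX.
    by move=> x _; rewrite !abse_EFin lee_fin !ger0_norm ?sqr_ge0.
  split => //; apply: (le_integrable mI _ _ (integrableD mI iC i2)).
    exact/measurable_EFinP.
  move=> x _; rewrite /= lee_fin [leRHS]ger0_norm; last by rewrite addr_ge0// sqr_ge0.
  rewrite -(real_normK (num_real (p (g x)))); have := sqr_ge0 (`|p (g x)| - 1).
  by have := normr_ge0 (p (g x)); move: (`|p (g x)|) => r; nra.
have [z|r2 r1] := bnd _ m1; first by rewrite sqr_cabs lerDl sqr_ge0.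
have [z|j2 j1] := bnd _ m2; first by rewrite sqr_cabs lerDr sqr_ge0.
rewrite sqr_cabs /cintegral /=.
under [X in _ <= _ * X]eq_Rintegral do rewrite sqr_cabs.
by rewrite RintegralD// mulrDr; apply: lerD; apply: Rintegral_sqr_le.
Qed.

Lemma square_integrableS (D E : set (measurableTypeR R)) g : measurable D -> measurable E ->
  D `<=` E -> square_integrable lam E g -> square_integrable lam D g.
Proof.
move=> mD mE DE [[m1 m2] sg]; split; last by apply: integrableS sg.
by split; [apply: measurable_funS m1|apply: measurable_funS m2].
Qed.

Lemma itv_seg u v c : 0 <= u -> v <= c -> `[u, v]%classic `<=` seg c.
Proof.
by move=> u0 vc; rewrite segE => x; rewrite /= !in_itv /= => /andP[h1 h2]; rewrite (le_trans u0 h1) (le_trans h2 vc).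
Qed.

Lemma density_hoelder f c g u v : H1loc L f -> dom L c -> density c f g ->
  0 <= u -> u <= v -> v <= c ->
  cabs (f v - f u) ^+ 2 <= (v - u) * \int[lam]_(x in `[u, v]%classic) (cabs (g x) ^+ 2).
Proof.
move=> Hf dc dg u0 uv vc; have [_ _ _ _ ftc] := dg.
move: uv; rewrite le_eqVlt => /predU1P[<-|uv].
  by rewrite !subrr cabs0 expr0n mul0r.
rewrite ftc ?(ltW uv)//; apply: cintegral_hoelder => //.
apply: square_integrableS (density_square_integrable Hf dc dg).
- exact: measurable_itvR.
- exact: measurable_seg.
- exact: itv_seg.
Qed.

Lemma H1loc_hoelder f c : H1loc L f -> dom L c -> exists2 K, 0 <= K &
  forall u v, seg c u -> seg c v -> cabs (f v - f u) ^+ 2 <= K * `|v - u|.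
Proof.
move=> Hf dc; have [c0 _] := dc; move: c0; rewrite le_eqVlt => /predU1P[c0|c0].
  exists 0 => // u v; rewrite /seg /= -c0 => /le_anti <- /le_anti <-.
  by rewrite !subrr cabs0 expr0n mul0r.
have [g dg] := density_exists Hf dc c0.
have [_ sg] := density_square_integrable Hf dc dg.
exists (\int[lam]_(x in seg c) (cabs (g x) ^+ 2)).
  by apply: Rintegral_ge0 => x _; exact: sqr_ge0.
have W u v : seg c u -> seg c v -> u <= v -> cabs (f v - f u) ^+ 2 <=
    (\int[lam]_(x in seg c) (cabs (g x) ^+ 2)) * (v - u).
  move=> /andP[u0 _] /andP[_ vc] uv; rewrite mulrC.
  apply: le_trans (density_hoelder Hf dc dg u0 uv vc) _.
  rewrite ler_wpM2l ?subr_ge0//.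
  have Isub : `[u, v]%classic `<=` seg c.
    by rewrite segE => x; rewrite /= !in_itv /= => /andP[h1 h2]; rewrite (le_trans u0 h1) (le_trans h2 vc).
  apply: fine_le.
  - by apply: integrable_fin_num => //; apply: integrableS sg => //; exact: measurable_seg.
  - by apply: integrable_fin_num => //; exact: measurable_seg.
  - apply: (@ge0_le_integral_off_null _ _ _ lam set0) => //.
    + by move=> x _; rewrite lee_fin sqr_ge0.
    + by move=> x _; rewrite lee_fin sqr_ge0.
move=> u v su sv; have [uv|vu] := leP u v.
  by rewrite ger0_norm ?subr_ge0//; exact: W.
by rewrite cabs_distC ltr0_norm ?subr_lt0// opprB; apply: W => //; exact: ltW.
Qed.

Lemma H1loc_bounded f c : H1loc L f -> dom L c -> exists2 M, 0 <= M &
  forall x, seg c x -> cabs (f x) <= M.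
Proof.
move=> Hf dc; have [K K0 HK] := H1loc_hoelder Hf dc; have [c0 _] := dc.
(* The summand [K * c + 1] comes from [a <= a ^+ 2 + 1] and the Hölder bound on [a ^+ 2]. *)
exists (cabs (f 0) + (K * c + 1)); first by rewrite !addr_ge0 ?cabs_ge0 ?mulr_ge0.
move=> x xc; have s0 : seg c 0 by rewrite /seg /= lexx.
have := HK _ _ s0 xc; have /andP[x0 xlc] := xc; rewrite subr0 ger0_norm// => h.
have -> : f x = f 0 + (f x - f 0) by ring.
apply: le_trans (cabsD _ _) _; rewrite lerD2l.
have {}h := le_trans h (ler_wpM2l K0 xlc).
have := cabs_ge0 (f x - f 0); move: (cabs _) h => a; nra.
Qed.

(** Continuity on the whole line after clamping yields measurability on segments and access to the
    extreme value theorem. *)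
Lemma H1loc_continuous_clamp f c (p : R[i] -> R) : H1loc L f -> dom L c ->
  (forall y z : R[i], `|p y - p z| <= cabs (y - z)) -> continuous (fun x => p (f (clamp c x))).
Proof.
move=> Hf dc pl x; have [K K0 HK] := H1loc_hoelder Hf dc; have [c0 _] := dc.
apply/cvgrPdist_lt => e e0; near=> y.
apply: le_lt_trans (pl _ _) _.
rewrite -(ltr_sqr (x := cabs _)) ?nnegrE ?cabs_ge0 ?ltW//.
apply: le_lt_trans (HK _ _ (clamp_in _ c0) (clamp_in _ c0)) _.
apply: (@le_lt_trans _ _ (K * `|x - y|)).
  rewrite ler_wpM2l//; have [xy|yx] := leP x y.
    by rewrite distrC [leRHS]distrC !ger0_norm ?subr_ge0 ?clamp_le// clamp_sub.
  by rewrite !ger0_norm ?subr_ge0 ?clamp_le// ?(ltW yx)// clamp_sub// ltW.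
apply: (@le_lt_trans _ _ ((K + 1) * `|x - y|)); first by rewrite ler_wpM2r// lerDl.
rewrite mulrC -ltr_pdivlMr; last lra.
near: y; apply: cvgr_dist_lt => //; first by rewrite divr_gt0 ?exprn_gt0//; lra.
Unshelve. all: by end_near. Qed.

Lemma H1loc_cmeasurable f c : H1loc L f -> dom L c -> cmeasurable (seg c) f.
Proof.
move=> Hf dc; have [c0 _] := dc.
have S (p : R[i] -> R) : (forall y z : R[i], `|p y - p z| <= cabs (y - z)) ->
    measurable_fun (seg c : set (measurableTypeR R)) (fun x : measurableTypeR R => p (f x)).
  move=> pl; apply: (@eq_measurable_fun _ _ _ _ _ (fun x : measurableTypeR R => p (f (clamp c x)))).
    by move=> x /set_mem xc; rewrite clampE.
  by apply: measurable_funTS; exact: continuous_measurable_fun (H1loc_continuous_clamp Hf dc pl).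
split; apply: S => y z; rewrite -?ReN -?ReD -?ImN -?ImD; [exact: Re_le_cabs|exact: Im_le_cabs].
Qed.

End SobolevToolkit.

(** * Products, quotients and supports *)

Section SobolevAlgebra.
Context {R : realType} (L : \bar R).
Implicit Types (f g h : R -> R[i]) (c u v x p q : R) (k : R[i]).
Local Notation lam := (@lebesgue_measure R).

Lemma H1loc_const k : H1loc L (fun=> k).
Proof.
split.
  move=> c _ e e0; exists 1 => // n u v _ _ _.
  by rewrite big1// => i _; rewrite subrr cabs0.
move=> c _; rewrite (@integral0_eq _ _ _ lam _ (fun x => (cabs (cderive (fun=> k) x) ^+ 2)%:E))// => x _.
by rewrite (cder_cderive (cderC k x)) cabs0 expr0n.
Qed.

Lemma H1loc_lip f C : 0 <= C ->
  (forall x y, 0 <= x -> 0 <= y -> cabs (f x - f y) <= C * `|x - y|) -> H1loc L f.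
Proof.
move=> C0 fC; apply: (@H1loc_lipschitz _ _ _ _ _ (H1loc_const 0) (H1loc_const 0)) => c dc.
exists C => // x y /andP[x0 _] /andP[y0 _]; rewrite subrr cabs0 !add0r; exact: fC.
Qed.

Lemma H1locD f g : H1loc L f -> H1loc L g -> H1loc L (fun x => f x + g x).
Proof.
move=> Hf Hg; apply: H1loc_lipschitz Hf Hg _ => c dc; exists 1 => // x y _ _.
rewrite mul1r opprD addrACA; apply: le_trans (cabsD _ _) _; by rewrite lerDl.
Qed.

Lemma H1locM f g : H1loc L f -> H1loc L g -> H1loc L (fun x => f x * g x).
Proof.
move=> Hf Hg; apply: (H1loc_lipschitz Hf Hg) => c dc.
have [M1 M10 h1] := H1loc_bounded Hf dc; have [M2 M20 h2] := H1loc_bounded Hg dc.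
exists (M1 + M2); first exact: addr_ge0.
move=> x y sx sy.
have -> : f x * g x - f y * g y = f x * (g x - g y) + (f x - f y) * g y by ring.
apply: le_trans (cabsD _ _) _; rewrite !cabsM.
have a := h1 x sx; have b := h2 y sy.
have e1 : cabs (f x) * cabs (g x - g y) <= M1 * cabs (g x - g y) by rewrite ler_wpM2r ?cabs_ge0.
have e2 : cabs (f x - f y) * cabs (g y) <= cabs (f x - f y) * M2 by rewrite ler_wpM2l ?cabs_ge0.
have e3 : 0 <= M1 * cabs (f x - f y) by rewrite mulr_ge0 ?cabs_ge0.
have e4 : 0 <= M2 * cabs (g x - g y) by rewrite mulr_ge0 ?cabs_ge0.
have e5 : 0 <= (M1 + M2) * `|x - y| by rewrite mulr_ge0// addr_ge0.
rewrite [X in _ <= X](_ : _ = M1 * cabs (g x - g y) + cabs (f x - f y) * M2 +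
  M1 * cabs (f x - f y) + M2 * cabs (g x - g y) + (M1 + M2) * `|x - y|); last by ring.
lra.
Qed.

Lemma H1locZ k f : H1loc L f -> H1loc L (fun x => k * f x).
Proof. by move=> Hf; exact: (H1locM (H1loc_const k) Hf). Qed.

Lemma H1locJ f : H1loc L f -> H1loc L (fun x => (f x)^*).
Proof.
move=> Hf; apply: (H1loc_lipschitz Hf Hf) => c dc; exists 1 => // x y _ _.
by rewrite mul1r -rmorphB cabsJ -addrA lerDl addr_ge0// cabs_ge0.
Qed.

Lemma H1loc_eq f g : (forall x, f x = g x) -> H1loc L f -> H1loc L g.
Proof. by move=> /funext ->. Qed.

Lemma H1loc_sum (I : Type) (s : seq I) (k : I -> R[i]) (f : I -> R -> R[i]) :
  (forall i, H1loc L (f i)) -> H1loc L (fun x => \sum_(i <- s) k i * f i x).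
Proof.
move=> Hf; elim: s => [|i s IH].
  by apply: (H1loc_eq _ (H1loc_const 0)) => x; rewrite big_nil.
apply: (H1loc_eq _ (H1locD (H1locZ (k i) (Hf i)) IH)) => x.
by rewrite big_cons.
Qed.

Lemma H1loc_cabs_min f c p q : H1loc L f -> dom L c -> 0 <= p -> p <= q -> q <= c ->
  (forall x, p <= x <= q -> f x != 0) ->
  exists2 d, 0 < d & forall x, p <= x <= q -> d <= cabs (f x).
Proof.
move=> Hf dc p0 pq qc fn0.
have pl (y z : R[i]) : `|cabs y - cabs z| <= cabs (y - z).
  have a := cabsD (y - z) z; have b := cabsD (z - y) y; move: a b.
  rewrite !subrK (cabs_distC z y) ler_norml => a b; apply/andP; split; lra.
have cf := H1loc_continuous_clamp Hf dc pl.
have [x xpq xm] := @EVT_min R (fun x => cabs (f (clamp c x))) p q pq (continuous_subspaceT cf).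
move: xpq; rewrite in_itv /= => /andP[px xq].
have cE y : p <= y <= q -> clamp c y = y.
  by move=> /andP[py yq]; rewrite clampE// (le_trans p0 py) (le_trans yq qc).
exists (cabs (f x)); first by rewrite cabs_gt0 fn0// px.
move=> y ypq; have := xm y; rewrite in_itv /= => /(_ ypq).
by rewrite !cE// px.
Qed.

(** The cut makes no jump: across an endpoint of [[p, q]] the increment is a multiple of
    [g x - g y], because [g y = 0] outside. This provides test functions divided by a member of the
    chain. *)
Lemma H1loc_cut_div g f p q c : H1loc L g -> H1loc L f -> dom L c -> 0 <= p -> p <= q -> q <= c ->
  (forall x, p <= x <= q -> f x != 0) ->
  (forall x, dom L x -> ~ (p <= x <= q) -> g x = 0) ->
  H1loc L (fun x => if p <= x <= q then g x / f x else 0).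
Proof.
move=> Hg Hf dc p0 pq qc fn0 g0; have [d d0 fd] := H1loc_cabs_min Hf dc p0 pq qc fn0.
apply: (H1loc_lipschitz Hg Hf) => c' dc'; have [M M0 gM] := H1loc_bounded Hg dc'.
exists (d^-1 + M * d^-1 ^+ 2).
  by apply: addr_ge0; [rewrite invr_ge0 ltW|rewrite mulr_ge0// sqr_ge0].
have di : 0 <= d^-1 by rewrite invr_ge0 ltW.
have inv x : p <= x <= q -> (cabs (f x))^-1 <= d^-1.
  by move=> /fd h; rewrite lef_pV2 ?posrE//; exact: lt_le_trans h.
have K0 : 0 <= M * d^-1 ^+ 2 by rewrite mulr_ge0// sqr_ge0.
have one x y : seg c' x -> seg c' y -> p <= x <= q -> ~~ (p <= y <= q) ->
    cabs (g x / f x) <= (d^-1 + M * d^-1 ^+ 2) * (cabs (g x - g y) + cabs (f x - f y) + `|x - y|).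
  move=> sx sy xpq /negP ypq; rewrite (g0 y)//; last exact: domS sy.
  rewrite subr0 cabsM cabsV.
  have a1 : cabs (g x) * (cabs (f x))^-1 <= cabs (g x) * d^-1 by rewrite ler_wpM2l ?cabs_ge0// inv.
  apply: le_trans a1 _; rewrite mulrC.
  apply: (@le_trans _ _ ((d^-1 + M * d^-1 ^+ 2) * cabs (g x))).
    by rewrite ler_wpM2r ?cabs_ge0// lerDl.
  by rewrite ler_wpM2l ?addr_ge0// -addrA lerDl addr_ge0 ?cabs_ge0.
move=> x y sx sy; case: ifPn => xpq; case: ifPn => ypq.
- have -> : g x / f x - g y / f y = (g x - g y) * (f x)^-1 + g y * (f y - f x) * ((f x)^-1 * (f y)^-1).
    by field; rewrite !fn0.
  apply: le_trans (cabsD _ _) _; rewrite !cabsM !cabsV (cabs_distC (f y)).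
  have i1 := inv x xpq; have i2 := inv y ypq; have gy := gM y sy.
  have f1 : 0 <= (cabs (f x))^-1 by rewrite invr_ge0 cabs_ge0.
  have f2 : 0 <= (cabs (f y))^-1 by rewrite invr_ge0 cabs_ge0.
  have t1 : cabs (g x - g y) * (cabs (f x))^-1 <= d^-1 * cabs (g x - g y).
    by rewrite [leRHS]mulrC ler_wpM2l ?cabs_ge0.
  have t2 : cabs (g y) * cabs (f x - f y) * ((cabs (f x))^-1 * (cabs (f y))^-1) <=
      M * d^-1 ^+ 2 * cabs (f x - f y).
    rewrite mulrAC expr2; apply: ler_wpM2r; first exact: cabs_ge0.
    by apply: ler_pM => //; [exact: cabs_ge0|exact: mulr_ge0|exact: ler_pM].
  have n1 : 0 <= d^-1 * cabs (f x - f y) by rewrite mulr_ge0 ?cabs_ge0.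
  have n2 : 0 <= M * d^-1 ^+ 2 * cabs (g x - g y) by rewrite mulr_ge0 ?cabs_ge0.
  have n3 : 0 <= (d^-1 + M * d^-1 ^+ 2) * `|x - y| by rewrite mulr_ge0 ?addr_ge0.
  rewrite [X in _ <= X](_ : _ = d^-1 * cabs (g x - g y) + M * d^-1 ^+ 2 * cabs (f x - f y) +
     d^-1 * cabs (f x - f y) + M * d^-1 ^+ 2 * cabs (g x - g y) + (d^-1 + M * d^-1 ^+ 2) * `|x - y|); last by ring.
  lra.
- by rewrite subr0; exact: one.
- rewrite sub0r cabsN distrC (cabs_distC (g x)) (cabs_distC (f x)); exact: one.
- by rewrite subrr cabs0 mulr_ge0 ?addr_ge0 ?cabs_ge0.
Qed.

Definition vanish_after c h := forall x, dom L x -> c < x -> h x = 0.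

(** A non-empty compact support has a maximum, beyond which [h] vanishes; conversely a closed subset
    of [[0, c]] is compact. A positive [c] is supplied because densities are constructed on
    non-degenerate segments. *)
Lemma H1cP h : (0 < L)%E -> H1c L h <-> H1loc L h /\ exists c, [/\ dom L c, 0 < c & vanish_after c h].
Proof.
move=> L0; split=> [[Hh]|[Hh [c [dc c0 hc]]]].
  move=> cK; split => //.
  have [c1 c10 dc1] : exists2 c1, 0 < c1 & dom L c1.
    case: L L0 => [l| |//].
      rewrite lte_fin => l0; exists (l / 2); first by rewrite divr_gt0.
      by split; [rewrite divr_ge0// ltW|rewrite lte_fin; lra].
    by move=> _; exists 1 => //; split => //; exact: ltry.
  have [e0|/set0P[x0 x0s]] := eqVneq (supp L h) set0.
    exists c1; split => // x dx _; apply/eqP/negPn/negP => hx.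
    have : supp L h x by split => //; apply: subset_closure.
    by rewrite e0.
  have sne : supp L h !=set0 by exists x0.
  have [M /set_mem sM HM] : exists2 M, M \in supp L h & forall t, t \in supp L h -> t <= M.
    apply: (@compact_EVT_max _ _ id) => //.
    by apply: continuous_subspaceT => y; exact: cvg_id.
  exists (Num.max c1 M); split.
  - by rewrite /Num.max; case: ifP => // _; case: sM.
  - by rewrite lt_max c10.
  - move=> x dx; rewrite gt_max => /andP[_ Mx]; apply/eqP/negPn/negP => hx.
    have sx : supp L h x by split => //; apply: subset_closure.
    by have := HM _ (mem_set sx); rewrite leNgt Mx.
split => //.
have cl : closed (seg c) by rewrite segE; exact: itv_closed.
have sub : closure [set x | dom L x /\ h x != 0] `<=` seg c.
  rewrite [X in _ `<=` X]((closure_id _).1 cl); apply: closure_subset => x [[x0 xL] hx].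
  rewrite /seg /= x0 leNgt; apply/negP => cx.
  by move: hx; rewrite hc ?eqxx.
rewrite /supp (_ : _ `&` _ = closure [set x | dom L x /\ h x != 0]).
  apply: (@subclosed_compact _ _ (seg c)) => //; first exact: closed_closure.
  by rewrite segE; exact: segment_compact.
apply/setIidPl => x /sub; exact: domS.
Qed.

End SobolevAlgebra.

(** * Piecewise linear cut-offs *)

Section Ramps.
Context {R : realType} (L : \bar R).
Implicit Types (f g h : R -> R[i]) (c u v x p q : R) (k : R[i]).
Local Notation lam := (@lebesgue_measure R).

Definition ramp p q x : R := clamp 1 ((q - x) / (q - p)).

Lemma ramp_left p q x : p < q -> x <= p -> ramp p q x = 1.
Proof.
move=> pq xp; rewrite /ramp /clamp min_r; first by rewrite max_r.
by rewrite ler_pdivlMr ?subr_gt0// mul1r; lra.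
Qed.

Lemma ramp_right p q x : p < q -> q <= x -> ramp p q x = 0.
Proof.
move=> pq xp; rewrite /ramp /clamp max_l// ge_min; apply/orP; left.
by rewrite ler_pdivrMr ?subr_gt0// mul0r; lra.
Qed.

Lemma ramp_mid p q x : p < q -> p <= x <= q -> ramp p q x = (q - x) / (q - p).
Proof.
move=> pq /andP[px xq]; rewrite /ramp clampE//; apply/andP; split.
  by rewrite divr_ge0// subr_ge0// ltW.
by rewrite ler_pdivrMr ?subr_gt0// mul1r; lra.
Qed.

Lemma ramp_ge0 p q x : 0 <= ramp p q x.
Proof. by have /andP[] := clamp_in ((q - x) / (q - p)) (@ler01 R). Qed.

Lemma ramp_le1 p q x : ramp p q x <= 1.
Proof. by have /andP[] := clamp_in ((q - x) / (q - p)) (@ler01 R). Qed.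

Lemma ramp_lip p q x y : p < q -> `|ramp p q x - ramp p q y| <= (q - p)^-1 * `|x - y|.
Proof.
move=> pq; have k0 : 0 < (q - p)^-1 by rewrite invr_gt0 subr_gt0.
wlog xy : x y / x <= y.
  by move=> H; have [xy|/ltW xy] := leP x y; [exact: H|rewrite distrC [`|x - y|]distrC; exact: H].
have h : (q - y) / (q - p) <= (q - x) / (q - p) by rewrite ler_wpM2r ?(ltW k0)//; lra.
rewrite ger0_norm; last by rewrite subr_ge0; exact: clamp_le.
rewrite ler0_norm ?subr_le0//; apply: le_trans (clamp_sub _ h) _.
by rewrite -mulrBl mulrC ler_wpM2l ?(ltW k0)//; lra.
Qed.

Definition cramp p q x : R[i] := (ramp p q x)%:C.

Lemma H1loc_cramp p q : p < q -> H1loc L (cramp p q).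
Proof.
move=> pq; apply: (@H1loc_lip _ _ _ (q - p)^-1).
  by rewrite invr_ge0 subr_ge0 ltW.
by move=> x y _ _; rewrite -rmorphB cabsC; exact: ramp_lip.
Qed.

Lemma weak_deriv_cramp p q c : p < q -> 0 <= c ->
  weak_deriv c (cramp p q) (fun x => (if p < x < q then - (q - p)^-1 else 0)%:C).
Proof.
move=> pq c0; apply: (@weak_deriv_fin _ _ _ _ [:: p; q]) => // x _.
rewrite !inE negb_or => /andP[xp xq].
have [xltp|pltx] := ltP x p.
  rewrite (_ : (p < x < q) = false) /=; last by apply/negbTE; rewrite negb_and -leNgt ltW.
  apply: cder_near (cderC 1 x); near=> t; rewrite /cramp ramp_left//.
  by apply: ltW; near: t; exact: lt_nbhsl.
have {}pltx : p < x by rewrite lt_neqAle eq_sym xp.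
rewrite pltx /=; have [xltq|qltx] := ltP x q.
  apply: (@cder_near _ (fun t => ((q - t) / (q - p))%:C)).
    near=> t; rewrite /cramp ramp_mid//; apply/andP; split; apply: ltW.
      by near: t; exact: lt_nbhsr.
    by near: t; exact: lt_nbhsl.
  apply: cder_real.
  have h1 : is_derive x (1 : R) (fun t : R => (q - p)^-1 *: (q - t)) ((q - p)^-1 *: (0 - 1)).
    by apply: is_deriveZ.
  by apply: (is_derive_ext _ _ h1) => [t|]; rewrite /GRing.scale /=; [rewrite mulrC|rewrite sub0r mulrN1].
have {}qltx : q < x by rewrite lt_neqAle eq_sym xq.
apply: cder_near (cderC 0 x); near=> t; rewrite /cramp ramp_right//.
by apply: ltW; near: t; exact: lt_nbhsr.
Unshelve. all: by end_near. Qed.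

Lemma vanish_cramp p q : p < q -> vanish_after L q (cramp p q).
Proof. by move=> pq x _ qx; rewrite /cramp ramp_right// ltW. Qed.

Lemma density_cintegrable f c g (D : set R) : H1loc L f -> dom L c -> density c f g ->
  measurable (D : set (measurableTypeR R)) -> D `<=` seg c -> cintegrable lam D g.
Proof.
move=> Hf dc dg mD Dc; have [mg g2] := density_square_integrable Hf dc dg.
have mS := @measurable_seg R c.
have mg' : cmeasurable D g by case: mg => m1 m2; split; apply: measurable_funS; eauto.
apply: (@cintegrable_le _ _ _ _ (fun x => 1 + cabs (g x) ^+ 2)) => //.
- rewrite (_ : _ \o _ = (fun x => 1%:E + (cabs (g x) ^+ 2)%:E)%E)//; apply: integrableD => //.
    apply: integrable_cst_lty => //; apply: le_lt_trans (lebesgue_seg_lty c).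
    by apply: le_measure => //; apply/mem_set.
  by apply: integrableS g2.
- move=> x _; have := sqr_ge0 (cabs (g x) - 1); have := cabs_ge0 (g x).
  by move: (cabs (g x)) => r; nra.
Qed.

(** The ramp has constant slope on []p, q[] and is flat elsewhere, so testing the equation with it
    reads off a difference quotient of [f]. *)
Lemma energy_cramp f p q : H1loc L f -> 0 <= p -> p < q -> dom L q ->
  energy L f (cramp p q) = - (f q - f p) / (q - p)%:C.
Proof.
move=> Hf p0 pq dq; have q0 : 0 < q by apply: le_lt_trans pq.
have [g dg] := density_exists Hf dq q0.
have [_ _ _ _ ftc] := dg.
rewrite (energyE dq (vanish_cramp pq) (density_weak dg) (weak_deriv_cramp pq (ltW q0))).
rewrite ftc// ?(ltW pq)//.
have mI := measurable_itvR `[p, q].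
have sub : `[p, q]%classic `<=` seg q.
  by rewrite segE => x; rewrite /= !in_itv /= => /andP[h1 ->]; rewrite (le_trans p0 h1).
have -> : - cintegral lam `[p, q]%classic g / (q - p)%:C =
    (- (q - p)^-1)%:C * cintegral lam `[p, q]%classic g.
  by move: (cintegral _ _ _) => A; rewrite rmorphN /= fmorphV !mulNr mulrC.
have cI := density_cintegrable Hf dq dg mI sub.
have Ix t : `[p, q]%classic t = (p <= t <= q) :> Prop by rewrite /= in_itv.
rewrite -(cintegralZ (- (q - p)^-1)%:C mI cI).
apply: (@cintegral_off_null _ _ [set` [:: p; q]]).
- exact: measurable_set_seq.
- rewrite !set_seq_cons set_seq_nil setU0; apply: null_set_setU => //; exact: set1_null.
- move=> x _ /= /negP; rewrite !inE !negb_or => /andP[xp xq] xI.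
  have /andP[px xq'] : p <= x <= q by rewrite -Ix.
  by rewrite !lt_neqAle px xq' xq eq_sym xp /= mulrC.
- move=> x _ _ xI; have /negP : ~ (p <= x <= q) by rewrite -Ix.
  rewrite negb_and -!ltNge => h.
  by rewrite (_ : (p < x < q) = false) ?mulr0//; apply/negbTE; rewrite negb_and -!leNgt; case/orP : h => /ltW ->; rewrite ?orbT.
- by move=> x xI _ h; exfalso; apply: h; exact: sub.
Qed.

End Ramps.

(** * The distribution omega on total functions *)

Section Functionals.
Context {R : realType} (S : gen_indefinite_string R).
Local Notation L := (len S).
Local Notation lam := (@lebesgue_measure R).
Implicit Types (f g h : R -> R[i]) (c u v x p q : R) (k : R[i]).

Lemma H1cS h : H1c L h -> H1loc L h /\ exists c, [/\ dom L c, 0 < c & vanish_after L c h].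
Proof. by move/(H1cP _ (len_gt0 S)). Qed.

Lemma H1cI h c : H1loc L h -> dom L c -> 0 < c -> vanish_after L c h -> H1c L h.
Proof. by move=> Hh dc c0 hc; apply/(H1cP _ (len_gt0 S)); split => //; exists c. Qed.

Lemma H1c_cramp p q : p < q -> 0 < q -> dom L q -> H1c L (cramp p q).
Proof. by move=> pq q0 dq; exact: (H1cI (@H1loc_cramp _ _ _ _ pq) dq q0 (@vanish_cramp _ _ _ _ pq)). Qed.

Lemma H1cM f h : H1loc L f -> H1c L h -> H1c L (fun x => f x * h x).
Proof.
move=> Hf /H1cS[Hh [c [dc c0 hc]]]; apply: (H1cI (H1locM Hf Hh) dc c0).
by move=> x dx cx; rewrite hc ?mulr0.
Qed.

Lemma H1cD f h : H1c L f -> H1c L h -> H1c L (fun x => f x + h x).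
Proof.
move=> /H1cS[Hf [c [dc c0 fc]]] /H1cS[Hh [c' [dc' c0' hc]]].
apply: (H1cI (c := Num.max c c') (H1locD Hf Hh)).
- by rewrite /Num.max; case: ifP.
- by rewrite lt_max c0.
- by move=> x dx; rewrite gt_max => /andP[h1 h2]; rewrite fc// hc// addr0.
Qed.

Lemma H1cZ k h : H1c L h -> H1c L (fun x => k * h x).
Proof. by move=> Hh; exact: (H1cM (@H1loc_const _ L k) Hh). Qed.

Lemma omega_lin k f h : H1c L f -> H1c L h ->
  omega S (fun x => k * f x + h x) = k * omega S f + omega S h.
Proof. exact: (omega_dual S).1. Qed.

Lemma H1c0 : H1c L (fun=> 0).
Proof.
have [c c0 dc] : exists2 c, 0 < c & dom L c.
  have := len_gt0 S; case: (len S) => [l| |//].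
    rewrite lte_fin => l0; exists (l / 2); first by rewrite divr_gt0.
    by split; [rewrite divr_ge0// ltW|rewrite lte_fin; lra].
  by move=> _; exists 1 => //; split => //; exact: ltry.
by apply: (H1cI (@H1loc_const _ _ 0) dc c0).
Qed.

Lemma omega0 : omega S (fun=> 0) = 0.
Proof.
have := omega_lin 1 H1c0 H1c0.
rewrite (_ : (fun x => 1 * 0 + 0) = (fun=> 0)); last by apply/funext => x; rewrite mulr0 addr0.
by rewrite mul1r => /esym/eqP; rewrite -subr_eq0 addrK => /eqP.
Qed.

Lemma omegaD f h : H1c L f -> H1c L h -> omega S (fun x => f x + h x) = omega S f + omega S h.
Proof.
move=> Hf Hh; rewrite -[omega S f]mul1r -omega_lin//; congr (omega S _).
by apply/funext => x; rewrite mul1r.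
Qed.

Lemma omegaZ k f : H1c L f -> omega S (fun x => k * f x) = k * omega S f.
Proof.
move=> Hf; rewrite -[RHS]addr0 -omega0 -omega_lin//; last exact: H1c0.
by congr (omega S _); apply/funext => x; rewrite addr0.
Qed.

(** [omega] takes total functions, but it is bounded by a norm that sees only [[0, L)]; values
    outside cannot influence it. *)
Lemma omega_zero_on h : H1c L h -> (forall x, dom L x -> h x = 0) -> omega S h = 0.
Proof.
move=> Hh h0; have [_ [c [dc c0 hc]]] := H1cS Hh.
have [C HC] := (omega_dual S).2 c dc.
have sh : supp L h `<=` [set x | x <= c].
  rewrite /supp (_ : [set x | dom L x /\ h x != 0] = set0); first by rewrite closure0 set0I.
  by apply/seteqP; split => // x [dx]; rewrite h0// eqxx.
have := HC h Hh sh; rewrite (_ : H1norm L h = 0).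
  by rewrite mulr0 => h1; apply/eqP; rewrite -cabs_eq0 eq_le h1 cabs_ge0.
rewrite /H1norm; suff -> : Rintegral lam (dom L) (fun x => cabs (h x) ^+ 2 + cabs (cderive h x) ^+ 2) = 0.
  by rewrite sqrtr0.
(* The point 0 is left out, since a derivative there would involve values to the left of the
   domain. *)
rewrite (@eq_Rintegral_off_null _ _ _ lam [set (0 : R)] _ _ (fun=> 0)).
- rewrite /Rintegral integral0_eq//.
- exact: measurable_set1.
- exact: set1_null.
- move=> x dx x0; rewrite h0// (@cder_cderive _ h x 0) ?cabs0 ?expr0n ?addr0//.
  have [x0' xL] := dx; have x1 : 0 < x by rewrite lt_neqAle eq_sym x0' andbT; apply/eqP.
  apply: cder_near (cderC 0 x); near=> t; rewrite h0//; split.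
    by apply: ltW; near: t; exact: lt_nbhsr.
  by near: t; exact: dom_open_nbhs.
Unshelve. all: by end_near. Qed.

Lemma omega_ext f h : H1c L f -> H1c L h -> (forall x, dom L x -> f x = h x) -> omega S f = omega S h.
Proof.
move=> Hf Hh fh; apply/eqP; rewrite -subr_eq0 -mulN1r addrC -(omega_lin (-1) Hh Hf); apply/eqP.
apply: omega_zero_on; first exact: H1cD (H1cZ (-1) Hh) Hf.
by move=> x dx; rewrite fh// mulN1r addNr.
Qed.

Lemma H1cJ h : H1c L h -> H1c L (fun x => (h x)^*).
Proof.
move=> /H1cS[Hh [c [dc c0 hc]]]; apply: (H1cI (H1locJ Hh) dc c0).
by move=> x dx cx; rewrite hc// conjc0.
Qed.

(** Reality applies to the sum of [h] and its conjugate and to ['i] times their difference; the two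
    equations determine the value at the conjugate. *)
Lemma omegaJ h : H1c L h -> omega S (fun x => (h x)^*) = (omega S h)^*.
Proof.
move=> Hh; have HJ := H1cJ Hh.
have real g : H1c L g -> (forall x, (g x)^* = g x) -> (omega S g)^* = omega S g.
  move=> Hg gr; have : Im (omega S g) = 0.
    by apply: omega_real => // x _; have := gr x; case: (g x) => a b [] /= /eqP; rewrite eq_sym -addr_eq0 -mulr2n mulrn_eq0 /= => /eqP.
  by case: (omega S g) => a b /= ->; rewrite oppr0.
have r1 : (omega S (fun x => h x + (h x)^*))^* = omega S (fun x => h x + (h x)^*).
  by apply: real; [exact: H1cD Hh HJ|move=> x; rewrite rmorphD /= conjcK addrC].
have r2 : (omega S (fun x => 'i%C * (h x + (-1) * (h x)^*)))^* = omega S (fun x => 'i%C * (h x + (-1) * (h x)^*)).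
  apply: real; first exact: H1cZ (H1cD Hh (H1cZ (-1) HJ)).
  move=> x; rewrite mulN1r rmorphM rmorphB /= conjcK.
  by case: (h x) => a b; apply: complex_ext; rewrite /=; ring.
have HZ := H1cZ (-1) HJ.
move: r1 r2; rewrite (omegaD Hh HJ) (omegaZ 'i%C (H1cD Hh HZ)) (omegaD Hh HZ) (omegaZ (-1) HJ).
move: (omega S h) (omega S (fun x => (h x)^*)) => [a b] [a' b'] /=.
rewrite /= => -[e1] [e2] ; apply: complex_ext => /=; lra.
Qed.

End Functionals.

(** * Rational Herglotz functions *)

Section LocallyNull.
Context {R : realType} (mu : {measure set (measurableTypeR R) -> \bar R}).

(** The null intervals with rational endpoints are countably many and already cover [D]. *)
Lemma measure_locally_null (D : set (measurableTypeR R)) : measurable D ->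
  (forall x : R, D x -> exists u v, u < x < v /\ mu `[u, v]%classic = 0%E) -> mu D = 0%E.
Proof.
move=> mD HD.
pose I (uv : rat * rat) : set R := `[(ratr uv.1), (ratr uv.2)]%classic.
pose F n : set (measurableTypeR R) := if @unpickle (rat * rat)%type n is Some uv then
  if mu (I uv) == 0%E then I uv else set0 else set0.
have mF n : measurable (F n).
  rewrite /F; case: (unpickle n) => [uv|]; last by apply: measurable0.
  by case: ifP => _; [exact: (measurable_itvR `[(ratr uv.1), (ratr uv.2)])|exact: measurable0].
have F0 n : mu (F n) = 0%E.
  by rewrite /F; case: unpickle => [uv|]; rewrite ?measure0//; case: eqP; rewrite ?measure0.
have neg : mu.-negligible (\bigcup_n F n).
  by apply: negligible_bigcup => n; exists (F n); split; [exact: mF|exact: F0|].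
have [B [mB B0 FB]] := neg.
have sub : D `<=` \bigcup_n F n.
  move=> x /HD[p [q [/andP[px xq] pq0]]].
  have [u] : exists u : rat, ratr u \in `]p, x[ by apply: rat_in_itvoo.
  have [v] : exists v : rat, ratr v \in `]x, q[ by apply: rat_in_itvoo.
  rewrite !in_itv /= => /andP[v1 v2] /andP[u1 u2].
  exists (pickle (u, v)); first exact: Logic.I.
  rewrite /F pickleK (_ : mu _ = 0%E).
    by rewrite eqxx /I /= in_itv /= !ltW.
  apply/eqP; rewrite eq_le measure_ge0 andbT -pq0.
  apply: le_measure; [apply/mem_set; exact: measurable_itvR..|].
  by apply: subset_itv; rewrite bnd_simp ltW.
apply/eqP; rewrite eq_le measure_ge0 andbT -B0.
by apply: le_measure; [apply/mem_set..|exact: subset_trans FB].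
Qed.

End LocallyNull.

Lemma invcE (R : realType) (u v : R) :
  (u +i* v)^-1 = (u / (u ^+ 2 + v ^+ 2)) +i* (- (v / (u ^+ 2 + v ^+ 2))).
Proof. by []. Qed.

Section PolynomialBounds.
Context {R : realType}.
Implicit Types (p q : {poly R[i]}) (z w : R[i]).

Lemma poly_bounded p (M : R) : 0 <= M -> exists2 K, 0 <= K & forall z, cabs z <= M -> cabs p.[z] <= K.
Proof.
move=> M0; elim/poly_ind: p => [|p c [K K0 HK]].
  by exists 0 => // z _; rewrite horner0 cabs0.
exists (K * M + cabs c); first by rewrite addr_ge0 ?mulr_ge0 ?cabs_ge0.
move=> z zM; rewrite hornerMXaddC; apply: le_trans (cabsD _ _) _.
by rewrite lerD2r cabsM ler_pM ?cabs_ge0 ?HK.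
Qed.

Lemma poly_lipschitz p (M : R) : 0 <= M -> exists2 K, 0 <= K &
  forall z w, cabs z <= M -> cabs w <= M -> cabs (p.[z] - p.[w]) <= K * cabs (z - w).
Proof.
move=> M0; elim/poly_ind: p => [|p c [K K0 HK]].
  by exists 0 => // z w _ _; rewrite !horner0 subrr cabs0 mul0r.
have [B B0 HB] := poly_bounded p M0.
exists (K * M + B); first by rewrite addr_ge0 ?mulr_ge0.
move=> z w zM wM; rewrite !hornerMXaddC.
have -> : p.[z] * z + c - (p.[w] * w + c) = (p.[z] - p.[w]) * z + p.[w] * (z - w) by ring.
apply: le_trans (cabsD _ _) _; rewrite !cabsM mulrDl; apply: lerD.
  by rewrite mulrAC ler_pM ?cabs_ge0 ?HK.
by rewrite ler_wpM2r ?cabs_ge0 ?HB.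
Qed.

End PolynomialBounds.

(** * The spectral measure of a rational Herglotz function *)

Section RationalHerglotz.
Context {R : realType} (rho : {measure set (measurableTypeR R) -> \bar R}).
Variables (m : R[i] -> R[i]) (a b : R).
Hypothesis Hm : herglotz_representation m a b rho.
Implicit Types (x y l r : R).

Local Notation kern z l := ((l%:C - z)^-1 - (l / (1 + l ^+ 2))%:C).

Lemma Im_kern x y l : Im (kern (x +i* y) l) = y / ((l - x) ^+ 2 + y ^+ 2).
Proof.
have -> : l%:C - (x +i* y) = (l - x) +i* (- y) by apply: complex_ext; rewrite /= ?sub0r.
by rewrite invcE /= sqrrN subr0 mulNr opprK.
Qed.

Lemma Re_kernJ x y l : Re (kern (x +i* (- y)) l) = Re (kern (x +i* y) l).
Proof.
have E t : l%:C - (x +i* t) = (l - x) +i* (- t) by apply: complex_ext; rewrite /= ?sub0r.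
by rewrite !E !invcE /= !sqrrN.
Qed.

(** Compares the Poisson kernel with [(1 + l ^+ 2)^-1], which is integrable by the Herglotz
    representation. *)
Lemma kern_bound x y : y != 0 -> exists2 C, 0 <= C & forall l,
  1 + l ^+ 2 <= C * ((l - x) ^+ 2 + y ^+ 2).
Proof.
move=> y0; have y2 : 0 < y ^+ 2 by rewrite exprn_even_gt0.
have A0 : 0 <= (1 + 2 * x ^+ 2) / y ^+ 2.
  apply: divr_ge0; last exact: ltW.
  by apply: addr_ge0 => //; apply: mulr_ge0 => //; exact: sqr_ge0.
exists (2 + (1 + 2 * x ^+ 2) / y ^+ 2).
  by rewrite addr_ge0.
move=> l; have h := mulr_ge0 A0 (sqr_ge0 (l - x)).
have -> : (2 + (1 + 2 * x ^+ 2) / y ^+ 2) * ((l - x) ^+ 2 + y ^+ 2) =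
  2 * (l - x) ^+ 2 + 2 * y ^+ 2 + (1 + 2 * x ^+ 2) / y ^+ 2 * (l - x) ^+ 2 + (1 + 2 * x ^+ 2).
  by field.
have := sqr_ge0 (l - 2 * x); have := sqr_ge0 (l - x); nra.
Qed.

Lemma measurable_inv_pos (h : R -> R) : continuous h -> (forall x, 0 < h x) ->
  measurable_fun setT (fun x : measurableTypeR R => (h x)^-1).
Proof.
move=> ch h0; apply: continuous_measurable_fun => x; apply: cvgV; last exact: ch.
by rewrite gt_eqF.
Qed.

Lemma continuous_quad x y : continuous (fun l : R => (l - x) ^+ 2 + y ^+ 2).
Proof.
move=> l; apply: cvgD; last exact: cvg_cst.
rewrite expr2; under eq_fun do rewrite expr2.
by apply: cvgM; (apply: cvgB; [exact: cvg_id|exact: cvg_cst]).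
Qed.

Lemma integrable_Im_kern x y : y != 0 ->
  rho.-integrable setT (EFin \o (fun l : R => y / ((l - x) ^+ 2 + y ^+ 2))).
Proof.
move=> y0; have y2 : 0 < y ^+ 2 by rewrite exprn_even_gt0.
have [_ fin _] := Hm; have [C C0 HC] := kern_bound x y0.
have q0 (l : R) : 0 < (l - x) ^+ 2 + y ^+ 2 by rewrite ltr_wpDl ?sqr_ge0.
have q1 (l : R) : 0 < 1 + l ^+ 2 by rewrite ltr_pwDl ?sqr_ge0.
have m1 : measurable_fun setT (fun l : measurableTypeR R => ((l - x) ^+ 2 + y ^+ 2)^-1).
  exact: measurable_inv_pos (@continuous_quad x y) q0.
have m2 : measurable_fun setT (fun l : measurableTypeR R => (1 + l ^+ 2)^-1).
  apply: measurable_inv_pos => // l.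
  apply: cvgD; first exact: cvg_cst.
  by rewrite expr2; under eq_fun do rewrite expr2; exact: cvgM.
have i2 : rho.-integrable setT (EFin \o (fun l : R => (1 + l ^+ 2)^-1)).
  apply/integrableP; split; first exact/measurable_EFinP.
  by under eq_integral do rewrite /= ger0_norm ?invr_ge0 ?(ltW (q1 _))//.
have i3 := integrableZl measurableT (`|y| * C) i2.
apply: le_integrable i3 => //.
  by apply/measurable_EFinP; apply: measurable_funM => //; exact: measurable_cst.
move=> l _; rewrite /= lee_fin normrM normfV (gtr0_norm (q0 l)).
rewrite normrM normfV (gtr0_norm (q1 l)) normrM normr_id (ger0_norm C0) -mulrA ler_wpM2l//.
by rewrite ler_pdivlMr// mulrC ler_pdivrMr// mulrC.
Qed.

Lemma Im_herglotz x y : y != 0 ->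
  Im (m (x +i* y)) = b * y + \int[rho]_(l in setT) (y / ((l - x) ^+ 2 + y ^+ 2)).
Proof.
move=> y0; have [_ _ ->] := Hm; last by [].
rewrite !ImD ImM /cintegral /= mul0r addr0 add0r; congr (_ + _).
by apply: eq_Rintegral => l _; rewrite -Im_kern.
Qed.

Lemma herglotzJ x y : y != 0 -> m (x +i* (- y)) = (m (x +i* y))^*.
Proof.
move=> y0; have [_ _ E] := Hm.
have ny0 : - y != 0 by rewrite oppr_eq0.
apply: complex_ext.
  rewrite ReJ !E// !ReD !ReM /cintegral /= !mul0r; congr (_ + _).
  by apply: eq_Rintegral => l _; exact: Re_kernJ.
rewrite ImJ !Im_herglotz// opprD mulrN; congr (_ + _).
have ii := integrable_Im_kern x y0.
rewrite -[RHS]mulN1r -(RintegralZl (-1) measurableT ii).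
by apply: eq_Rintegral => l _; rewrite sqrrN mulN1r mulNr.
Qed.

(** On this interval the Poisson kernel is at least [1 / (2 y)]. *)
Lemma rho_interval_le x y : 0 < y ->
  (rho `[(x - y)%R, (x + y)%R]%classic <= (2 * y * Im (m (x +i* y)))%:E)%E.
Proof.
move=> y0; have yn0 : y != 0 by rewrite gt_eqF.
have [b0 _ _] := Hm.
have ii := integrable_Im_kern x yn0.
have y2 : 0 < y ^+ 2 by rewrite exprn_gt0.
have q0 (l : R) : 0 < (l - x) ^+ 2 + y ^+ 2 by rewrite ltr_wpDl ?sqr_ge0.
have mI := measurable_itvR `[x - y, x + y].
have step : ((2 * y)^-1%:E * rho `[(x - y)%R, (x + y)%R]%classic <= (Im (m (x +i* y)))%:E)%E.
  apply: (@le_trans _ _ (\int[rho]_(l in setT) (y / ((l - x) ^+ 2 + y ^+ 2))%:E)%E); last first.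
    rewrite Im_herglotz// -[leLHS]fineK; last exact: integrable_fin_num.
    by rewrite lee_fin lerDr mulr_ge0// ltW.
  rewrite -integral_cst//; apply: ge0_le_integral_off_null (measure0 rho) _ _ _ _ => //.
  - by move=> l _; rewrite lee_fin invr_ge0 mulr_ge0// ltW.
  - by move=> l _; rewrite lee_fin divr_ge0// ltW.
  - move=> l; rewrite /= in_itv /= => /andP[h1 h2] _; rewrite lee_fin ler_pdivlMr//.
    rewrite mulrC ler_pdivrMr ?mulr_gt0//.
    have : (l - x) ^+ 2 <= y ^+ 2 by have h3 : 0 <= (y - (l - x)) * (y + (l - x)); [apply: mulr_ge0; lra|rewrite -subr_ge0; move: h3; rewrite (_ : (y - (l - x)) * _ = y ^+ 2 - (l - x) ^+ 2)//; ring].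
    by rewrite (_ : y * (2 * y) = 2 * y ^+ 2); [lra|ring].
have yy : 0 < 2 * y by rewrite mulr_gt0.
rewrite EFinM -lee_pdivrMl//.
Qed.

Section NonPole.
Variables (p q : {poly R[i]}).
Hypothesis mpq : forall z : R[i], Im z != 0 -> m z = p.[z] / q.[z].

(** By symmetry [2 i Im (m z)] is the difference of the values of [m] at [z] and at its conjugate,
    two points at distance [2 y]. Away from the zeros of [q] the quotient is Lipschitz. *)
Lemma Im_rational_bound x0 : ~~ root q x0%:C -> exists r C, [/\ 0 < r, 0 <= C &
  forall x y, x0 - r < x < x0 + r -> 0 < y -> y < r -> Im (m (x +i* y)) <= C * y].
Proof.
rewrite /root -cabs_gt0 => d0; set d := cabs _ in d0.
have M0 : 0 <= `|x0| + 2 by rewrite addr_ge0.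
set M := _ + _ in M0.
have [Kq Kq0 lq] := poly_lipschitz q M0; have [Kp Kp0 lp] := poly_lipschitz p M0.
have [Bq Bq0 bq] := poly_bounded q M0; have [Bp Bp0 bp] := poly_bounded p M0.
(* The second bound keeps the modulus of [q] above [d / 2] within distance [2 r] of [x0]. *)
pose r := Num.min 1 (d / (4 * (Kq + 1))).
have r0 : 0 < r by rewrite lt_min ltr01 divr_gt0// mulr_gt0//; lra.
have r1 : r <= 1 by rewrite ge_min lexx.
have rK : Kq * (2 * r) <= d / 2.
  have : r <= d / (4 * (Kq + 1)) by rewrite ge_min lexx orbT.
  rewrite ler_pdivlMr; [nra|lra].
exists r, ((Kp * Bq + Bp * Kq) / (d / 2) ^+ 2); split => //.
  by rewrite divr_ge0 ?sqr_ge0// addr_ge0 ?mulr_ge0.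
move=> x y /andP[xl xr] y0 yr; have yn0 : y != 0 by rewrite gt_eqF.
have cz (s : R) : `|s| = y -> cabs (x +i* s - x0%:C) <= 2 * r /\ cabs (x +i* s) <= M.
  move=> sy; have h1 : cabs (x +i* s - x0%:C) <= `|x - x0| + y.
    by apply: le_trans (cabs_le_ReIm _) _; rewrite ReD ImD ReN ImN /= subr0 sy.
  have h2 : `|x - x0| <= r by rewrite ler_norml; apply/andP; split; lra.
  split; first lra.
  have -> : x +i* s = x0%:C + (x +i* s - x0%:C) by ring.
  apply: le_trans (cabsD _ _) _; rewrite cabsC /M; lra.
have x0M : cabs x0%:C <= M by rewrite cabsC /M; lra.
pose z := x +i* y; pose w := x +i* (- y).
have [z1 z2] := cz y (gtr0_norm y0).
have [w1 w2] : cabs (w - x0%:C) <= 2 * r /\ cabs w <= M by apply: cz; rewrite normrN gtr0_norm.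
have low u : cabs (u - x0%:C) <= 2 * r -> cabs u <= M -> d / 2 <= cabs q.[u].
  move=> u1 u2; have := lq _ _ u2 x0M; have := ler_wpM2l Kq0 u1.
  have := cabsB q.[u] (q.[u] - q.[x0%:C]).
  rewrite opprB addrC subrK -/d; lra.
have qz := low z z1 z2; have qw := low w w1 w2.
have qz0 : q.[z] != 0 by rewrite -cabs_gt0; lra.
have qw0 : q.[w] != 0 by rewrite -cabs_gt0; lra.
have E : m z - m w = ((p.[z] - p.[w]) * q.[w] - p.[w] * (q.[z] - q.[w])) / (q.[z] * q.[w]).
  by rewrite !mpq//= ?oppr_eq0//; field; rewrite qz0 qw0.
have zw : cabs (z - w) = 2 * y.
  have -> : z - w = 0 +i* (2 * y) by apply: complex_ext; rewrite /= ?subrr//; ring.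
  by rewrite /cabs /= expr0n add0r sqrtr_sqr gtr0_norm// mulr_gt0.
have E2 : cabs (m z - m w) = 2 * `|Im (m z)|.
  rewrite /w herglotzJ// -/z; have -> : m z - (m z)^* = 0 +i* (2 * Im (m z)).
    by case: (m z) => u v; apply: complex_ext => /=; ring.
  by rewrite /cabs /= expr0n add0r sqrtr_sqr normrM ger0_norm.
have N : cabs ((p.[z] - p.[w]) * q.[w] - p.[w] * (q.[z] - q.[w])) <= (Kp * Bq + Bp * Kq) * (2 * y).
  apply: le_trans (cabsB _ _) _; rewrite !cabsM -zw mulrDl; apply: lerD.
    by rewrite mulrAC ler_pM ?cabs_ge0 ?lp ?bq.
  by rewrite -mulrA ler_pM ?cabs_ge0 ?lq ?bp.
have Dn : (d / 2) ^+ 2 <= cabs (q.[z] * q.[w]) by rewrite cabsM expr2 ler_pM// divr_ge0// ltW.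
have D0 : 0 < (d / 2) ^+ 2 by rewrite exprn_gt0// divr_gt0.
have := E2; rewrite E cabsM cabsV => E3.
have : 2 * `|Im (m z)| <= (Kp * Bq + Bp * Kq) * (2 * y) / (d / 2) ^+ 2.
  rewrite -E3; apply: ler_pM; rewrite ?cabs_ge0 ?invr_ge0 ?cabs_ge0//.
  by rewrite lef_pV2 ?posrE//; apply: lt_le_trans Dn.
have := ler_norm (Im (m z)).
have -> : (Kp * Bq + Bp * Kq) * (2 * y) / (d / 2) ^+ 2 = 2 * ((Kp * Bq + Bp * Kq) / (d / 2) ^+ 2 * y).
  by field; rewrite gt_eqF.
rewrite -/z; lra.
Qed.

(* Halving an interval doubles the number of pieces but divides the bound
   rho_interval_le on each of them by 4. *)
Lemma rho_null_near x0 : ~~ root q x0%:C -> exists2 r, 0 < r & rho `](x0 - r)%R, (x0 + r)%R[%classic = 0%E.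
Proof.
move=> /Im_rational_bound[r [C [r0 C0 HC]]].
have key n : forall c h, 0 < h -> x0 - r < c - h -> c + h < x0 + r ->
    (rho `[(c - h)%R, (c + h)%R]%classic <= (2 * C * h ^+ 2 / 2 ^+ n)%:E)%E.
  elim: n => [|n IH] c h h0 cl cr.
    apply: le_trans (rho_interval_le c h0) _; rewrite lee_fin expr0 divr1.
    have ch : x0 - r < c < x0 + r by apply/andP; split; lra.
    have hr : h < r by lra.
    have := ler_wpM2l (ltW h0) (HC c h ch h0 hr).
    by move: (Im _) => i; rewrite expr2; lra.
  have h20 : 0 < h / 2 by rewrite divr_gt0.
  have -> : `[c - h, c + h]%classic =
     `[(c - h / 2) - h / 2, (c - h / 2) + h / 2]%classic `|` `[(c + h / 2) - h / 2, (c + h / 2) + h / 2]%classic.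
    apply/seteqP; split => t; rewrite /= !in_itv /=.
      move=> /andP[t1 t2]; have [tc|ct] := leP t c; [left|right]; apply/andP; split; lra.
    by case=> /andP[t1 t2]; apply/andP; split; lra.
  apply: (le_trans (measureU2 _ _ _)); [exact: measurable_itvR..|].
  have -> : 2 * C * h ^+ 2 / 2 ^+ n.+1 = 2 * C * (h / 2) ^+ 2 / 2 ^+ n + 2 * C * (h / 2) ^+ 2 / 2 ^+ n.
    by rewrite (exprS 2 n) invfM; move: (2 ^+ n)^-1 => k; field.
  by rewrite EFinD; apply: leeD; apply: IH => //; lra.
exists (r / 2); first by rewrite divr_gt0.
apply/eqP; rewrite eq_le measure_ge0 andbT.
apply: (@le_trans _ _ (rho `[(x0 - r / 2)%R, (x0 + r / 2)%R]%classic)).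
  apply: le_measure; [apply/mem_set; exact: measurable_itvR..|exact: subset_itv_oo_cc].
apply/lee_addgt0Pr => e e0; rewrite add0e.
pose n := Num.bound (2 * C * (r / 2) ^+ 2 / e).
have r20 : 0 < r / 2 by rewrite divr_gt0.
apply: le_trans (key n x0 (r / 2) r20 _ _) _; [lra|lra|].
rewrite lee_fin ler_pdivrMr ?exprn_gt0// [leRHS]mulrC -ler_pdivrMr//.
apply: (@le_trans _ _ n%:R).
  apply: ltW; apply: archi_boundP; apply: divr_ge0; [apply: mulr_ge0; [exact: mulr_ge0|exact: sqr_ge0]|exact: ltW].
by rewrite -natrX ler_nat ltnW// ltn_expl.
Qed.

Lemma rho_null_nonroot (s : seq R) : (forall x, root q x%:C = (x \in s)) -> rho (~` [set` s]) = 0%E.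
Proof.
move=> sP.
apply: measure_locally_null; first by apply: measurableC; exact: measurable_set_seq.
move=> x /negP; rewrite -sP => xq; have [e e0 re] := rho_null_near xq.
exists (x - e / 2), (x + e / 2); split; first by apply/andP; split; lra.
apply/eqP; rewrite eq_le measure_ge0 andbT -re.
apply: le_measure; [apply/mem_set; exact: measurable_itvR..|].
by apply: subset_itv; rewrite bnd_simp; lra.
Qed.

End NonPole.

Lemma rho_point_lty x : (rho [set x] < +oo)%E.
Proof.
apply: (@le_lt_trans _ _ (rho `[(x - 1)%R, (x + 1)%R]%classic)).
  apply: le_measure; [apply/mem_set; exact: measurable_set1|apply/mem_set; exact: measurable_itvR|].
  by move=> y /= ->; rewrite in_itv /=; apply/andP; split; lra.
by apply: le_lt_trans (rho_interval_le x ltr01) (ltry _).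
Qed.

(** The measure is carried by the real zeros of the denominator, at most [D] in number; zeros
    without mass are removed so that all residues are positive. *)
Lemma herglotz_rational_discrete D : rational_with_poles m D ->
  exists s : seq R, [/\ uniq s, (size s <= D)%N,
    forall x, x \in s -> (0 < rho [set x] < +oo)%E & rho (~` [set` s]) = 0%E].
Proof.
move=> [p [q [q0 _ mpq cq]]].
have fq : finite_set [set z | root q z] by apply/finite_setP; exists D.
pose rs : seq R[i] := finmap.enum_fset (fset_set [set z | root q z]).
have rsP z : (z \in rs) = root q z.
  transitivity (z \in [set z | root q z]); first exact: (in_fset_set fq z).
  by apply/idP/idP => [/set_mem|h]; [|apply/mem_set].
have urs : uniq rs by exact: finmap.fset_uniq.
have srs : size rs = D by exact: card_fset_set.
pose s0 := [seq Re z | z <- rs & Im z == 0].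
have s0P x : root q x%:C = (x \in s0).
  rewrite -rsP; apply/idP/mapP => [xr|[z]].
    by exists x%:C => //; rewrite mem_filter /= eqxx.
  by rewrite mem_filter => /andP[/eqP iz zr ->]; rewrite -[X in X \in _](_ : z = _)//; apply: complex_ext.
have n0 := rho_null_nonroot mpq s0P.
have us0 : uniq s0.
  rewrite map_inj_in_uniq ?filter_uniq// => z w; rewrite !mem_filter => /andP[/eqP z0 _] /andP[/eqP w0 _] zw.
  by apply: complex_ext => //; rewrite z0 w0.
exists [seq x <- s0 | (0 < rho [set x])%E]; split.
- exact: filter_uniq.
- apply: leq_trans (_ : size s0 <= D)%N; first by rewrite size_filter count_size.
  by rewrite size_map size_filter -srs count_size.
- by move=> x; rewrite mem_filter => /andP[-> _] /=; exact: rho_point_lty.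
have zer (t : seq R) : rho [set` [seq x <- t | ~~ (0 < rho [set x])%E]] = 0%E.
  elim: t => [|x t IH] /=; first by rewrite set_seq_nil measure0.
  case: ifP => [h|_] //; rewrite set_seq_cons.
  have x0 : rho [set x] = 0%E by apply/eqP; rewrite eq_le measure_ge0 andbT leNgt.
  by apply: null_set_setU => //; (exact: measurable_set1 || exact: measurable_set_seq).
apply/eqP; rewrite eq_le measure_ge0 andbT.
pose Z := [set` [seq x <- s0 | ~~ (0 < rho [set x])%E]] : set (measurableTypeR R).
pose Y := ~` [set` s0] : set (measurableTypeR R).
have mY : measurable Y by apply: measurableC; exact: measurable_set_seq.
have mZ : measurable Z by exact: measurable_set_seq.
apply: (@le_trans _ _ (rho (Y `|` Z))).
  apply: le_measure; [apply/mem_set|apply/mem_set; exact: measurableU|].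
    by apply: measurableC; exact: measurable_set_seq.
  move=> x xn; have : x \notin [seq x <- s0 | (0 < rho [set x])%E] by apply/negP.
  rewrite mem_filter negb_and => /orP[h|h].
    have [xs|xs] := boolP (x \in s0); last by left => /=; apply/negP.
    by right; rewrite /Z /= mem_filter h xs.
  by left => /=; apply/negP.
by rewrite (null_set_setU mY mZ n0 (zer s0)).
Qed.

End RationalHerglotz.

(** * Green's identity for Weyl solutions *)

Section KineticEnergy.
Context {R : realType} (L : \bar R).
Hypothesis L0 : (0 < L)%E.
Implicit Types (f g h : R -> R[i]) (c u v x : R).
Local Notation lam := (@lebesgue_measure R).

Definition kin f c : R := \int[lam]_(x in seg c) (cabs (cderive f x) ^+ 2).

Lemma kinE f c g : density c f g -> kin f c = \int[lam]_(x in seg c) (cabs (g x) ^+ 2).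
Proof.
move=> /density_cderive[N [mN N0 HN]]; apply: (eq_Rintegral_off_null mN N0) => x xc Nx.
by have [_ _ _ ->] := HN x xc Nx.
Qed.

Lemma kin_sub f u v g : H1loc L f -> dom L v -> density v f g -> 0 <= u -> u <= v ->
  kin f v - kin f u = \int[lam]_(x in `[u, v]%classic) (cabs (g x) ^+ 2).
Proof.
move=> Hf dv dg u0 uv; rewrite (kinE dg).
have -> : kin f u = \int[lam]_(x in seg u) (cabs (g x) ^+ 2).
  have [N [mN N0 HN]] := density_cderive dg; apply: (eq_Rintegral_off_null mN N0) => x xu Nx.
  have xv : 0 <= x <= v by move: xu; rewrite /seg /= => /andP[-> xu]; rewrite (le_trans xu).
  by have [_ _ _ ->] := HN x xv Nx.
have [_ sg] := density_square_integrable Hf dv dg.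
rewrite segE in sg; rewrite !segE (Rintegral_itvB (f := fun x => cabs (g x) ^+ 2) sg); rewrite ?bnd_simp//.
rewrite Rintegral_itv_obnd_cbnd//.
apply: integrableS sg; [exact: measurable_itvR|exact: measurable_itvR|].
by move=> x; rewrite /= !in_itv /= => /andP[h1 ->]; rewrite (le_trans u0)// ltW.
Qed.

Lemma kin_le f u v : H1loc L f -> dom L v -> 0 <= u -> u <= v -> kin f u <= kin f v.
Proof.
move=> Hf dv u0 uv; have [v0|v0] := ltP 0 v; last first.
  by have -> : u = v by apply/eqP; rewrite eq_le uv (le_trans v0 u0).
have [g dg] := density_exists Hf dv v0.
rewrite -subr_ge0 (kin_sub Hf dv dg u0 uv); apply: Rintegral_ge0 => x _; exact: sqr_ge0.
Qed.

Definition finite_energy f := (\int[lam]_(x in dom L) (cabs (cderive f x) ^+ 2)%:E < +oo)%E.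

Definition weylfun f := [/\ H1loc L f, finite_energy f &
  forall l : R, L = l%:E -> cabs (f x) @[x --> l^'-] --> (0 : R)].

Lemma kin_bounded f : H1loc L f -> finite_energy f ->
  exists2 J, 0 <= J & forall c, dom L c -> kin f c <= J.
Proof.
move=> Hf fe; exists (fine (\int[lam]_(x in dom L) (cabs (cderive f x) ^+ 2)%:E)).
  by apply: fine_ge0; apply: integral_ge0 => x _; rewrite lee_fin sqr_ge0.
move=> c dc; rewrite /kin /Rintegral; apply: fine_le.
- rewrite ge0_fin_numE; first exact: Hf.2.
  by apply: integral_ge0 => x _; rewrite lee_fin sqr_ge0.
- rewrite ge0_fin_numE//; by apply: integral_ge0 => x _; rewrite lee_fin sqr_ge0.
- apply: (ge0_le_integral_off_null measurable0 (measure0 lam)) => //.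
  + by move=> x xc; exact: domS xc.
  + by move=> x _; rewrite lee_fin sqr_ge0.
  + by move=> x _; rewrite lee_fin sqr_ge0.
Qed.

Lemma kin_hoelder f u v : H1loc L f -> dom L v -> 0 <= u -> u <= v ->
  cabs (f v - f u) ^+ 2 <= (v - u) * (kin f v - kin f u).
Proof.
move=> Hf dv u0; rewrite le_eqVlt => /predU1P[<-|uv].
  by rewrite !subrr cabs0 expr0n mul0r.
have v0 : 0 < v by apply: le_lt_trans uv.
have [g dg] := density_exists Hf dv v0.
by rewrite (kin_sub Hf dv dg u0 (ltW uv)); apply: (density_hoelder Hf dv dg) => //; exact: ltW.
Qed.

Lemma kin_ge0 f c : 0 <= kin f c.
Proof. by apply: Rintegral_ge0 => x _; exact: sqr_ge0. Qed.

Lemma weyl_hoelder f : weylfun f -> exists2 J, 0 <= J & forall u v, 0 <= u -> u <= v -> dom L v ->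
  cabs (f v - f u) ^+ 2 <= (v - u) * J.
Proof.
move=> [Hf fe _]; have [J J0 HJ] := kin_bounded Hf fe; exists J => // u v u0 uv dv.
apply: le_trans (kin_hoelder Hf dv u0 uv) _; rewrite ler_wpM2l ?subr_ge0//.
by have := HJ v dv; have := kin_ge0 f u; lra.
Qed.

(** The point [c'] halves the distance to a finite endpoint, or doubles [c] when [L] is infinite. In
    both cases the square-root bound on [f] is measured on a length comparable with [c' - c], which
    compensates the slope [1 / (c' - c)] of the cut-off. *)
Lemma weyl_growth f : weylfun f -> exists2 M, 0 <= M & forall c c' t, 0 < c -> c <= t <= c' -> dom L c' ->
  (L = +oo%E -> 1 <= c /\ c' = 2 * c) -> (forall l, L = l%:E -> c' = (c + l) / 2) ->
  cabs (f t) ^+ 2 <= M * (c' - c).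
Proof.
move=> wf; have [J J0 HJ] := weyl_hoelder wf; have [Hf fe v0] := wf.
have sq (z w : R[i]) : cabs (z + w) ^+ 2 <= 2 * cabs z ^+ 2 + 2 * cabs w ^+ 2.
  apply: (@le_trans _ _ ((cabs z + cabs w) ^+ 2)).
    by rewrite ler_sqr ?nnegrE ?cabsD ?addr_ge0 ?cabs_ge0.
  by have := sqr_ge0 (cabs z - cabs w); rewrite !sqrrD sqrrN mulrN; lra.
case EL : L L0 => [l| |//]; last first.
  move=> _; exists (4 * J + 2 * cabs (f 0) ^+ 2).
    by apply: addr_ge0; apply: mulr_ge0 => //; exact: sqr_ge0.
  move=> c c' t c0 /andP[ct tc'] dc' /(_ erefl)[c1 cc'] _.
  have dt : dom +oo%E t by split; [lra|exact: ltry].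
  rewrite EL in HJ; have h := HJ 0 t (lexx _) (le_trans (ltW c0) ct) dt; rewrite subr0 in h.
  have -> : f t = (f t - f 0) + f 0 by rewrite subrK.
  apply: le_trans (sq _ _) _; rewrite cc'.
  have h2 : t * J <= 2 * c * J by rewrite ler_wpM2r//; lra.
  have h3 : 2 * cabs (f 0) ^+ 2 <= 2 * cabs (f 0) ^+ 2 * c by rewrite ler_peMr//; apply: mulr_ge0 => //; exact: sqr_ge0.
  lra.
move=> l0; exists (2 * J); first by rewrite mulr_ge0.
move=> c c' t c0 /andP[ct tc'] dc' _ /(_ _ erefl) cc'.
have c'l : c' < l by have [_] := dc'; rewrite lte_fin.
have t0 : 0 <= t by lra.
suff : cabs (f t) ^+ 2 <= (l - t) * J.
  move=> h; apply: le_trans h _; rewrite mulrAC ler_wpM2r//; lra.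
rewrite EL in HJ; apply/ler_addgt0Pl => e e0.
(* let v tend to l in |f t| <= |f v| + |f v - f t| *)
have cf : (fun v => (cabs (f v) + Num.sqrt ((l - t) * J)) ^+ 2) @ l^'- --> (0 + Num.sqrt ((l - t) * J)) ^+ 2.
  rewrite expr2; under eq_fun do rewrite expr2.
  by apply: cvgM; apply: cvgD; (exact: v0 _ EL || exact: cvg_cst).
have lt0 : 0 <= (l - t) * J by apply: mulr_ge0 => //; lra.
rewrite add0r sqr_sqrtr// in cf.
have b : \forall v \near l^'-, cabs (f t) ^+ 2 <= (cabs (f v) + Num.sqrt ((l - t) * J)) ^+ 2.
  near=> v.
  have tv : t <= v by apply: ltW; near: v; apply: nbhs_left_gt; lra.
  have vl : v < l by near: v; exact: nbhs_left_lt.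
  rewrite ler_sqr ?nnegrE ?addr_ge0 ?cabs_ge0 ?sqrtr_ge0//.
  have -> : f t = f v - (f v - f t) by ring.
  apply: le_trans (cabsB _ _) _; rewrite lerD2l -[leLHS]ger0_norm ?cabs_ge0// -sqrtr_sqr ler_wsqrtr//.
  apply: le_trans (HJ t v t0 tv _) _; first by split; [exact: le_trans tv|rewrite lte_fin].
  by rewrite ler_wpM2r//; lra.
apply: le_trans (_ : (l - t) * J <= _); last by lra.
exact: cvgr_to_ge cf b.
Unshelve. all: by end_near. Qed.

(** Far enough to the right, [F] is within [e] of its supremum. *)
Lemma nondecreasing_sup_tail (F : R -> R) (J : R) : (forall c, dom L c -> F c <= J) ->
  (forall u v, 0 <= u -> u <= v -> dom L v -> F u <= F v) ->
  forall e, 0 < e -> exists2 c0, dom L c0 & forall c c', c0 <= c -> c <= c' -> dom L c' -> F c' - F c <= e.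
Proof.
move=> FJ Fnd e e0; pose A := [set F c | c in dom L].
have d0 : dom L 0 by split.
have sA : has_sup A by split; [exists (F 0); exists 0|exists J => _ [c dc <-]; exact: FJ].
have [_ [c0 dc0 <-] h] := sup_adherent e0 sA.
exists c0 => // c c' c0c cc' dc'.
have c00 : 0 <= c0 by case: dc0.
have : F c' <= sup A by apply: ub_le_sup; [exact: sA.2|exists c'].
have : F c0 <= F c.
  apply: Fnd => //; apply: domS dc' _; apply/andP; split => //; exact: le_trans c0c.
lra.
Qed.

(** The finitely many energies are added up, so that one pair [c], [c'] serves all functions. *)
Lemma cutoff_exists (n : nat) (f : 'I_n -> R -> R[i]) : (forall i, weylfun (f i)) ->
  exists2 M, 0 <= M & forall x e, dom L x -> 0 < e -> exists c c',
    [/\ x <= c, 0 < c, c < c', dom L c' &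
      forall i, kin (f i) c' - kin (f i) c <= e /\
        forall t, c <= t <= c' -> cabs (f i t) ^+ 2 <= M * (c' - c)].
Proof.
move=> wf.
pose G (i : 'I_n) (M : R) := 0 <= M /\ forall c c' t, 0 < c -> c <= t <= c' -> dom L c' ->
  (L = +oo%E -> 1 <= c /\ c' = 2 * c) -> (forall l, L = l%:E -> c' = (c + l) / 2) ->
  cabs (f i t) ^+ 2 <= M * (c' - c).
have [Mi HM] : {Mi : 'I_n -> R & forall i, G i (Mi i)}.
  by apply: choice => i; have [M M0 H] := weyl_growth (wf i); exists M.
have [Ji HJ] : {Ji : 'I_n -> R & forall i c, dom L c -> kin (f i) c <= Ji i}.
  apply: (@choice _ _ (fun i (J : R) => forall c, dom L c -> kin (f i) c <= J)) => i.
  by have [Hf fe _] := wf i; have [J J0 H] := kin_bounded Hf fe; exists J.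
exists (\sum_i Mi i); first by apply: sumr_ge0 => i _; case: (HM i).
move=> x e dx e0; have [x0 xL] := dx.
pose F c := \sum_i kin (f i) c.
have FJ c : dom L c -> F c <= \sum_i Ji i by move=> dc; apply: ler_sum => i _; exact: HJ.
have Fnd u v : 0 <= u -> u <= v -> dom L v -> F u <= F v.
  by move=> u0 uv dv; apply: ler_sum => i _; apply: kin_le => //; case: (wf i).
have [c0 dc0 Hc0] := nondecreasing_sup_tail FJ Fnd e0.
have [c00 c0L] := dc0.
have key c c' : x <= c -> c0 <= c -> 0 < c -> c < c' -> dom L c' ->
   (L = +oo%E -> 1 <= c /\ c' = 2 * c) -> (forall l, L = l%:E -> c' = (c + l) / 2) ->
   exists c c', [/\ x <= c, 0 < c, c < c', dom L c' &
      forall i, kin (f i) c' - kin (f i) c <= e /\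
        forall t, c <= t <= c' -> cabs (f i t) ^+ 2 <= (\sum_i Mi i) * (c' - c)].
  move=> xc c0c cp cc' dc' h1 h2; exists c, c'; split => // i; split.
    apply: le_trans (Hc0 c c' c0c (ltW cc') dc').
    rewrite /F -sumrB (bigD1 i)//= lerDl; apply: sumr_ge0 => j _.
    by rewrite subr_ge0; apply: kin_le => //; [case: (wf j)|exact: ltW|exact: ltW].
  move=> t tc; apply: le_trans ((HM i).2 c c' t cp tc dc' h1 h2) _.
  rewrite ler_wpM2r ?subr_ge0 ?(ltW cc')// (bigD1 i)//= lerDl; apply: sumr_ge0 => j _.
  by case: (HM j).
case EL : L L0 => [l| |//] Lp.
  rewrite EL in key.
  have xl : x < l by rewrite -lte_fin -EL.
  have c0l : c0 < l by rewrite -lte_fin -EL.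
  pose c := (Num.max x c0 + l) / 2.
  have mx : Num.max x c0 < l by rewrite gt_max xl c0l.
  have [hx hc] : x <= Num.max x c0 /\ c0 <= Num.max x c0 by rewrite !le_max !lexx orbT.
  apply: (key c ((c + l) / 2)); rewrite /c ?EL; try lra.
  - by split; [lra|rewrite lte_fin; lra].
  - by [].
  - by move=> l' [->].
rewrite EL in key.
have [c1 [xc1 c01 c11]] : exists c1, [/\ x <= c1, c0 <= c1 & 1 <= c1].
  by exists (Num.max (Num.max x c0) 1); rewrite !le_max !lexx !orbT.
apply: (key c1 (2 * c1)) => //; try lra.
by split; [lra|exact: ltry].
Qed.

End KineticEnergy.

Section QuadraticForm.
Context {R : realType} (mu : {measure set (measurableTypeR R) -> \bar R}).

Lemma cintegral_quadratic (D : set (measurableTypeR R)) n (k : 'I_n -> R[i])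
    (F : 'I_n -> R -> R[i]) (w : R -> R) : measurable D ->
  (forall i j, cintegrable mu D (fun x => F i x * ((F j x)^* * (w x)%:C))) ->
  \sum_i \sum_j k i * (k j)^* * cintegral mu D (fun x => F i x * ((F j x)^* * (w x)%:C)) =
  (\int[mu]_(x in D) (cabs (\sum_i k i * F i x) ^+ 2 * w x))%:C.
Proof.
move=> mD ci.
have ci2 i j : cintegrable mu D (fun x => k i * (k j)^* * (F i x * ((F j x)^* * (w x)%:C))).
  exact: cintegrableZ.
have ci1 i : cintegrable mu D (fun x => \sum_j k i * (k j)^* * (F i x * ((F j x)^* * (w x)%:C))).
  by apply: cintegrable_sum.
under eq_bigr => i _.
  under eq_bigr => j _ do rewrite -(cintegralZ _ mD (ci i j)).
  rewrite -(cintegral_sum mD (fun j _ => ci2 i j)).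
  over.
rewrite -(cintegral_sum mD (fun i _ => ci1 i)).
have E x : \sum_i \sum_j k i * (k j)^* * (F i x * ((F j x)^* * (w x)%:C)) =
    (cabs (\sum_i k i * F i x) ^+ 2 * w x)%:C.
  rewrite rmorphM /= sqr_cabsC rmorph_sum /= !mulr_suml; apply: eq_bigr => i _.
  rewrite mulr_sumr mulr_suml; apply: eq_bigr => j _.
  by rewrite rmorphM /=; ring.
rewrite /cintegral; apply: complex_ext => /=.
  by apply: eq_Rintegral => x _; rewrite E.
rewrite /Rintegral integral0_eq// => x _; by rewrite E.
Qed.

End QuadraticForm.

(** * The equation tested with a cut-off conjugate solution *)

Section CutoffIdentity.
Context {R : realType} (S : gen_indefinite_string R).
Local Notation L := (len S).
Local Notation lam := (@lebesgue_measure R).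
Implicit Types (f g h : R -> R[i]) (c x : R) (k : R[i]).

Lemma seg_compact c : compact (seg c).
Proof. by rewrite segE; exact: segment_compact. Qed.

Lemma upsilon_seg_lty c : dom L c -> (upsilon S (seg c) < +oo)%E.
Proof. by move=> dc; apply: upsilon_compact; [exact: seg_compact|move=> x; exact: domS]. Qed.

Lemma cintegrable_bounded (mu : {measure set (measurableTypeR R) -> \bar R})
    (D : set (measurableTypeR R)) f M : measurable D -> (mu D < +oo)%E -> cmeasurable D f ->
  (forall x, D x -> cabs (f x) <= M) -> cintegrable mu D f.
Proof.
move=> mD Dy mf fM; apply: (cintegrable_le mD mf _ fM).
exact: integrable_cst_lty.
Qed.

Lemma upsilon_cintegrable f c : H1loc L f -> dom L c -> cintegrable (upsilon S) (seg c) f.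
Proof.
move=> Hf dc; have [M M0 fM] := H1loc_bounded Hf dc.
apply: (cintegrable_bounded (measurable_seg c) (upsilon_seg_lty dc) _ fM).
exact: H1loc_cmeasurable Hf dc.
Qed.

Lemma upsilon_restrict f h c : dom L c -> vanish_after L c h ->
  cintegral (upsilon S) (dom L) (fun x => f x * h x) =
  cintegral (upsilon S) (seg c) (fun x => f x * h x).
Proof.
move=> dc hc; apply: (cintegral_off_null measurable0 (measure0 _)) => //.
- move=> x [x0 xL] _ nxc; rewrite hc ?mulr0//.
  by rewrite ltNge; apply/negP => xc; apply: nxc; rewrite /seg /= x0.
- by move=> x xc _ ndx; exfalso; apply: ndx; exact: domS xc.
Qed.

Lemma cmeasurable_step (D : set (measurableTypeR R)) (c c' r : R) : measurable D ->
  cmeasurable D (fun x => (if c < x < c' then r else 0)%:C).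
Proof.
move=> mD; split; last exact: measurable_cst.
rewrite /= (_ : (fun x => _) = (fun x => r * \1_(`]c, c'[%classic : set (measurableTypeR R)) x)).
  apply: measurable_funM; first exact: measurable_cst.
  by apply: measurable_indic; exact: measurable_itv.
apply/funext => x; rewrite indicE mem_setE in_itv /=.
by case: ifP => _; rewrite ?mulr1 ?mulr0.
Qed.

Lemma cintegral_conj_swap (mu : {measure set (measurableTypeR R) -> \bar R})
    (D : set (measurableTypeR R)) f g (w : R -> R) : measurable D ->
  cintegrable mu D (fun x => f x * ((g x)^* * (w x)%:C)) ->
  (cintegral mu D (fun x => f x * ((g x)^* * (w x)%:C)))^* =
  cintegral mu D (fun x => g x * ((f x)^* * (w x)%:C)).
Proof.
move=> mD ci; rewrite -(cintegralJ mD ci).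
rewrite (_ : (fun x => (f x * ((g x)^* * (w x)%:C))^*) = (fun x => g x * ((f x)^* * (w x)%:C)))//.
apply/funext => x; case: (f x) (g x) => [p q] [r t]; apply: complex_ext; rewrite ?(ReJ, ImJ, ReM, ImM, ReC, ImC) /=; ring.
Qed.

Section Pair.
Variables (zi zj di dj : R[i]) (fi fj gi gj : R -> R[i]) (c c' : R).
Hypotheses (si : solution S zi fi di) (sj : solution S zj fj dj).
Hypotheses (c0 : 0 < c) (cc' : c < c') (dc' : dom L c').
Hypotheses (dgi : density c' fi gi) (dgj : density c' fj gj).
Let chi := ramp c c'.
Let chi' x := (if c < x < c' then - (c' - c)^-1 else 0).
Let c'0 : 0 < c' := lt_trans c0 cc'.

Lemma cmeasurable_cramp (D : set (measurableTypeR R)) : D `<=` seg c' -> measurable D -> cmeasurable D (cramp c c').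
Proof.
move=> Dc mD; have [m1 m2] := H1loc_cmeasurable (@H1loc_cramp _ L _ _ cc') dc'.
by split; [apply: measurable_funS m1|apply: measurable_funS m2] => //; exact: measurable_seg.
Qed.

Lemma cutoff_cintegrable : cintegrable lam (seg c') (fun x => gi x * ((gj x)^* * (chi x)%:C)).
Proof.
have mS := @measurable_seg R c'.
apply: square_integrableM => //; first exact: density_square_integrable si.1 dc' dgi.
have [mj [_ sj2]] := (erefl true, density_square_integrable sj.1 dc' dgj).
have [[mj1 mj2] _] := density_square_integrable sj.1 dc' dgj.
have sJ : square_integrable lam (seg c') (fun x => (gj x)^*).
  split; first by apply: cmeasurableJ.
  by under eq_fun do rewrite cabsJ.
have := @square_integrable_bounded _ _ _ _ (cramp c c') 1 mS (cmeasurable_cramp (@subset_refl _ _) mS) _ sJ.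
rewrite (_ : (fun x => cramp c c' x * (gj x)^*) = (fun x => (gj x)^* * (chi x)%:C)).
  by apply => x _; rewrite cabsC ger0_norm ?ramp_ge0// ramp_le1.
by apply/funext => x; rewrite mulrC.
Qed.

Lemma cutoff_square_integrable : square_integrable lam (seg c') (fun x => (fj x)^* * (chi' x)%:C).
Proof.
have mS := @measurable_seg R c'.
have [M M0 fM] := H1loc_bounded sj.1 dc'.
apply: (@square_integrable_fin _ _ _ _ (M * (c' - c)^-1)) => //; first exact: lebesgue_seg_lty.
  apply: cmeasurableM; last exact: cmeasurable_step.
  by apply: cmeasurableJ; exact: H1loc_cmeasurable sj.1 dc'.
move=> x sx; rewrite cabsM cabsJ cabsC; apply: ler_pM; rewrite ?cabs_ge0//; first exact: fM.
have k0 : 0 <= (c' - c)^-1 by rewrite invr_ge0 subr_ge0 ltW.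
by rewrite /chi'; case: ifP => _; rewrite ?normrN ?normr0 ?ger0_norm.
Qed.

Lemma cutoff_cintegrable' : cintegrable lam (seg c') (fun x => gi x * ((fj x)^* * (chi' x)%:C)).
Proof.
apply: square_integrableM; first exact: measurable_seg.
  exact: density_square_integrable si.1 dc' dgi.
exact: cutoff_square_integrable.
Qed.

Lemma vanish_cutoff f : vanish_after L c' (fun x => (f x)^* * cramp c c' x).
Proof. by move=> x _ cx; rewrite /cramp ramp_right ?mulr0// ltW. Qed.

Lemma H1c_cutoff f : H1loc L f -> H1c L (fun x => (f x)^* * cramp c c' x).
Proof. by move=> Hf; exact: (H1cM (H1locJ Hf) (H1c_cramp cc' c'0 dc')). Qed.

(** The product rule splits the energy of the cut-off test function; the term with [chi'] is the
    error to be made small. *)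
Lemma cutoff_equation :
  di * (fj 0)^* + (cintegral lam (seg c') (fun x => gi x * ((gj x)^* * (chi x)%:C)) +
    cintegral lam (seg c') (fun x => gi x * ((fj x)^* * (chi' x)%:C))) =
  zi * omega S (fun x => fi x * ((fj x)^* * cramp c c' x)) +
  zi ^+ 2 * cintegral (upsilon S) (seg c') (fun x => fi x * ((fj x)^* * (chi x)%:C)).
Proof.
have [Hi E] := si; have := E _ (H1c_cutoff sj.1).
rewrite (upsilon_restrict _ dc' (@vanish_cutoff fj)) => <-.
have -> : cramp c c' 0 = 1 by rewrite /cramp (ramp_left cc' (ltW c0)).
rewrite mulr1; congr (_ + _).
have wd : weak_deriv c' (fun x => (fj x)^* * cramp c c' x)
    (fun x => (gj x)^* * (chi x)%:C + (fj x)^* * (chi' x)%:C).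
  apply: weak_deriv_map2 (density_weak dgj) (weak_deriv_cramp cc' (ltW c'0)) => x _ h1 h2.
  exact: cderM (cderJ h1) h2.
rewrite -/(energy L fi (fun x => (fj x)^* * cramp c c' x)).
rewrite (energyE dc' (@vanish_cutoff fj) (density_weak dgi) wd).
rewrite -(cintegralD (measurable_seg c') cutoff_cintegrable cutoff_cintegrable').
by congr (cintegral lam _ _); apply/funext => x; rewrite mulrDr.
Qed.

(** The weight [t] is free: when the energy [T] on the cut-off zone is [t ^+ 2], the bound is a
    multiple of [t]. *)
Lemma cutoff_error t M T : 0 < t -> (forall x, c <= x <= c' -> cabs (fj x) ^+ 2 <= M * (c' - c)) ->
  \int[lam]_(x in `[c, c']%classic) (cabs (gi x) ^+ 2) <= T ->
  cabs (cintegral lam (seg c') (fun x => gi x * ((fj x)^* * (chi' x)%:C))) <= 2 * (T / t + t * M).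
Proof.
move=> t0 fM gT; have l0 : 0 < c' - c by rewrite subr_gt0.
have mI := measurable_itvR `[c, c'].
have sub : `[c, c']%classic `<=` seg c' by apply: itv_seg; rewrite ?lexx// ltW.
have ci := cutoff_cintegrable'.
have ci' : cintegrable lam `[c, c']%classic (fun x => gi x * ((fj x)^* * (chi' x)%:C)).
  have [[m1 m2] i1] := ci; split; last by apply: integrableS i1 => //; exact: measurable_seg.
  by split; [apply: measurable_funS m1|apply: measurable_funS m2] => //; exact: measurable_seg.
have -> : cintegral lam (seg c') (fun x => gi x * ((fj x)^* * (chi' x)%:C)) =
  cintegral lam `[c, c']%classic (fun x => gi x * ((fj x)^* * (chi' x)%:C)).
  apply: (cintegral_off_null measurable0 (measure0 _)) => //.
  - move=> x _ _ xI; rewrite /chi' (_ : (c < x < c') = false) ?mulr0//.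
    by apply/negbTE/negP => /andP[h1 h2]; apply: xI; rewrite /= in_itv /= !ltW.
  - by move=> x /sub.
have sg : lam.-integrable `[c, c']%classic (EFin \o (fun x => cabs (gi x) ^+ 2)).
  have [_ s2] := density_square_integrable si.1 dc' dgi.
  by apply: integrableS s2 => //; exact: measurable_seg.
have i1 : lam.-integrable `[c, c']%classic (EFin \o (fun x => t^-1 * cabs (gi x) ^+ 2)).
  by rewrite (_ : _ \o _ = (fun x => t^-1%:E * (cabs (gi x) ^+ 2)%:E)%E)//; exact: integrableZl.
have i2 : lam.-integrable `[c, c']%classic (EFin \o (fun=> t * M / (c' - c))).
  by apply: integrable_cst_lty => //; exact: lebesgue_itv_lty.
have i3 : lam.-integrable `[c, c']%classic (EFin \o (fun x => t^-1 * cabs (gi x) ^+ 2 + t * M / (c' - c))).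
  by rewrite (_ : _ \o _ = (fun x => (t^-1 * cabs (gi x) ^+ 2)%:E + (t * M / (c' - c))%:E)%E)//; exact: integrableD.
apply: le_trans (cabs_cintegral_le mI ci' i3 _) _; last first.
  rewrite ler_wpM2l// RintegralD// Rintegral_cst// RintegralZl// (fine_lebesgue_itv (ltW cc')).
  rewrite divfK ?gt_eqF// lerD2r mulrC ler_wpM2r// invr_ge0 ltW//.
move=> x; rewrite /= in_itv /= => xI; rewrite !cabsM cabsJ cabsC.
have fx := fM x xI.
have k1 : `|chi' x| <= (c' - c)^-1.
  have k0 : 0 <= (c' - c)^-1 by rewrite invr_ge0 ltW.
  by rewrite /chi'; case: ifP => _; rewrite ?normrN ?normr0 ?ger0_norm.
have G0 := cabs_ge0 (gi x); have F0 := cabs_ge0 (fj x).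
set G := cabs (gi x) in G0 *; set F := cabs (fj x) in F0 fx *.
apply: (@le_trans _ _ (G * (F * (c' - c)^-1))); first by rewrite ler_wpM2l// ler_wpM2l.
(* AM-GM: [2 G (F / l) <= G^2 / t + t (F / l)^2] *)
have ff : t * (F * (c' - c)^-1) ^+ 2 <= t * M / (c' - c).
  rewrite -mulrA ler_wpM2l ?(ltW t0)// exprMn.
  apply: (@le_trans _ _ (M * (c' - c) * (c' - c)^-1 ^+ 2)); first by rewrite ler_wpM2r ?sqr_ge0.
  by rewrite expr2 mulrA mulfK ?gt_eqF.
set H := F * (c' - c)^-1 in ff *.
have am : 2 * (G * H) <= t^-1 * G ^+ 2 + t * H ^+ 2.
  rewrite -subr_ge0 (_ : _ - _ = t^-1 * (G - t * H) ^+ 2); last by field; rewrite gt_eqF.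
  by rewrite mulr_ge0 ?sqr_ge0// invr_ge0 ltW.
have H0 : 0 <= G * H by rewrite mulr_ge0// /H mulr_ge0// invr_ge0 ltW.
lra.
Qed.

End Pair.

End CutoffIdentity.

Lemma square_integrable_lincomb (R : realType) (D : set (measurableTypeR R)) n
    (k : 'I_n -> R[i]) (g : 'I_n -> R -> R[i])
    (mu : {measure set (measurableTypeR R) -> \bar R}) : measurable D ->
  (forall i, square_integrable mu D (g i)) ->
  square_integrable mu D (fun x => \sum_i k i * g i x).
Proof.
move=> mD sg.
have Z i : square_integrable mu D (fun x => k i * g i x).
  by apply: (@square_integrable_bounded _ _ _ _ (fun=> k i) (cabs (k i))) => //; exact: cmeasurable_cst.
elim: (index_enum _) => [|i s [ms IH]].
  split; under eq_fun do rewrite big_nil; first exact: cmeasurable_cst.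
  under eq_fun do rewrite cabs0 expr0n; exact: integrable0.
have [mi Zi] := Z i.
have mcons : cmeasurable D (fun x => \sum_(j <- i :: s) k j * g j x).
  by under eq_fun do rewrite big_cons; exact: cmeasurableD.
split => //.
have ii : mu.-integrable D (fun x => (2 * cabs (k i * g i x) ^+ 2)%:E + (2 * cabs (\sum_(j <- s) k j * g j x) ^+ 2)%:E)%E.
  have Z2 h : mu.-integrable D (fun x => (cabs (h x) ^+ 2)%:E) -> mu.-integrable D (fun x => (2 * cabs (h x) ^+ 2)%:E).
    by move=> ih; under eq_fun do rewrite EFinM; exact: integrableZl.
  by apply: integrableD => //; [exact: (Z2 (fun x => k i * g i x))|exact: (Z2 (fun x => \sum_(j <- s) k j * g j x))].
apply: le_integrable ii => //.
  by apply/measurable_EFinP; exact: cmeasurable_cabs2.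
move=> x _; rewrite /= !ger0_norm ?sqr_ge0//; last first.
  by rewrite addr_ge0// mulr_ge0// sqr_ge0.
rewrite lee_fin big_cons.
set p := k i * _; set q := \sum_(j <- s) _.
apply: (@le_trans _ _ ((cabs p + cabs q) ^+ 2)).
  by rewrite ler_sqr ?nnegrE ?cabsD ?addr_ge0 ?cabs_ge0.
by have := sqr_ge0 (cabs p - cabs q); rewrite !sqrrD sqrrN mulrN; lra.
Qed.

Lemma conj_equation (R : rcfType) (a x p q z o u : R[i]) :
  a * x^* + (p + q) = z * o + z ^+ 2 * u ->
  a^* * x + (p^* + q^*) = z^* * o^* + z^* ^+ 2 * u^*.
Proof. by move=> /(congr1 conjc); rewrite !rmorphD !rmorphM /= -!/(Num.conj _) conjcK. Qed.

(** * The Hermitian boundary form *)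

Section Combination.
Context {R : realType} (S : gen_indefinite_string R).
Local Notation L := (len S).
Local Notation lam := (@lebesgue_measure R).
Variables (n : nat) (z d : 'I_n -> R[i]) (f : 'I_n -> R -> R[i]).
Hypothesis z_gt0 : forall i, 0 < Im (z i).
Hypothesis sol : forall i, solution S (z i) (f i) (d i).

(** For Weyl solutions this is the Nevanlinna kernel of [m], up to the values at 0; see
    [weyl_boundary_form]. *)
Definition boundary_form i j : R[i] :=
  (d i * (f j 0)^* / z i - (d j)^* * f i 0 / (z j)^*) / (z i - (z j)^*).

Lemma UHP_neq0 i : z i != 0.
Proof. by apply/eqP => E; have := z_gt0 i; rewrite E /= ltxx. Qed.

Lemma UHP_conj_neq i j : z i - (z j)^* != 0.
Proof.
rewrite subr_eq0; apply/eqP => E; have := z_gt0 i; rewrite E ImJ => h; have := z_gt0 j; lra.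
Qed.

Section Cutoff.
Variables (c c' : R) (g : 'I_n -> R -> R[i]).
Hypotheses (c0 : 0 < c) (cc' : c < c') (dc' : dom L c').
Hypothesis dg : forall i, density c' (f i) (g i).

Let P i j := cintegral lam (seg c') (fun x => g i x * ((g j x)^* * (ramp c c' x)%:C)).
Let U i j := cintegral (upsilon S) (seg c') (fun x => f i x * ((f j x)^* * (ramp c c' x)%:C)).
Let A i j := cintegral lam (seg c') (fun x => g i x * ((f j x)^* *
     ((fun x0 : R => if c < x0 < c' then - (c' - c)^-1 else 0) x)%:C)).

Lemma upsilon_cutoff_cintegrable i j :
  cintegrable (upsilon S) (seg c') (fun x => f i x * ((f j x)^* * (ramp c c' x)%:C)).
Proof.
exact: (upsilon_cintegrable (H1locM (sol i).1 (H1locM (H1locJ (sol j).1) (@H1loc_cramp _ L _ _ cc'))) dc').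
Qed.

(** Dividing the equation for [i], [j] by [z i], and the conjugate of the one for [j], [i] by the
    conjugate of [z j], makes the [omega] terms equal; the difference eliminates them. *)
Lemma boundary_formE i j :
  boundary_form i j = U i j + (z i)^-1 * ((z j)^*)^-1 * P i j -
    (A i j / z i - (A j i)^* / (z j)^*) / (z i - (z j)^*).
Proof.
have mS := @measurable_seg R c'.
have E1 := cutoff_equation (sol i) (sol j) c0 cc' dc' (dg i) (dg j).
have E2 := conj_equation (cutoff_equation (sol j) (sol i) c0 cc' dc' (dg j) (dg i)).
move: E2.
rewrite (cintegral_conj_swap mS (cutoff_cintegrable (sol j) (sol i) cc' dc' (dg j) (dg i)) : Num.conj _ = _).
rewrite (cintegral_conj_swap mS (upsilon_cutoff_cintegrable j i) : Num.conj _ = _).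
rewrite -(omegaJ (H1cM (sol j).1 (H1c_cutoff c0 cc' dc' (sol i).1)) : _ = Num.conj _).
rewrite (_ : (fun x => (f j x * ((f i x)^* * cramp c c' x))^*) = (fun x => f i x * ((f j x)^* * cramp c c' x))); last first.
  apply/funext => x; rewrite /cramp; case: (f j x) (f i x) => [p q] [r t].
  by apply: complex_ext; rewrite ?(ReJ, ImJ, ReM, ImM, ReC, ImC) /=; ring.
move: E1; rewrite -/(P i j) -/(U i j) -/(A i j) -/(A j i) /boundary_form.
set O := omega S _.
have zi := UHP_neq0 i; have zj : ((z j)^*)%R != 0 by rewrite conjc_eq0 UHP_neq0.
have zz := UHP_conj_neq i j.
move: ((z j)^*)%R ((A j i)^*)%R ((d j)^*)%R ((f j 0)^*)%R zj zz => zj' A' dj' fj' zj zz E1 E2.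
have -> : d i * fj' = z i * O + z i ^+ 2 * U i j - (P i j + A i j).
  by rewrite -E1; ring.
have -> : dj' * f i 0 = zj' * O + zj' ^+ 2 * U i j - (P i j + A').
  by rewrite -E2; ring.
by field; rewrite zi zj zz.
Qed.

Lemma boundary_form_sum (k : 'I_n -> R[i]) :
  \sum_i \sum_j k i * (k j)^* * boundary_form i j =
  (\int[upsilon S]_(x in seg c') (cabs (\sum_i k i * f i x) ^+ 2 * ramp c c' x) +
   \int[lam]_(x in seg c') (cabs (\sum_i k i / z i * g i x) ^+ 2 * ramp c c' x))%:C -
  \sum_i \sum_j k i * (k j)^* * ((A i j / z i - (A j i)^* / (z j)^*) / (z i - (z j)^*)).
Proof.
have mS := @measurable_seg R c'.
rewrite rmorphD /= -(cintegral_quadratic k mS upsilon_cutoff_cintegrable).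
rewrite -(cintegral_quadratic (fun i => k i / z i) mS
  (fun i j => cutoff_cintegrable (sol i) (sol j) cc' dc' (dg i) (dg j))).
rewrite -big_split -sumrB; apply: eq_bigr => i _.
rewrite -big_split -sumrB; apply: eq_bigr => j _ /=.
rewrite boundary_formE -/(U i j) -/(P i j) (rmorphM Num.conj) (fmorphV Num.conj) /=.
ring.
Qed.

Lemma ramp_energy_le (k : 'I_n -> R[i]) x : 0 <= x <= c ->
  \int[lam]_(y in seg x) (cabs (\sum_i k i * g i y) ^+ 2) <=
  \int[lam]_(y in seg c') (cabs (\sum_i k i * g i y) ^+ 2 * ramp c c' y).
Proof.
move=> /andP[x0 xc]; have xc' : x <= c' by rewrite (le_trans xc)// ltW.
have mS := @measurable_seg R c'.
have [mg ig] : square_integrable lam (seg c') (fun y => \sum_i k i * g i y).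
  by apply: square_integrable_lincomb => // i; exact: density_square_integrable (sol i).1 dc' (dg i).
have sub : seg x `<=` seg c'.
  by move=> y /andP[y0 yx]; rewrite /seg /= y0 (le_trans yx).
have fin D : D `<=` seg c' -> (\int[lam]_(y in D) (cabs (\sum_i k i * g i y) ^+ 2)%:E < +oo)%E.
  move=> Dc; apply: (le_lt_trans _ (integrable_lty mS ig)).
  apply: (ge0_le_integral_off_null measurable0 (measure0 lam)) => // y _; rewrite lee_fin sqr_ge0//.
have r0 y : 0 <= cabs (\sum_i k i * g i y) ^+ 2 * ramp c c' y.
  by rewrite mulr_ge0 ?sqr_ge0 ?ramp_ge0.
apply: fine_le.
- by rewrite ge0_fin_numE ?fin//; apply: integral_ge0 => y _; rewrite lee_fin sqr_ge0.
- rewrite ge0_fin_numE; last by apply: integral_ge0 => y _; rewrite lee_fin.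
  apply: le_lt_trans (fin _ (@subset_refl _ _)).
  apply: (ge0_le_integral_off_null measurable0 (measure0 lam)) => // y _; rewrite ?lee_fin ?sqr_ge0//.
  by move=> _; rewrite ler_piMr ?sqr_ge0 ?ramp_le1.
apply: (ge0_le_integral_off_null measurable0 (measure0 lam)) => // y; rewrite ?lee_fin ?sqr_ge0//.
by move=> /andP[_ yx] _; rewrite ramp_left ?mulr1// (le_trans yx).
Qed.

End Cutoff.

(* Testing the equation for [f i] against the cut-off conjugate of [f j] gives, up to an error
   that tends to zero, a Green identity: the Hermitian form of [boundary_form] at [k] is the sum
   of the energies of the combinations [sum k i / z i *: f i] and [sum k i *: f i]. *)
Lemma weyl_combination (k : 'I_n -> R[i]) : (forall i, weylfun L (f i)) ->
  \sum_i \sum_j k i * (k j)^* * boundary_form i j = 0 ->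
  forall x, dom L x -> \sum_i k i / z i * (f i x - f i 0) = 0.
Proof.
move=> wf k0 x dx.
have : 0 <= x by case: dx.
rewrite le_eqVlt => /predU1P[<-|x0].
  by rewrite big1 // => i _; rewrite subrr mulr0.
have [M M0 HM] := cutoff_exists (len_gt0 S) wf.
(* [C] bounds the cut-off error per unit of [t], independently of [c] and [c']. *)
pose C := \sum_i \sum_j cabs (k i * (k j)^*) * ((2 * (1 + M)) * (cabs (z i)^-1 + cabs (z j)^-1) * cabs (z i - (z j)^*)^-1).
have C0 : 0 <= C.
  apply: sumr_ge0 => i _; apply: sumr_ge0 => j _; rewrite mulr_ge0 ?cabs_ge0//.
  by rewrite mulr_ge0 ?cabs_ge0// mulr_ge0 ?addr_ge0 ?cabs_ge0// mulr_ge0// addr_ge0.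
suff bound t : 0 < t -> cabs (\sum_i k i / z i * (f i x - f i 0)) ^+ 2 <= x * C * t.
  apply/eqP; rewrite -cabs_eq0 -sqrf_eq0 eq_le sqr_ge0 andbT.
  apply/ler_addgt0Pl => e e0; rewrite addr0.
  apply: le_trans (bound (e / (x * C + 1)) _) _.
    by rewrite divr_gt0// ltr_wpDl// mulr_ge0// ltW.
  rewrite mulrA ler_pdivrMr; last by rewrite ltr_wpDl// mulr_ge0// ltW.
  by rewrite mulrC ler_wpM2l ?(ltW e0)// lerDl.
move=> t0; have t20 : 0 < t ^+ 2 by rewrite exprn_gt0.
(* Energies at most [t ^+ 2] between [c] and [c'] balance the two terms of [cutoff_error]. *)
have [c [c' [xc c0 cc' dc' H]]] := HM x _ dx t20.
have c'0 : 0 < c' := lt_trans c0 cc'.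
have [g dg] : {g : 'I_n -> R -> R[i] & forall i, density c' (f i) (g i)}.
  by apply: (@choice _ _ (fun i h => density c' (f i) h)) => i; exact: (density_exists (sol i).1 dc' c'0).
have bA i j : cabs (cintegral lam (seg c') (fun x => g i x * ((f j x)^* *
     ((fun x0 : R => if c < x0 < c' then - (c' - c)^-1 else 0) x)%:C))) <= 2 * (1 + M) * t.
  have [e1 _] := H i; have [_ e2] := H j.
  have e3 : \int[lam]_(y in `[c, c']%classic) (cabs (g i y) ^+ 2) <= t ^+ 2.
    by rewrite -(kin_sub (sol i).1 dc' (dg i) (ltW c0) (ltW cc')).
  apply: le_trans (cutoff_error (sol i) (sol j) c0 cc' dc' (dg i) t0 e2 e3) _.
  by rewrite expr2 mulfK ?gt_eqF// (_ : t + t * M = (1 + M) * t) ?mulrA//; ring.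
have := boundary_form_sum c0 cc' dc' dg k.
rewrite k0; set E := \sum_i \sum_j _; set I1 := \int[_]_(x in _) _; set I2 := \int[_]_(x in _) _ => /eqP.
rewrite eq_sym subr_eq0 => /eqP EE.
have I10 : 0 <= I1.
  by apply: Rintegral_ge0 => y _; apply: mulr_ge0 (ramp_ge0 _ _ _); exact: sqr_ge0.
have I2C : I2 <= C * t.
  apply: (@le_trans _ _ (cabs E)).
    by rewrite -EE cabsC; apply: le_trans (ler_norm _); rewrite lerDr.
  apply: le_trans (cabs_sum _ _ _) _; rewrite /C mulr_suml; apply: ler_sum => i _.
  apply: le_trans (cabs_sum _ _ _) _; rewrite mulr_suml; apply: ler_sum => j _.
  rewrite cabsM -mulrA ler_wpM2l ?cabs_ge0// cabsM mulrAC ler_wpM2r ?cabs_ge0//.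
  apply: le_trans (cabsB _ _) _; rewrite mulrAC mulrDr; apply: lerD.
    by rewrite cabsM ler_wpM2r ?cabs_ge0// bA.
  by rewrite -(fmorphV Num.conj) cabsM !cabsJ ler_wpM2r ?cabs_ge0// bA.
have xc' : x <= c' by rewrite (le_trans xc)// ltW.
have mI := measurable_itvR `[0, x].
have sub : `[0, x]%classic `<=` seg c' by apply: itv_seg; rewrite ?lexx.
have sq : square_integrable lam `[0, x]%classic (fun y => \sum_i k i / z i * g i y).
  apply: square_integrable_lincomb => // i.
  apply: square_integrableS (density_square_integrable (sol i).1 dc' (dg i)) => //; exact: measurable_seg.
have ci i : cintegrable lam `[0, x]%classic (g i) := density_cintegrable (sol i).1 dc' (dg i) mI sub.
have -> : \sum_i k i / z i * (f i x - f i 0) = cintegral lam `[0, x]%classic (fun y => \sum_i k i / z i * g i y).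
  rewrite (cintegral_sum mI (fun i _ => cintegrableZ (k i / z i) mI (ci i))).
  apply: eq_bigr => i _; rewrite (cintegralZ _ mI (ci i)); congr (_ * _).
  by have [_ _ _ _ h] := dg i; apply: h => //; exact: ltW.
apply: le_trans (cintegral_hoelder x0 sq) _; rewrite subr0 -mulrA ler_wpM2l ?(ltW x0)//.
apply: le_trans I2C; rewrite -segE; apply: ramp_energy_le => //.
by rewrite (ltW x0).
Qed.

End Combination.

(** * Linear combinations of solutions *)

Section LinearCombinations.
Context {R : realType} (S : gen_indefinite_string R).
Local Notation L := (len S).
Local Notation lam := (@lebesgue_measure R).
Implicit Types (f g h : R -> R[i]) (c x : R) (k : R[i]).

Lemma weak_deriv_eq c f h g : dom L c -> (forall x, dom L x -> f x = h x) ->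
  weak_deriv c f g -> weak_deriv c h g.
Proof.
move=> dc fh [N [mN N0 H]]; exists N; split => // x xc Nx.
have [/andP[x0 xlc] fx] := H x xc Nx; split; first by rewrite x0.
apply: cder_near fx; near=> t; apply: fh; apply: domS dc _.
rewrite /seg /=; apply/andP; split; apply: ltW; near: t; first exact: lt_nbhsr.
exact: lt_nbhsl.
Unshelve. all: end_near. Qed.

Lemma energy_ext f g h : H1loc L f -> (forall x, dom L x -> f x = g x) -> H1c L h ->
  energy L f h = energy L g h.
Proof.
move=> Hf fg /H1cS[Hh [c [dc c0 hc]]].
have [gf df] := density_exists Hf dc c0; have [gh dh] := density_exists Hh dc c0.
rewrite (energyE dc hc (density_weak df) (density_weak dh)).
by rewrite (energyE dc hc (weak_deriv_eq dc fg (density_weak df)) (density_weak dh)).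
Qed.

Lemma weak_deriv_lincomb c n (k : 'I_n -> R[i]) (f g : 'I_n -> R -> R[i]) : 0 <= c ->
  (forall i, weak_deriv c (f i) (g i)) ->
  weak_deriv c (fun x => \sum_i k i * f i x) (fun x => \sum_i k i * g i x).
Proof.
move=> c0 wd; elim: (index_enum _) => [|i s IH].
  apply: (weak_deriv_fin (s := [::])) => // x _ _.
  rewrite (_ : (fun x => _) = (fun=> 0)); last by apply/funext => y; rewrite big_nil.
  by rewrite big_nil; exact: cderC.
apply: weak_deriv_map2 (wd i) IH => x _ h1 h2.
rewrite (_ : (fun x => _) = (fun x => k i * f i x + \sum_(j <- s) k j * f j x)); last first.
  by apply/funext => y; rewrite big_cons.
rewrite big_cons; apply: cderD => //.
have := cderM (cderC (k i) x) h1; by rewrite mul0r add0r.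
Qed.

Lemma energy_lincomb n (k : 'I_n -> R[i]) (f : 'I_n -> R -> R[i]) h :
  (forall i, H1loc L (f i)) -> H1c L h ->
  energy L (fun x => \sum_i k i * f i x) h = \sum_i k i * energy L (f i) h.
Proof.
move=> Hf /H1cS[Hh [c [dc c0 hc]]].
have [g dg] : {g : 'I_n -> R -> R[i] & forall i, density c (f i) (g i)}.
  by apply: (@choice _ _ (fun i h => density c (f i) h)) => i; exact: density_exists (Hf i) dc c0.
have [gh dh] := density_exists Hh dc c0.
have wg := weak_deriv_lincomb k (ltW c0) (fun i => density_weak (dg i)).
rewrite (energyE dc hc wg (density_weak dh)).
have mS := @measurable_seg R c.
have ci i : cintegrable lam (seg c) (fun x => g i x * gh x).
  by apply: square_integrableM => //; [exact: density_square_integrable (Hf i) dc (dg i)|exact: density_square_integrable Hh dc dh].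
transitivity (cintegral lam (seg c) (fun x => \sum_i k i * (g i x * gh x))).
  by congr (cintegral _ _ _); apply/funext => x; rewrite mulr_suml; apply: eq_bigr => i _; rewrite mulrA.
rewrite (cintegral_sum mS (fun i _ => cintegrableZ (k i) mS (ci i))).
apply: eq_bigr => i _; rewrite (cintegralZ _ mS (ci i)).
by rewrite (energyE dc hc (density_weak (dg i)) (density_weak dh)).
Qed.

Definition upairing f h := cintegral (upsilon S) (dom L) (fun x => f x * h x).

Lemma upairing_ext f g h : (forall x, dom L x -> f x = g x) -> upairing f h = upairing g h.
Proof.
by move=> fg; rewrite /upairing /cintegral; congr (_ +i* _); apply: eq_Rintegral => x /set_mem dx; rewrite fg.
Qed.

Lemma upairing_lincomb n (k : 'I_n -> R[i]) (f : 'I_n -> R -> R[i]) h :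
  (forall i, H1loc L (f i)) -> H1c L h ->
  upairing (fun x => \sum_i k i * f i x) h = \sum_i k i * upairing (f i) h.
Proof.
move=> Hf /H1cS[Hh [c [dc c0 hc]]]; have mS := @measurable_seg R c.
have ci i : cintegrable (upsilon S) (seg c) (fun x => f i x * h x).
  exact: (upsilon_cintegrable (H1locM (Hf i) Hh) dc).
rewrite /upairing (upsilon_restrict _ dc hc).
transitivity (cintegral (upsilon S) (seg c) (fun x => \sum_i k i * (f i x * h x))).
  by congr (cintegral _ _ _); apply/funext => x; rewrite mulr_suml; apply: eq_bigr => i _; rewrite mulrA.
rewrite (cintegral_sum mS (fun i _ => cintegrableZ (k i) mS (ci i))).
by apply: eq_bigr => i _; rewrite (cintegralZ _ mS (ci i)) (upsilon_restrict _ dc hc).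
Qed.

Definition opairing f h := omega S (fun x => f x * h x).

Lemma opairing_ext f g h : H1loc L f -> H1loc L g -> H1c L h ->
  (forall x, dom L x -> f x = g x) -> opairing f h = opairing g h.
Proof.
by move=> Hf Hg Hh fg; apply: omega_ext (H1cM Hf Hh) (H1cM Hg Hh) _ => x dx; rewrite fg.
Qed.

Lemma opairing_lincomb n (k : 'I_n -> R[i]) (f : 'I_n -> R -> R[i]) h :
  (forall i, H1loc L (f i)) -> H1c L h ->
  opairing (fun x => \sum_i k i * f i x) h = \sum_i k i * opairing (f i) h.
Proof.
move=> Hf Hh; rewrite /opairing; elim: (index_enum _) => [|i s IH].
  rewrite (_ : (fun x => _) = (fun=> 0)) ?omega0 ?big_nil//.
  by apply/funext => x; rewrite big_nil mul0r.
have Hs : H1c L (fun x => (\sum_(j <- s) k j * f j x) * h x).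
  exact: (H1cM (H1loc_sum s k Hf) Hh).
rewrite big_cons -IH -(omega_lin (k i) (H1cM (Hf i) Hh) Hs).
by congr (omega S _); apply/funext => x; rewrite big_cons mulrDl mulrA.
Qed.

Lemma solutionE z f d h : solution S z f d -> H1c L h ->
  d * h 0 + energy L f h = z * opairing f h + z ^+ 2 * upairing f h.
Proof. by move=> [_]; exact. Qed.

Lemma H1loc_lincomb n (k : 'I_n -> R[i]) (f : 'I_n -> R -> R[i]) :
  (forall i, H1loc L (f i)) -> H1loc L (fun x => \sum_i k i * f i x).
Proof. exact: H1loc_sum. Qed.

Lemma solutionZ z k f d : solution S z f d -> solution S z (fun x => k * f x) (k * d).
Proof.
move=> sf; split; first exact: H1locZ sf.1.
have one u : (fun x => k * u x) = (fun x => \sum_(i < 1) k * u x).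
  by apply/funext => x; rewrite big_ord1.
move=> h Hh; rewrite -/(energy L _ h) -/(opairing _ h) -/(upairing _ h) one.
rewrite (@energy_lincomb 1 (fun=> k) (fun=> f))//; last by move=> _; exact: sf.1.
rewrite (@opairing_lincomb 1 (fun=> k) (fun=> f))//; last by move=> _; exact: sf.1.
rewrite (@upairing_lincomb 1 (fun=> k) (fun=> f))//; last by move=> _; exact: sf.1.
rewrite !big_ord1 -mulrA -mulrDr (solutionE sf Hh); ring.
Qed.

Lemma weyl_weylfun z psi d : weyl_solution S z psi d -> weylfun L psi.
Proof.
move=> [[Hpsi _] _ fin v0]; split => //.
apply: le_lt_trans fin; rewrite leeDl//; apply: integral_ge0 => x _.
by rewrite lee_fin sqr_ge0.
Qed.

End LinearCombinations.

Section Conjugation.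
Context {R : rcfType}.
Implicit Types x y : R[i].
Lemma NconjD x y : Num.conj (x + y) = Num.conj x + Num.conj y. Proof. exact: rmorphD. Qed.
Lemma NconjN x : Num.conj (- x) = - Num.conj x. Proof. exact: rmorphN. Qed.
Lemma NconjM x y : Num.conj (x * y) = Num.conj x * Num.conj y. Proof. exact: rmorphM. Qed.
Lemma NconjV x : Num.conj (x^-1) = (Num.conj x)^-1. Proof. exact: fmorphV. Qed.
Lemma NconjR (a : R) : Num.conj (a%:C : R[i]) = a%:C. Proof. exact: conjc_real. Qed.
Lemma Nconj0 : Num.conj (0 : R[i]) = 0. Proof. exact: rmorph0. Qed.
Lemma Nconj1 : Num.conj (1 : R[i]) = 1. Proof. exact: rmorph1. Qed.
Lemma Nconj_sum (I : Type) (s : seq I) (F : I -> R[i]) :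
  Num.conj (\sum_(i <- s) F i) = \sum_(i <- s) Num.conj (F i).
Proof. exact: rmorph_sum. Qed.
Definition NconjE := (NconjD, NconjN, NconjM, NconjV, NconjR, Nconj0, Nconj1, Nconj_sum).
End Conjugation.

(** * Linear relations between Weyl solutions *)

Section Interpolation.
Context {R : realType} (S : gen_indefinite_string R) (m : R[i] -> R[i]).
Variables (s : seq R) (r : R -> R) (A b : R).
Local Notation L := (len S).
Hypothesis wt : weyl_titchmarsh S m.
Hypothesis mE : forall z, 0 < Im z ->
  m z = A%:C + b%:C * z + \sum_(l <- s) (r l)%:C / (l%:C - z).

Lemma real_sub_neq0 (l : R) (z : R[i]) : 0 < Im z -> l%:C - z != 0.
Proof. by move=> z0; rewrite subr_eq0; apply/eqP => E; move: z0; rewrite -E /= ltxx. Qed.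

Lemma UHP_nz (z : R[i]) : 0 < Im z -> z != 0.
Proof. by move=> z0; apply/eqP => E; move: z0; rewrite E /= ltxx. Qed.

(** Partial fractions exhibit the kernel as a sum of finitely many rank one terms; a vector
    annihilating each of them is a null vector. *)
Lemma nevanlinna_kernel (z w : R[i]) : 0 < Im z -> 0 < Im w ->
  (m z - (m w)^*) / (z - w^*) = b%:C + \sum_(l <- s) (r l)%:C * ((l%:C - z)^-1 * ((l%:C - w)^-1)^*).
Proof.
move=> z0 w0; have zw : z - (w^*)%R != 0.
  by rewrite subr_eq0; apply/eqP => E; move: z0; rewrite E ImJ oppr_gt0 => h; have := lt_trans h w0; rewrite ltxx.
apply: (mulIf zw); rewrite divfK// !mE// !NconjE.
rewrite mulrDl mulr_suml.
under [X in _ - (_ + X)]eq_bigr => l _ do rewrite !NconjE.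
transitivity (b%:C * (z - (w^*)%R) + \sum_(l <- s) ((r l)%:C / (l%:C - z) - (r l)%:C / (l%:C - (w^*)%R))).
  by rewrite sumrB; ring.
congr (_ + _); apply: eq_bigr => l _; rewrite -mulrA; rewrite !NconjE.
have lz := real_sub_neq0 l z0.
have lw' : l%:C - (w^*)%R != 0.
  rewrite subr_eq0; apply/eqP => E; have := congr1 Num.conj E; rewrite NconjR conjCK => E'.
  by move: w0; rewrite -E' /= ltxx.
by field; rewrite lz lw'.
Qed.

(** With value 1 at 0, the slope at [0-] is [z * m z]. *)
Definition normalized_weyl (z : R[i]) (phi : R -> R[i]) :=
  [/\ solution S z phi (z * m z), phi 0 = 1,
    exists2 J, 0 <= J & forall u v, 0 <= u -> u <= v -> dom L v ->
      cabs (phi v - phi u) <= J * Num.sqrt (v - u) &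
    forall l, L = l%:E -> cabs (phi x) @[x --> l^'-] --> (0 : R)].

Lemma weyl_boundary_form n (z d : 'I_n -> R[i]) (psi : 'I_n -> R -> R[i]) :
  (forall i, 0 < Im (z i)) -> (forall i, psi i 0 != 0) ->
  (forall i, m (z i) = d i / (z i * psi i 0)) -> forall i j,
  boundary_form z d psi i j = psi i 0 * (psi j 0)^* *
    (b%:C + \sum_(l <- s) (r l)%:C * ((l%:C - z i)^-1 * ((l%:C - z j)^-1)^*)).
Proof.
move=> z0 p0 md i j; rewrite -(nevanlinna_kernel (z0 i) (z0 j)) !md !NconjE /boundary_form.
have ni := UHP_nz (z0 i).
have nc (x : R[i]) : x != 0 -> (x^*)%R != 0 by rewrite conjC_eq0.
have nj := nc _ (UHP_nz (z0 j)); have pi := p0 i; have pj := nc _ (p0 j).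
have zz := UHP_conj_neq z0 i j.
by field; rewrite ni nj pi pj zz.
Qed.

(** If [psi 0 = 0], the boundary form of size one is zero, so [psi] is constant on the domain and
    hence zero. *)
Lemma weyl_nonzero z psi d : 0 < Im z -> weyl_solution S z psi d -> psi 0 != 0.
Proof.
move=> z0 ws; apply/eqP => p0; have [sol [x dx nz] _ _] := ws.
have := @weyl_combination _ S 1 (fun=> z) (fun=> d) (fun=> psi) (fun=> z0) (fun=> sol) (fun=> z)
  (fun=> weyl_weylfun ws).
rewrite !big_ord1 /boundary_form p0 Nconj0 !(mulr0, mul0r, subrr) => /(_ erefl x dx).
by rewrite big_ord1 divff ?UHP_nz// mul1r subr0 => E; rewrite E eqxx in nz.
Qed.

Lemma weyl_hoelder_sqrt f : weylfun L f ->
  exists2 J, 0 <= J & forall u v, 0 <= u -> u <= v -> dom L v ->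
      cabs (f v - f u) <= J * Num.sqrt (v - u).
Proof.
move=> wf; have [J J0 HJ] := weyl_hoelder wf; exists (Num.sqrt J); first exact: sqrtr_ge0.
move=> u v u0 uv dv; rewrite -ler_sqr ?nnegrE ?cabs_ge0 ?mulr_ge0 ?sqrtr_ge0//.
have v0 : 0 <= v - u by rewrite subr_ge0.
rewrite exprMn (sqr_sqrtr J0) (sqr_sqrtr v0) mulrC; exact: HJ.
Qed.

(** The conditions on [k] annihilate each rank one term of the kernel, so [weyl_combination] applies
    with the weights divided by the values of the solutions at 0. *)
Lemma weyl_interpolation : exists2 phi : R[i] -> R -> R[i],
  (forall z, 0 < Im z -> normalized_weyl z (phi z)) &
  forall n (z : 'I_n -> R[i]) (k : 'I_n -> R[i]), (forall i, 0 < Im (z i)) -> \sum_i k i = 0 ->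
    (forall l, l \in s -> \sum_i k i / (l%:C - z i) = 0) ->
    forall x, dom L x -> \sum_i k i / z i * (phi (z i) x - 1) = 0.
Proof.
(* A dummy value outside the upper half-plane makes the choice function total. *)
have H z : exists p : (R -> R[i]) * R[i], 0 < Im z -> weyl_solution S z p.1 p.2 /\
    m z = p.2 / (z * p.1 0).
  have [z0|z0] := ltP 0 (Im z); last by exists (fun=> 0, 0).
  have zi : Im z != 0 by rewrite gt_eqF.
  by have [psi [d [h1 h2]]] := wt zi; exists (psi, d).
have {H}[p H] := choice H.
pose psi z := (p z).1; pose d z := (p z).2.
have ws z : 0 < Im z -> weyl_solution S z (psi z) (d z) by move=> z0; exact: (H z z0).1.
have md z : 0 < Im z -> m z = d z / (z * psi z 0) by move=> z0; exact: (H z z0).2.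
have p0 z : 0 < Im z -> psi z 0 != 0 by move=> z0; exact: weyl_nonzero z0 (ws z z0).
have sol z : 0 < Im z -> solution S z (psi z) (d z) by move=> /ws[].
exists (fun z x => (psi z 0)^-1 * psi z x).
  move=> z z0; have pz := p0 z z0; split.
  - rewrite (_ : z * m z = (psi z 0)^-1 * d z); first exact: solutionZ (sol z z0).
    by rewrite md//; field; rewrite pz UHP_nz.
  - by rewrite mulVf.
  - have [J J0 HJ] := weyl_hoelder_sqrt (weyl_weylfun (ws z z0)).
    exists (cabs (psi z 0)^-1 * J); first by rewrite mulr_ge0 ?cabs_ge0.
    by move=> u v u0 uv dv; rewrite -mulrBr cabsM -mulrA ler_wpM2l ?cabs_ge0// HJ.
  - move=> l Ll; have [_ _ _ /(_ l Ll) h] := ws z z0.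
    rewrite (_ : (fun x => _) = (fun x => cabs (psi z 0)^-1 * cabs (psi z x))); last first.
      by apply/funext => x; rewrite cabsM.
    have h' : cabs (psi z 0)^-1 @[x --> l^'-] --> cabs (psi z 0)^-1 := cvg_cst _.
    by have := cvgM (h' _) h; rewrite mulr0; exact.
move=> n z k z0 k0 kl x dx.
have pz i := p0 (z i) (z0 i).
have := weyl_combination z0 (fun i => sol _ (z0 i)) (k := fun i => k i / psi (z i) 0)
  (fun i => weyl_weylfun (ws _ (z0 i))) _ dx.
rewrite (_ : \sum_i \sum_j _ = 0); last first.
  under eq_bigr => i _ do under eq_bigr => j _ do
    rewrite (weyl_boundary_form z0 pz (fun i => md _ (z0 i))) NconjM NconjV.
  transitivity (\sum_i \sum_j (b%:C * (k i * (k j)^*) + \sum_(l <- s) (r l)%:C * ((k i / (l%:C - z i)) * (k j / (l%:C - z j))^*))).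
    apply: eq_bigr => i _; apply: eq_bigr => j _.
    have pj : (psi (z j) 0)^*%R != 0 by rewrite conjC_eq0 pz.
    rewrite (_ : _ * _ = k i * (k j)^* * (b%:C + \sum_(l <- s) (r l)%:C * ((l%:C - z i)^-1 * ((l%:C - z j)^-1)^*))); last first.
      by field; rewrite pj pz.
    rewrite mulrDr mulr_sumr; congr (_ + _); first ring.
    by apply: eq_bigr => l _; rewrite !NconjM; ring.
  under eq_bigr => i _ do rewrite big_split /= -mulr_sumr -mulr_sumr.
  rewrite big_split /= -mulr_sumr -mulr_suml k0 mul0r mulr0 add0r.
  under eq_bigr => i _ do rewrite exchange_big /=.
  rewrite exchange_big /= big_seq big1// => l ls.
  under eq_bigr => i _ do rewrite -mulr_sumr -mulr_sumr.
  by rewrite -mulr_sumr -mulr_suml kl// mul0r mulr0.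
move=> /(_ erefl) E; rewrite -[RHS]E; apply: eq_bigr => i _.
by field; rewrite pz UHP_nz.
Qed.

End Interpolation.

(** * The chain of coefficient functions *)

Section ImaginaryPoints.
Context {R : realType}.

(** Distinct points of the upper half-plane: enough to identify polynomials, and the nodes for
    Lagrange interpolation. *)
Definition ipoint (n : nat) : R[i] := 0 +i* n.+1%:R.

Lemma ipoint_inj : injective ipoint.
Proof. by move=> i j [/eqP]; rewrite eqr_nat eqSS => /eqP. Qed.

Lemma Im_ipoint i : 0 < Im (ipoint i).
Proof. by rewrite /= ltr0n. Qed.

Lemma poly_eq0_ipoint (p : {poly R[i]}) : (forall i, p.[ipoint i] = 0) -> p = 0.
Proof.
move=> p0; apply: (@roots_geq_poly_eq0 _ _ [seq ipoint i | i <- iota 0 (size p)]).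
- by apply/allP => _ /mapP[i _ ->]; apply/eqP.
- by rewrite map_inj_uniq ?iota_uniq//; exact: ipoint_inj.
- by rewrite size_map size_iota.
Qed.

Lemma poly_eq_ipoint (p q : {poly R[i]}) : (forall i, p.[ipoint i] = q.[ipoint i]) -> p = q.
Proof.
move=> pq; apply/eqP; rewrite -subr_eq0; apply/eqP/poly_eq0_ipoint => i.
by rewrite !hornerE pq subrr.
Qed.

End ImaginaryPoints.

Section Chain.
Context {R : realType} (S : gen_indefinite_string R) (m : R[i] -> R[i]).
Variables (s : seq R) (r : R -> R) (A b : R).
Local Notation L := (len S).
Hypothesis wt : weyl_titchmarsh S m.
Hypothesis us : uniq s.
Hypothesis mE : forall z, 0 < Im z ->
  m z = A%:C + b%:C * z + \sum_(l <- s) (r l)%:C / (l%:C - z).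

(** Features of a Weyl solution that survive linear combinations and so pass to the coefficient
    functions. *)
Definition tame (f : R -> R[i]) := [/\ H1loc L f,
    exists2 J, 0 <= J & forall u v, 0 <= u -> u <= v -> dom L v ->
      cabs (f v - f u) <= J * Num.sqrt (v - u) &
    forall l, L = l%:E -> cabs (f x) @[x --> l^'-] --> (0 : R)].

Lemma tame_lincomb n (k : 'I_n -> R[i]) (f : 'I_n -> R -> R[i]) :
  (forall i, tame (f i)) -> tame (fun x => \sum_i k i * f i x).
Proof.
move=> tf; split.
- by apply: H1loc_lincomb => i; have [] := tf i.
- have [J HJ] : {J : 'I_n -> R & forall i, 0 <= J i /\ forall u v, 0 <= u -> u <= v -> dom L v ->
      cabs (f i v - f i u) <= J i * Num.sqrt (v - u)}.
    apply: (@choice _ _ (fun i J => 0 <= J /\ forall u v, 0 <= u -> u <= v -> dom L v ->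
      cabs (f i v - f i u) <= J * Num.sqrt (v - u))) => i.
    by have [_ [J J0 HJ] _] := tf i; exists J.
  exists (\sum_i cabs (k i) * J i).
    by apply: sumr_ge0 => i _; rewrite mulr_ge0 ?cabs_ge0// (HJ i).1.
  move=> u v u0 uv dv; rewrite -sumrB mulr_suml.
  apply: le_trans (cabs_sum _ _ _) _; apply: ler_sum => i _.
  by rewrite -mulrBr cabsM -mulrA ler_wpM2l ?cabs_ge0// (HJ i).2.
- move=> l Ll; have cv : (\sum_i cabs (k i) * cabs (f i x)) @[x --> l^'-] --> (0 : R).
    elim: (index_enum _) => [|i t IH].
      by rewrite (_ : (fun x => _) = (fun=> 0)); [exact: cvg_cst|apply/funext => x; rewrite big_nil].
    rewrite (_ : (fun x => _) = (fun x => cabs (k i) * cabs (f i x) + \sum_(j <- t) cabs (k j) * cabs (f j x))); last first.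
      by apply/funext => x; rewrite big_cons.
    have [_ _ /(_ l Ll) h] := tf i.
    have h' : cabs (k i) @[x --> l^'-] --> cabs (k i) := cvg_cst _.
    by have := cvgD (cvgM (h' _) h) IH; rewrite mulr0 addr0; exact.
  apply: (squeeze_cvgr _ (cvg_cst 0) cv); near=> x.
  rewrite cabs_ge0 /=; apply: le_trans (cabs_sum _ _ _) _.
  by apply: ler_sum => i _; rewrite cabsM.
Unshelve. all: end_near. Qed.

Let Q : {poly R[i]} := \prod_(l <- s) (l%:C%:P - 'X).
(** ['X * Q] has size at most [n], so interpolation at [n] nodes is exact on it. *)
Let n := (size s).+2.

Lemma size_linear_prod (t : seq R) : (size (\prod_(l <- t) (l%:C%:P - 'X) : {poly R[i]})%R <= (size t).+1)%N.
Proof.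
elim: t => [|l t IH]; first by rewrite big_nil size_poly1.
rewrite big_cons; apply: leq_trans (size_polyMleq _ _) _.
have : (size (l%:C%:P - 'X : {poly R[i]})%R <= 2)%N.
  by apply: leq_trans (size_polyD _ _) _; rewrite size_polyN size_polyX geq_max size_polyC; case: (_ == _).
move: IH => /=; lia.
Qed.

Lemma Q_divl l : l \in s -> exists2 q : {poly R[i]}, (size q <= size s)%N & Q = (l%:C%:P - 'X) * q.
Proof.
move=> ls; exists (\prod_(l' <- rem l s) (l'%:C%:P - 'X)).
  by apply: leq_trans (size_linear_prod _) _; rewrite size_rem// prednK//; case: (s) ls.
by rewrite /Q (perm_big _ (perm_to_rem ls)) big_cons.
Qed.

Lemma Q_neq0 z : 0 < Im z -> Q.[z] != 0.
Proof.
move=> z0; rewrite /Q; elim: (s) => [|l t IH]; first by rewrite big_nil hornerE oner_neq0.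
by rewrite big_cons hornerM mulf_neq0// !hornerE real_sub_neq0.
Qed.

Let ell (i : 'I_n) : {poly R[i]} := tnth (n.-lagrange (@ipoint R)) i.

Lemma lagrange_eval (p : {poly R[i]}) z : (size p <= n)%N ->
  \sum_i (ell i).[z] * p.[ipoint i] = p.[z].
Proof.
move=> sp; rewrite [in RHS](lagrange_gen (ltn0Sn _) (@ipoint_inj R) sp) horner_sum.
by apply: eq_bigr => i _; rewrite hornerM hornerC mulrC.
Qed.

Variable phi : R[i] -> R -> R[i].
Hypothesis phi_weyl : forall z, 0 < Im z -> normalized_weyl S m z (phi z).
Hypothesis phi_interp : forall n (z : 'I_n -> R[i]) (k : 'I_n -> R[i]), (forall i, 0 < Im (z i)) -> \sum_i k i = 0 ->
    (forall l, l \in s -> \sum_i k i / (l%:C - z i) = 0) ->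
    forall x, dom L x -> \sum_i k i / z i * (phi (z i) x - 1) = 0.

(** The point [z] joins the nodes, with weights for which [\sum_i k i * G (Z i)] is the
    interpolation error at [z] of [w * Q.[w] * G w]. The error is zero when this is a polynomial of
    size at most [n], which covers [G] equal to 1, to [(l - w)^-1] and to [w^-1]. *)
Lemma phi_lagrange z x : 0 < Im z -> dom L x ->
  Q.[z] * phi z x = \sum_i (ell i).[z] * (Q.[ipoint i] * phi (ipoint i) x).
Proof.
move=> z0 dx.
pose Z (i : 'I_n.+1) := if unlift ord0 i is Some j then ipoint j else z.
pose k (i : 'I_n.+1) := if unlift ord0 i is Some j then (ell j).[z] * (ipoint j * Q.[ipoint j]) else - (z * Q.[z]).
have Z0 i : 0 < Im (Z i) by rewrite /Z; case: unliftP => [j _|_] //; exact: Im_ipoint.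
have E0 : unlift ord0 (ord0 : 'I_n.+1) = None by rewrite unlift_none.
have E1 (j : 'I_n) : unlift ord0 (lift ord0 j) = Some j by rewrite liftK.
have sQ := size_linear_prod s.
have kE (G : R[i] -> R[i]) : \sum_i k i * G (Z i) =
    \sum_i (ell i).[z] * (ipoint i * Q.[ipoint i] * G (ipoint i)) - z * Q.[z] * G z.
  rewrite big_ord_recl /k /Z E0 addrC mulNr; congr (_ - _).
  by apply: eq_bigr => i _; rewrite E1 -mulrA.
have kp (p : {poly R[i]}) (G : R[i] -> R[i]) : (size p <= n)%N ->
    (forall w, 0 < Im w -> w * Q.[w] * G w = p.[w]) -> \sum_i k i * G (Z i) = 0.
  move=> sp Gp; rewrite kE Gp// -(lagrange_eval z sp) -sumrB big1// => i _.
  by rewrite Gp ?subrr// Im_ipoint.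
have k0 : \sum_i k i = 0.
  transitivity (\sum_i k i * (fun=> 1) (Z i)); first by under [RHS]eq_bigr do rewrite mulr1.
  apply: (kp ('X * Q) (fun=> 1)); last by move=> w _; rewrite !hornerE.
  apply: leq_trans (size_polyMleq _ _) _; rewrite size_polyX; move: sQ; rewrite -/Q /n; lia.
have kl l : l \in s -> \sum_i k i / (l%:C - Z i) = 0.
  move=> ls; have [q sq Qq] := Q_divl ls.
  apply: (kp ('X * q) (fun w => (l%:C - w)^-1)).
    apply: leq_trans (size_polyMleq _ _) _; rewrite size_polyX; move: sq; rewrite /n; lia.
  by move=> w w0; rewrite Qq !hornerE /=; have h := real_sub_neq0 l w0; field.
have k1 : \sum_i k i / Z i = 0.
  apply: (kp Q (fun w => w^-1)); first by apply: leq_trans sQ _; rewrite /n; lia.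
  by move=> w w0 /=; have h := UHP_nz w0; field.
have := phi_interp Z0 k0 kl dx; under eq_bigr => i _ do rewrite mulrBr mulr1.
rewrite sumrB k1 subr0 => E.
have := kE (fun w => w^-1 * phi w x).
under eq_bigr => i _ do rewrite mulrA.
rewrite E => /esym/eqP; rewrite subr_eq0 => /eqP E'.
have nz := UHP_nz z0.
rewrite (_ : Q.[z] * phi z x = z * Q.[z] * (z^-1 * phi z x)); last by field.
rewrite -E'; apply: eq_bigr => i _; have ni := UHP_nz (@Im_ipoint R i).
by field.
Qed.

(** The coefficient of [z ^+ j] in [Q.[z] * phi z x]. *)
Let f (j : nat) x := \sum_i ((ell i)`_j * Q.[ipoint i]) * phi (ipoint i) x.

Lemma phi_tame z : 0 < Im z -> tame (phi z).
Proof. by move=> z0; have [[? _] _ ? ?] := phi_weyl z0; split. Qed.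

(** For fixed [h], the energy and both pairings of [Q.[z] * phi z] are polynomials in [z] related by
    the equation at all points [ipoint]; coefficients are compared. The condition [h 0 = 0] removes
    the boundary term. *)
Lemma weyl_chain_coef j h : H1c L h -> h 0 = 0 ->
  energy L (f j) h = (if j is j'.+1 then opairing S (f j') h else 0) +
                     (if j is j'.+2 then upairing S (f j') h else 0).
Proof.
move=> Hh h0; have Hphi i : H1loc L (phi (ipoint i)) by have [] := phi_tame (Im_ipoint i).
pose poly_of (F : (R -> R[i]) -> R[i]) : {poly R[i]} :=
  \sum_(i < n) (Q.[ipoint i] * F (phi (ipoint i))) *: ell i.
have coef F j' : (poly_of F)`_j' = \sum_i ((ell i)`_j' * Q.[ipoint i]) * F (phi (ipoint i)).
  by rewrite coef_sum; apply: eq_bigr => i _; rewrite coefZ; ring.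
have evl F z : (poly_of F).[z] = \sum_i ((ell i).[z] * Q.[ipoint i]) * F (phi (ipoint i)).
  by rewrite horner_sum; apply: eq_bigr => i _; rewrite hornerZ; ring.
pose E g := energy L g h; pose O g := opairing S g h; pose U g := upairing S g h.
have cE j' : energy L (f j') h = (poly_of E)`_j'.
  by rewrite coef /f (energy_lincomb _ (fun i : 'I_n => Hphi i) Hh).
have cO j' : opairing S (f j') h = (poly_of O)`_j'.
  by rewrite coef /f (opairing_lincomb _ (fun i : 'I_n => Hphi i) Hh).
have cU j' : upairing S (f j') h = (poly_of U)`_j'.
  by rewrite coef /f (upairing_lincomb _ (fun i : 'I_n => Hphi i) Hh).
suff -> : energy L (f j) h = ('X * poly_of O + 'X^2 * poly_of U)`_j.
  rewrite coefD coefXM coefXnM; case: j => [|[|j]] /=; rewrite ?addr0 ?cO//.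
  by rewrite cU subSS subSS subn0.
rewrite cE; suff -> : poly_of E = 'X * poly_of O + 'X^2 * poly_of U by [].
apply: poly_eq_ipoint => i0; set z := ipoint i0.
have z0 : 0 < Im z := Im_ipoint i0.
have Hz : H1loc L (phi z) by have [] := phi_tame z0.
(* The one-term sum lets the lemmas on linear combinations handle the factor [Q.[z]]. *)
have ext x : dom L x -> \sum_(i < 1) Q.[z] * phi z x = \sum_i ((ell i).[z] * Q.[ipoint i]) * phi (ipoint i) x.
  by move=> dx; rewrite big_ord1 phi_lagrange//; apply: eq_bigr => i _; rewrite mulrA.
have H1 := H1loc_lincomb (fun=> Q.[z]) (fun _ : 'I_1 => Hz).
have H2 := H1loc_lincomb (fun i : 'I_n => (ell i).[z] * Q.[ipoint i]) (fun i : 'I_n => Hphi i).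
have eE : (poly_of E).[z] = Q.[z] * E (phi z).
  rewrite evl -(energy_lincomb _ (fun i : 'I_n => Hphi i) Hh) -(energy_ext H1 ext Hh).
  by rewrite (energy_lincomb _ (fun=> Hz) Hh) big_ord1.
have eO : (poly_of O).[z] = Q.[z] * O (phi z).
  rewrite evl -(opairing_lincomb _ (fun i : 'I_n => Hphi i) Hh) -(opairing_ext H1 H2 Hh ext).
  by rewrite (opairing_lincomb _ (fun=> Hz) Hh) big_ord1.
have eU : (poly_of U).[z] = Q.[z] * U (phi z).
  rewrite evl -(upairing_lincomb _ (fun i : 'I_n => Hphi i) Hh) -(upairing_ext _ ext).
  by rewrite (upairing_lincomb _ (fun=> Hz) Hh) big_ord1.
rewrite hornerD !hornerM !hornerX eE eO eU.
have [sol _ _ _] := phi_weyl z0; have := solutionE sol Hh.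
by rewrite h0 mulr0 add0r -/(E _) -/(O _) -/(U _) => ->; ring.
Qed.

(** The chain stops because Lagrange polynomials have bounded degree, and it is not zero at 0
    because [Q.[z] * phi z 0 = Q.[z]] does not vanish. *)
Lemma weyl_chain : exists (n : nat) (f : nat -> R -> R[i]),
  [/\ forall j, tame (f j), forall j x, (n <= j)%N -> f j x = 0, exists j, f j 0 != 0 &
   forall j h, H1c L h -> h 0 = 0 ->
     energy L (f j) h = (if j is j'.+1 then opairing S (f j') h else 0) +
                        (if j is j'.+2 then upairing S (f j') h else 0)].
Proof.
exists n, f; split; last exact: weyl_chain_coef.
- by move=> j; apply: (tame_lincomb _ (fun i : 'I_n => phi_tame (Im_ipoint i))).
- move=> j x nj; rewrite /f big1// => i _.
  by rewrite nth_default ?mul0r// size_lagrange_ //; exact: ipoint_inj.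
- apply: contrapT => nx.
  have fz j : f j 0 = 0 by apply: contrapT => /eqP h; apply: nx; exists j.
  have z0 := @Im_ipoint R 0.
  have d0 : dom L 0 by split => //; exact: len_gt0.
  have := phi_lagrange z0 d0.
  have [_ -> _ _] := phi_weyl z0.
  rewrite mulr1 => E; have := Q_neq0 z0; rewrite E => /eqP; apply.
  transitivity ((\sum_(i < n) (Q.[ipoint i] * phi (ipoint i) 0) *: ell i).[ipoint 0]).
    by rewrite horner_sum; apply: eq_bigr => i _; rewrite hornerZ mulrC.
  rewrite (_ : \sum_i _ = 0) ?horner0//; apply/polyP => j; rewrite coef0 -[RHS](fz j) coef_sum.
  by apply: eq_bigr => i _; rewrite coefZ; ring.
Qed.

End Chain.

(** * Discreteness of the string *)

Section Pairings.
Context {R : realType} (S : gen_indefinite_string R).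
Local Notation L := (len S).
Local Notation lam := (@lebesgue_measure R).
Implicit Types (f g h : R -> R[i]) (c x p q : R) (k : R[i]).

Lemma H1c_common h1 h2 : H1c L h1 -> H1c L h2 ->
  exists c, [/\ dom L c, 0 < c, vanish_after L c h1 & vanish_after L c h2].
Proof.
move=> /H1cS[_ [c1 [d1 c10 v1]]] /H1cS[_ [c2 [d2 c20 v2]]]; exists (Num.max c1 c2); split.
- by rewrite /Num.max; case: ifP.
- by rewrite lt_max c10.
- by move=> x dx; rewrite gt_max => /andP[h _]; exact: v1.
- by move=> x dx; rewrite gt_max => /andP[_ h]; exact: v2.
Qed.

Lemma energy_lin f k h1 h2 : H1loc L f -> H1c L h1 -> H1c L h2 ->
  energy L f (fun x => k * h1 x + h2 x) = k * energy L f h1 + energy L f h2.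
Proof.
move=> Hf H1 H2; have [c [dc c0 v1 v2]] := H1c_common H1 H2.
have [L1 L2] := ((H1cS H1).1, (H1cS H2).1).
have [gf df] := density_exists Hf dc c0; have [g1 d1] := density_exists L1 dc c0.
have [g2 d2] := density_exists L2 dc c0.
have v3 : vanish_after L c (fun x => k * h1 x + h2 x) by move=> x dx cx; rewrite v1// v2// mulr0 addr0.
have w3 : weak_deriv c (fun x => k * h1 x + h2 x) (fun x => k * g1 x + g2 x).
  apply: weak_deriv_map2 (density_weak d1) (density_weak d2) => x _ e1 e2; apply: cderD => //.
  by have := cderM (cderC k x) e1; rewrite mul0r add0r.
rewrite (energyE dc v3 (density_weak df) w3) (energyE dc v1 (density_weak df) (density_weak d1)).
rewrite (energyE dc v2 (density_weak df) (density_weak d2)).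
have mS := @measurable_seg R c.
have ci g h : H1loc L h -> density c h g -> cintegrable lam (seg c) (fun x => gf x * g x).
  by move=> Hh dh; apply: square_integrableM => //; [exact: density_square_integrable Hf dc df|exact: density_square_integrable Hh dc dh].
rewrite -(cintegralZ k mS (ci _ _ L1 d1)) -(cintegralD mS (cintegrableZ k mS (ci _ _ L1 d1)) (ci _ _ L2 d2)).
by congr (cintegral _ _ _); apply/funext => x; ring.
Qed.

Lemma energyC f h : energy L f h = energy L h f.
Proof. by congr (cintegral _ _ _); apply/funext => x; rewrite mulrC. Qed.

Lemma energy_eq_seg f g h c : dom L c -> 0 < c -> vanish_after L c h -> H1loc L f -> H1loc L h ->
  (forall x, 0 <= x <= c -> f x = g x) -> energy L f h = energy L g h.
Proof.
move=> dc c0 hc Hf Hh fg.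
have [gf df] := density_exists Hf dc c0; have [gh dh] := density_exists Hh dc c0.
rewrite (energyE dc hc (density_weak df) (density_weak dh)).
apply/esym/(energyE dc hc _ (density_weak dh)).
have [N [mN N0 H]] := density_weak df; exists N; split => // x xc Nx.
have [/andP[x0 xlc] fx] := H x xc Nx; split; first by rewrite x0.
apply: cder_near fx; near=> t; apply: fg; apply/andP; split; apply: ltW; near: t; first exact: lt_nbhsr.
exact: lt_nbhsl.
Unshelve. all: end_near. Qed.

Lemma upairing_lin f k h1 h2 : H1loc L f -> H1c L h1 -> H1c L h2 ->
  upairing S f (fun x => k * h1 x + h2 x) = k * upairing S f h1 + upairing S f h2.
Proof.
move=> Hf H1 H2; have [c [dc c0 v1 v2]] := H1c_common H1 H2.
have [L1 L2] := ((H1cS H1).1, (H1cS H2).1).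
have v3 : vanish_after L c (fun x => k * h1 x + h2 x) by move=> x dx cx; rewrite v1// v2// mulr0 addr0.
have mS := @measurable_seg R c.
have ci h : H1loc L h -> cintegrable (upsilon S) (seg c) (fun x => f x * h x).
  by move=> Hh; exact: (upsilon_cintegrable (H1locM Hf Hh) dc).
rewrite /upairing !(upsilon_restrict _ dc)//.
rewrite -(cintegralZ k mS (ci _ L1)) -(cintegralD mS (cintegrableZ k mS (ci _ L1)) (ci _ L2)).
by congr (cintegral _ _ _); apply/funext => x; ring.
Qed.

Lemma opairing_lin f k h1 h2 : H1loc L f -> H1c L h1 -> H1c L h2 ->
  opairing S f (fun x => k * h1 x + h2 x) = k * opairing S f h1 + opairing S f h2.
Proof.
move=> Hf H1 H2; rewrite /opairing -(omega_lin k (H1cM Hf H1) (H1cM Hf H2)).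
by congr (omega S _); apply/funext => x; ring.
Qed.

Lemma exists_dom_gt0 : exists2 c, 0 < c & dom L c.
Proof.
have := len_gt0 S; case E : L => [l| |//]; rewrite ?lte_fin => l0.
  exists (l / 2); first by rewrite divr_gt0.
  by split; [rewrite divr_ge0// ltW|rewrite lte_fin ltr_pdivrMr//; lra].
by exists 1 => //; split => //; exact: ltry.
Qed.

Definition prev1 (F : nat -> R -> R[i]) j : R -> R[i] := if j is j'.+1 then F j' else fun=> 0.
Definition prev2 (F : nat -> R -> R[i]) j : R -> R[i] := if j is j'.+2 then F j' else fun=> 0.

(** The constant [d] acts as the slope of [F j] at [0-]. *)
Definition chain (F : nat -> R -> R[i]) := forall j, exists d, forall h, H1c L h ->
  d * h 0 + energy L (F j) h = opairing S (prev1 F j) h + upairing S (prev2 F j) h.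

Lemma opairing0 h : opairing S (fun=> 0) h = 0.
Proof. by rewrite /opairing (_ : (fun x => _) = (fun=> 0)) ?omega0//; apply/funext => x; rewrite mul0r. Qed.

Lemma upairing0 h : upairing S (fun=> 0) h = 0.
Proof.
rewrite /upairing (_ : (fun x : R => _) = (fun=> 0)); last by apply/funext => x; rewrite mul0r.
by apply: complex_ext; rewrite /= /Rintegral integral0.
Qed.

Lemma pairing_zero f h : H1loc L f -> H1c L h -> (forall x, dom L x -> f x = 0) ->
  opairing S f h = 0 /\ upairing S f h = 0.
Proof.
move=> Hf Hh f0; rewrite (opairing_ext Hf (@H1loc_const _ _ 0) Hh f0) opairing0.
by rewrite (upairing_ext h f0) upairing0.
Qed.

(* Subtracting a multiple of a fixed cut-off that equals [1] at [0] extends an identity for test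
   functions vanishing at [0] to all test functions. *)
Lemma chain_extend f (T : (R -> R[i]) -> R[i]) : H1loc L f ->
  (forall k h1 h2, H1c L h1 -> H1c L h2 -> T (fun x => k * h1 x + h2 x) = k * T h1 + T h2) ->
  (forall h, H1c L h -> h 0 = 0 -> energy L f h = T h) ->
  exists d, forall h, H1c L h -> d * h 0 + energy L f h = T h.
Proof.
move=> Hf Tl H; have [c c0 dc] := exists_dom_gt0.
have Hc := H1c_cramp c0 c0 dc; have c1 : cramp 0 c 0 = 1 :> R[i] by rewrite /cramp ramp_left.
exists (T (cramp 0 c) - energy L f (cramp 0 c)) => h Hh.
have := H (fun x => - h 0 * cramp 0 c x + h x) (H1cD (H1cZ _ Hc) Hh).
rewrite c1 mulr1 addNr => /(_ erefl); rewrite (energy_lin _ Hf Hc Hh) (Tl _ _ _ Hc Hh) => E.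
move: (energy L f h) (energy L f _) (T h) (T _) E => e1 e2 t1 t2 E.
have -> : e1 = - h 0 * t2 + t1 + h 0 * e2 by rewrite -E; ring.
by ring.
Qed.

Lemma chain_of_coef F : (forall j, H1loc L (F j)) ->
  (forall j h, H1c L h -> h 0 = 0 ->
     energy L (F j) h = (if j is j'.+1 then opairing S (F j') h else 0) +
                        (if j is j'.+2 then upairing S (F j') h else 0)) -> chain F.
Proof.
move=> HF H j; have H1 : H1loc L (prev1 F j) by case: j => [|j] /=; [exact: H1loc_const|exact: HF].
have H2 : H1loc L (prev2 F j) by clear H1; case: j => [|[|j]] /=; [exact: H1loc_const..|exact: HF].
apply: (@chain_extend _ (fun h => opairing S (prev1 F j) h + upairing S (prev2 F j) h) (HF j)).
  move=> k h1 h2 Hh1 Hh2; rewrite (opairing_lin k H1 Hh1 Hh2) (upairing_lin k H2 Hh1 Hh2).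
  by rewrite mulrDr addrACA.
move=> h Hh h0; rewrite (H j h Hh h0).
by clear H1 H2; case: j => [|[|j]] /=; rewrite ?opairing0 ?upairing0 ?add0r ?addr0.
Qed.

(** Leading functions that vanish on the domain contribute nothing to the right-hand sides, so the
    chain may be reindexed. *)
Lemma chain_shift F j0 : (forall j, H1loc L (F j)) -> chain F ->
  (forall j, (j < j0)%N -> forall x, dom L x -> F j x = 0) -> chain (fun j => F (j0 + j)%N).
Proof.
move=> HF HC Z j; have [d Hd] := HC (j0 + j)%N; exists d => h Hh; rewrite Hd//.
have E1 : opairing S (prev1 F (j0 + j)) h = opairing S (prev1 (fun j => F (j0 + j)%N) j) h.
  case: j {Hd} => [|j]; last by rewrite addnS.
  rewrite addn0 [RHS]opairing0; case: (j0) Z => [|j1] Z /=; first exact: opairing0.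
  by have [] := pairing_zero (HF j1) Hh (Z j1 (leqnn _)).
have E2 : upairing S (prev2 F (j0 + j)) h = upairing S (prev2 (fun j => F (j0 + j)%N) j) h.
  case: j {Hd E1} => [|[|j]]; last by rewrite !addnS.
    rewrite addn0 [RHS]upairing0; case: (j0) Z => [|[|j1]] Z /=; [exact: upairing0..|].
    by have [] := pairing_zero (HF j1) Hh (Z j1 (leqnSn _)).
  rewrite addn1 [RHS]upairing0; case: (j0) Z => [|j1] Z /=; first exact: upairing0.
  by have [] := pairing_zero (HF j1) Hh (Z j1 (leqnn _)).
by rewrite E1 E2.
Qed.

End Pairings.

Section Hoelder.
Context {R : realType} (f : R -> R[i]) (J : R) (a b : R).
Hypotheses (J0 : 0 <= J) (fJ : forall u v, a <= u -> u <= v -> v <= b -> cabs (f v - f u) <= J * Num.sqrt (v - u)).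

Lemma hoelder_zero (q : R[i]) (K e : R) : 0 <= K -> 0 < e ->
  (forall s, 0 < s < e -> cabs q <= K * (Num.sqrt s + s)) -> q = 0.
Proof.
move=> K0 e0 H; apply/eqP; rewrite -cabs_eq0 eq_le cabs_ge0 andbT.
apply/ler_addgt0Pl => eps eps0; rewrite addr0.
(* Below [e], at most 1 so that [t <= Num.sqrt t], and with root at most [eps / (2 * K + 1)]. *)
pose t := Num.min (Num.min (e / 2) 1) ((eps / (2 * K + 1)) ^+ 2).
have k1 : 0 < 2 * K + 1 by lra.
have ek : 0 < eps / (2 * K + 1) by rewrite divr_gt0.
have t0 : 0 < t by rewrite !lt_min !(exprn_gt0, divr_gt0, ltr01).
have te : t < e by rewrite !gt_min; apply/orP; left; apply/orP; left; lra.
have t1 : t <= 1 by rewrite !ge_min lexx orbT.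
have st : Num.sqrt t <= eps / (2 * K + 1).
  rewrite -(ler_sqr (y := eps / _)) ?nnegrE ?sqrtr_ge0 ?(ltW ek)// sqr_sqrtr ?(ltW t0)//.
  by rewrite ge_min lexx orbT.
have tst : t <= Num.sqrt t.
  have s0 := sqrtr_ge0 t; have s1 : Num.sqrt t <= 1 by rewrite -sqrtr1 ler_wsqrtr.
  by rewrite -{1}(sqr_sqrtr (ltW t0)) expr2 ler_piMl.
apply: le_trans (H t _) _; first by rewrite t0 te.
apply: (@le_trans _ _ (K * (2 * (eps / (2 * K + 1))))); first by rewrite ler_wpM2l//; lra.
have -> : K * (2 * (eps / (2 * K + 1))) = eps * (2 * K / (2 * K + 1)) by field; rewrite gt_eqF.
by rewrite ler_piMr ?(ltW eps0)// ler_pdivrMr// mul1r; lra.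
Qed.

(** Hölder continuity carries the affine formula to the endpoint. *)
Lemma affine_left k0 k1 y : a < y -> y <= b -> (forall t, a < t < y -> f t = k0 + k1 * t%:C) ->
  f a = k0 + k1 * a%:C.
Proof.
move=> ay yb H; apply/eqP; rewrite -subr_eq0; apply/eqP.
apply: (@hoelder_zero _ (J + cabs k1) (y - a)); rewrite ?addr_ge0 ?cabs_ge0 ?subr_gt0// => s /andP[s0 sy].
have Ht := H (a + s); rewrite ltrDl s0 /= -ltrBrDl sy in Ht.
have -> : f a - (k0 + k1 * a%:C) = - (f (a + s) - f a) + k1 * s%:C.
  by rewrite Ht// rmorphD /=; ring.
apply: le_trans (cabsD _ _) _; rewrite cabsN cabsM cabsC (gtr0_norm s0).
have h1 : cabs (f (a + s) - f a) <= J * Num.sqrt s.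
  have := fJ (lexx a) (_ : a <= a + s) (_ : a + s <= b); rewrite addrAC subrr add0r; apply; first by rewrite lerDl ltW.
  by lra.
have sq := sqrtr_ge0 s; have c1 := cabs_ge0 k1.
have := mulr_ge0 J0 (ltW s0); have := mulr_ge0 c1 sq.
by rewrite mulrDl !mulrDr; lra.
Qed.

Lemma affine_right k0 k1 y : a <= y -> y < b -> (forall t, y < t < b -> f t = k0 + k1 * t%:C) ->
  f b = k0 + k1 * b%:C.
Proof.
move=> ay yb H; apply/eqP; rewrite -subr_eq0; apply/eqP.
apply: (@hoelder_zero _ (J + cabs k1) (b - y)); rewrite ?addr_ge0 ?cabs_ge0 ?subr_gt0// => s /andP[s0 sy].
have Ht : f (b - s) = k0 + k1 * (b - s)%:C by apply: H; apply/andP; split; lra.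
have -> : f b - (k0 + k1 * b%:C) = (f b - f (b - s)) - k1 * s%:C.
  by rewrite Ht rmorphB /=; ring.
apply: le_trans (cabsB _ _) _; rewrite cabsM cabsC (gtr0_norm s0).
have h1 : cabs (f b - f (b - s)) <= J * Num.sqrt s.
  have := fJ (_ : a <= b - s) (_ : b - s <= b) (lexx b); rewrite (_ : b - (b - s) = s); last by ring.
  by apply; lra.
have sq := sqrtr_ge0 s; have c1 := cabs_ge0 k1.
have := mulr_ge0 J0 (ltW s0); have := mulr_ge0 c1 sq.
by rewrite mulrDl !mulrDr; lra.
Qed.

End Hoelder.

(** * Intervals without mass *)

Section Free.
Context {R : realType} (S : gen_indefinite_string R).
Local Notation L := (len S).
Local Notation lam := (@lebesgue_measure R).
Implicit Types (f g h : R -> R[i]) (c x p q : R) (k : R[i]).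

Definition off p q h := forall x, dom L x -> ~ (p <= x <= q) -> h x = 0.

(** [omega] is only a functional, so absence of mass is expressed by test functions concentrated on
    [[p, q]]. *)
Definition free p q := upsilon S `[p, q]%classic = 0%E /\
  forall h, H1c L h -> off p q h -> omega S h = 0.

Lemma upairing_null p q f h : upsilon S `[p, q]%classic = 0%E -> off p q h -> upairing S f h = 0.
Proof.
move=> u0 hoff; transitivity (cintegral (upsilon S) (dom L) (fun=> 0)); last first.
  by apply: complex_ext; rewrite /= /Rintegral integral0.
apply: (cintegral_off_null (measurable_itvR `[p, q]) u0) => // x dx nx _.
by rewrite hoff ?mulr0// => xpq; apply: nx; rewrite /= in_itv.
Qed.

Lemma free_pairing p q f h : free p q -> H1loc L f -> H1c L h -> off p q h ->
  opairing S f h = 0 /\ upairing S f h = 0.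
Proof.
move=> [u0 o0] Hf Hh hoff; split; last exact: upairing_null u0 hoff.
by apply: o0 (H1cM Hf Hh) _ => x dx nx; rewrite hoff ?mulr0.
Qed.

Variable F : nat -> R -> R[i].
Hypothesis tF : forall j, tame S (F j).
Hypothesis cF : chain S F.
Let HF j : H1loc L (F j). Proof. by have [] := tF j. Qed.

Lemma H1loc_prev j : H1loc L (prev1 F j) /\ H1loc L (prev2 F j).
Proof.
split; first by case: j => [|j] /=; [exact: H1loc_const|exact: HF].
by case: j => [|[|j]] /=; [exact: H1loc_const..|exact: HF].
Qed.

Lemma dom_between p x : 0 <= p -> p <= x -> forall q, dom L q -> x <= q -> dom L x.
Proof. by move=> p0 px q dq xq; apply: domS dq _; rewrite /seg /= (le_trans p0 px). Qed.

(** The difference of two ramps is a tent supported in [[x, w]]. Without mass its energy with [F j]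
    is zero, which says that the slopes on both sides of [y] agree. *)
Lemma free_three p q j x y w : 0 < p -> dom L q -> free p q -> p <= x -> x < y -> y < w -> w <= q ->
  (w - y)%:C * F j x + (x - w)%:C * F j y + (y - x)%:C * F j w = 0.
Proof.
move=> p0 dq fpq px xy yw wq.
have x0 : 0 < x := lt_le_trans p0 px; have y0 : 0 < y := lt_trans x0 xy; have w0 : 0 < w := lt_trans y0 yw.
have dw : dom L w := dom_between (ltW p0) (le_trans px (ltW (lt_trans xy yw))) dq wq.
have dy : dom L y := dom_between (ltW p0) (le_trans px (ltW xy)) dw (ltW yw).
have Hy := H1c_cramp xy y0 dy; have Hw := H1c_cramp yw w0 dw.
pose h t : R[i] := (-1) * cramp x y t + cramp y w t.
have Hh : H1c L h := H1cD (H1cZ (-1) Hy) Hw.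
have h0 : h 0 = 0.
  by rewrite /h /cramp (ramp_left xy (ltW x0)) (ramp_left yw (ltW y0)) mulr1 addNr.
have hoff : off p q h.
  move=> t dt nt; rewrite /h /cramp; have [tx|xt] := leP t x.
    by rewrite (ramp_left xy tx) (ramp_left yw (le_trans tx (ltW xy))) mulr1 addNr.
  have wt : w <= t by rewrite leNgt; apply/negP => tw; apply: nt; apply/andP; split; lra.
  by rewrite (ramp_right yw wt) (ramp_right xy (le_trans (ltW yw) wt)) mulr0 addr0.
have [d Hd] := cF j; have := Hd h Hh; have [P1 P2] := H1loc_prev j.
have [-> _] := free_pairing fpq P1 Hh hoff; have [_ ->] := free_pairing fpq P2 Hh hoff.
rewrite h0 mulr0 !add0r (energy_lin (-1) (HF j) Hy Hw).
rewrite (energy_cramp (HF j) (ltW x0) xy dy) (energy_cramp (HF j) (ltW y0) yw dw) => E.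
have yx : (y - x)%:C != 0 :> R[i] by rewrite (inj_eq (@complexI _)) subr_eq0 gt_eqF.
have wy : (w - y)%:C != 0 :> R[i] by rewrite (inj_eq (@complexI _)) subr_eq0 gt_eqF.
transitivity (- ((y - x)%:C * (w - y)%:C) * (-1 * (- (F j y - F j x) / (y - x)%:C) + - (F j w - F j y) / (w - y)%:C)); last by rewrite E mulr0.
have -> : (x - w)%:C = - ((y - x)%:C + (w - y)%:C) :> R[i] by rewrite -rmorphD -rmorphN; congr (_%:C); ring.
by move: (y - x)%:C (w - y)%:C yx wy => A B yx wy; field; rewrite yx wy.
Qed.

(** Two reference points [u], [v] fix the line; every other point is collinear with them. *)
Lemma free_line j a b : 0 <= a -> a < b -> (b%:E <= L)%E ->
  (forall p q, a < p -> p <= q -> q < b -> free p q) ->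
  exists k0 k1, forall t, a < t < b -> F j t = k0 + k1 * t%:C.
Proof.
move=> a0 ab bL fr.
pose u := a + (b - a) / 3; pose v := a + 2 * (b - a) / 3.
have au : a < u by rewrite /u; lra. have uv : u < v by rewrite /u /v; lra.
have vb : v < b by rewrite /v; lra.
have vu : (v - u)%:C != 0 :> R[i] by rewrite (inj_eq (@complexI _)) subr_eq0 gt_eqF.
pose k1 := (F j v - F j u) / (v - u)%:C.
exists (F j u - k1 * u%:C), k1 => t /andP[at_ tb].
have D3 x y w : a < x -> x < y -> y < w -> w < b ->
    (w - y)%:C * F j x + (x - w)%:C * F j y + (y - x)%:C * F j w = 0.
  move=> ax xy yw wb; have wx : x <= w by lra.
  apply: (@free_three x w) => //; first by apply: le_lt_trans ax.
    by split; [lra|apply: lt_le_trans bL; rewrite lte_fin].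
  exact: fr.
suff E : (v - u)%:C * F j t = (v - u)%:C * F j u + (F j v - F j u) * (t - u)%:C.
  apply: (mulfI vu); rewrite E /k1 (_ : (t - u)%:C = t%:C - u%:C :> R[i]); last by rewrite -rmorphB.
  by move: (v - u)%:C vu => A vu; field.
have [tu|ut|->] := ltgtP t u; last by rewrite subrr mulr0 addr0.
  have E := D3 t u v at_ tu uv vb; apply/eqP; rewrite -subr_eq0; apply/eqP; rewrite -[RHS]E !rmorphB /=; ring.
have [tv|vt|->] := ltgtP t v; last by rewrite rmorphB /=; ring.
  have E := D3 u t v au ut tv vb; apply/eqP; rewrite -subr_eq0; apply/eqP; rewrite -[RHS]oppr0 -[in RHS]E !rmorphB /=; ring.
have E := D3 u v t au uv vt tb; apply/eqP; rewrite -subr_eq0; apply/eqP; rewrite -[RHS]E !rmorphB /=; ring.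
Qed.

(** Away from 0, [p] and [q], one of the two functions is zero near each point of the domain. *)
Lemma energy_disjoint p q f h : (forall t, p < t < q -> f t = 0) ->
  off p q h -> energy L f h = 0.
Proof.
move=> f0 h0; transitivity (cintegral lam (dom L) (fun=> 0)); last first.
  by apply: complex_ext; rewrite /= /Rintegral integral0.
have mN : measurable ([set` [:: 0; p; q]] : set (measurableTypeR R)) by exact: measurable_set_seq.
have N0 : lam ([set` [:: 0; p; q]] : set (measurableTypeR R)) = 0%E.
  by apply: countable_lebesgue_measure0; apply: finite_set_countable; exact: finite_seq.
apply: (cintegral_off_null mN N0) => // x [x0 xL] nx _.
have [n0 np nq] : [/\ x != 0, x != p & x != q].
  by split; apply/eqP => E; apply: nx; rewrite E /= !inE eqxx ?orbT.
have [/andP[px xq]|nI] := boolP (p < x < q).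
  have -> : cderive f x = 0; last by rewrite mul0r.
  apply: cder_cderive; apply: cder_near (cderC 0 x); near=> t; rewrite f0//.
  by apply/andP; split; near: t; [exact: lt_nbhsr|exact: lt_nbhsl].
have -> : cderive h x = 0; last by rewrite mulr0.
have xx : x < p \/ q < x.
  have [xp|px] := ltP x p; first by left.
  right; rewrite lt_neqAle eq_sym nq /= leNgt; apply: contra nI => ->.
  by rewrite andbT lt_neqAle eq_sym np px.
apply: cder_cderive; apply: cder_near (cderC 0 x).
have xpos : 0 < x by rewrite lt_neqAle eq_sym n0 x0.
case: xx => xx; near=> t; apply/esym/h0.
- split; last by near: t; exact: dom_open_nbhs.
  by apply: ltW; near: t; exact: lt_nbhsr.
- move=> /andP[pt tq]; have : t < p by near: t; exact: lt_nbhsl.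
  by rewrite ltNge pt.
- split; last by near: t; exact: dom_open_nbhs.
  by apply: ltW; near: t; exact: lt_nbhsr.
- move=> /andP[pt tq]; have : q < t by near: t; exact: lt_nbhsr.
  by rewrite ltNge tq.
Unshelve. all: by end_near. Qed.

(** Equation [k + 2] leaves only the pairing of [upsilon] with [F k], tested with the cut-off
    conjugate of [F k]; equation [k + 1] then leaves only that of [omega], tested with [g / F k].
    The larger interval makes room for the slopes of the cut-off [chi]. *)
Lemma nonvanish_free (k : nat) p' p q q' : 0 < p' -> p' < p -> p <= q -> q < q' -> dom L q' ->
  (forall j t, (k < j)%N -> p' <= t <= q' -> F j t = 0) ->
  (forall t, p <= t <= q -> F k t != 0) -> free p q.
Proof.
move=> p'0 pp pq qq dq' F0 nz.
have p0 : 0 < p := lt_trans p'0 pp. have q0 : 0 < q := lt_le_trans p0 pq.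
have q'0 : 0 < q' := lt_trans q0 qq.
have dq : dom L q := dom_between (ltW p0) pq dq' (ltW qq).
have dp : dom L p := dom_between (lexx 0) (ltW p0) dq pq.
have mI : measurable (`[p, q]%classic : set (measurableTypeR R)) := measurable_itvR `[p, q].
have mS := @measurable_seg R q'.
pose chi x : R[i] := (-1) * cramp p' p x + cramp q q' x.
have Hchi : H1c L chi := H1cD (H1cZ (-1) (H1c_cramp pp p0 dp)) (H1c_cramp qq q'0 dq').
have chiE x : chi x = (ramp q q' x - ramp p' p x)%:C by rewrite /chi /cramp rmorphB /= mulN1r addrC.
pose h x := (F k x)^* * chi x.
have Hh : H1c L h := H1cM (H1locJ (HF k)) Hchi.
have chi0 x : ~ (p' <= x <= q') -> chi x = 0.
  move=> nx; rewrite chiE; have [xp|px] := leP x p'.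
    by rewrite (ramp_left pp xp) ramp_left ?subrr//; lra.
  have qx : q' <= x by rewrite leNgt; apply/negP => xq; apply: nx; rewrite !ltW.
  by rewrite (ramp_right qq qx) (ramp_right pp) ?subrr//; lra.
have hoff : off p' q' h by move=> x _ nx; rewrite /h chi0 ?mulr0.
have u0 : upairing S (F k) h = 0.
  have [d Hd] := cF k.+2; have := Hd h Hh; rewrite /=.
  rewrite (energy_disjoint _ hoff); last by move=> t /andP[h1 h2]; rewrite F0 ?(ltW h1) ?(ltW h2).
  have -> : h 0 = 0 by rewrite /h chi0 ?mulr0//; move=> /andP[+ _]; rewrite leNgt p'0.
  rewrite (_ : opairing S (F k.+1) h = 0) ?mulr0 ?add0r ?addr0//.
  apply: (omega_zero_on (H1cM (HF k.+1) Hh)) => x dx.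
  have [xI|nI] := boolP (p' <= x <= q'); first by rewrite F0 ?mul0r.
  by rewrite hoff ?mulr0//; exact/negP.
have vh : vanish_after L q' h by move=> x dx qx; apply: hoff => // /andP[_]; rewrite leNgt qx.
have Upq : upsilon S `[p, q]%classic = 0%E.
  have ci : cintegrable (upsilon S) (seg q') (fun x => F k x * h x).
    exact: (upsilon_cintegrable (H1locM (HF k) (H1cS Hh).1) dq').
  have hE x : F k x * h x = (cabs (F k x) ^+ 2 * (ramp q q' x - ramp p' p x))%:C.
    by rewrite /h mulrA chiE rmorphM /= sqr_cabsC.
  have chige0 x : 0 <= ramp q q' x - ramp p' p x.
    have [xq|qx] := leP x q; first by rewrite (ramp_left qq xq) subr_ge0 ramp_le1.
    by rewrite (ramp_right pp) ?subr0 ?ramp_ge0//; lra.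
  pose G x := cabs (F k x) ^+ 2 * (ramp q q' x - ramp p' p x).
  have G0 x : 0 <= G x by apply: mulr_ge0 => //; exact: sqr_ge0.
  have iG : (upsilon S).-integrable (seg q') (EFin \o G).
    rewrite (_ : EFin \o G = (fun x => (Re (F k x * h x))%:E)); first exact: cintegrable_Re mS ci.
    by apply/funext => x; rewrite hE.
  have intG : (\int[upsilon S]_(x in seg q') (G x)%:E = 0)%E.
    rewrite -[LHS](fineK (integrable_fin_num mS iG)); congr (_%:E).
    move: u0; rewrite /upairing (upsilon_restrict _ dq' vh) => /(congr1 (@complex.Re R)) /=.
    by rewrite /Rintegral => <-; congr fine; apply: eq_integral => x _; rewrite hE.
  have [e e0 He] := H1loc_cabs_min (HF k) dq (ltW p0) pq (lexx q) nz.
  have le1 : ((e ^+ 2)%:E * upsilon S `[p, q]%classic <= 0)%E.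
    rewrite -integral_cst// -intG; apply: (ge0_le_integral_off_null measurable0 (measure0 _)).
    - move=> x; rewrite /= in_itv /= => /andP[px xq]; rewrite /seg /=; apply/andP; split; lra.
    - by move=> x _; rewrite lee_fin sqr_ge0.
    - by move=> x _; rewrite lee_fin.
    move=> x; rewrite /= in_itv /= => /andP[px xq] _; rewrite lee_fin /G.
    rewrite (ramp_left qq xq) (ramp_right pp px) subr0 mulr1.
    by rewrite ler_sqr ?nnegrE ?cabs_ge0 ?(ltW e0)// He// px.
  apply/eqP; rewrite eq_le measure_ge0 andbT.
  rewrite -(@lee_pmul2l _ (e ^+ 2)%:E) ?lte_fin ?exprn_gt0// mule0//.
split => // g Hg goff.
pose g' x := if p <= x <= q then g x / F k x else 0.
have Lg' : H1loc L g' := H1loc_cut_div (H1cS Hg).1 (HF k) dq (ltW p0) pq (lexx q) nz goff.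
have g'off : off p q g' by move=> x _ /negP/negbTE nx; rewrite /g' nx.
have vg' : vanish_after L q g' by move=> x dx qx; apply: g'off => // /andP[_]; rewrite leNgt qx.
have Hg' : H1c L g' := H1cI Lg' dq q0 vg'.
have [d Hd] := cF k.+1; have := Hd g' Hg'.
have -> : g' 0 = 0 by rewrite /g' leNgt p0.
rewrite (energy_disjoint (p := p) (q := q)) //; last first.
  by move=> t /andP[h1 h2]; apply: F0 => //; apply/andP; split; lra.
rewrite mulr0 addr0 /= (upairing_null _ Upq g'off) addr0 => E.
transitivity (opairing S (F k) g'); last by rewrite -E.
apply: (omega_ext Hg (H1cM (HF k) Hg')) => x dx; rewrite /g'.
case: ifPn => [xI|/negP nI]; last by rewrite mulr0 goff.
by rewrite mulrC divfK// nz.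
Qed.

End Free.

Section LastZero.
Context {R : realType} (f : R -> R[i]) (J : R) (x y : R).
Hypotheses (J0 : 0 <= J) (fJ : forall u v, x <= u -> u <= v -> v <= y -> cabs (f v - f u) <= J * Num.sqrt (v - u)).
Hypothesis xy : x <= y.

(** The supremum of the zeros is a zero by Hölder continuity. *)
Lemma last_zero : f x = 0 -> exists a, [/\ x <= a, a <= y, f a = 0 & forall t, a < t -> t <= y -> f t != 0].
Proof.
move=> fx; pose A := [set t | x <= t <= y /\ f t = 0].
have sA : has_sup A by split; [exists x; split; rewrite ?lexx|exists y => t [/andP[]]].
have xa : x <= sup A by apply: ub_le_sup; [exact: sA.2|split; rewrite ?lexx].
have ay : sup A <= y by apply: ge_sup; [exact: sA.1|move=> t [/andP[]]].
exists (sup A); split => //.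
  apply: (@hoelder_zero _ _ J 1) => // s /andP[s0 _].
  have [t [/andP[xt ty] ft] ht] := sup_adherent s0 sA.
  have ta : t <= sup A by apply: ub_le_sup; [exact: sA.2|split; rewrite ?xt].
  rewrite -[f (sup A)]subr0 -ft; apply: le_trans (fJ xt ta ay) _.
  rewrite ler_wpM2l//; apply: (@le_trans _ _ (Num.sqrt s)); last by rewrite lerDl ltW.
  by rewrite ler_wsqrtr//; lra.
move=> t at_ ty; apply/eqP => ft.
have : t <= sup A by apply: ub_le_sup; [exact: sA.2|split => //; rewrite (le_trans xa (ltW at_))].
by rewrite leNgt at_.
Qed.

Lemma first_zero : f y = 0 -> exists b, [/\ x <= b, b <= y, f b = 0 & forall t, x <= t -> t < b -> f t != 0].
Proof.
move=> fy; pose A := [set t | x <= t <= y /\ f t = 0].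
have sA : has_inf A by split; [exists y; split; rewrite ?lexx ?xy|exists x => t [/andP[]]].
have bY : inf A <= y by apply: ge_inf; [exact: sA.2|split; rewrite ?lexx ?xy].
have xb : x <= inf A by apply: lb_le_inf; [exact: sA.1|move=> t [/andP[]]].
exists (inf A); split => //.
  apply: (@hoelder_zero _ _ J 1) => // s /andP[s0 _].
  have [t [/andP[xt ty] ft] ht] := inf_adherent s0 sA.
  have ta : inf A <= t by apply: ge_inf; [exact: sA.2|split; rewrite ?xt].
  rewrite -cabsN -[- f _]add0r -ft; apply: le_trans (fJ xb ta ty) _.
  rewrite ler_wpM2l//; apply: (@le_trans _ _ (Num.sqrt s)); last by rewrite lerDl ltW.
  by rewrite ler_wsqrtr//; lra.
move=> t xt tb; apply/eqP => ft.
have : inf A <= t by apply: ge_inf; [exact: sA.2|split => //; rewrite xt (le_trans (ltW tb) bY)].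
by rewrite leNgt tb.
Qed.

End LastZero.

(** * Finitely many exceptional points *)

Section FreePoints.
Context {R : realType} (S : gen_indefinite_string R).
Local Notation L := (len S).
Variable F : nat -> R -> R[i].
Hypothesis tF : forall j, tame S (F j).
Hypothesis cF : chain S F.
Let HF j : H1loc L (F j). Proof. by have [] := tF j. Qed.
Implicit Types (x y w p q : R) (alpha beta : \bar R).

(** If [F k y] were not zero, the maximal interval around [y] without zeros would carry no mass;
    there [F k] would be affine with zeros at both ends. *)
Lemma zeros_convex (k : nat) alpha beta x y w : (0%:E <= alpha)%E -> (beta <= L)%E ->
  (forall j t, (k < j)%N -> (alpha < t%:E)%E -> (t%:E < beta)%E -> F j t = 0) ->
  (alpha < x%:E)%E -> x < y -> y < w -> (w%:E < beta)%E -> F k x = 0 -> F k w = 0 -> F k y = 0.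
Proof.
move=> a0 bL F0 ax xy yw wb fx fw; apply: contrapT => /eqP fy.
have x0 : 0 < x by rewrite -lte_fin; apply: le_lt_trans ax.
have dw : dom L w by split; [lra|apply: lt_le_trans bL].
have [_ [J J0 HJ] _] := tF k.
have fJ u v : x <= u -> u <= v -> v <= w -> cabs (F k v - F k u) <= J * Num.sqrt (v - u).
  by move=> xu uv vw; apply: HJ => //; [lra|exact: (dom_between (le_trans (ltW x0) xu) uv dw vw)].
have [a [xa ay fa nza]] := last_zero J0 (fun u v h1 h2 h3 => fJ u v h1 h2 (le_trans h3 (ltW yw))) (ltW xy) fx.
have [b [yb bw fb nzb]] := first_zero J0 (fun u v h1 h2 h3 => fJ u v (le_trans (ltW xy) h1) h2 h3) (ltW yw) fw.
have {}ay : a < y by rewrite lt_neqAle ay andbT; apply/eqP => E; rewrite -E fa eqxx in fy.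
have {}yb : y < b by rewrite lt_neqAle yb andbT; apply/eqP => E; rewrite E fb eqxx in fy.
have ab : a < b := lt_trans ay yb.
have nz t : a < t -> t < b -> F k t != 0.
  by move=> h1 h2; have [ty|yt] := leP t y; [exact: nza|apply: nzb => //; exact: ltW].
have [k0 [k1 line]] : exists k0 k1, forall t, a < t < b -> F k t = k0 + k1 * t%:C.
  apply: (free_line tF cF) => //; first by lra.
    by apply: le_trans bL; apply: ltW; apply: le_lt_trans wb; rewrite lee_fin.
  move=> p q ap pq qb.
  pose p' : R := (a + p) / 2; pose q' : R := (q + b) / 2.
  have [h1 [h2 [h3 [h4 h5]]]] : 0 < p' /\ (p' < p /\ (q < q' /\ (q' < b /\ a < p'))).
    by clear -ap pq qb x0 xa; rewrite /p' /q'; do ?split; lra.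
  have dq' : dom L q' := dom_between (lexx 0) (ltW (lt_trans h1 (lt_trans h2 (le_lt_trans pq h3)))) dw (ltW (lt_le_trans h4 bw)).
  apply: (nonvanish_free tF cF h1 h2 pq h3 dq') => [j t kj /andP[e1 e2]|t /andP[e1 e2]].
    apply: F0 kj _ _; first by apply: lt_trans ax _; rewrite lte_fin (le_lt_trans xa (lt_le_trans h5 e1)).
    by apply: lt_trans wb; rewrite lte_fin (le_lt_trans e2 (lt_le_trans h4 bw)).
  by apply: nz; [exact: lt_le_trans e1|exact: le_lt_trans e2 qb].
have ea := affine_left J0 (fun u v h1 h2 h3 => fJ u v (le_trans xa h1) h2 (le_trans h3 bw)) ay (ltW yb)
  (fun t h => line t (introT andP (conj (andP h).1 (lt_trans (andP h).2 yb)))).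
have eb := affine_right J0 (fun u v h1 h2 h3 => fJ u v (le_trans xa h1) h2 (le_trans h3 bw)) (ltW ay) yb
  (fun t h => line t (introT andP (conj (lt_trans ay (andP h).1) (andP h).2))).
rewrite fa in ea; rewrite fb in eb.
have ba : (b - a)%:C != 0 :> R[i] by rewrite (inj_eq (@complexI _)) subr_eq0 gt_eqF.
have k10 : k1 = 0.
  by apply: (mulfI ba); rewrite mulr0 -[RHS](subrr 0) {1}eb ea rmorphB /=; ring.
have k00 : k0 = 0 by rewrite ea k10; ring.
by move: fy; rewrite line ?ay// k10 k00 mul0r addr0 eqxx.
Qed.

Hypothesis F0n : forall x, dom L x -> F 0%N x != 0.

(* The last non-zero function [F k] is affine wherever it does not vanish, since there is no mass
   there; hence its zeros form a convex set, in whose interior one recurses. *)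
Lemma free_points (k : nat) alpha beta : (0%:E <= alpha)%E -> (beta <= L)%E ->
  (forall j t, (k <= j)%N -> (alpha < t%:E)%E -> (t%:E < beta)%E -> F j t = 0) ->
  exists s : seq (\bar R), forall p q, (alpha < p%:E)%E -> p <= q -> (q%:E < beta)%E ->
    (forall t, p <= t <= q -> t%:E \notin s) -> free S p q.
Proof.
elim: k alpha beta => [|k IH] alpha beta a0 bL F0.
  (* Here [F 0] itself would vanish on the interval, although it has no zeros, so no such [p]
     exists. *)
  exists [::] => p q ap pq qb _.
  have pb : (p%:E < beta)%E by apply: le_lt_trans qb; rewrite lee_fin.
  have p0 : 0 < p by rewrite -lte_fin; apply: le_lt_trans ap.
  have := F0n (_ : dom L p); rewrite F0// eqxx => h.
  have : false by apply: h; split; [exact: ltW|exact: lt_le_trans bL].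
  by [].
(* The bounds [a] and [b] of the zeros may be infinite, in particular when there are none, hence
   extended reals. *)
pose Z := [set t%:E | t in [set t : R | [/\ (alpha < t%:E)%E, (t%:E < beta)%E & F k t = 0]]].
pose a := ereal_inf Z; pose b := ereal_sup Z.
have between x : (a < x%:E)%E -> (x%:E < b)%E -> exists u w, [/\ (alpha < u%:E)%E, (w%:E < beta)%E, u < x, x < w & F k u = 0 /\ F k w = 0].
  move=> /ereal_inf_lt[_ [u [au ub fu] <-] ux] /ereal_sup_gt[_ [w [aw wb fw] <-] xw].
  by exists u, w; split => //; rewrite -lte_fin.
have a'0 : (0%:E <= a)%E.
  apply: le_ereal_inf_tmp => _ [t [at_ _ _] <-]; exact: ltW (le_lt_trans a0 at_).
have b'L : (b <= L)%E.
  apply: ge_ereal_sup => _ [t [_ tb _] <-]; exact: ltW (lt_le_trans tb bL).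
have F0' j t : (k <= j)%N -> (a < t%:E)%E -> (t%:E < b)%E -> F j t = 0.
  move=> kj at_ tb; have [u [w [au wb ut tw [fu fw]]]] := between t at_ tb.
  move: kj; rewrite leq_eqVlt => /predU1P[<-|kj].
    exact: (zeros_convex a0 bL F0 au ut tw wb fu fw).
  apply: F0 => //; first by apply: lt_trans au _; rewrite lte_fin.
  by apply: lt_trans wb; rewrite lte_fin.
have [s Hs] := IH a b a'0 b'L F0'.
exists [:: a, b & s] => p q ap pq qb nos.
have nin t : p <= t <= q -> [/\ t%:E != a, t%:E != b & t%:E \notin s].
  by move=> /nos; rewrite !inE !negb_or => /and3P[].
(* A zero in [[p, q]] places this interval inside []a, b[], as [a] and [b] are exceptional points;
   without a zero, [nonvanish_free] applies. *)
have [[t [tpq ft]]|nZ] := pselect (exists t, p <= t <= q /\ F k t = 0).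
  have /andP[pt tq] := tpq.
  have tZ : Z t%:E.
    by exists t => //; split => //; [apply: lt_le_trans ap _|apply: le_lt_trans qb]; rewrite lee_fin.
  have at_ : (a <= t%:E)%E by exact: ereal_inf_lbound.
  have tb : (t%:E <= b)%E by exact: ereal_sup_ubound.
  apply: Hs => //; last by move=> r /nin[].
  - rewrite ltNge; apply/negP => pa.
    have af : a \is a fin_num.
      by rewrite fin_numElt (lt_le_trans (ltNyr p) pa) (le_lt_trans at_ (ltry t)).
    have := nin (fine a); rewrite fineK// eqxx -!lee_fin fineK// pa (le_trans at_) ?lee_fin//.
    by move=> /(_ isT)[].
  - rewrite ltNge; apply/negP => bq.
    have bf : b \is a fin_num.
      by rewrite fin_numElt (lt_le_trans (ltNyr t) tb) (le_lt_trans bq (ltry q)).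
    have := nin (fine b); rewrite fineK// eqxx -!lee_fin fineK// bq (le_trans _ tb) ?lee_fin//.
    by move=> /(_ isT)[].
have [p' [p'0 ap' p'p]] : exists p', [/\ 0 < p', (alpha < p'%:E)%E & p' < p].
  case: (alpha) a0 ap => [r| |] //; rewrite lee_fin lte_fin => r0 rp.
  by exists ((r + p) / 2); rewrite lte_fin; split; lra.
have [q' [q'b qq']] : exists q', (q'%:E < beta)%E /\ q < q'.
  case: (beta) qb => [r| |] //; rewrite ?lte_fin => qr.
    by exists ((q + r) / 2); rewrite lte_fin; split; lra.
  by exists (q + 1); rewrite ltry; split => //; lra.
have dq' : dom L q'.
  split; last exact: lt_le_trans q'b bL.
  exact: ltW (lt_trans p'0 (lt_trans p'p (le_lt_trans pq qq'))).
apply: (nonvanish_free (k := k) tF cF p'0 p'p pq qq' dq').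
- move=> j t kj /andP[h1 h2].
  have t1 : (p'%:E <= t%:E)%E by rewrite lee_fin.
  have t2 : (t%:E <= q'%:E)%E by rewrite lee_fin.
  exact: F0 kj (lt_le_trans ap' t1) (le_lt_trans t2 q'b).
- by move=> t tpq; apply/eqP => ft; apply: nZ; exists t.
Qed.

End FreePoints.

Section Nodes.
Context {R : realType}.
Implicit Types (s t : seq R) (x y a b : R).

Lemma separated s x : x \notin s -> exists2 e, 0 < e & forall y, y \in s -> e <= `|y - x|.
Proof.
elim: s => [|z s IH]; first by exists 1.
rewrite inE negb_or => /andP[xz /IH[e e0 He]]; exists (Num.min e `|z - x|).
  by rewrite lt_min e0 normr_gt0 subr_eq0 eq_sym.
by move=> y; rewrite inE => /predU1P[->|/He h]; rewrite ge_min ?lexx ?orbT// h.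
Qed.

Lemma path_consecutive s a t : path <%R a t ->
  (forall y, y \in s -> [|| y <= a, y \in t | last a t <= y]) ->
  path (fun u v => (u < v) && all (fun y => ~~ (u < y < v)) s) a t.
Proof.
elim: t a => [//|b t IH] a /= /andP[ab pt] H; rewrite ab /=; apply/andP; split.
  apply/allP => y ys; apply/negP => /andP[ay yb].
  have := H y ys; rewrite leNgt ay /= inE => /orP[/orP[/eqP E|yt]|].
  - by rewrite E ltxx in yb.
  - by have /allP/(_ y yt) := order_path_min lt_trans pt; rewrite ltNge (ltW yb).
  - move=> ly; have bl : b <= last b t.
      have := mem_last b t; rewrite inE => /predU1P[->//|lt].
      exact: ltW (allP (order_path_min lt_trans pt) _ lt).
    by have := lt_le_trans yb (le_trans bl ly); rewrite ltxx.
apply: IH => // y /H; rewrite inE => /or3P[ya|/predU1P[->|->]|->]; rewrite ?lexx ?orbT//.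
by rewrite (le_trans ya (ltW ab)).
Qed.

Lemma tent_lip x z y d : 0 < d ->
  `|Num.max 0 (1 - `|x - y| / d) - Num.max 0 (1 - `|z - y| / d)| <= d^-1 * `|x - z|.
Proof.
move=> d0.
have mx (u v : R) : `|Num.max 0 u - Num.max 0 v| <= `|u - v|.
  have h1 := ler_norm (u - v); have h2 := ler_norm (v - u); rewrite distrC in h2.
  rewrite /Num.max; case: ltP => u0; case: ltP => v0 //; rewrite ?subrr ?normr0 ?normr_ge0// ?subr0 ?sub0r ?normrN.
    by rewrite gtr0_norm//; lra.
  by rewrite gtr0_norm//; lra.
apply: le_trans (mx _ _) _.
have -> : 1 - `|x - y| / d - (1 - `|z - y| / d) = d^-1 * (`|z - y| - `|x - y|) by ring.
have := ler_dist_dist (z - y) (x - y); rewrite (_ : z - y - (x - y) = - (x - z)); last by ring.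
rewrite normrN => h; rewrite normrM (gtr0_norm (x := d^-1)) ?invr_gt0//.
by apply: ler_wpM2l; rewrite // invr_ge0 ltW.
Qed.

End Nodes.

Lemma measurable_dom (R : realType) (L : \bar R) : measurable (dom L : set (measurableTypeR R)).
Proof.
case: L => [l| |].
- rewrite (_ : dom _ = `[0, l[%classic); first exact: (measurable_itvR `[0, l[).
  by apply/seteqP; split => x; rewrite /dom /= in_itv /= lte_fin => /andP.
- rewrite (_ : dom _ = `[0, +oo[%classic); first exact: (measurable_itvR `[0, +oo[).
  by apply/seteqP; split => x; rewrite /dom /= in_itv /= andbT ltry => // -[].
- rewrite (_ : dom _ = set0); first exact: measurable0.
  by apply/seteqP; split => x //= [_]; rewrite ltNge leNye.
Qed.

Lemma dom_above (R : realType) (L : \bar R) x : dom L x -> exists v, x < v /\ dom L v.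
Proof.
case: L => [l| |] [x0] //; rewrite ?lte_fin => xl.
  by exists ((x + l) / 2); split; [lra|split; [lra|rewrite lte_fin; lra]].
by exists (x + 1); split; [lra|split; [lra|rewrite ltry]].
Qed.

(** * Point masses at the nodes *)

Section Discreteness.
Context {R : realType} (S : gen_indefinite_string R).
Local Notation L := (len S).
Variable F : nat -> R -> R[i].
Hypothesis tF : forall j, tame S (F j).
Hypothesis cF : chain S F.
Let HF j : H1loc L (F j). Proof. by have [] := tF j. Qed.
Implicit Types (x y p q c : R) (h f : R -> R[i]).

Definition line_on f a b := exists k0 k1 : R[i], forall t, a <= t <= b -> f t = k0 + k1 * t%:C.

Lemma energy_const k h : H1c L h -> energy L (fun=> k) h = 0.
Proof.
move=> /H1cS[Hh [c [dc c0 hc]]]; have [gh dh] := density_exists Hh dc c0.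
have w0 : weak_deriv c (fun=> k) (fun=> 0) by apply: (@weak_deriv_fin _ c _ _ [::] (ltW c0)) => x _ _; exact: cderC.
rewrite (energyE dc hc w0 (density_weak dh)).
by apply: complex_ext; rewrite /= /Rintegral integral0_eq// => x _; rewrite mul0r.
Qed.

(** Adding a multiple of a ramp and a constant makes [f] constant up to the next node. Neither
    changes the energy: [h] vanishes at both ends of the ramp, and constants have no energy. *)
Lemma energy_piecewise a t f h k : 0 <= a -> 0 < last a t -> dom L (last a t) -> path <%R a t ->
  H1loc L f -> H1c L h -> (forall x, 0 <= x <= a -> f x = k) ->
  path (fun u v => `[< line_on f u v >]) a t ->
  (forall y, y \in a :: t -> h y = 0) -> vanish_after L (last a t) h -> energy L f h = 0.
Proof.
elim: t a f => [|b t IH] a f a0 l0 dl pt Hf Hh fk pl h0 vh.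
  by rewrite /= in l0 dl vh; rewrite (energy_eq_seg dl l0 vh Hf (H1cS Hh).1 fk) energy_const.
move: pt pl => /= /andP[ab pt] /andP[/asboolP[k0 [k1 fab]] pl].
have bl : b <= last b t.
  have := mem_last b t; rewrite inE => /predU1P[->//|lt].
  exact: ltW (allP (order_path_min lt_trans pt) _ lt).
have b0 : 0 <= b by rewrite (le_trans a0)// ltW.
have db : dom L b := dom_between (lexx 0) b0 dl bl.
have fa : k = k0 + k1 * a%:C by rewrite -(fk a) ?a0 ?lexx// fab// lexx ltW.
have fb : f b = k0 + k1 * b%:C by rewrite fab// lexx (ltW ab).
pose c : R[i] := f b - k.
(* The factor 1 shows [f'] as a linear combination of three functions. *)
pose f' x : R[i] := f x + c * cramp a b x + (- c) * 1.
have H1 : H1loc L (fun x => c * cramp a b x) := H1locZ c (@H1loc_cramp _ L _ _ ab).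
have Hf' : H1loc L f' := H1locD (H1locD Hf H1) (@H1loc_const _ L ((- c) * 1)).
have ba : (b - a)%:C != 0 :> R[i] by rewrite (inj_eq (@complexI _)) subr_eq0 gt_eqF.
have f'k x : 0 <= x <= b -> f' x = k.
  move=> /andP[x0 xb]; rewrite /f' /cramp; have [xa|ax] := leP x a.
    by rewrite (ramp_left ab xa) fk ?x0//; ring.
  have xab : a <= x <= b by rewrite xb ltW.
  rewrite (ramp_mid ab xab) rmorphM /= fmorphV /= fab// /c fb fa.
  have -> : (b - x)%:C = (b - a)%:C - (x%:C - a%:C) :> R[i] by rewrite -!rmorphB /=; congr (_%:C); ring.
  have -> : b%:C = (b - a)%:C + a%:C :> R[i] by rewrite -rmorphD /= subrK.
  by move: (b - a)%:C ba => A ba; field.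
have pl' : path (fun u v => `[< line_on f' u v >]) b t.
  have inc u : b <= u -> forall x, u <= x -> f' x = f x - c.
    move=> bu x ux; rewrite /f' /cramp ramp_right ?mulr0 ?addr0 ?mulr1//; exact: le_trans ux.
  have : forall u, b <= u -> path <%R u t -> path (fun u v => `[< line_on f u v >]) u t ->
      path (fun u v => `[< line_on f' u v >]) u t.
    move: inc; clear; move=> inc; elim: t => [//|v t IH] u bu /= /andP[uv pt] /andP[/asboolP[k0 [k1 H]] pl].
    apply/andP; split; last by apply: IH => //; exact: le_trans (ltW uv).
    apply/asboolP; exists (k0 - c), k1 => x /andP[ux xv].
    by rewrite (inc u bu x ux) H ?ux//; ring.
  by apply.
have hb : h b = 0 by apply: h0; rewrite !inE eqxx orbT.
have ha : h a = 0 by apply: h0; rewrite !inE eqxx.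
have := IH b f' b0 l0 dl pt Hf' Hh f'k pl' _ vh.
have -> : f' = (fun x => \sum_(i < 3) (nth 0 [:: 1; c; - c] i) * (nth f [:: f; cramp a b; fun=> 1] i x)).
  by apply/funext => x; rewrite !big_ord_recr big_ord0 /= add0r mul1r.
rewrite (energy_lincomb _ _ Hh); last first.
  case=> [[|[|[|i]]] hi] /=; last by discriminate hi.
  - exact: Hf.
  - exact: (@H1loc_cramp _ L _ _ ab).
  - exact: (@H1loc_const _ L 1).
rewrite !big_ord_recr big_ord0 /= add0r mul1r energy_const//.
rewrite (energyC S (cramp a b)) (energy_cramp (H1cS Hh).1 a0 ab db) ha hb subrr oppr0 mul0r !mulr0 !addr0.
by apply=> y yt; apply: h0; rewrite inE yt orbT.
Qed.

(* If the endpoint is infinite, the square-root growth of a tame function forces the slope to be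
   zero. *)
Lemma tame_end f a (k0 k1 : R[i]) : tame S f -> dom L a ->
  (forall x, dom L x -> a <= x -> f x = k0 + k1 * x%:C) -> k0 * (inv_length L)%:C + k1 = 0.
Proof.
move=> [_ [J J0 HJ] vL] da lin; have [a0 aL] := da.
case EL : L (len_gt0 S) => [l| |//]; last first.
  move=> _; rewrite /= mulr0 add0r; apply/eqP; rewrite -cabs_eq0; apply/eqP/le_anti.
  rewrite cabs_ge0 andbT leNgt; apply/negP => d0.
  (* For this [q] the increment [cabs k1 * q ^+ 2] exceeds the permitted [J * q]. *)
  pose q := J / cabs k1 + 1; have q0 : 0 < q by rewrite ltr_wpDl// divr_ge0// ltW.
  have aq : a <= a + q ^+ 2 by rewrite lerDl sqr_ge0.
  have dv : dom L (a + q ^+ 2) by split; [exact: le_trans aq|rewrite EL ltry].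
  have := HJ a _ a0 aq dv; rewrite !lin//.
  rewrite (_ : _ + _ - _ = k1 * (q ^+ 2)%:C); last by rewrite rmorphD /=; ring.
  rewrite (_ : a + q ^+ 2 - a = q ^+ 2); last by ring.
  rewrite sqrtr_sqr (gtr0_norm q0) cabsM cabsC (ger0_norm (sqr_ge0 q)).
  rewrite expr2 mulrA ler_pM2r// /q mulrDr mulrC divfK ?gt_eqF// mulr1 gerDl leNgt d0//.
rewrite lte_fin => l0; rewrite /=; have al : a < l by rewrite -lte_fin -EL.
have ln : l%:C != 0 :> R[i] by rewrite (inj_eq (@complexI _)) gt_eqF.
suff E : k0 + k1 * l%:C = 0.
  apply: (mulIf ln); rewrite mulrDl -mulrA -rmorphM /= mulVf ?gt_eqF// mulr1 mul0r.
  by rewrite -[RHS]E.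
have al0 : 0 < l - a by rewrite subr_gt0.
apply: (@hoelder_zero _ _ (cabs k1) (l - a)) => //; first exact: cabs_ge0.
move=> s /andP[s0 sl]; apply/ler_addgt0Pl => e e0.
have [x [x1 x2 x3]] : exists x, [/\ l - s < x, x < l & cabs (f x) < e].
  have := vL l EL => /cvgrPdist_lt/(_ e e0) H.
  have : \forall x \near l^'-, [/\ l - s < x, x < l & cabs (f x) < e].
    near=> x; split.
    - by near: x; apply: nbhs_left_gt; rewrite ltrBlDr ltrDl.
    - by near: x; exact: nbhs_left_lt.
    - have : `|0 - cabs (f x)| < e by near: x.
      by rewrite sub0r normrN ger0_norm ?cabs_ge0.
  by move=> /filter_ex[x hx]; exists x.
have ax : a <= x by lra.
have dx : dom L x by split; [exact: le_trans ax|rewrite EL lte_fin].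
rewrite (_ : _ + _ = f x + k1 * (l - x)%:C); last by rewrite (lin x dx ax) rmorphB /=; ring.
apply: le_trans (cabsD _ _) _; apply: lerD; first exact: ltW.
rewrite cabsM cabsC ger0_norm; last by lra.
rewrite ler_wpM2l ?cabs_ge0//; have := sqrtr_ge0 s; lra.
Unshelve. all: by end_near. Qed.

(* In the lowest order the chain says [F 0] has no mass at all, so it is affine; the condition at
   the right endpoint then fixes its slope. *)
Lemma chain0_form : (exists2 x, dom L x & F 0%N x != 0) ->
  exists2 k : R[i], k != 0 & forall x, dom L x -> F 0%N x = k * (1 - x * inv_length L)%:C.
Proof.
move=> [x0 dx0 nz]; have [d Hd] := cF 0%N.
have lin x : dom L x -> F 0%N x = F 0%N 0 + d * x%:C.
  move=> dx; have [xs _] := dx; move: xs; rewrite le_eqVlt => /predU1P[<-|xp]; first by rewrite mulr0 addr0.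
  have := Hd _ (H1c_cramp xp xp dx); rewrite /= opairing0 upairing0 addr0.
  rewrite (energy_cramp (HF 0%N) (lexx 0) xp dx) {1}/cramp ramp_left// mulr1 subr0 => /eqP.
  rewrite mulNr subr_eq0 => /eqP ->.
  have xn : x%:C != 0 :> R[i] by rewrite (inj_eq (@complexI _)) gt_eqF.
  by rewrite divfK//; ring.
have d0 : dom L 0 by split => //; exact: len_gt0.
have E : d = - (F 0%N 0 * (inv_length L)%:C).
  apply/eqP; rewrite -addr_eq0 addrC; apply/eqP.
  by apply: (tame_end (tF 0%N) d0) => x dx _; exact: lin.
have form x : dom L x -> F 0%N x = F 0%N 0 * (1 - x * inv_length L)%:C.
  by move=> dx; rewrite lin// E rmorphB rmorphM /=; ring.
by exists (F 0%N 0) => //; apply: contra nz => /eqP k0; rewrite form// k0 mul0r.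
Qed.

Hypothesis F0n : exists2 x, dom L x & F 0%N x != 0.
Variable n : nat.
Hypothesis Fn : forall j x, (n <= j)%N -> F j x = 0.

(** The point 0 is added as a node because freeness is only obtained for [p > 0]. *)
Lemma nodes_exist : exists s : seq R, [/\ uniq s, 0 \in s, forall y, y \in s -> dom L y &
  forall p q, 0 < p -> p <= q -> dom L q -> (forall y, y \in s -> ~~ (p <= y <= q)) -> free S p q].
Proof.
have [k k0 F0E] := chain0_form F0n.
have Fnz x : dom L x -> F 0%N x != 0.
  move=> dx; rewrite F0E// mulf_neq0// (inj_eq (@complexI _)) subr_eq0.
  have [x0 xL] := dx; case EL : L (len_gt0 S) xL => [l| |]//= l0 xl.
    by rewrite lte_fin in xl l0; rewrite gt_eqF// ltr_pdivrMr ?mul1r.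
  by rewrite mulr0 gt_eqF.
have [s Hs] := free_points (k := n) tF cF Fnz (lexx 0%:E) (lexx L) (fun j t nj _ _ => Fn t nj).
exists (undup (0 :: [seq y <- [seq fine t | t <- s] | `[< dom L y >]])); split.
- exact: undup_uniq.
- by rewrite mem_undup mem_head.
- move=> y; rewrite mem_undup inE mem_filter => /predU1P[->|/andP[/asboolP]]//.
  by split => //; exact: len_gt0.
move=> p q p0 pq dq H; have [_ qL] := dq; apply: Hs => // t tpq; apply/negP => ts.
have dt : dom L t.
  have /andP[pt tq] := tpq. exact (dom_between (ltW p0) pt dq tq).
have := H t; rewrite tpq mem_undup inE mem_filter => /(_ _)/negP; apply => //.
apply/orP; right; apply/andP; split; first exact/asboolP.
by apply/mapP; exists t%:E.
Qed.

Variable s : seq R.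
Hypotheses (us : uniq s) (s0 : 0 \in s) (sL : forall y, y \in s -> dom L y).
Hypothesis sfree : forall p q, 0 < p -> p <= q -> dom L q ->
  (forall y, y \in s -> ~~ (p <= y <= q)) -> free S p q.

(** A point of the domain off the nodes is positive, 0 being a node, and has a neighbourhood without
    mass. *)
Lemma upsilon_null_off_nodes : upsilon S (~` [set` s]) = 0%E.
Proof.
have mD : measurable (dom L : set (measurableTypeR R)) by exact: measurable_dom.
have ms : measurable ([set` s] : set (measurableTypeR R)) by exact: measurable_set_seq.
have mX : measurable (dom L `\` [set` s] : set (measurableTypeR R)) by exact: measurableD.
have nX : upsilon S (dom L `\` [set` s]) = 0%E.
  apply: measure_locally_null => // x [dx /negP xs].
  have [e e0 He] := separated xs.
  have x0 : 0 < x.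
    have [x0 _] := dx; rewrite lt_neqAle x0 andbT; apply/eqP => E; by rewrite -E s0 in xs.
  have [v [xv dv]] := dom_above dx.
  pose d := Num.min (Num.min (e / 2) (x / 2)) (v - x).
  have d1 : d <= e / 2 by rewrite !ge_min lexx.
  have d2 : d <= x / 2 by rewrite !ge_min lexx orbT.
  have d3 : d <= v - x by rewrite ge_min lexx orbT.
  have d0 : 0 < d by rewrite !lt_min subr_gt0 xv !divr_gt0.
  exists (x - d), (x + d); split; first by apply/andP; split; lra.
  have [] // := sfree (_ : 0 < x - d) (_ : x - d <= x + d) (_ : dom L (x + d)); try lra.
    have e1 : x <= x + d by lra. have e2 : x + d <= v by lra.
    exact (dom_between (ltW x0) e1 dv e2).
  move=> y ys; apply/negP => /andP[h1 h2]; have := He y ys; rewrite leNgt => /negP; apply.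
  by rewrite ltr_norml; apply/andP; split; lra.
apply/eqP; rewrite eq_le measure_ge0 andbT.
have mY : measurable (~` dom L : set (measurableTypeR R)) by exact: measurableC.
apply: (@le_trans _ _ (upsilon S ((dom L `\` [set` s]) `|` ~` dom L))).
  apply: le_measure; [apply/mem_set; exact: measurableC|apply/mem_set; exact: measurableU|].
  by move=> x xs; have [dx|dx] := pselect (dom L x); [left|right].
by rewrite null_set_setU//; exact: upsilon_dom.
Qed.

(* The first two equations of the chain express [omega] by the piecewise affine function [F 1]:
   it is concentrated on the nodes. *)
Lemma omega_vanish h : H1c L h -> (forall y, y \in s -> h y = 0) -> omega S h = 0.
Proof.
move=> Hh hs; have [k k0 F0E] := chain0_form F0n.
have [Lh [c1 [dc1 c10 hc1]]] := H1cS Hh; have [c [c1c dc]] := dom_above dc1.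
have c0 : 0 < c := lt_trans c10 c1c.
have hc : vanish_after L c h by move=> x dx cx; apply: hc1 => //; exact: lt_trans cx.
have hcz : h c = 0 by exact: hc1.
have Fnz x : 0 <= x <= c -> F 0%N x != 0.
  move=> /andP[x0 xc]; have dx : dom L x := dom_between (lexx 0) x0 dc xc.
  rewrite F0E// mulf_neq0// (inj_eq (@complexI _)) subr_eq0.
  have [_ xL] := dx; case EL : L (len_gt0 S) xL => [l| |]//= l0 xl.
    by rewrite lte_fin in xl l0; rewrite gt_eqF// ltr_pdivrMr ?mul1r.
  by rewrite mulr0 gt_eqF.
(* In equation 1 of the chain, [omega] is applied to [F 0 * g], which is [h]. *)
pose g x := if 0 <= x <= c then h x / F 0%N x else 0.
have Lg : H1loc L g.
  apply: (H1loc_cut_div Lh (HF 0%N) dc (lexx 0) (ltW c0) (lexx c) Fnz) => x dx nx; apply: hc => //.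
  by rewrite ltNge; apply/negP => xc; apply: nx; rewrite xc; have [-> _] := dx.
have vg : vanish_after L c g by move=> x dx cx; rewrite /g [x <= c]leNgt cx andbF.
have Hg : H1c L g := H1cI Lg dc c0 vg.
(* The last point [c] is no node in general, but [h] vanishes there too. *)
pose u := sort <=%R [seq y <- s | 0 < y < c]; pose t := rcons u c.
have memu y : (y \in u) = (0 < y < c) && (y \in s) by rewrite mem_sort mem_filter.
have pt : path <%R 0 t.
  rewrite rcons_path path_sortedE; last exact: lt_trans.
  rewrite sort_lt_sorted filter_uniq// andbT; apply/andP; split.
    by apply/allP => y; rewrite memu => /andP[/andP[]].
  by have := mem_last 0 u; rewrite inE memu => /predU1P[->//|/andP[/andP[]]].
have lt_ : last 0 t = c by rewrite last_rcons.
have pc := path_consecutive (s := s) pt.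
have {}pc : path (fun u v => (u < v) && all (fun y => ~~ (u < y < v)) s) 0 t.
  apply: pc => y ys; rewrite lt_ mem_rcons inE memu ys andbT.
  by have [//|y0] := leP y 0; rewrite /= ; have [//|cy] := ltP y c; rewrite orbT.
have [_ [J J0 HJ] _] := tF 1%N.
have pl : path (fun u v => `[< line_on (F 1%N) u v >]) 0 t.
  apply: (@sub_in_path _ (fun y => 0 <= y <= c)) pc.
    move=> a b /andP[a0 ac] /andP[b0 bc] /andP[ab /allP nos].
    have db : dom L b := dom_between (lexx 0) b0 dc bc.
    have [k0' [k1 line]] : exists k0 k1, forall t, a < t < b -> F 1%N t = k0 + k1 * t%:C.
      apply: (free_line tF cF 1 a0 ab); first by have [_ /ltW] := db.
      move=> p q ap pq qb; apply: sfree => //; first exact: le_lt_trans ap.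
        exact (dom_between (lexx 0) (le_trans (ltW (le_lt_trans a0 ap)) pq) db (ltW qb)).
      move=> y /nos; apply: contra => /andP[py yq].
      by rewrite (lt_le_trans ap py) (le_lt_trans yq qb).
    have fJ u' v : a <= u' -> u' <= v -> v <= b -> cabs (F 1%N v - F 1%N u') <= J * Num.sqrt (v - u').
      move=> au uv vb; apply: HJ => //; first exact: le_trans au.
      exact (dom_between (lexx 0) (le_trans (le_trans a0 au) uv) db vb).
    have ea := affine_left J0 fJ ab (lexx b) line; have eb := affine_right J0 fJ (lexx a) ab line.
    apply/asboolP; exists k0', k1 => x /andP[]; rewrite le_eqVlt => /predU1P[<-//|ax].
    by rewrite le_eqVlt => /predU1P[->//|xb]; rewrite line ?ax.
  rewrite /= lexx (ltW c0) /= all_rcons lexx (ltW c0) /=; apply/allP => y.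
  by rewrite memu => /andP[/andP[y0 yc] _]; rewrite !ltW.
have gz y : y \in 0 :: t -> g y = 0.
  have gh z : h z = 0 -> g z = 0 by move=> e; rewrite /g e mul0r if_same.
  rewrite inE mem_rcons inE memu => /predU1P[->|/predU1P[->|/andP[_ ys]]]; apply: gh => //; exact: hs.
have E0 := energy_piecewise (lexx 0) (_ : 0 < last 0 t) (_ : dom L (last 0 t)) pt (HF 1%N) Hg
  (k := F 1%N 0) _ pl gz.
rewrite lt_ in E0; have {}E0 := E0 c0 dc _ vg.
have {}E0 : energy L (F 1%N) g = 0.
  by apply: E0 => x /andP[x1 x2]; rewrite (_ : x = 0)//; apply/eqP; rewrite eq_le x1 x2.
have [d Hd] := cF 1%N; have := Hd g Hg; rewrite /= E0 (gz 0 (mem_head _ _)) mulr0 addr0 upairing0 addr0 => E.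
rewrite [RHS]E; apply: (omega_ext Hh (H1cM (HF 0%N) Hg)) => x dx; rewrite /g.
case: ifPn => [xI|xI]; first by rewrite mulrC divfK// Fnz.
rewrite mulr0; apply: hc => //; move: xI; have [x0 _] := dx.
by rewrite x0 /= -ltNge.
Qed.

Lemma tent_exists y : y \in s -> exists e : R -> R,
  [/\ H1c L (fun x => (e x)%:C), e y = 1 & forall z, z \in s -> z != y -> e z = 0].
Proof.
move=> ys; have [v [yv dv]] := dom_above (sL ys).
have y0 : 0 <= y by have [] := sL ys.
have ny : y \notin rem y s by rewrite mem_rem_uniqF.
have [e e0 He] := separated ny.
pose d := Num.min e (v - y); have d0 : 0 < d by rewrite lt_min e0 subr_gt0.
have d1 : d <= e by rewrite ge_min lexx.
have d2 : y + d <= v by rewrite -lerBrDl ge_min lexx orbT.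
have far z : d <= `|z - y| -> Num.max 0 (1 - `|z - y| / d) = 0.
  by move=> dz; apply/max_l; rewrite subr_le0 ler_pdivlMr// mul1r.
exists (fun x => Num.max 0 (1 - `|x - y| / d)); split.
- apply: (@H1cI _ _ _ v).
  + apply: (@H1loc_lip _ _ _ d^-1); first by rewrite invr_ge0 ltW.
    by move=> x z _ _; rewrite -rmorphB cabsC; exact: tent_lip.
  + exact: dv.
  + exact: le_lt_trans yv.
  + by move=> x _ vx; rewrite far// (le_trans _ (ler_norm _))//; lra.
- by rewrite subrr normr0 mul0r subr0; apply: max_r.
- by move=> z zs zy; apply: far; apply: le_trans d1 (He _ _); rewrite (rem_filter _ us) mem_filter /= zy.
Qed.

(** Subtracting [h y] times a tent at every node [y] leaves a function that vanishes at all nodes,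
    to which [omega_vanish] applies. *)
Lemma omega_discrete : exists W : R -> R, forall h, H1c L h ->
  omega S h = \sum_(y <- s) (W y)%:C * h y.
Proof.
have [e He] : {e : R -> R -> R & forall y, y \in s ->
    [/\ H1c L (fun x => (e y x)%:C), e y y = 1 & forall z, z \in s -> z != y -> e y z = 0]}.
  apply: (@choice _ _ (fun y e => y \in s -> [/\ H1c L (fun x => (e x)%:C), e y = 1 & forall z, z \in s -> z != y -> e z = 0])) => y.
  have [/tent_exists[e ?]|nys] := boolP (y \in s); first by exists e.
  by exists (fun=> 0).
exists (fun y => complex.Re (omega S (fun x => (e y x)%:C))) => h Hh.
have WE y : y \in s -> (complex.Re (omega S (fun x => (e y x)%:C)))%:C = omega S (fun x => (e y x)%:C).
  by move=> /He[H _ _]; apply: complex_ext => //=; apply/esym/(omega_real (g := S)).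
suff P t : {subset t <= s} -> uniq t -> forall h, H1c L h -> (forall y, y \in s -> y \notin t -> h y = 0) ->
    omega S h = \sum_(y <- t) (complex.Re (omega S (fun x => (e y x)%:C)))%:C * h y.
  by apply: P => // y ->.
elim: t => [|y t IH] sub ut f Hf fz; first by rewrite big_nil; apply: omega_vanish => // z zs; exact: fz.
have ys : y \in s by apply: sub; rewrite mem_head.
have [Hey ey1 ey0] := He y ys; move: ut => /= /andP[nyt ut].
have Hd := H1cD (H1cZ (- f y) Hey) Hf.
have := IH (fun z zt => sub z (mem_behead (s := y :: t) zt)) ut _ Hd.
rewrite (omega_lin _ Hey Hf) => E; rewrite big_cons WE//.
have -> : omega S f = omega S (fun x => (e y x)%:C) * f y + (- f y * omega S (fun x => (e y x)%:C) + omega S f).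
  by move: (omega S _) (omega S f) => o1 o2; ring.
congr (_ + _); rewrite E.
  apply: eq_big_seq => z zt; rewrite ey0 ?mulr0 ?add0r//; first by apply: sub; rewrite inE zt orbT.
  by apply: contraNneq nyt => <-.
move=> z zs zt; have [->|zy] := eqVneq z y; first by rewrite ey1 mulr1 addNr.
by rewrite ey0// mulr0 add0r fz// inE negb_or zy.
Qed.

Lemma upsilon_discrete (A : set (measurableTypeR R)) : measurable A ->
  upsilon S A = (\sum_(y <- s) (fine (upsilon S [set y]))%:E * \d_(y : measurableTypeR R) A)%E.
Proof.
move=> mA; rewrite (discrete_measureE us upsilon_null_off_nodes mA).
apply: eq_big_seq => y ys; rewrite fineK// ge0_fin_numE//.
by apply: upsilon_compact; [exact: compact_set1|move=> _ ->; exact: sL].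
Qed.

End Discreteness.

(** * Hankel determinants and rational approximation *)

Section Hankel.
Context {R : realFieldType} (s : int -> R).
Implicit Types (j : int) (c U V : {poly R}) (i k n : nat).

Definition hank j k : R := \det (\matrix_(p < k, q < k) s (j + p%:Z + q%:Z)).

(** The moment functional: for [j >= 0] and moments of a measure, the integral of [lambda ^+ j]
    times [c]; for [j] equal to [-1] or [-2], its formal continuation. *)
Definition sig j c : R := \sum_(q < size c) c`_q * s (j + q%:Z).

Lemma sigE j c n : (size c <= n)%N -> sig j c = \sum_(q < n) c`_q * s (j + q%:Z).
Proof.
move=> cn; rewrite /sig (big_ord_widen n (fun q : nat => c`_q * s (j + q%:Z)) cn) big_mkcond.
by apply: eq_bigr => q _; case: ltnP => // h; rewrite nth_default ?mul0r.
Qed.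

Lemma sigD j c e : sig j (c + e) = sig j c + sig j e.
Proof.
rewrite (sigE j (size_polyD c e)) (@sigE j c (maxn (size c) (size e))) ?leq_maxl//.
rewrite (@sigE j e (maxn (size c) (size e))) ?leq_maxr// -big_split.
by apply: eq_bigr => q _; rewrite coefD mulrDl.
Qed.

Lemma sigZ j a c : sig j (a *: c) = a * sig j c.
Proof.
by rewrite (sigE j (size_scale_leq a c)) /sig mulr_sumr; apply: eq_bigr => q _; rewrite coefZ mulrA.
Qed.

Lemma sig0 j : sig j 0 = 0.
Proof. by rewrite /sig size_poly0 big_ord0. Qed.

Lemma sigC j a : sig j a%:P = a * s j.
Proof. by rewrite (sigE j (size_polyC_leq1 a)) big_ord1 coefC /= addr0. Qed.

Lemma sigXM j c : sig j ('X * c) = sig (j + 1) c.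
Proof.
have h : (size ('X * c)%R <= (size c).+1)%N.
  by apply: leq_trans (size_polyMleq _ _) _; rewrite size_polyX.
rewrite (sigE j h) big_ord_recl coefXM /= mul0r add0r; apply: eq_bigr => q _.
by rewrite coefXM /= /bump /= -addrA; congr (_ * s (j + _)); lia.
Qed.

(** The coefficients of [c] solve a Hankel system with right-hand side [t] times the first unit
    vector; deleting the first row and column raises the index by 2. *)
Lemma cramer j j' k c t : j' = j + 2 -> (size c <= k.+1)%N ->
  (forall i, (i <= k)%N -> sig (j + i%:Z) c = t * (i == 0%N)%:R) ->
  hank j k.+1 * c`_0 = t * hank j' k.
Proof.
move=> -> sc H; rewrite /hank; set A : 'M[R]_k.+1 := \matrix_(p, q) _.
pose v : 'cV[R]_k.+1 := \col_q c`_q.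
have Av : A *m v = \col_i (t * (i == 0)%:R).
  apply/matrixP => i z; rewrite !mxE -(H i (ltn_ord i)) (sigE _ sc).
  by apply: eq_bigr => q _; rewrite !mxE mulrC.
have := congr1 (fun B : 'cV[R]_k.+1 => B 0 0) (congr1 (mulmx (\adj A)) Av).
rewrite mulmxA mul_adj_mx mul_scalar_mx !mxE => ->.
rewrite (bigD1 ord0) //= big1 ?addr0; last first.
  by move=> i i0; rewrite !mxE (negbTE i0) !mulr0.
rewrite !mxE eqxx mulr1 mulrC; congr (_ * _).
rewrite /cofactor /= expr0 mul1r; congr (\det _); apply/matrixP => p q.
by rewrite !mxE /= /bump /=; congr s; lia.
Qed.

Lemma hank0 j : hank j 0 = 1.
Proof. by rewrite /hank det_mx00. Qed.

Lemma hank1 j : hank j 1 = s j.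
Proof. by rewrite /hank det_mx11 mxE /= !addr0. Qed.

Lemma hank_kernel j k : hank j k = 0 -> exists2 c : {poly R}, c != 0 &
  (size c <= k)%N /\ forall i, (i < k)%N -> sig (j + i%:Z) c = 0.
Proof.
move=> /eqP/det0P[v v0 vA].
case: k v v0 vA => [|k] v v0 vA.
  by case/eqP: v0; apply/rowP => -[].
pose c : {poly R} := \poly_(q < k.+1) v 0 (inord q).
have cv (q : 'I_k.+1) : c`_q = v 0 q by rewrite coef_poly ltn_ord inord_val.
exists c; first by apply: contraNneq v0 => c0; apply/eqP/rowP => q; rewrite -cv c0 coef0 mxE.
split; first exact: size_poly.
move=> i ik; rewrite (sigE _ (size_poly _ _)).
have := congr1 (fun B : 'rV[R]_k.+1 => B 0 (Ordinal ik)) vA; rewrite !mxE => E.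
rewrite -[RHS]E; apply: eq_bigr => q _; rewrite cv mxE /=; congr (_ * s _); lia.
Qed.

Lemma kernel_hank j k c : c != 0 -> (size c <= k)%N ->
  (forall i, (i < k)%N -> sig (j + i%:Z) c = 0) -> hank j k = 0.
Proof.
move=> c0 ck H; apply/eqP/det0P; exists (\row_(q < k) c`_q).
  apply: contra c0 => /eqP v0; apply/eqP/polyP => i; rewrite coef0.
  have [ik|ki] := ltnP i k; last by rewrite nth_default// (leq_trans ck).
  by have := congr1 (fun B : 'rV[R]_k => B 0 (Ordinal ik)) v0; rewrite !mxE.
apply/rowP => i; rewrite !mxE -[RHS](H i (ltn_ord i)) (sigE _ ck).
by apply: eq_bigr => q _; rewrite !mxE; congr (_ * s _); lia.
Qed.

End Hankel.

(** * Moments and expansions at infinity *)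

Section PartialFractions.
Context {R : realFieldType} (s : int -> R) (l : seq R) (r : R -> R).
Hypothesis ul : uniq l.
Hypothesis r0 : forall x, x \in l -> 0 < r x.
Hypothesis sE : forall i : nat, s i%:Z = \sum_(x <- l) r x * x ^+ i.
Implicit Types (U V P F : {poly R}).

Definition nodepoly : {poly R} := \prod_(x <- l) (x%:P - 'X).
Definition codepoly y : {poly R} := \prod_(x <- l | x != y) (x%:P - 'X).
(** [nodepoly] times the Cauchy transform [\sum_x r x * U.[x] / (x - z)]. *)
Definition resid U : {poly R} := \sum_(x <- l) (r x * U.[x]) *: codepoly x.
(** The numerator of [m] over the denominator [nodepoly]. *)
Definition mupoly : {poly R} :=
  (- (s (- 2%:Z)) *: 'X - (s (- 1%:Z))%:P) * nodepoly + \sum_(x <- l) r x *: codepoly x.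

Lemma nodepoly_split y : y \in l -> nodepoly = (y%:P - 'X) * codepoly y.
Proof. by move=> yl; rewrite /nodepoly /codepoly (bigD1_seq y). Qed.

Lemma size_factor y : size (y%:P - 'X : {poly R}) = 2%N.
Proof. by rewrite -opprB size_polyN size_XsubC. Qed.

Lemma size_nodepoly : size nodepoly = (size l).+1.
Proof.
rewrite /nodepoly; elim: (l) => [|x t IH]; first by rewrite big_nil size_poly1.
by rewrite big_cons size_mul ?size_factor ?IH// -size_poly_eq0 ?size_factor ?IH.
Qed.

Lemma nodepoly_neq0 : nodepoly != 0.
Proof. by rewrite -size_poly_eq0 size_nodepoly. Qed.

Lemma size_codepoly y : y \in l -> size (codepoly y) = size l.
Proof.
move=> yl; have := size_nodepoly; rewrite (nodepoly_split yl) size_mul ?size_factor.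
- by rewrite add2n => -[].
- by rewrite -size_poly_gt0 size_factor.
- by apply: contraNneq nodepoly_neq0 => c0; rewrite (nodepoly_split yl) c0 mulr0.
Qed.

Lemma size_resid U : (size (resid U) <= size l)%N.
Proof.
rewrite /resid big_seq; apply: (big_ind (fun p : {poly R} => (size p <= size l)%N)).
- by rewrite size_poly0.
- by move=> p q hp hq; apply: leq_trans (size_polyD _ _) _; rewrite geq_max hp.
- by move=> x xl; apply: leq_trans (size_scale_leq _ _) _; rewrite size_codepoly.
Qed.

Lemma sigS i U : sig s i%:Z U = \sum_(x <- l) r x * (x ^+ i * U.[x]).
Proof.
rewrite /sig; under eq_bigr => q _ do rewrite -PoszD sE mulr_sumr.
rewrite exchange_big /=; apply: eq_bigr => x _; rewrite horner_coef !mulr_sumr.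
by apply: eq_bigr => q _; rewrite exprD; ring.
Qed.

(** This is [z / (x - z) = x / (x - z) - 1], summed over the support. *)
Lemma residXM U : 'X * resid U = resid ('X * U) - sig s 0 U *: nodepoly.
Proof.
rewrite (sigS 0 U) /resid mulr_sumr scaler_suml -sumrB big_seq [RHS]big_seq; apply: eq_bigr => x xl.
rewrite hornerM hornerX expr0 mul1r (nodepoly_split xl) -!mul_polyC !polyCM; ring.
Qed.

Lemma resid_lin a U V : resid (a *: U + V) = a *: resid U + resid V.
Proof.
rewrite /resid scaler_sumr -big_split /=; apply: eq_bigr => x _.
by rewrite hornerD hornerZ scalerA -scalerDl; congr (_ *: _); ring.
Qed.

(* Dividing [U(z) - U(x)] by [z - x] gives the polynomial part; its two lowest coefficients are
   the moments of negative index. *)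
Lemma resid_decomp U : exists Q : {poly R},
  [/\ (\sum_(x <- l) r x *: codepoly x) * U = resid U - Q * nodepoly,
      Q`_0 = sig s (- 1%:Z) U - s (- 1%:Z) * U`_0 &
      Q`_1 = sig s (- 2%:Z) U - s (- 2%:Z) * U`_0 - s (- 1%:Z) * U`_1].
Proof.
elim/poly_ind: U => [|U c [Q [E Q0 Q1]]].
  exists 0; rewrite mulr0 mul0r subr0 !sig0 !coef0 !mulr0 !subr0; split => //.
  by rewrite /resid big1// => x _; rewrite horner0 mulr0 scale0r.
rewrite (mulrC U); exists ('X * Q + (sig s 0 U)%:P); split.
- rewrite mulrDr mulrCA E mulrBr residXM.
  have -> : resid ('X * U + c%:P) = resid ('X * U) + c *: (\sum_(x <- l) r x *: codepoly x).
    rewrite addrC -[c%:P]mulr1 mul_polyC resid_lin addrC; congr (_ + _ *: _).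
    by rewrite /resid; apply: eq_bigr => x _; rewrite hornerE mulr1.
  by rewrite -!mul_polyC mulrDl; ring.
- by rewrite !coefD !coefXM !coefC /= !add0r sigD sigC sigXM addNr; ring.
- rewrite !coefD !coefXM !coefC /= !addr0 add0r Q0 sigD sigC sigXM (_ : - 2%:Z + 1 = - 1%:Z)//; ring.
Qed.

(** The hypothesis says that [m U + V] equals [F / P], which tends to 0 at infinity, so its
    polynomial part [Z] is zero. The two lowest coefficients of [Z] yield the moments of negative
    index. *)
Lemma laurent P U V F : P * (mupoly * U + V * nodepoly) = F * nodepoly ->
  (size F < size P)%N ->
  [/\ V`_0 = sig s (- 1%:Z) U, V`_1 = sig s (- 2%:Z) U & P * resid U = F * nodepoly].
Proof.
move=> E sF; have [Q [EQ Q0 Q1]] := resid_decomp U.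
pose Z := V + (- (s (- 2%:Z)) *: 'X - (s (- 1%:Z))%:P) * U - Q.
have EZ : mupoly * U + V * nodepoly = Z * nodepoly + resid U.
  rewrite /mupoly mulrDl EQ /Z; ring.
have P0 : P != 0 by rewrite -size_poly_gt0; exact: leq_ltn_trans sF.
have Z0 : Z = 0.
  apply/eqP; apply: contraLR sF => Zn; rewrite -leqNgt.
  have sZ : size (Z * nodepoly + resid U) = size (Z * nodepoly)%R.
    apply: size_polyDl; rewrite size_mul ?nodepoly_neq0// size_nodepoly addnS /=.
    apply: leq_ltn_trans (size_resid U) _; rewrite -[X in (X < _)%N]add0n ltn_add2r.
    by rewrite size_poly_gt0.
  have nz : Z * nodepoly + resid U != 0.
    by rewrite -size_poly_eq0 sZ size_poly_eq0 mulf_neq0// nodepoly_neq0.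
  have F0 : F != 0.
    by apply/eqP => F0; move: E; rewrite EZ F0 mul0r => /eqP; rewrite mulf_eq0 (negbTE P0) (negbTE nz).
  have := congr1 (fun p : {poly R} => size p) E.
  rewrite EZ !size_mul// ?nodepoly_neq0// sZ size_mul ?nodepoly_neq0// size_nodepoly.
  move: Zn; rewrite -size_poly_gt0; move: (size P) (size Z) (size F) (size l) => p z f n.
  by rewrite !addnS /= ?addnS /=; lia.
split.
- have := congr1 (fun p : {poly R} => p`_0) Z0; rewrite /Z coef0 !coefD !coefN Q0.
  rewrite mulrBl coefB -scalerAl coefZ coefXM coefCM /= mulr0 sub0r => /eqP.
  by rewrite subr_eq0 => /eqP h; apply/eqP; rewrite -subr_eq0; apply/eqP; move: h; lra.
- have := congr1 (fun p : {poly R} => p`_1) Z0; rewrite /Z coef0 !coefD !coefN Q1.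
  rewrite mulrBl coefB -scalerAl coefZ coefXM coefCM /= => h; lra.
- by rewrite -E EZ Z0 mul0r add0r.
Qed.

(** The Cauchy transform of [U] expands at infinity with coefficients [sig s i U] up to sign; each
    step multiplies by ['X] and compares degrees. The zero polynomial is a separate case because its
    size 0 would still limit [k] by [size l]. *)
Lemma resid_sig k U : (resid U == 0) || (size (resid U) + k <= size l)%N ->
  forall i, (i < k)%N -> sig s i%:Z U = 0.
Proof.
elim: k U => [//|k IH] U H.
have sX : (size ('X * resid U)%R <= size l)%N /\ ((resid U == 0) || (size ('X * resid U)%R + k <= size l)%N).
  have [->|nz] := eqVneq (resid U) 0; first by rewrite mulr0 size_poly0.
  move: H; rewrite (negbTE nz) /= => H.
  have h : (size ('X * resid U)%R <= (size (resid U)).+1)%N.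
    by apply: leq_trans (size_polyMleq _ _) _; rewrite size_polyX.
  by move: h H; rewrite /=; move: (size ('X * resid U)%R) (size (resid U)) (size l) => a c d; lia.
have s0 : sig s 0 U = 0.
  apply: contraTeq isT => nz.
  have : (size (sig s 0 U *: nodepoly) <= size l)%N.
    rewrite (_ : _ *: _ = resid ('X * U) - 'X * resid U); last by rewrite residXM; ring.
    by apply: leq_trans (size_polyD _ _) _; rewrite size_polyN geq_max size_resid sX.1.
  by rewrite size_scale// size_nodepoly ltnn.
have EX : resid ('X * U) = 'X * resid U by rewrite residXM s0 scale0r subr0.
case=> [//|i] ik; have := IH ('X * U) _ i ik; rewrite sigXM (_ : i%:Z + 1 = i.+1%:Z); last by lia.
by apply; rewrite EX mulf_eq0 polyX_eq0 /=; exact: sX.2.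
Qed.

(** The sum of these products is the integral of [U ^+ 2], and all residues are positive. *)
Lemma sig_sqr_eq0 U n : (forall i, (i < n)%N -> U`_i * sig s i%:Z U = 0) -> (size U <= n)%N ->
  forall x, x \in l -> U.[x] = 0.
Proof.
move=> H sU.
have S0 : \sum_(x <- l) r x * U.[x] ^+ 2 = 0.
  transitivity (\sum_(i < size U) U`_i * sig s i%:Z U).
    under [RHS]eq_bigr => i _ do rewrite sigS mulr_sumr.
    rewrite [RHS]exchange_big /=; apply: eq_bigr => x _.
    rewrite expr2 {1}horner_coef mulr_suml mulr_sumr; apply: eq_bigr => i _; ring.
  by rewrite big1// => i _; rewrite H// (leq_trans (ltn_ord i)).
move=> x xl; move: S0; rewrite (bigD1_seq x)//= => S0.
have h1 : 0 <= r x * U.[x] ^+ 2 by rewrite mulr_ge0 ?sqr_ge0// ltW// r0.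
have h2 : 0 <= \sum_(y <- l | y != x) r y * U.[y] ^+ 2.
  by rewrite big_seq_cond; apply: sumr_ge0 => y /andP[yl _]; rewrite mulr_ge0 ?sqr_ge0// ltW// r0.
have : r x * U.[x] ^+ 2 = 0 by lra.
by move/eqP; rewrite mulf_eq0 gt_eqF ?r0//= sqrf_eq0 => /eqP.
Qed.

Lemma vanish_eq0 (t : seq R) U : uniq t -> (forall x, x \in t -> U.[x] = 0) -> (size U <= size t)%N -> U = 0.
Proof.
move=> ut H st; apply: (roots_geq_poly_eq0 _ ut st).
by apply/allP => x /H h; apply/eqP.
Qed.

Lemma hank0_neq0 k : (k <= size l)%N -> hank s 0 k != 0.
Proof.
move=> kl; apply/eqP => /hank_kernel[c c0 [sc H]]; case/eqP: c0.
have H' i : (i < k)%N -> c`_i * sig s i%:Z c = 0 by move=> ik; rewrite -[i%:Z]add0r H ?mulr0.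
by apply: (vanish_eq0 ul (sig_sqr_eq0 H' sc)); exact: leq_trans sc kl.
Qed.

(** Positivity is applied to ['X * c]: moments from index 2 on belong to [lambda ^+ 2] times the
    measure, for which a node at 0 does not count. *)
Lemma hank2_neq0 k : (k <= size [seq x <- l | x != 0%R])%N -> hank s 2 k != 0.
Proof.
move=> kl; apply/eqP => /hank_kernel[c c0 [sc H]]; case/eqP: c0.
have H2 i : (i < k.+1)%N -> ('X * c)`_i * sig s i%:Z ('X * c) = 0.
  case: i => [|i] ik; first by rewrite coefXM mul0r.
  by rewrite sigXM (_ : i.+1%:Z + 1 = 2 + i%:Z) ?H ?mulr0//; lia.
have sX : (size ('X * c)%R <= k.+1)%N.
  by apply: leq_trans (size_polyMleq _ _) _; rewrite size_polyX.
apply: (vanish_eq0 (filter_uniq _ ul)) (leq_trans sc kl) => x; rewrite mem_filter => /andP[x0 xl].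
have := sig_sqr_eq0 H2 sX xl; rewrite hornerM hornerX => /eqP.
by rewrite mulf_eq0 (negbTE x0) /= => /eqP.
Qed.

End PartialFractions.

Section LaurentSig.
Context {R : realFieldType} (s : int -> R) (l : seq R) (r : R -> R).
Hypothesis ul : uniq l.
Hypothesis sE : forall i : nat, s i%:Z = \sum_(x <- l) r x * x ^+ i.

(** The condition on sizes is a zero of [F / P] at infinity of order at least [k + 1]. *)
Lemma laurent_sig k (P U V F : {poly R}) :
  P * (mupoly s l r * U + V * nodepoly l) = F * nodepoly l -> (size F + k.+1 <= size P)%N ->
  [/\ V`_0 = sig s (- 1%:Z) U, V`_1 = sig s (- 2%:Z) U & forall i, (i < k)%N -> sig s i%:Z U = 0].
Proof.
move=> E sF; have sF' : (size F < size P)%N by apply: leq_trans sF; rewrite addnS ltnS leq_addr.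
have [v0 v1 PR] := laurent ul sE E sF'; split => //; apply: (resid_sig ul sE).
have [//|nz] /= := eqVneq (resid l r U) 0.
have P0 : P != 0 by rewrite -size_poly_gt0; exact: leq_ltn_trans sF'.
have F0 : F != 0.
  by apply/eqP => F0; move: PR; rewrite F0 mul0r => /eqP; rewrite mulf_eq0 (negbTE P0) (negbTE nz).
have := congr1 (fun p : {poly R} => size p) PR.
rewrite !size_mul// ?(nodepoly_neq0 l)// size_nodepoly.
move: P0 F0 nz sF; rewrite -!size_poly_gt0.
move: (size P) (size (resid l r U)) (size F) (size l) => p q f n.
by rewrite !addnS /=; lia.
Qed.

End LaurentSig.

(** * Two-term recursion over the nodes *)

Section Recursion.
Context {R : realFieldType} (N : nat) (x w u : nat -> R) (iL : R).
Hypothesis x0 : x 0%N = 0.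
Hypothesis xlt : forall n, (n < N)%N -> x n < x n.+1.
Hypothesis wu : forall n, (0 < n <= N)%N -> (w n != 0) || (u n != 0).
Hypothesis xN : 1 - iL * x N != 0.

Definition mass n : {poly R} := ((u n)%:P * 'X + (w n)%:P) * 'X.

(** Value at [x n] and slope just to the left of [x n], for the solution with value [y] at 0 and
    slope [p] at [0-]. The mass at [x n] enters only in the next step. *)
Fixpoint transfer (y p : {poly R}) n : {poly R} * {poly R} :=
  if n is n'.+1 then
    let q := (transfer y p n').2 - mass n' * (transfer y p n').1 in
    ((transfer y p n').1 + (x n'.+1 - x n') *: q, q)
  else (y, p).

Local Notation A n := (transfer 1 0 n).1.
Local Notation E n := (transfer 1 0 n).2.
Local Notation B n := (transfer 0 1 n).1.
Local Notation C n := (transfer 0 1 n).2.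

(** For a line with value [v] at [x N] and slope [q], the condition at [L] is
    [iL * v + (1 - iL * x N) * q = 0], for finite and infinite [L] alike. [Pstar] and [Ostar] are
    its left-hand sides for the two basic solutions. *)
Definition Pstar := iL *: B N + (1 - iL * x N) *: C N.+1.
Definition Ostar := iL *: A N + (1 - iL * x N) *: E N.+1.

(** The degree of [mass n] at a node that carries mass. *)
Definition dmass n := (u n != 0%R).+1.
(** The degree of [C n], and eventually [kappa n]. The sum starts at 1 because [B 0 = 0] hides the
    mass at 0. *)
Definition degK n := (\sum_(1 <= i < n) dmass i)%N.

Lemma degK1 : degK 1 = 0%N.
Proof. by rewrite /degK big_geq. Qed.

Lemma degKS n : (0 < n)%N -> degK n.+1 = (degK n + dmass n)%N.
Proof. by move=> n0; rewrite /degK big_nat_recr. Qed.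

Lemma degK_lt n : (0 < n)%N -> (degK n < degK n.+1)%N.
Proof. by move=> n0; rewrite degKS// /dmass addnS ltnS leq_addr. Qed.

Lemma degK_le n k : (0 < n)%N -> (n <= k)%N -> (degK n <= degK k)%N.
Proof.
move=> n0; elim: k => [|k IH]; first by rewrite leqn0 => /eqP nn; rewrite nn in n0.
rewrite leq_eqVlt => /predU1P[->//|]; rewrite ltnS => nk.
by apply: leq_trans (IH nk) _; rewrite degKS ?leq_addr//; exact: leq_trans nk.
Qed.

Lemma size_mass n : (0 < n <= N)%N -> size (mass n) = (dmass n).+1.
Proof.
move=> /wu h; have sz : size ((u n)%:P * 'X + (w n)%:P) = dmass n.
  by rewrite size_MXaddC size_polyC polyC_eq0 /dmass; move: h; rewrite -negb_and andbC => /negbTE ->.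
by rewrite size_mulX ?sz// -size_poly_gt0 sz.
Qed.

Lemma mass_coef n p : [/\ (mass n * p)`_0 = 0, (mass n * p)`_1 = w n * p`_0 &
  (mass n * p)`_2 = w n * p`_1 + u n * p`_0].
Proof.
rewrite (_ : mass n * p = 'X * ('X * ((u n)%:P * p) + (w n)%:P * p)); last by rewrite /mass; ring.
by rewrite !coefXM /= !coefD !coefXM !coefCM /= add0r; split => //; rewrite addrC.
Qed.

Lemma coefA0 n : (A n)`_0 = 1 /\ (E n)`_0 = 0.
Proof.
elim: n => [|n [IA IE]]; first by rewrite /= coef1 coef0.
have [m0 _ _] := mass_coef n (A n).
by rewrite /= coefD coefZ !coefB m0 IA IE subrr mulr0 addr0.
Qed.

Lemma coefB0 n : (B n)`_0 = x n /\ (C n)`_0 = 1.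
Proof.
elim: n => [|n [IB IC]]; first by rewrite /= coef1 coef0 x0.
have [m0 _ _] := mass_coef n (B n).
by rewrite /= coefD coefZ !coefB m0 IB IC subr0 mulr1 addrC subrK.
Qed.

Definition wsum n := \sum_(k < n) w k.

Lemma coefE1 n : (E n)`_1 = - wsum n.
Proof.
elim: n => [|n IH]; first by rewrite /= coef0 /wsum big_ord0 oppr0.
have [_ m1 _] := mass_coef n (A n).
by rewrite /= coefB m1 IH (coefA0 n).1 mulr1 /wsum big_ord_recr /= opprD.
Qed.

Lemma coefE2 n : (E n.+1)`_2 = (E n)`_2 - w n * (A n)`_1 - u n.
Proof.
have [_ _ m2] := mass_coef n (A n).
by rewrite /= coefB m2 (coefA0 n).1 mulr1; ring.
Qed.

Lemma wronskian n : A n * C n - B n * E n = 1 /\ A n * C n.+1 - B n * E n.+1 = 1.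
Proof.
suff h : A n * C n - B n * E n = 1 by split => //; rewrite -[RHS]h /=; ring.
elim: n => [|n IH]; first by rewrite /= mul0r subr0 mulr1.
by rewrite -[RHS]IH /= -!mul_polyC; ring.
Qed.

(** Each mass raises the degree by [dmass], and strict growth excludes cancellation of leading
    terms; [B] follows since the distances of the nodes are positive. *)
Lemma size_transfer n : (n <= N)%N ->
  size (C n.+1) = (degK n.+1).+1 /\ ((n < N)%N -> size (B n.+1) = (degK n.+1).+1).
Proof.
elim: n => [|n IH] nN.
  rewrite degK1 /= mulr0 subr0 size_poly1; split => // /xlt h.
  by rewrite add0r size_scale ?size_poly1// subr_eq0 gt_eqF.
have [sC /(_ nN) sB] := IH (ltnW nN).
have sMB : size (mass n.+1 * B n.+1) = (degK n.+2).+1.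
  have sM : size (mass n.+1) = (dmass n.+1).+1 by apply: size_mass.
  rewrite size_mul -?size_poly_gt0; [|by rewrite sM|by rewrite sB].
  by rewrite sM sB (degKS (ltn0Sn n)) addnS /=; lia.
have sC' : size (C n.+2) = (degK n.+2).+1.
  rewrite -sMB -[RHS]size_polyN [C n.+2]/= addrC size_polyDl// size_polyN sMB.
  by rewrite [X in (X < _)%N]sC ltnS; exact: degK_lt.
split => // /xlt h; rewrite [B n.+2]/= addrC size_polyDl size_scale ?subr_eq0 ?gt_eqF//.
by rewrite [X in (_ < X)%N]sC' [X in (X < _)%N]sB ltnS; exact: degK_lt.
Qed.

Lemma size_Pstar : size Pstar = (degK N.+1).+1.
Proof.
have [sC _] := size_transfer (leqnn N).
have sCC : size ((1 - iL * x N) *: C N.+1) = (degK N.+1).+1 by rewrite size_scale.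
rewrite /Pstar addrC size_polyDl sCC//.
apply: leq_ltn_trans (size_scale_leq _ _) _.
case: (N) size_transfer => [|n] sz; first by rewrite size_poly0.
by have [_ /(_ (ltnSn _)) ->] := sz n (leqnSn _); rewrite ltnS; exact: degK_lt.
Qed.

Lemma Pstar0 : Pstar`_0 = 1.
Proof. by rewrite /Pstar coefD !coefZ (coefB0 N).1 (coefB0 N.+1).2; ring. Qed.

Lemma Ostar0 : Ostar`_0 = iL.
Proof. by rewrite /Ostar coefD !coefZ (coefA0 N).1 (coefA0 N.+1).2; ring. Qed.

(* The Weyl solution, rescaled by [Pstar], in terms of its values and slopes: polynomials whose
   degree decreases towards the right end. *)
Definition rightY n := Pstar * A n - Ostar * B n.
Definition rightP n := Pstar * E n - Ostar * C n.

Lemma right_end : rightY N = (1 - iL * x N)%:P /\ rightP N.+1 = (- iL)%:P.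
Proof.
have [_ wr] := wronskian N; have ww : (A N * C N.+1 - B N * E N.+1) = 1 := wr.
rewrite /rightY /rightP /Pstar /Ostar; split.
  transitivity ((1 - iL * x N)%:P * (A N * C N.+1 - B N * E N.+1)); last by rewrite ww mulr1.
  by rewrite -!mul_polyC; ring.
transitivity ((- iL)%:P * (A N * C N.+1 - B N * E N.+1)); last by rewrite ww mulr1.
by rewrite -!mul_polyC polyCN; ring.
Qed.

(** Induction from the right end, where both polynomials are constants: passing a node to the left
    raises the degree by at most that of its mass. *)
Lemma size_right n : (n <= N)%N -> (size (rightY (N - n)) <= degK N.+1 - degK (N - n).+1 + 1)%N /\
  (size (rightP (N - n).+1) <= degK N.+1 - degK (N - n).+1 + 1)%N.
Proof.
have [e1 e2] := right_end; elim: n => [|n IH] nN.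
  by rewrite subn0 e1 e2 !(leq_trans (size_polyC_leq1 _))// leq_addl.
have [IY IP] := IH (ltnW nN); have En : (N - n = (N - n.+1).+1)%N by lia.
move: IY IP; rewrite En; set k := (N - n.+1)%N => IY IP.
have kN : (k < N)%N by rewrite /k; lia.
have Pk : rightP k.+1 = rightP k.+2 + mass k.+1 * rightY k.+1 by rewrite /rightP /rightY /=; ring.
have Yk : rightY k = rightY k.+1 - (x k.+1 - x k) *: rightP k.+1.
  by rewrite /rightP /rightY /= -!mul_polyC; ring.
have dle := degK_le (ltn0Sn k) (leqnSn k.+1); have dN : (degK k.+2 <= degK N.+1)%N by exact: degK_le.
have sP : (size (rightP k.+1) <= degK N.+1 - degK k.+1 + 1)%N.
  rewrite Pk; apply: leq_trans (size_polyD _ _) _; rewrite geq_max; apply/andP; split.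
    by apply: leq_trans IP _; rewrite leq_add2r leq_sub2l.
  apply: leq_trans (size_polyMleq _ _) _; rewrite size_mass ?kN//.
  rewrite addSn /=; apply: leq_trans (leq_add (leqnn _) IY) _.
  by move: dN; rewrite (degKS (ltn0Sn k)); lia.
split => //; rewrite Yk; apply: leq_trans (size_polyD _ _) _; rewrite geq_max size_polyN.
rewrite (leq_trans (size_scale_leq _ _) sP) andbT.
by apply: leq_trans IY _; rewrite leq_add2r leq_sub2l.
Qed.

Lemma size_rightY n : (n <= N)%N -> (size (rightY n) <= degK N.+1 - degK n.+1 + 1)%N.
Proof. by move=> nN; have [+ _] := size_right (leq_subr n N); rewrite subKn. Qed.

Lemma size_rightP n : (0 < n <= N.+1)%N -> (size (rightP n) <= degK N.+1 - degK n + 1)%N.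
Proof. by case: n => // n nN; have [_] := size_right (leq_subr n N); rewrite subKn. Qed.

End Recursion.

(** * Hankel determinants from the string *)

Section InverseFormulas.
Context {R : realFieldType} (s : int -> R) (l : seq R) (r : R -> R).
Hypothesis ul : uniq l.
Hypothesis r0 : forall y, y \in l -> 0 < r y.
Hypothesis sE : forall i : nat, s i%:Z = \sum_(y <- l) r y * y ^+ i.
Variables (N : nat) (x w u : nat -> R) (iL : R).
Hypothesis x0 : x 0%N = 0.
Hypothesis xlt : forall n, (n < N)%N -> x n < x n.+1.
Hypothesis wu : forall n, (0 < n <= N)%N -> (w n != 0) || (u n != 0).
Hypothesis xN : 1 - iL * x N != 0.

Local Notation A n := (transfer x w u 1 0 n).1.
Local Notation E n := (transfer x w u 1 0 n).2.
Local Notation B n := (transfer x w u 0 1 n).1.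
Local Notation C n := (transfer x w u 0 1 n).2.
Local Notation P := (Pstar N x w u iL).
Local Notation O := (Ostar N x w u iL).
Local Notation K n := (degK u n).
Local Notation M := (nodepoly l).

Hypothesis star : 'X * mupoly s l r * P + O * M = 0.

Let sP : size P = (K N.+1).+1 := size_Pstar xlt wu xN.

(** The value [A n + z m B n] is [rightY n / Pstar], which vanishes at infinity to order at least
    [degK n.+1]. *)
Lemma laurentB n : (0 < n <= N)%N ->
  [/\ sig s 0 (B n) = 1, (A n)`_1 = sig s (- 2%:Z) ('X * B n) &
    forall i, (i.+1 < K n.+1)%N -> sig s i.+1%:Z (B n) = 0].
Proof.
move=> /andP[n0 nN]; have e1 : (K n.+1 <= K N.+1)%N by exact: degK_le.
have e2 : (0 < K n.+1)%N by apply: leq_ltn_trans (degK_lt u n0).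
have [] := @laurent_sig _ s l r ul sE (K n.+1).-1 P ('X * B n) (A n) (rightY N x w u iL n).
- transitivity (('X * mupoly s l r * P) * B n + P * A n * M); first by ring.
  by rewrite (_ : 'X * mupoly s l r * P = - (O * M)) /rightY; [ring|apply/eqP; rewrite -addr_eq0 star].
- by rewrite sP; have := size_rightY (x := x) wu xN nN; move: (size _) => f; lia.
rewrite (coefA0 x w u n).1 !sigXM => h1 h2 h3; split; [exact: esym h1|exact: h2|].
move=> i iK; have := h3 i; rewrite sigXM (_ : i%:Z + 1 = i.+1%:Z); [apply; lia|lia].
Qed.

(** The analogue for slopes; [E n] vanishes at 0, so a factor [z] cancels and [m] itself remains. *)
Lemma laurentC n : (0 < n <= N.+1)%N ->
  [/\ sig s (- 1%:Z) (C n) = - wsum w n, (E n)`_2 = sig s (- 2%:Z) (C n) &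
    forall i, (i < K n)%N -> sig s i%:Z (C n) = 0].
Proof.
move=> /andP[n0 nN]; have e1 : (K n <= K N.+1)%N by exact: degK_le.
have [q Eq] : exists q, E n = 'X * q.
  have /factor_theorem[q ->] : root (E n) 0 by rewrite /root horner_coef0 (coefA0 x w u n).2.
  by exists q; rewrite polyC0 subr0 mulrC.
have [] := @laurent_sig _ s l r ul sE (K n) ('X * P) (C n) q (rightP N x w u iL n).
- transitivity (('X * mupoly s l r * P) * C n + P * ('X * q) * M); first by ring.
  by rewrite -Eq (_ : 'X * mupoly s l r * P = - (O * M)) /rightP; [ring|apply/eqP; rewrite -addr_eq0 star].
- rewrite mulrC size_mulX -?size_poly_gt0 ?sP//.
  have nN' : (0 < n <= N.+1)%N by rewrite n0.
  by have := size_rightP (x := x) wu xN nN'; move: (size _) => f; lia.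
have -> : q`_0 = (E n)`_1 by rewrite Eq coefXM.
have -> : q`_1 = (E n)`_2 by rewrite Eq coefXM.
by rewrite coefE1 => ->.
Qed.

(** Here [O + z m P] is exactly zero, so no moment from index 1 on survives. *)
Lemma laurentP : sig s 0 P = iL /\ forall i, sig s i.+1%:Z P = 0.
Proof.
have E1 : 1 * (mupoly s l r * ('X * P) + O * M) = 0 * M.
  by rewrite mul1r mul0r -star; ring.
have [|h0 _ _] := laurent ul sE E1; first by rewrite size_poly0 size_poly1.
have [|h1 _ PR] := laurent ul sE E1; first by rewrite size_poly0 size_poly1.
have rz : resid l r ('X * P) = 0 by move: PR; rewrite mul1r mul0r.
have h0' : sig s (- 1%:Z + 1) P = iL by rewrite -sigXM -h0 Ostar0.
split; first exact: h0'.
move=> i; have := @resid_sig _ s l r ul sE i.+1 ('X * P).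
rewrite rz eqxx => /(_ isT i (ltnSn i)); rewrite sigXM (_ : i%:Z + 1 = i.+1%:Z) //.
by lia.
Qed.

Lemma sizeBC n : (0 < n <= N)%N -> size (B n) = (K n).+1 /\ size (C n) = (K n).+1.
Proof.
case: n => // n /= nN; have [sC /(_ nN) sB] := size_transfer xlt wu xN (ltnW nN).
by split; [exact: sB|exact: sC].
Qed.

Lemma sizeC n : (0 < n <= N.+1)%N -> size (C n) = (K n).+1.
Proof. by case: n => // n /= nN; have [sC _] := size_transfer xlt wu xN (n := n) nN. Qed.

(** [B n] has value [x n] at 0 and solves the Hankel system for the first unit vector. *)
Lemma hank_x n : (0 < n <= N)%N -> hank s 0 (K n).+1 * x n = hank s 2 (K n).
Proof.
move=> nN; have [b0 _ bi] := laurentB nN; have [sB _] := sizeBC nN.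
rewrite -(coefB0 w u x0 n).1 -[RHS]mul1r; apply: cramer; rewrite ?sB//.
case=> [|i] iK; first by rewrite b0 mulr1.
rewrite mulr0 add0r bi//; apply: leq_ltn_trans iK (degK_lt u _).
by case/andP: nN.
Qed.

(** [C n] has value 1 at 0, and in the system only its moment of index [-1] survives. *)
Lemma hank_w n : (0 < n <= N.+1)%N -> hank s (- 1%:Z) (K n).+1 = - wsum w n * hank s 1 (K n).
Proof.
move=> nN; have [c0 _ ci] := laurentC nN.
rewrite -[LHS]mulr1 -(coefB0 w u x0 n).2; apply: cramer; rewrite ?(sizeC nN)//.
case=> [|i] iK; first by rewrite addr0 c0 mulr1.
by rewrite mulr0 (_ : - 1%:Z + i.+1%:Z = i%:Z) ?ci//; lia.
Qed.

(** [tau] and [tau'] are the moments of index [-2] of [C k + wsum w k *: ('X * B n)] for [k = n] and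
    [k = n.+1]; their difference isolates [u n]. *)
Definition tau n := (E n)`_2 + wsum w n * (A n)`_1.
Definition tau' n := (E n.+1)`_2 + wsum w n.+1 * (A n)`_1.

Lemma tau_sub n : tau n - tau' n = u n.
Proof. by rewrite /tau /tau' coefE2 /wsum big_ord_recr /=; ring. Qed.

(** The multiple of ['X * B n] cancels the moment of index [-1] of [C k]. The combination has value
    1 at 0, and in the system only its moment of index [-2] survives. *)
Lemma hank_comb n k a : (0 < n <= N)%N -> (n <= k <= n.+1)%N ->
  (K n < a)%N -> (K k <= a)%N -> (forall i, (i.+1 < a)%N -> (i < K k)%N /\ (i.+1 < K n.+1)%N) ->
  hank s (- 2%:Z) a.+1 = ((E k)`_2 + wsum w k * (A n)`_1) * hank s 0 a.
Proof.
move=> nN nk Ka Kka H; have nN' := nN; case/andP: nN' => n0 nN1.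
have kN : (0 < k <= N.+1)%N by case/andP: nk => h1 h2; rewrite (leq_trans n0 h1) (leq_trans h2).
have [b0 b1 bi] := laurentB nN; have [c0 c1 ci] := laurentC kN; have [sB _] := sizeBC nN.
pose p := C k + wsum w k *: ('X * B n).
have p0 : p`_0 = 1 by rewrite coefD (coefB0 w u x0 k).2 coefZ coefXM mulr0 addr0.
rewrite -[LHS]mulr1 -p0; apply: cramer => //.
  apply: leq_trans (size_polyD _ _) _; rewrite geq_max (sizeC kN) ltnS Kka.
  apply: leq_trans (size_scale_leq _ _) _; apply: leq_trans (size_polyMleq _ _) _.
  by rewrite size_polyX sB.
case=> [|[|i]] ia; rewrite /p sigD sigZ !sigXM.
- by rewrite addr0 -c1 -sigXM -b1 mulr1.
- by rewrite (_ : - 2%:Z + 1%:Z = - 1%:Z)// c0 (_ : - 1%:Z + 1 = 0)// b0 !mulr1 mulr0 addNr.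
- have [h1 h2] := H i ia; rewrite (_ : - 2%:Z + i.+2%:Z = i%:Z); last by lia.
  by rewrite (_ : i%:Z + 1 = i.+1%:Z) ?ci ?bi// ?mulr0 ?addr0//; lia.
Qed.

Lemma hank_tau n : (0 < n <= N)%N -> hank s (- 2%:Z) (K n).+2 = tau n * hank s 0 (K n).+1.
Proof.
move=> nN; have [n0 _] := andP nN; have lt_ := degK_lt u n0.
by apply: hank_comb => //; rewrite ?leqnn ?leqnSn// => i iK; split => //; exact: leq_trans iK lt_.
Qed.

Lemma hank_tau' n : (0 < n <= N)%N -> hank s (- 2%:Z) (K n.+1).+1 = tau' n * hank s 0 (K n.+1).
Proof.
move=> nN; have [n0 _] := andP nN; have lt_ := degK_lt u n0.
by apply: hank_comb => //; rewrite ?leqnn ?leqnSn// => i iK; split => //; exact: ltnW.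
Qed.

(** The case [n = 1], where [C 1 = 1]. *)
Lemma moment_u0 : s (- 2%:Z) = - u 0%N /\ s (- 1%:Z) = - w 0%N.
Proof.
have [c0 c1 _] := laurentC (isT : (0 < 1 <= N.+1)%N).
have C1 : C 1 = 1%:P by rewrite /= mulr0 subr0.
rewrite C1 !sigC !mul1r in c0 c1; split; last by rewrite c0 /wsum big_ord1.
by rewrite -c1 coefE2 /= coef0 coef1 /= mulr0 subr0 sub0r.
Qed.

Lemma hank_L : hank s 0 (K N.+1).+1 = iL * hank s 2 (K N.+1).
Proof.
have [p0 pi] := laurentP.
rewrite -[LHS]mulr1 -(Pstar0 N w u iL x0); apply: cramer; rewrite ?sP//.
by case=> [|i] _; rewrite ?add0r ?p0 ?mulr1// pi mulr0.
Qed.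

(** [Pstar] is prime to [Ostar] by the Wronskian identity, hence divides [nodepoly]; its value 1 at
    0 excludes the root 0. *)
Lemma degK_support : (K N.+1 <= size [seq y <- l | y != 0%R])%N.
Proof.
set l0 := [seq y <- l | y != 0].
have cPO : coprimep P O.
  apply/Bezout_coprimepP; exists (A N, - B N) => /=.
  have [e1 _] := right_end N x w u iL.
  rewrite (_ : _ + _ = (1 - iL * x N) *: 1); first exact: eqp_scale.
  by rewrite alg_polyC -e1 /rightY; ring.
have PM : P %| M.
  rewrite -(Gauss_dvdpr _ cPO); apply/dvdpP; exists (- ('X * mupoly s l r)).
  by apply/eqP; rewrite mulNr -addr_eq0 addrC star.
have MX : M %| 'X * nodepoly l0.
  have [l0' | nl0] := boolP (0 \in l).
    rewrite (nodepoly_split ul l0') /codepoly -big_filter -/(nodepoly _) polyC0 sub0r mulNr.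
    by rewrite -mulrN dvdp_mul2l ?polyX_eq0// dvdpNl dvdpp.
  rewrite (_ : l0 = l) ?dvdp_mull//; apply/all_filterP/allP => y yl.
  by apply: contraNneq nl0 => <-.
have cPX : coprimep P 'X.
  by rewrite coprimepX /root horner_coef0 (Pstar0 N w u iL x0) oner_neq0.
have : P %| nodepoly l0 by rewrite -(Gauss_dvdpr _ cPX); exact: dvdp_trans MX.
by move=> /(dvdp_leq (nodepoly_neq0 l0)); rewrite sP size_nodepoly ltnS.
Qed.

Lemma degK_size : (K N.+1 <= size l)%N.
Proof. by apply: leq_trans degK_support _; rewrite size_filter count_size. Qed.

(** For a kernel vector [c], both ['X * c] and [C n] are orthogonal to all powers below [degK n].
    Their combination [q] of lower degree is orthogonal to itself, hence zero; evaluation at 0,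
    where [C n] is 1, gives [t = 0] and so [c = 0]. *)
Lemma hank1_neq0 n : (0 < n <= N.+1)%N -> hank s 1 (K n) != 0.
Proof.
move=> nN; have [n0 nN1] := andP nN; apply/eqP => /hank_kernel[c c0 [sc H]].
have [_ _ ci] := laurentC nN; have sC := sizeC nN.
have C0 : (C n)`_(K n) != 0 by have := lead_coef_eq0 (C n); rewrite lead_coefE sC /= -size_poly_eq0 sC => ->.
(* [t] cancels the coefficient of degree [degK n]; the Boolean factor is for [degK n = 0], where
   ['X * c] has coefficient 0. *)
pose t := c`_(K n).-1 * (K n != 0%N)%:R / (C n)`_(K n).
have ct : ('X * c)`_(K n) = t * (C n)`_(K n).
  by rewrite /t divfK// coefXM; case: (K n) => [|k] /=; rewrite ?mulr0 ?mulr1.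
pose q := 'X * c - t *: C n.
have sq : (size q <= K n)%N.
  apply/leq_sizeP => j; rewrite leq_eqVlt => /predU1P[<-|Kj].
    by rewrite coefB ct coefZ subrr.
  rewrite coefB coefXM coefZ [(C n)`_j]nth_default ?sC// mulr0 subr0.
  by case: j Kj => [|j] //= Kj; rewrite nth_default// (leq_trans sc).
have qi i : (i < K n)%N -> q`_i * sig s i%:Z q = 0.
  move=> iK; rewrite /q -scaleNr sigD sigZ ci// mulr0 addr0 sigXM.
  by rewrite (_ : i%:Z + 1 = 1 + i%:Z) ?H ?mulr0//; lia.
have q0 : q = 0.
  have sl : (size q <= size l)%N.
    by apply: leq_trans sq _; apply: leq_trans degK_size; exact: degK_le.
  exact (vanish_eq0 ul (sig_sqr_eq0 ul r0 sE qi sq) sl).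
have t0 : t = 0.
  have := congr1 (fun p : {poly R} => p`_0) q0; rewrite /q coefB coefXM coefZ (coefB0 w u x0 n).2 coef0 /=.
  by rewrite mulr1 sub0r => /eqP; rewrite oppr_eq0 => /eqP.
move: q0; rewrite /q t0 scale0r subr0 => /eqP; rewrite mulf_eq0 polyX_eq0 /=.
exact/negP.
Qed.

(** [B n], of degree [degK n], lies in the kernel: its moments of index 1 to [degK n.+1 - 1]
    vanish. *)
Lemma hank1_gap n k : (0 < n <= N)%N -> (K n < k)%N -> (k < K n.+1)%N -> hank s 1 k = 0.
Proof.
move=> nN Kk kK; have [_ _ bi] := laurentB nN; have [sB _] := sizeBC nN.
apply: (@kernel_hank _ _ _ _ (B n)); rewrite ?sB//.
  by rewrite -size_poly_gt0 sB.
move=> i ik; rewrite (_ : 1 + i%:Z = i.+1%:Z); last by lia.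
by apply: bi; exact: leq_ltn_trans kK.
Qed.

Lemma hank1_tail k : (K N.+1 < k)%N -> hank s 1 k = 0.
Proof.
move=> Kk; have [_ pi] := laurentP; apply: (@kernel_hank _ _ _ _ P); rewrite ?sP//.
  by rewrite -size_poly_gt0 sP.
by move=> i _; rewrite (_ : 1 + i%:Z = i.+1%:Z) ?pi//; lia.
Qed.

Definition hcount k := count (fun i => hank s 1 i != 0) (iota 0 k.+1).

Lemma hcountS k : hcount k.+1 = (hcount k + (hank s 1 k.+1 != 0)%R)%N.
Proof. by rewrite /hcount -[k.+2]addn1 iotaD count_cat /= addn0. Qed.

(** The determinants vanish strictly between consecutive values of [degK], so the count rises by one
    exactly there. *)
Lemma hcount_degK n : (0 < n <= N.+1)%N ->
  hcount (K n) = n /\ forall k, (k < K n)%N -> (hcount k < n)%N.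
Proof.
elim: n => [//|n IH] /= nN; case: n IH nN => [|n] IH nN.
  by rewrite degK1 /hcount /= hank0 oner_neq0.
have [h1 h2] := IH (ltnW nN).
have h3 : hank s 1 (K n.+2) != 0 by apply: hank1_neq0.
have nN' : (0 < n.+1 <= N)%N by [].
have gap k : (K n.+1 <= k)%N -> (k < K n.+2)%N -> hcount k = n.+1.
  elim: k => [|k IHk] k1 k2; first by move: k1; rewrite leqn0 => /eqP k1; rewrite -[in LHS]k1.
  move: k1; rewrite leq_eqVlt => /predU1P[<-//|k1].
  by rewrite hcountS IHk ?(ltnW k2)// (hank1_gap nN' k1 k2) eqxx addn0.
have lt_ := degK_lt u (ltn0Sn n).
have E1 : K n.+2 = (K n.+2).-1.+1 by rewrite prednK//; exact: leq_ltn_trans lt_.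
split.
  have g : hcount (K n.+2).-1 = n.+1 by apply: gap; rewrite -ltnS -E1.
  by rewrite {1}E1 hcountS -E1 h3 g addn1.
move=> k kK; have [k1|k1] := ltnP k (K n.+1); first by apply: leq_trans (h2 k k1) _.
by rewrite gap.
Qed.

Lemma hcount_tail k : (K N.+1 <= k)%N -> hcount k = N.+1.
Proof.
have NN : (0 < N.+1 <= N.+1)%N by rewrite /= leqnn.
have [h1 _] := hcount_degK NN.
elim: k => [|k IH] Kk; first by move: Kk; rewrite leqn0 => /eqP Kk; rewrite -[in LHS]Kk h1.
move: Kk; rewrite leq_eqVlt => /predU1P[<-|Kk]; first by rewrite h1.
by rewrite hcountS IH// (hank1_tail Kk) eqxx addn0.
Qed.

(** This identifies [kappa n] with [degK n]; the search range reaches it because [degK n] is at most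
    the number of support points. *)
Lemma find_hcount D n : (size l <= D)%N -> (0 < n <= N.+1)%N ->
  find (fun k => hcount k == n) (iota 0 D.+1) = K n.
Proof.
move=> lD nN; have [h1 h2] := hcount_degK nN; have [n0 nN1] := andP nN.
have KD : (K n < D.+1)%N by rewrite ltnS (leq_trans (degK_le u n0 nN1))// (leq_trans degK_size).
have hs : has (fun k => hcount k == n) (iota 0 D.+1).
  by apply/hasP; exists (K n); rewrite ?mem_iota ?h1.
set f := find _ _; have fD : (f < D.+1)%N by have := hs; rewrite has_find size_iota.
have := nth_find 0%N hs; rewrite -/f nth_iota// add0n => /eqP fn.
have [fK|Kf|//] := ltngtP f (K n); first by have := h2 f fK; rewrite fn ltnn.
by have := before_find 0%N Kf; rewrite nth_iota// add0n h1 eqxx.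
Qed.

End InverseFormulas.

(** * The transfer recursion and the theorem *)

Section BigNodes.
Context {R : realType} (T : Type) (idx : T) (op : Monoid.com_law idx).

(** The node 0 is kept even without mass, since the formulas treat the weights at 0 separately. *)
Lemma big_nodes (s : seq R) (c : pred R) (G : R -> T) : uniq s -> 0 \in s ->
  (forall y, y \in s -> y != 0 -> ~~ c y -> G y = idx) ->
  \big[op/idx]_(y <- s) G y =
  \big[op/idx]_(i < (size [seq y <- s | (y != 0) && c y]).+1)
     G (nth 0 (0 :: sort <=%R [seq y <- s | (y != 0) && c y]) i).
Proof.
move=> us s0 H; set t := [seq y <- s | _].
transitivity (\big[op/idx]_(y <- 0 :: sort <=%R t) G y); last first.
  by rewrite (big_nth 0) big_mkord /= size_sort.
rewrite (bigD1_seq 0)//= big_cons; congr (op _ _).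
rewrite (bigID c)/= [X in op _ X]big_seq_cond [X in op _ X]big1 ?Monoid.mulm1; last first.
  by move=> y /and3P[ys y0 cy]; exact: H.
by rewrite -big_filter; apply: perm_big; rewrite perm_sym perm_sort.
Qed.

End BigNodes.

Section DiscreteString.
Context {R : realType} (S : gen_indefinite_string R).
Local Notation L := (len S).

Definition discrete_form N (x w u : nat -> R) :=
  [/\ x 0%N = 0 /\ (forall n, (n < N)%N -> x n < x n.+1),
      dom L (x N),
      (forall n, (n <= N)%N -> 0 <= u n) /\ (forall n, (0 < n <= N)%N -> (w n != 0) || (u n != 0)),
      (forall h, H1c L h -> omega S h = \sum_(n < N.+1) (w n)%:C * h (x n)) &
      (forall A : set (measurableTypeR R), measurable A ->
         upsilon S A = (\sum_(n < N.+1) (u n)%:E * \d_(x n : measurableTypeR R) A)%E) /\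
      (forall f h, upairing S f h = \sum_(n < N.+1) (u n)%:C * (f (x n) * h (x n)))].

Lemma discrete_form_exists (F : nat -> R -> R[i]) n : (forall j, tame S (F j)) -> chain S F ->
  (exists2 x, dom L x & F 0%N x != 0) -> (forall j x, (n <= j)%N -> F j x = 0) ->
  exists N x w u, discrete_form N x w u.
Proof.
move=> tF cF F0n Fn; have [s [us s0 sL sfree]] := nodes_exist tF cF F0n Fn.
have [W HW] := omega_discrete tF cF F0n us s0 sL sfree.
have HU := upsilon_discrete us s0 sL sfree.
have n0 := upsilon_null_off_nodes s0 sfree.
(* Nodes other than 0 without mass are discarded, so that every step of the recursion raises the
   degree. *)
pose U y := fine (upsilon S [set y]); pose c y := (W y != 0) || (U y != 0).
pose t := [seq y <- s | (y != 0) && c y]; pose xs := 0 :: sort <=%R t.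
pose x i := nth 0 xs i.
have memt y : (y \in sort <=%R t) = [&& y != 0, c y & y \in s] by rewrite mem_sort mem_filter -andbA.
have pt : path <%R 0 (sort <=%R t).
  rewrite path_sortedE; last exact: lt_trans.
  rewrite sort_lt_sorted filter_uniq// andbT; apply/allP => y; rewrite memt => /and3P[y0 _ ys].
  by rewrite lt_neqAle eq_sym y0; have [] := sL y ys.
have xin i : (i < (size t).+1)%N -> x i \in s.
  move=> it; have : x i \in xs by apply: mem_nth; rewrite /= size_sort.
  by rewrite inE memt => /predU1P[->|/and3P[]].
exists (size t), x, (fun i => W (x i)), (fun i => U (x i)); split.
- split => // i it; have := pathP 0 pt i; rewrite size_sort => /(_ it); exact.
- exact: sL (xin _ (ltnSn _)).
- split=> [i _|[//|i] /= it]; first by rewrite fine_ge0.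
  have : x i.+1 \in sort <=%R t by apply: mem_nth; rewrite size_sort.
  by rewrite memt => /and3P[].
- move=> h Hh; rewrite HW//; apply: (@big_nodes _ _ _ _ s c) => // y _ _.
  by rewrite negb_or negbK => /andP[/eqP -> _]; rewrite mul0r.
have Ufin y : y \in s -> (upsilon S [set y] < +oo)%E.
  by move=> ys; apply: upsilon_compact; [exact: compact_set1|move=> _ ->; exact: sL].
split.
  move=> A mA; rewrite HU//; apply: (@big_nodes _ _ _ _ s c) => // y _ _.
  by rewrite negb_or !negbK => /andP[_ /eqP]; rewrite /U => ->; rewrite mul0e.
move=> f h; transitivity (\sum_(y <- s) (U y)%:C * (f y * h y)); last first.
  apply: (@big_nodes _ _ _ _ s c) => // y _ _.
  by rewrite negb_or !negbK => /andP[_ /eqP]; rewrite /U => ->; rewrite mul0r.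
have dE (g : R -> R) : \sum_(y <- s | y \in dom L) g y * fine (upsilon S [set y]) = \sum_(y <- s) g y * U y.
  by rewrite big_seq_cond [RHS]big_seq; apply: eq_bigl => y; case ys : (y \in s) => //=; apply/mem_set; exact: sL.
rewrite /upairing /cintegral !(discrete_RintegralE us n0 Ufin) !dE.
apply: complex_ext; rewrite ?(Re_sum, Im_sum); apply: eq_bigr => y _.
  by rewrite [RHS]ReM [complex.Re _%:C]/= [complex.Im _%:C]/= mul0r subr0 mulrC.
by rewrite [RHS]ImM [complex.Re _%:C]/= [complex.Im _%:C]/= mul0r addr0 mulrC.
Qed.

End DiscreteString.

Section ComplexEvaluation.
Context {R : realType} (z : R[i]).
Implicit Types p q : {poly R}.

Definition ceval (p : {poly R}) : R[i] := (map_poly (real_complex R) p).[z].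

Lemma cevD p q : ceval (p + q) = ceval p + ceval q. Proof. by rewrite /ceval rmorphD hornerD. Qed.
Lemma cevN p : ceval (- p) = - ceval p. Proof. by rewrite /ceval rmorphN hornerN. Qed.
Lemma cevM p q : ceval (p * q) = ceval p * ceval q. Proof. by rewrite /ceval rmorphM hornerM. Qed.
Lemma cevZ a p : ceval (a *: p) = a%:C * ceval p.
Proof. by rewrite /ceval map_polyZ hornerZ. Qed.
Lemma cevC a : ceval a%:P = a%:C. Proof. by rewrite /ceval map_polyC hornerC. Qed.
Lemma cevX : ceval 'X = z. Proof. by rewrite /ceval map_polyX hornerX. Qed.

End ComplexEvaluation.

(** * Solutions on a discrete string *)

Section ForwardRecursion.
Context {R : realType} (S : gen_indefinite_string R).
Local Notation L := (len S).
Variables (N : nat) (x w u : nat -> R).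
Hypothesis df : discrete_form S N x w u.

Lemma nodes_mono i j : (i <= j)%N -> (j <= N)%N -> x i <= x j.
Proof.
have [[_ xlt] _ _ _ _] := df.
elim: j => [|j IH]; first by rewrite leqn0 => /eqP ->.
rewrite leq_eqVlt => /predU1P[->//|ij] jN.
exact: le_trans (IH ij (ltnW jN)) (ltW (xlt j jN)).
Qed.

Lemma nodes_lt i j : (i < j)%N -> (j <= N)%N -> x i < x j.
Proof.
move=> ij jN; have [[_ xlt] _ _ _ _] := df.
exact: lt_le_trans (xlt i (leq_trans ij jN)) (nodes_mono ij jN).
Qed.

Lemma node_ge0 n : (n <= N)%N -> 0 <= x n.
Proof. by move=> nN; have [[x0 _] _ _ _ _] := df; rewrite -x0; exact: nodes_mono. Qed.

Lemma node_dom n : (n <= N)%N -> dom L (x n).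
Proof.
by move=> nN; have [_ dN _ _ _] := df; exact (dom_between (lexx 0) (node_ge0 nN) dN (nodes_mono nN (leqnn _))).
Qed.

Variables (z d : R[i]) (f : R -> R[i]).
Hypothesis sol : solution S z f d.
Let m k : R[i] := z * (w k)%:C + z ^+ 2 * (u k)%:C.
Let slope n := d - \sum_(k < n) m k * f (x k).

(** The ramp from [x n] to [t] is 1 at the nodes up to [n] and 0 at the later ones, so testing with
    it gives the difference quotient as the initial slope minus the jumps passed. *)
Lemma solution_step n t : (n <= N)%N -> x n < t -> dom L t -> ((n < N)%N -> t <= x n.+1) ->
  f t - f (x n) = (t - x n)%:C * slope n.+1.
Proof.
move=> nN xt dt tx; have x0 := node_ge0 nN; have t0 := le_lt_trans x0 xt.
have Hh := H1c_cramp xt t0 dt.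
have h0 : cramp (x n) t 0 = 1 :> R[i] by rewrite /cramp (ramp_left xt x0).
have [_ _ _ wE [_ uE]] := df.
have := solutionE sol Hh; rewrite h0 mulr1 (energy_cramp sol.1 x0 xt dt).
rewrite /opairing (wE _ (H1cM sol.1 Hh)) uE !mulr_sumr -big_split /=.
rewrite (eq_bigr (fun k : 'I_N.+1 => if (k < n.+1)%N then m k * f (x k) else 0)); last first.
  move=> k _; rewrite /cramp ltnS; case: leqP => [kn|nk].
    by rewrite (ramp_left xt (nodes_mono kn nN)) /m; ring.
  have kN : (k <= N)%N by rewrite -ltnS.
  rewrite (ramp_right xt) ?mulr0 ?addr0//.
  by apply: le_trans (tx (leq_trans nk kN)) _; exact: nodes_mono.
rewrite -big_mkcond /= -(big_ord_widen N.+1 (fun k => m k * f (x k))) ?ltnS// => E.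
have tn : (t - x n)%:C != 0 :> R[i] by rewrite (inj_eq (@complexI _)) subr_eq0 gt_eqF.
rewrite /slope -E; move: (t - x n)%:C (f t - f (x n)) tn => a b a0; field.
by [].
Qed.

Local Notation cev := (ceval z).

Lemma cev_mass n : cev (mass w u n) = m n.
Proof. by rewrite /mass cevM cevD cevM !cevC cevX /m; ring. Qed.

Hypothesis f0 : f 0 = 1.
Let A n := cev (transfer x w u 1 0 n).1 + d * cev (transfer x w u 0 1 n).1.
Let E n := cev (transfer x w u 1 0 n).2 + d * cev (transfer x w u 0 1 n).2.

Lemma solution_transfer n : (n <= N)%N -> f (x n) = A n /\ slope n = E n.
Proof.
have [[x0 xlt] _ _ _ _] := df.
elim: n => [|n IH] nN.
  rewrite x0 f0 /A /E /slope big_ord0 /= -!polyC1 -!polyC0 !cevC subr0 !rmorph1 !rmorph0.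
  by rewrite mulr0 mulr1 addr0 add0r.
have [IA IE] := IH (ltnW nN).
have slS : slope n.+1 = E n.+1.
  rewrite /slope big_ord_recr opprD addrA -/(slope n) IE IA /= /E /A !(cevD, cevN) !(cevM _ (mass w u n)) cev_mass; ring.
split => //.
have := solution_step (ltnW nN) (xlt n nN) (node_dom nN) (fun _ => lexx _); rewrite slS IA => h.
rewrite -[LHS](subrK (A n)) h /A /E /= !(cevD, cevN, cevZ) !(cevM _ (mass w u n)) cev_mass; ring.
Qed.

Lemma slope_end : slope N.+1 = E N.+1.
Proof.
have [IA IE] := solution_transfer (leqnn N).
by rewrite /slope big_ord_recr opprD addrA -/(slope N) IE IA /= /E /A !(cevD, cevN) !(cevM _ (mass w u N)) cev_mass; ring.
Qed.

Lemma weyl_end : tame S f ->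
  ceval z (Ostar N x w u (inv_length L)) + d * ceval z (Pstar N x w u (inv_length L)) = 0.
Proof.
move=> tf; have [IA _] := solution_transfer (leqnn N); have sE := slope_end.
pose k0 := f (x N) - slope N.+1 * (x N)%:C.
have lin t : dom L t -> x N <= t -> f t = k0 + slope N.+1 * t%:C.
  move=> dt; rewrite le_eqVlt => /predU1P[<-|xt]; first by rewrite subrK.
  have := solution_step (leqnn N) xt dt _; rewrite ltnn => /(_ (fun h => False_ind _ (notF h))).
  by rewrite /k0 rmorphB /= => h; rewrite -[LHS](subrK (f (x N))) h; ring.
have := tame_end tf (node_dom (leqnn N)) lin; rewrite /k0 IA sE => h.
rewrite -[RHS]h /Ostar /Pstar !cevD !cevZ /A /E rmorphB rmorphM rmorph1; ring.
Qed.

End ForwardRecursion.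

Section SpectralFormula.
Context {R : realType} (rho : {measure set (measurableTypeR R) -> \bar R}).
Variables (l : seq R) (m : R[i] -> R[i]) (a b : R).
Hypotheses (ul : uniq l) (fin_l : forall y, y \in l -> (0 < rho [set y] < +oo)%E).
Hypothesis null_l : rho (~` [set` l]) = 0%E.
Hypothesis Hm : herglotz_representation m a b rho.
Let r y := fine (rho [set y]).

Lemma Rintegral_rho (f : R -> R) : Rintegral rho [set: R] f = \sum_(y <- l) r y * f y.
Proof.
rewrite (discrete_RintegralE ul null_l); last by move=> y /fin_l/andP[].
by apply: eq_big => y; [rewrite in_setT|rewrite mulrC].
Qed.

Lemma residue_gt0 y : y \in l -> 0 < r y.
Proof. by move=> /fin_l; exact: fine_gt0. Qed.

Lemma moment_nat (i : nat) : moment a b rho i%:Z = \sum_(y <- l) r y * y ^+ i.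
Proof. exact: Rintegral_rho. Qed.

(** The regularizing terms sum to [a] plus the moment of index [-1], which leaves minus that moment
    as the constant. *)
Lemma herglotz_fractions z : 0 < Im z ->
  m z = (- moment a b rho (- 1%:Z))%:C + b%:C * z + \sum_(y <- l) (r y)%:C / (y%:C - z).
Proof.
move=> z0; have [_ _ ->] := Hm; last by rewrite gt_eqF.
have -> : cintegral rho [set: R] (fun y => (y%:C - z)^-1 - (y / (1 + y ^+ 2))%:C) =
    \sum_(y <- l) (r y)%:C * ((y%:C - z)^-1 - (y / (1 + y ^+ 2))%:C).
  apply: complex_ext; rewrite ?(Re_sum, Im_sum) [LHS]/= Rintegral_rho; apply: eq_bigr => y _.
    by rewrite [RHS]ReM [complex.Re _%:C]/= [complex.Im _%:C]/= mul0r subr0.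
  by rewrite [RHS]ImM [complex.Re _%:C]/= [complex.Im _%:C]/= mul0r addr0.
under eq_bigr => y _ do rewrite mulrBr -rmorphM /=.
rewrite sumrB -rmorph_sum /= /moment /= Rintegral_rho opprB rmorphB /=; ring.
Qed.

End SpectralFormula.

(** * From a rational Weyl function to a discrete string *)

Section DiscreteFromRational.
Context {R : realType} (S : gen_indefinite_string R) (m : R[i] -> R[i]).
Variables (s : int -> R) (l : seq R) (r : R -> R).
Local Notation L := (len S).
Hypothesis wt : weyl_titchmarsh S m.
Hypothesis ul : uniq l.
Hypothesis mE : forall z, 0 < Im z ->
  m z = (- s (- 1%:Z))%:C + (- s (- 2%:Z))%:C * z + \sum_(y <- l) (r y)%:C / (y%:C - z).

Lemma inv_length_dom t : dom L t -> 1 - inv_length L * t != 0.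
Proof.
move=> [t0 tL]; rewrite subr_eq0; case EL : L (len_gt0 S) tL => [k| |]//= k0 tk.
  by rewrite lte_fin in tk k0; rewrite gt_eqF// mulrC ltr_pdivrMr ?mul1r.
by rewrite mul0r oner_eq0.
Qed.

(** The recursion gives [Ostar + z m Pstar = 0] in the upper half-plane; multiplied by [nodepoly]
    this is an identity of real polynomials, checked at the points [ipoint]. *)
Lemma discrete_string : exists N x w u, discrete_form S N x w u /\
  'X * mupoly s l r * Pstar N x w u (inv_length L) + Ostar N x w u (inv_length L) * nodepoly l = 0.
Proof.
have [phi phiW phiI] := weyl_interpolation wt mE.
have [n [f [tf fn [j1 fj1] fE]]] := weyl_chain ul phiW phiI.
have Hf j : H1loc L (f j) by have [] := tf j.
have cf : chain S f := chain_of_coef Hf fE.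
have d0 : dom L 0 by split => //; exact: len_gt0.
(* The chain is restarted at its first function that is not identically zero, because [chain0_form]
   concerns index 0. *)
have ex : exists j, `[< exists2 x, dom L x & f j x != 0 >] by exists j1; apply/asboolP; exists 0.
pose j0 := ex_minn ex.
have [nz min] : (exists2 x, dom L x & f j0 x != 0) /\ forall j, (j < j0)%N -> forall x, dom L x -> f j x = 0.
  rewrite /j0; case: ex_minnP => j /asboolP nz min; split => // i ij x dx.
  apply/eqP; apply: contraTT ij => fx; rewrite -leqNgt; apply: min; apply/asboolP; by exists x.
have cF := chain_shift Hf cf min.
have nz' : exists2 x, dom L x & f (j0 + 0)%N x != 0 by rewrite addn0.
have Fn j x : (n <= j)%N -> f (j0 + j)%N x = 0 by move=> nj; apply: fn; rewrite (leq_trans nj)// leq_addl.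
have [N [x [w [u df]]]] := discrete_form_exists (fun j => tf (j0 + j)%N) cF nz' Fn.
exists N, x, w, u; split => //.
apply: (map_poly_inj (real_complex R)); rewrite rmorph0; apply: poly_eq0_ipoint => i.
set z := ipoint i; have z0 : 0 < Im z := Im_ipoint i.
have [sol p0 hol van] := phiW z z0.
have tphi : tame S (phi z) by split => //; exact: sol.1.
have E := weyl_end df sol p0 tphi.
have cy y : y \in l -> ceval z (nodepoly l) = (y%:C - z) * ceval z (codepoly l y).
  move=> yl; by rewrite (nodepoly_split ul yl) cevM cevD cevN cevC cevX.
have mu : ceval z (mupoly s l r) = m z * ceval z (nodepoly l).
  rewrite mE// /mupoly cevD cevM cevD cevN cevZ cevX cevC.
  rewrite (_ : ceval z (\sum_(y <- l) r y *: codepoly l y) = \sum_(y <- l) (r y)%:C / (y%:C - z) * ceval z (nodepoly l)).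
    by rewrite -mulr_suml !rmorphN /=; ring.
  rewrite /ceval rmorph_sum horner_sum big_seq [RHS]big_seq; apply: eq_bigr => y yl.
  rewrite -!/(ceval z _) cevZ (cy y yl) mulrA divfK//; exact: real_sub_neq0.
rewrite -/(ceval z _) cevD !cevM cevX mu.
transitivity ((ceval z (Ostar N x w u (inv_length L)) + z * m z * ceval z (Pstar N x w u (inv_length L))) * ceval z (nodepoly l)); first by ring.
by rewrite E mul0r.
Qed.

End DiscreteFromRational.

(** The equation reconciles different spellings of the same integer, such as [-1] and [- 1%:Z]. *)
Lemma hankelE (R : realType) (s : int -> R) j j' k : j = j' -> hankel s j k = hank s j' k.
Proof. by move=> ->. Qed.

Theorem proposition2p2 (R : realType) (S : gen_indefinite_string R)
    (m : R[i] -> R[i]) (a b : R)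
    (rho : {measure set (measurableTypeR R) -> \bar R}) (D : nat) :
  weyl_titchmarsh S m ->
  herglotz_representation m a b rho ->
  rational_with_poles m D ->
  let s := moment a b rho in
  let Delta := hankel s in
  let N := Nindex s D in
  let kappa := kappa_index s D in
  let x (n : nat) : R := Delta 2 (kappa n) / Delta 0 (kappa n).+1 in
  let w (n : nat) : R :=
    if n is 0%N then - (Delta (-1) 1%N / Delta 1 0%N)
    else Delta (-1) (kappa n).+1 / Delta 1 (kappa n)
         - Delta (-1) (kappa n.+1).+1 / Delta 1 (kappa n.+1) in
  let u (n : nat) : R :=
    if n is 0%N then - (Delta (-2) 1%N / Delta 0 0%N)
    else Delta (-2) (kappa n).+2 / Delta 0 (kappa n).+1
         - Delta (-2) (kappa n.+1).+1 / Delta 0 (kappa n.+1) in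
  (* all denominators are non-zero *)
  [/\ Delta 2 (kappa N.+1) != 0,
      forall n, (1 <= n <= N.+1)%N -> Delta 1 (kappa n) != 0 &
      forall n, (1 <= n <= N)%N ->
        Delta 0 (kappa n).+1 != 0 /\ Delta 0 (kappa n.+1) != 0] /\
  [/\ inv_length (len S) = Delta 0 (kappa N.+1).+1 / Delta 2 (kappa N.+1),
      (forall n, (1 <= n <= N)%N -> 0 < x n /\ ((x n)%:E < len S)%E) /\
      (forall n, (1 <= n < N)%N -> x n < x n.+1),
      forall n, (n <= N)%N -> 0 <= u n,
      forall h, H1c (len S) h ->
        omega S h = (w 0%N)%:C * h 0
                    + \sum_(1 <= n < N.+1) (w n)%:C * h (x n) &
      forall A : set (measurableTypeR R), measurable A ->
        upsilon S A = ((u 0%N)%:E * \d_((0 : R)%R : measurableTypeR R) A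
          + \sum_(1 <= n < N.+1)
              (u n)%:E * \d_(x n : measurableTypeR R) A)%E].
Proof.
move=> wt Hm rat s Delta N kappa x w u.
have [l [ul lD fin_l null_l]] := herglotz_rational_discrete Hm rat.
pose r y := fine (rho [set y]).
have r0 : forall y, y \in l -> 0 < r y := residue_gt0 fin_l.
have sE : forall i : nat, s i%:Z = \sum_(y <- l) r y * y ^+ i := moment_nat a b ul fin_l null_l.
have b2 : - s (- 2%:Z) = b by rewrite /s /moment /= opprK.
have mE z : 0 < Im z -> m z = (- s (- 1%:Z))%:C + (- s (- 2%:Z))%:C * z + \sum_(y <- l) (r y)%:C / (y%:C - z).
  by move=> z0; rewrite b2; exact: herglotz_fractions.
have [N' [x' [w' [u' [df star]]]]] := discrete_string wt ul mE.
have [[x'0 xlt] dN [u'0 wu] omE [upE _]] := df.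
have xN := inv_length_dom dN.
have KS := degK_size ul x'0 xlt wu xN star.
have Kle n : (0 < n <= N'.+1)%N -> (degK u' n <= size l)%N.
  by move=> /andP[n0 nN]; apply: leq_trans KS; exact: degK_le.
(* Up to [D] there are [N' + 1] non-zero determinants, so the index read off from [m] is the number
   of nodes other than 0. *)
have NE : N = N'.
  rewrite /N /Nindex (_ : nonzero_count s D = hcount s D)//.
  by rewrite (hcount_tail ul r0 sE x'0 xlt wu xN star (leq_trans KS lD)).
have kE n : (0 < n <= N'.+1)%N -> kappa n = degK u' n.
  by move=> nN; exact: (find_hcount ul r0 sE x'0 xlt wu xN star lD nN).
have D0 k : Delta 0 k = hank s 0 k by exact: hankelE.
have D1 k : Delta 1 k = hank s 1 k by exact: hankelE.
have D2 k : Delta 2 k = hank s 2 k by exact: hankelE.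
have Dm1 k : Delta (-1) k = hank s (- 1%:Z) k by exact: hankelE.
have Dm2 k : Delta (-2) k = hank s (- 2%:Z) k by exact: hankelE.
have NN : (0 < N'.+1 <= N'.+1)%N by rewrite /= leqnn.
have nS n : (0 < n <= N')%N -> (0 < n <= N'.+1)%N /\ (0 < n.+1 <= N'.+1)%N.
  by move=> /andP[n0 nN]; rewrite n0 /= ltnS nN leqW.
have h1n n : (0 < n <= N'.+1)%N -> hank s 1 (degK u' n) != 0.
  by move=> nN; exact (hank1_neq0 ul r0 sE x'0 xlt wu xN star nN).
have h0n n : (0 < n <= N')%N -> hank s 0 (degK u' n).+1 != 0 /\ hank s 0 (degK u' n.+1) != 0.
  move=> nN; have [n1 n2] := nS n nN; have /andP[n0 _] := nN.
  by split; apply: (hank0_neq0 ul r0 sE); [exact: leq_trans (degK_lt u' n0) (Kle _ n2)|exact: Kle].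
have h2n : hank s 2 (degK u' N'.+1) != 0.
  exact (hank2_neq0 ul r0 sE (degK_support ul x'0 xlt wu xN star)).
have xE n : (0 < n <= N')%N -> x n = x' n.
  move=> nN; have [n1 _] := nS n nN; have [h0 _] := h0n n nN.
  by rewrite /x kE// D2 D0 -(hank_x ul sE x'0 xlt wu xN star nN) mulrC mulKf.
(* The quotients are minus the partial sums of the weights, so that consecutive differences are
   single weights. *)
have wE n : (0 < n <= N'.+1)%N -> Delta (-1) (kappa n).+1 / Delta 1 (kappa n) = - wsum w' n.
  move=> nN; rewrite kE// D1 Dm1 (hank_w ul sE x'0 xlt wu xN star nN) mulfK//; exact: h1n.
have [m2 m1] := moment_u0 ul sE xlt wu xN star.
have w_eq n : (n <= N')%N -> w n = w' n.
  case: n => [_|n nN].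
    by rewrite /w D1 Dm1 hank0 hank1 divr1 m1 opprK.
  have [n1 n2] := nS n.+1 nN; rewrite /w !wE// /wsum [in X in _ - X]big_ord_recr /=; ring.
have u_eq n : (n <= N')%N -> u n = u' n.
  case: n => [_|n nN].
    by rewrite /u D0 Dm2 hank0 hank1 divr1 m2 opprK.
  have [n1 n2] := nS n.+1 nN; have [h0 h0'] := h0n n.+1 nN.
  rewrite /u !kE// !D0 !Dm2 (hank_tau ul sE x'0 xlt wu xN star (n := n.+1) nN)
    (hank_tau' ul sE x'0 xlt wu xN star (n := n.+1) nN).
  by rewrite !mulfK// tau_sub.
rewrite NE; split; split.
- by rewrite kE// D2.
- by move=> n nN; rewrite kE// D1; exact: h1n.
- by move=> n nN; have [n1 n2] := nS n nN; rewrite !kE// !D0; exact: h0n.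
- by rewrite kE// D0 D2 (hank_L ul sE x'0 xlt wu xN star) mulfK.
- split=> [n nN|n /andP[n0 nN]].
    rewrite xE//; have /andP[n0 nN'] := nN.
    split; last by have [] := node_dom df nN'.
    by rewrite -x'0; exact: (nodes_lt df).
  by rewrite !xE ?n0 ?nN ?(ltnW nN)//; exact: xlt.
- by move=> n nN; rewrite u_eq//; exact: u'0.
- move=> h Hh; rewrite omE// -(big_mkord xpredT (fun n => (w' n)%:C * h (x' n))) big_ltn// x'0 w_eq//.
  congr (_ + _); rewrite big_nat [RHS]big_nat; apply: eq_bigr => n nN.
  by have /andP[n0 nN'] := nN; rewrite ltnS in nN'; rewrite w_eq// xE// n0.
- move=> A mA; rewrite upE// -(big_mkord xpredT (fun n => ((u' n)%:E * \d_(x' n : measurableTypeR R) A)%E)) big_ltn// x'0 u_eq//.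
  congr (_ + _)%E; rewrite big_nat [RHS]big_nat; apply: eq_bigr => n nN.
  by have /andP[n0 nN'] := nN; rewrite ltnS in nN'; rewrite u_eq// xE// n0.
Qed.
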